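(* Let $\mathcal S\subset\mathbb H^1$ be an oriented $C^2$ surface in the first Heisenberg group with characteristic set $\Sigma_{\mathcal S}$. For every vector field $\mathcal X=aX_1+bX_2+kT$ with $a,b,k\in C^2_0(\mathcal S\setminus\Sigma_{\mathcal S})$, the first variation of the $H$-perimeter along the deformation $\mathcal S^\lambda=\mathcal S+\lambda\mathcal X$ is $$\mathcal V^H_I(\mathcal S;\mathcal X)=\int_{\mathcal S}\mathcal H\,F\,d\sigma_H,\qquad F=\bar p\,a+\bar q\,b+\bar\omega\,k=\frac{\langle\mathcal X,\boldsymbol N\rangle}{\langle\nu^H,\boldsymbol N\rangle}.$$ In particular, when $\Sigma_{\mathcal S}=\varnothing$, $\mathcal S$ is stationary if and only if it is $H$-minimal.
   Context: $\mathbb H^1=\mathbb R^3$ with group law $(x,y,t)(x',y',t')=(x+x',y+y',t+t'+\frac12(xy'-x'y))$ and left-invariant fields $X_1=\partial_x-\frac y2\partial_t$, $X_2=\partial_y+\frac x2\partial_t$, $T=\partial_t$; $\langle\cdot,\cdot\rangle$ is the Riemannian metric making $\{X_1,X_2,T\}$ orthonormal, $\nabla$ its Levi-Civita connection. For an oriented $C^2$ surface $\mathcal S$, $\boldsymbol N$ is a non-unit Riemannian normal, $p=\langle\boldsymbol N,X_1\rangle$, $q=\langle\boldsymbol N,X_2\rangle$, $\omega=\langle\boldsymbol N,T\rangle$, $W=\sqrt{p^2+q^2}$, $\Sigma_{\mathcal S}=\{W=0\}$ (characteristic set); on $\mathcal S\setminus\Sigma_{\mathcal S}$: $\bar p=p/W$,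 $\bar q=q/W$, $\bar\omega=\omega/W$, $\nu^H=\bar pX_1+\bar qX_2$. The $H$-perimeter measure is $d\sigma_H=\frac{W}{|\boldsymbol N|}d\sigma$, $\sigma$ the Riemannian surface measure. The $H$-mean curvature on $\mathcal S\setminus\Sigma_{\mathcal S}$ is $\mathcal H=-\langle\nabla_{\boldsymbol e}\boldsymbol e,\nu^H\rangle$ with $\boldsymbol e=\bar qX_1-\bar pX_2$; equivalently $\mathcal H=X_1\bar p+X_2\bar q$ when $\bar p,\bar q$ are computed in a neighborhood from $\boldsymbol N=\nabla\phi$ for a local defining function $\phi$. $\mathcal S$ is $H$-minimal if $\mathcal H\equiv0$ on $\mathcal S$. Deformation: $\mathcal S^\lambda=\{g+\lambda\mathcal X(g):g\in\mathcal S\}$ for small $\lambda\in\mathbb R$, where $\mathcal X(g)=aX_1+bX_2+kT$ is regarded as the vector $(a,b,k+\frac{bx-ay}{2})\in\mathbb R^3$ at $g=(x,y,t)$, and $+$ is addition in $\mathbb R^3$. $P_H(\mathcal S^\lambda)=\sigma_H(\mathcal S^\lambda)$ (if this is infinite, only the image of a relatively compact open subset of $\mathcal S$ containing the support of $\mathcal X$ is counted), and $\mathcal V^H_I(\mathcal S;\mathcal X)=\frac{d}{d\lambda}P_H(\mathcal S^\lambda)\big|_{\lambda=0}$. If $\Sigma_{\mathcal S}=\varnothing$, $\mathcal S$ is called stationary if $\mathcal V^H_I(\mathcal S;\mathcal X)=0$ for every such $\mathcal X$. *)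

(* Defs.v *)
From HB Require Import structures.
From mathcomp Require Import all_boot all_order all_algebra.
From mathcomp Require Import ring.
From mathcomp Require Import all_classical all_reals all_analysis.
Import Order.TTheory GRing.Theory Num.Theory.
Import numFieldNormedType.Exports.

Set Implicit Arguments.
Unset Strict Implicit.
Unset Printing Implicit Defensive.

Local Open Scope classical_set_scope.
Local Open Scope ring_scope.

Section Heisenberg.
Context {R : realType}.

(* A point (x, y, t) of the Heisenberg group H^1; tangent vectors are also
   written in the coordinate basis (d/dx, d/dy, d/dt). *)
Local Notation pt := (R * R * R)%type.
Implicit Types (g v w n : pt) (S U M K : set pt) (N X Y V : pt -> pt).

Definition X1 g : pt := (1, 0, - g.1.2 / 2).
Definition X2 g : pt := (0, 1, g.1.1 / 2).
Definition T3 g : pt := (0, 0, 1).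

Definition frame (i : 'I_3) : pt -> pt := nth T3 [:: X1; X2; T3] i.

(* T-component of v at g in the basis X1, X2, T of the tangent space; the other
   two components are v.1.1 and v.1.2. *)
Definition Tcoord g v : R := v.2 + (g.1.2 * v.1.1 - g.1.1 * v.1.2) / 2.

Definition inner g v w : R :=
  v.1.1 * w.1.1 + v.1.2 * w.1.2 + Tcoord g v * Tcoord g w.

Definition rnorm g v : R := Num.sqrt (inner g v v).

Lemma inner_frame g (i j : 'I_3) :
  inner g (frame i g) (frame j g) = (i == j)%:R.
Proof.
by case: i => [[|[|[|]]] ?] //; case: j => [[|[|[|]]] ?] //;
  rewrite /inner /Tcoord /frame /=; field.
Qed.

Definition lie_bracket V Y : pt -> pt := fun g => 'D_(V g) Y g - 'D_(Y g) V g.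

(* Koszul formula for <nabla_{E_i} E_j, E_k> in the orthonormal frame. *)
Definition christoffel (i j k : 'I_3) g : R :=
  (inner g (lie_bracket (frame i) (frame j) g) (frame k g)
   - inner g (lie_bracket (frame j) (frame k) g) (frame i g)
   + inner g (lie_bracket (frame k) (frame i) g) (frame j g)) / 2.

(* A tangent vector at g is the velocity
    of a curve in S through g, and derivatives of functions defined only on S are
    taken along such curves. *)

Definition curve_in S g v (c : R -> pt) : Prop :=
  [/\ \forall s \near (0 : R), S (c s), c 0 = g & is_derive (0 : R) (1 : R) c v].

Definition tangent S g v : Prop := exists c, curve_in S g v c.

Definition derive_along S g v (f : pt -> R) : R :=
  xget 0 [set d | exists2 c, curve_in S g v c &
                             is_derive (0 : R) (1 : R) (f \o c) d].

(* nabla_v Y at g, for v tangent to S and Y a vector field given along S. *)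
Definition covariant S g v Y : pt :=
  \sum_(k < 3)
    (derive_along S g v (fun h => inner h (Y h) (frame k h))
     + \sum_(i < 3) \sum_(j < 3)
         inner g v (frame i g) * inner g (Y g) (frame j g) * christoffel i j k g)
    *: frame k g.

(* For an open set D. *)
Definition C1_on {V W : normedModType R} (D : set V) (f : V -> W) : Prop :=
  (forall x, D x -> differentiable f x) /\
  (forall (v : V) x, D x -> {for x, continuous (fun y => 'D_v f y)}).

Definition C2_on {V W : normedModType R} (D : set V) (f : V -> W) : Prop :=
  C1_on D f /\ forall v : V, C1_on D (fun y => 'D_v f y).

(* C^2 immersions that are homeomorphisms onto open subsets of S. *)
Definition local_param S (D : set (R * R)) (th : R * R -> pt) : Prop :=
  [/\ open D, C2_on D th,
      (forall z, D z -> forall xi, 'D_xi th z = 0 -> xi = 0),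
      set_inj D th &
      forall A, open A -> A `<=` D ->
        exists2 O : set pt, open O & th @` A = S `&` O].

Definition C2_surface S : Prop :=
  forall g, S g -> exists D th, local_param S D th /\ (th @` D) g.

Definition normal_vector S g n : Prop :=
  n <> 0 /\ forall v, tangent S g v -> inner g v n = 0.

Definition oriented_C2_surface S N : Prop :=
  [/\ C2_surface S, {within S, continuous N} &
      forall g, S g -> normal_vector S g (N g)].

Definition C2_fun M (f : pt -> R) : Prop :=
  forall D th, local_param M D th -> C2_on D (f \o th).

(* C^2_0(M); its elements are extended by zero to the whole space. *)
Definition C2_0 M (f : pt -> R) : Prop :=
  [/\ C2_fun M f, compact (closure [set g | f g != 0]) &
      closure [set g | f g != 0] `<=` M].

Definition area_element (th : R * R -> pt) (z : R * R) : R :=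
  let th_u := 'D_(1, 0) th z in
  let th_v := 'D_(0, 1) th z in
  Num.sqrt (inner (th z) th_u th_u * inner (th z) th_v th_v
            - inner (th z) th_u th_v ^+ 2).

Definition is_surface_measure S (mu : {measure set pt -> \bar R}) : Prop :=
  mu (~` S) = 0%E /\
  forall D th, local_param S D th ->
    forall A : set (R * R), measurable A -> A `<=` D ->
      mu (th @` A) =
      (\int[lebesgue_measure \x lebesgue_measure]_(z in A) (area_element th z)%:E)%E.

(* The Riemannian surface measure: the unique measure given by the area formula
   in every local parametrization (the zero measure if there is none). *)
Definition surface_measure S : {measure set pt -> \bar R} :=
  match pselect (exists mu, is_surface_measure S mu) with
  | left e => projT1 (cid e)
  | right _ => mzero
  end.

Section Normal.
Variable N : pt -> pt.

Definition pN g : R := inner g (N g) (X1 g).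
Definition qN g : R := inner g (N g) (X2 g).
Definition omegaN g : R := inner g (N g) (T3 g).
Definition WN g : R := Num.sqrt (pN g ^+ 2 + qN g ^+ 2).
Definition pbar g : R := pN g / WN g.
Definition qbar g : R := qN g / WN g.
Definition omegabar g : R := omegaN g / WN g.

Definition nuH g : pt := pbar g *: X1 g + qbar g *: X2 g.
Definition eH g : pt := qbar g *: X1 g - pbar g *: X2 g.

Definition charset S : set pt := [set g | S g /\ WN g = 0].

Definition Hmean S g : R := - inner g (covariant S g (eH g) eH) (nuH g).

Definition H_minimal S : Prop :=
  forall g, (S `\` charset S) g -> Hmean S g = 0.

Definition integral_sigmaH S (f : pt -> R) : \bar R :=
  (\int[surface_measure S]_(g in S) (f g * (WN g / rnorm g (N g)))%:E)%E.

End Normal.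

(* The H-perimeter measure does not depend on the orientation or on the length of
   the normal, so any pointwise choice of a normal vector gives P_H. *)
Definition some_normal S g : pt := xget 0 (normal_vector S g).

Definition P_H S : \bar R := integral_sigmaH (some_normal S) S (fun=> 1).

Definition vfield (a b k : pt -> R) g : pt :=
  a g *: X1 g + b g *: X2 g + k g *: T3 g.

Definition support X : set pt := closure [set g | X g != 0].

Definition deform X (l : R) S : set pt := [set g + l *: X g | g in S].

Definition rel_compact_nbhd S X U : Prop :=
  [/\ exists2 O : set pt, open O & U = S `&` O,
      compact (closure U), closure U `<=` S & support X `<=` U].

(* P_H(S^l), where only the image of U is counted if P_H(S^l) is infinite. *)
Definition perimeter S X U (l : R) : R :=
  if (P_H (deform X l S) < +oo)%E then fine (P_H (deform X l S))
  else fine (P_H (deform X l U)).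

Definition first_variation S X U : R := 'D_1 (perimeter S X U) (0 : R).

Definition stationary S : Prop :=
  forall a b k : pt -> R, C2_0 S a -> C2_0 S b -> C2_0 S k ->
  forall U, rel_compact_nbhd S (vfield a b k) U ->
    derivable (perimeter S (vfield a b k) U) (0 : R) 1 /\
    first_variation S (vfield a b k) U = 0.

End Heisenberg.

(* Main.v *)
(** Write [P, Q, O] for the components of [th_u x th_v] in the frame [X1, X2, T], for a
    chart [th] with coordinates [(u, v)].  In this chart [W / |N|] times the area element is
    [sqrt (P^2 + Q^2)], whatever the normal [N], so that [d sigma_H = sqrt (P^2 + Q^2) du dv].

    A field [X] of class C^2 with compact support is Lipschitz on [S], hence for small [l]
    the map [g |-> g + l X g] is bi-Lipschitz and carries the charts of [S] to charts of
    [S^l].  Therefore [P_H (S^l)] is the integral over [S] of a chart-independent Jacobian,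
    whose Taylor expansion at [l = 0] is uniform on the support of [X]: the first variation
    is the integral of the derivative [J'] of the Jacobian.  In a chart,
    [J' - H F W / |N|], multiplied by the area element, is the divergence of a C^1 field that
    vanishes with [X]; a partition of unity and Fubini's theorem show that its integral is
    zero.

    If [H] does not vanish at [g0], then the variation along a nonnegative bump times
    [sgn (H g0) (pbar g0 X1 + qbar g0 X2)] is positive. *)

From HB Require Import structures.
From mathcomp Require Import all_boot all_order all_algebra.
From mathcomp Require Import ring lra.
From mathcomp Require Import all_classical all_reals all_analysis measurable_realfun.
Require Import Defs.
Import Order.TTheory GRing.Theory Num.Theory.
Import numFieldNormedType.Exports.

Set Implicit Arguments.
Unset Strict Implicit.
Unset Printing Implicit Defensive.

Local Open Scope classical_set_scope.
Local Open Scope ring_scope.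

(** * Measurability and images of measures *)

(** The divergence comes from Cartan's formula. Let [tau = dt + (y dx - x dy) / 2] and
    [(p, q) = (P, Q) / W]. The two-form [(p dy - q dx) wedge tau] restricts to [d sigma_H] on [S],
    and to first order the change of [sqrt (P^2 + Q^2)] is that of [p P + q Q] with [p], [q] frozen.
    The Lie derivative of this form along [X] is the differential of its contraction with [X], plus
    the contraction of its differential; the latter is [H] times the volume form and gives
    [H F W / |N|]. The proof checks this as an identity between numbers; besides the gradients of
    [P] and [Q], only mixed second derivatives of the chart enter.

    The obstacle is the measure. It is specified by the area formula in all charts at once, so that
    its existence rests on the change of variables for transition maps. These are differentiated
    through a linear left inverse of the differential of a chart, as functions on [S] have no
    derivatives off [S].

    When [P_H S] is infinite, only the increment of the perimeter makes sense: it is the integral of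
    a bounded function supported in the support of [X]. *)

Definition countable_base {T : topologicalType} (B : nat -> set T) : Prop :=
  (forall n, open (B n)) /\
  forall x U, nbhs x U -> exists n, B n x /\ B n `<=` U.

Definition prod_base {T1 T2 : Type} (B1 : nat -> set T1) (B2 : nat -> set T2)
    (n : nat) : set (T1 * T2) :=
  if unpickle n is Some p then B1 p.1 `*` B2 p.2 else set0.

Lemma countable_base_prod (T1 T2 : topologicalType) B1 B2 :
  @countable_base T1 B1 -> @countable_base T2 B2 ->
  countable_base (prod_base B1 B2).
Proof.
move=> [ob1 b1] [ob2 b2]; split.
  move=> n; rewrite /prod_base; case: unpickle => [[i j]|]; last exact: open0.
  rewrite openE => -[x y] [/= B1x B2y]; exists (B1 i, B2 j) => //=.
  by split; apply: open_nbhs_nbhs.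
move=> [x y] U [[/= V1 V2] [nV1 nV2] VU].
have [i [ix iV]] := b1 _ _ nV1; have [j [jy jV]] := b2 _ _ nV2.
exists (pickle (i, j)); rewrite /prod_base pickleK; split=> //.
by move=> [a b] [/= ia jb]; apply: VU; split => /=; [apply: iV|apply: jV].
Qed.

(** An open set is the union of the base sets that it contains, a countable union. The product
    sigma-algebras of the plane and of space thus contain the open sets. *)
Lemma countable_base_measurable (T : topologicalType) (M : set (set T)) B :
  countable_base B -> sigma_algebra setT M -> (forall n, M (B n)) ->
  forall U, open U -> M U.
Proof.
move=> [oB bB] [M0 MC MU] MB U oU.
have -> : U = \bigcup_n (if `[< B n `<=` U >] then B n else set0).
  apply/seteqP; split=> [x Ux|x [n _]]; last by case: asboolP => // + Bx; apply.
  have [n [Bx BU]] := bB x U (open_nbhs_nbhs (conj oU Ux)).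
  by exists n => //; case: asboolP.
by apply: MU => n; case: ifP => _.
Qed.

(** The sets with measurable preimage in [D] form a sigma-algebra, and the two hypotheses put the
    generating cylinders in it. *)
Lemma measurable_fun_pair_on d d1 d2 (T : measurableType d) (T1 : measurableType d1)
    (T2 : measurableType d2) (D : set T) (h : T -> T1 * T2) :
  measurable_fun D (fst \o h) -> measurable_fun D (snd \o h) -> measurable_fun D h.
Proof.
move=> mf mg mD; have {}mf := mf mD; have {}mg := mg mD.
apply: (@smallest_sub _ _ _ (fun B => measurable (D `&` h @^-1` B))); first split.
- by rewrite preimage_set0 setI0.
- move=> A MA; rewrite setTD (_ : D `&` h @^-1` (~` A) = D `\` (D `&` h @^-1` A)).
    exact: measurableD.
  by apply/seteqP; split => x /=; tauto.
- by move=> F MF; rewrite preimage_bigcup setI_bigcupr; exact: bigcup_measurable.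
by rewrite subUset; split=> _ [A mA <-]; rewrite setTI -comp_preimage; [exact: mf|exact: mg].
Qed.

Section real_bases.
Context {R : realType}.

Definition base_R (n : nat) : set R :=
  if unpickle n is Some p then `](ratr p.1), (ratr p.2)[%classic : set R
  else set0.

Lemma base_RP : countable_base base_R.
Proof.
split.
  move=> n; rewrite /base_R; case: unpickle => [[i j]|]; last exact: open0.
  exact: interval_open.
move=> x U /nbhs_ballP[e /= e0 eU].
have xe : x - e < x by rewrite ltrBlDr ltrDl.
have ex : x < x + e by rewrite ltrDl.
have [p] := rat_in_itvoo xe; rewrite in_itv/= => /andP[xp px].
have [q] := rat_in_itvoo ex; rewrite in_itv/= => /andP[xq qx].
exists (pickle (p, q)); rewrite /base_R pickleK; split=> /=.
  by rewrite in_itv/= px xq.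
move=> y /=; rewrite in_itv/= => /andP[py yq]; apply: eU.
rewrite /ball/= ltr_norml; apply/andP; split; lra.
Qed.

Lemma base_R_measurable n : measurable (base_R n).
Proof.
rewrite /base_R; case: unpickle => [[i j]|]; last exact: measurable0.
exact: measurable_itv.
Qed.

Definition base_R2 : nat -> set (R * R) := prod_base base_R base_R.
Definition base_R3 : nat -> set (R * R * R) := prod_base base_R2 base_R.

Lemma base_R2P : countable_base base_R2.
Proof. by apply: countable_base_prod; exact: base_RP. Qed.

Lemma base_R3P : countable_base base_R3.
Proof. by apply: countable_base_prod; [exact: base_R2P|exact: base_RP]. Qed.

Lemma open_measurable2 (U : set (R * R)) : open U -> measurable U.
Proof.
apply: (countable_base_measurable base_R2P); first exact: sigma_algebra_measurable.
move=> n; rewrite /base_R2 /prod_base; case: unpickle => [p|]; last exact: measurable0.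
by apply: measurableX; exact: base_R_measurable.
Qed.

Lemma open_measurable3 (U : set (R * R * R)) : open U -> measurable U.
Proof.
apply: (countable_base_measurable base_R3P); first exact: sigma_algebra_measurable.
move=> n; rewrite /base_R3 /prod_base; case: unpickle => [p|]; last exact: measurable0.
apply: measurableX; last exact: base_R_measurable.
rewrite /base_R2 /prod_base; case: unpickle => [q|]; last exact: measurable0.
by apply: measurableX; exact: base_R_measurable.
Qed.

Lemma open_preimage_cont (T1 T2 : topologicalType) (D : set T1) (f : T1 -> T2) (U : set T2) :
  open D -> (forall z, D z -> {for z, continuous f}) -> open U ->
  open (D `&` f @^-1` U).
Proof.
move=> oD cf oU; rewrite openE => z [Dz Uz]; apply: filterI.
  exact: open_nbhs_nbhs.
by apply: (cf z Dz); exact: open_nbhs_nbhs.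
Qed.

Lemma continuous_measurable2 (D : set (R * R)) (f : R * R -> R) :
  open D -> (forall z, D z -> {for z, continuous f}) -> measurable_fun D f.
Proof.
move=> oD cf; apply: (measurability _ (RGenOpens.measurableE R)).
move=> _ [_ [a [b ->] <-]]; apply: open_measurable2.
by apply: open_preimage_cont => //; exact: interval_open.
Qed.

Lemma continuous_measurable22 (D : set (R * R)) (f : R * R -> R * R) :
  open D -> (forall z, D z -> {for z, continuous f}) -> measurable_fun D f.
Proof.
move=> oD cf.
have m1 : measurable_fun D (fst \o f).
  apply: (@continuous_measurable2 D (fst \o f) oD) => z Dz.
  exact: (@continuous_comp _ _ _ f fst z (cf z Dz) (@cvg_fst _ _ _ _ _)).
have m2 : measurable_fun D (snd \o f).
  apply: (@continuous_measurable2 D (snd \o f) oD) => z Dz.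
  exact: (@continuous_comp _ _ _ f snd z (cf z Dz) (@cvg_snd _ _ _ _ _)).
exact: (measurable_fun_pair_on m1 m2).
Qed.

Lemma continuous_measurable23 (D : set (R * R)) (f : R * R -> R * R * R) :
  open D -> (forall z, D z -> {for z, continuous f}) -> measurable_fun D f.
Proof.
move=> oD cf.
have m1 : measurable_fun D (fst \o f).
  apply: (@continuous_measurable22 D (fst \o f) oD) => z Dz.
  exact: (@continuous_comp _ _ _ f fst z (cf z Dz) (@cvg_fst _ _ _ _ _)).
have m2 : measurable_fun D (snd \o f).
  apply: (@continuous_measurable2 D (snd \o f) oD) => z Dz.
  exact: (@continuous_comp _ _ _ f snd z (cf z Dz) (@cvg_snd _ _ _ _ _)).
exact: (measurable_fun_pair_on m1 m2).
Qed.

End real_bases.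

(** * Push-forwards of measures with a density *)

Section density.
Context d d' (T : measurableType d) (T' : measurableType d') (R : realType).
Variables (m : {measure set T -> \bar R}) (D : set T) (w : T -> R) (h : T -> T').

(** The push-forward under [h] of the measure with density [w] on [D]. The surface measure has this
    form in every chart, and so have both sides of the change of variables. *)
Definition image_density (B : set T') : \bar R :=
  (\int[m]_(x in D `&` h @^-1` B) (w x)%:E)%E.

Hypotheses (w_ge0 : forall x, 0 <= w x) (mD : measurable D) (mw : measurable_fun D w) (mh : measurable_fun D h).

Lemma image_density_exists : exists nu : {measure set T' -> \bar R},
  forall B, measurable B -> nu B = image_density B.
Proof.
have w0 x : (0 <= (w x)%:E)%E by rewrite lee_fin.
have mw' : measurable_fun D (EFin \o w) by exact/measurable_EFinP.
have n0 : image_density set0 = 0%E.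
  by rewrite /image_density preimage_set0 setI0 integral_set0.
have nge0 B : (0 <= image_density B)%E by apply: integral_ge0.
have sa : semi_sigma_additive image_density.
  move=> F mF tF mUF; rewrite /image_density preimage_bigcup setI_bigcupr.
  rewrite ge0_integral_bigcup//.
  - by apply: is_cvg_ereal_nneg_natsum => n _; exact: integral_ge0.
  - by move=> k; exact: mh.
  - apply: (measurable_funS mD) => //.
    by apply: bigcup_sub => i _; exact: subIsetl.
  - move/trivIsetP : tF => tF; apply/trivIsetP => i j _ _ ij.
    by rewrite setIACA -(preimage_setI h (F i)) tF// preimage_set0 setI0.
pose mm := isMeasure.Build _ _ _ image_density n0 nge0 sa.
pose nu : {measure set T' -> \bar R} := HB.pack image_density mm.
by exists nu.
Qed.

Variables (nu : {measure set T' -> \bar R}) (E : set T').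
Hypotheses (mE : measurable E) (hE : forall x, D x -> E (h x)).
Hypothesis nuE : forall B, measurable B -> B `<=` E -> nu B = image_density B.

Import HBNNSimple.

Local Lemma integral_image_density_nnsfun (g : {nnsfun T' >-> R}) :
  (\int[nu]_(y in E) (g y)%:E = \int[m]_(x in D) (g (h x) * w x)%:E)%E.
Proof.
have mgh : measurable_fun D (g \o h).
  by apply: (@measurable_comp _ _ _ _ _ _ setT).
have mk k : measurable (D `&` h @^-1` (g @^-1` [set k])).
  by apply: mh => //; rewrite -[_ @^-1` _]setTI; exact: (@measurable_funP _ _ _ _ setT g).
transitivity (\sum_(k \in range g) k%:E * image_density (E `&` g @^-1` [set k]))%E.
  under eq_integral do rewrite fimfunE -fsumEFin//.
  rewrite ge0_integral_fsum//; last 2 first.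
  - by move=> y; exact/measurable_EFinP/measurable_funM.
  - by move=> y x _; rewrite nnfun_muleindic_ge0.
  apply: eq_fsbigr => r _; rewrite integralZl_indic_nnsfun// integral_indic//=.
  by rewrite setIC nuE//; exact: measurableI.
transitivity (\sum_(k \in range g)
    \int[m]_(x in D) (k * \1_(g @^-1` [set k]) (h x) * w x)%:E)%E; last first.
  rewrite -ge0_integral_fsum//; last 2 first.
  - move=> k; apply/measurable_EFinP; apply: measurable_funM => //.
    apply: measurable_funM => //.
    by apply: (@measurable_comp _ _ _ _ _ _ setT).
  - move=> k x _; rewrite EFinM mule_ge0 ?lee_fin//.
    by have := nnfun_muleindic_ge0 g k (h x); rewrite lee_fin.
  apply: eq_integral => x _; rewrite fsumEFin//; congr EFin.
  by rewrite [in RHS](fimfunE g) mulr_fsuml.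
apply: eq_fsbigr => k _.
(* Factoring [k] out of the integral needs [k >= 0]; for negative [k] the fibre of the nonnegative
   [g] is empty. *)
have [k0|k0] := ltP k 0.
  rewrite preimage_nnfun0// setI0.
  have -> : image_density set0 = 0%E.
    by rewrite /image_density preimage_set0 setI0 integral_set0.
  by rewrite mule0 integral0_eq// => x _; rewrite indic0 mulr0 mul0r.
under [RHS]eq_integral do rewrite -mulrA EFinM.
rewrite ge0_integralZl//; last 2 first.
- apply/measurable_EFinP; apply: measurable_funM => //.
  by apply: (@measurable_comp _ _ _ _ _ _ setT).
- by move=> x _; rewrite lee_fin mulr_ge0.
congr (_ * _)%E; rewrite /image_density.
have -> : D `&` h @^-1` (E `&` g @^-1` [set k]) = D `&` (h @^-1` (g @^-1` [set k])).
  by apply/seteqP; split => x /=; [tauto|move=> [Dx gx]; split=> //; split=> //; exact: hE].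
rewrite integral_mkcondr; apply: eq_integral => x _.
rewrite patchE indicE; case: ifPn => [|] xA.
  by rewrite (_ : _ \in _ = true) ?mul1r//; rewrite inE; rewrite inE in xA.
rewrite (_ : _ \in _ = false) ?mul0r//; apply/negbTE.
by apply: contra xA; rewrite !inE.
Qed.

Lemma ge0_integral_image_density (f : T' -> R) :
  measurable_fun E f -> (forall y, E y -> 0 <= f y) ->
  (\int[nu]_(y in E) (f y)%:E = \int[m]_(x in D) (f (h x) * w x)%:E)%E.
Proof.
move=> mf f0; have mf' : measurable_fun E (EFin \o f) by exact/measurable_EFinP.
pose f_ := nnsfun_approx mE mf'.
have cf y : E y -> (f_ n y)%:E @[n --> \oo] --> (f y)%:E.
  by move=> Ey; apply: cvg_nnsfun_approx => // z Ez; rewrite lee_fin f0.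
transitivity (limn (fun n => \int[nu]_(x in E) (f_ n x)%:E))%E.
  rewrite -monotone_convergence//.
  - by apply: eq_integral => y /[!inE] yE; apply/esym/cvg_lim => //; exact: cf.
  - by move=> n; exact/measurable_EFinP/measurable_funP.
  - by move=> n y _; rewrite lee_fin.
  - by move=> y _ i j ij; rewrite lee_fin; exact/lefP/nd_nnsfun_approx.
under eq_fun do rewrite integral_image_density_nnsfun.
rewrite -monotone_convergence//; last 3 first.
- move=> n; apply/measurable_EFinP; apply: measurable_funM => //.
  by apply: (@measurable_comp _ _ _ _ _ _ setT).
- by move=> n x _; rewrite lee_fin mulr_ge0.
- move=> x _ i j ij; rewrite lee_fin ler_wpM2r//; exact/lefP/nd_nnsfun_approx.
apply: eq_integral => x /[!inE] xD; apply/cvg_lim => //.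
rewrite EFinM; under eq_fun do rewrite EFinM.
by apply: cvgeZr => //; apply: cf; exact: hE.
Qed.

Lemma integral_image_density (f : T' -> R) : measurable_fun E f ->
  (\int[nu]_(y in E) (f y)%:E = \int[m]_(x in D) (f (h x) * w x)%:E)%E.
Proof.
move=> mf; rewrite [LHS]integralE [RHS]integralE; congr (_ - _)%E.
- transitivity (\int[nu]_(y in E) (Num.max (f y) 0)%:E)%E.
    by apply: eq_integral => y _; rewrite funeposE EFin_max.
  rewrite ge0_integral_image_density; last 2 first.
  - by apply: measurable_maxr.
  - by move=> y _; rewrite le_max lexx orbT.
  apply: eq_integral => x _; rewrite funeposE -EFin_max; congr EFin.
  by rewrite maxr_pMl ?mul0r.
- transitivity (\int[nu]_(y in E) (Num.max (- f y) 0)%:E)%E.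
    by apply: eq_integral => y _; rewrite funenegE EFin_max.
  rewrite ge0_integral_image_density; last 2 first.
  - by apply: measurable_maxr => //; exact: measurableT_comp.
  - by move=> y _; rewrite le_max lexx orbT.
  apply: eq_integral => x _; rewrite funenegE -EFinN -EFin_max; congr EFin.
  by rewrite maxr_pMl ?mul0r// mulNr.
Qed.

End density.

Lemma image_density_cst d d' (T : measurableType d) (T' : measurableType d')
    (R : realType) (m : {measure set T -> \bar R}) (c : R) (h : T -> T') (B : set T') :
  measurable (h @^-1` B) ->
  image_density m setT (cst c) h B = (c%:E * m (h @^-1` B))%E.
Proof. by move=> mB; rewrite /image_density setTI -(integral_cst m mB c%:E). Qed.

(** * Change of variables in the plane *)

Section lebesgue2.
Context {R : realType}.

Local Notation leb := (@lebesgue_measure R).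
Local Notation leb2 := (leb \x leb)%E.
Local Notation lebm := (leb : {measure set (measurableTypeR R) -> \bar R}).
Local Notation leb2m :=
  (leb2 : {measure set (measurableTypeR R * measurableTypeR R) -> \bar R}).

(** Both sides are measures in [A], so half-open intervals suffice. For [a < 0] the preimage is open
    at the other end, which does not affect its length. *)
Lemma lebesgue_measure_affine (a b : R) (A : set R) : a != 0 -> measurable A ->
  (`|a|%:E * leb [set x | A (a * x + b)%R] = leb A)%E.
Proof.
move=> a0 mA.
have mh : measurable_fun [set: R] (fun x : R => a * x + b).
  by apply: measurable_funD => //; exact: measurable_funM.
have [nu nuE] := @image_density_exists _ _ _ (measurableTypeR R) R lebm setT (cst `|a|)
  (fun x => a * x + b) (fun=> normr_ge0 a) measurableT (measurable_cst _) mh.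
have nuE' B : measurable B -> nu B = (`|a|%:E * leb [set x | B (a * x + b)%R])%E.
  move=> mB; rewrite nuE//; apply: image_density_cst.
  by rewrite -[X in measurable X]setTI; exact: mh.
rewrite -nuE'//; apply/esym; apply: lebesgue_measure_unique => // _ [[c d] _ <-].
have [cd|dc] := ltP c d; last first.
  by rewrite set_itv_ge ?bnd_simp ?ltNge ?dc//= !measure0.
rewrite nuE' ?lebesgue_measure_itv/= ?lte_fin ?cd//.
have [apos|aneg] := ltP 0 a.
  have -> : [set x | `]c, d]%classic (a * x + b)] = `](c - b) / a, (d - b) / a]%classic.
    apply/seteqP; split => x /=; rewrite !in_itv/= ltr_pdivrMr// ler_pdivlMr//;
      by move=> /andP[? ?]; apply/andP; split; lra.
  rewrite lebesgue_measure_itv/= lte_fin ltr_pM2r ?invr_gt0// ltrD2r cd.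
  by rewrite -!EFinD -EFinM gtr0_norm//; congr EFin; field.
have {}aneg : a < 0 by rewrite lt_neqAle a0.
have -> : [set x | `]c, d]%classic (a * x + b)] = `[(d - b) / a, (c - b) / a[%classic.
  apply/seteqP; split => x /=; rewrite !in_itv/= ler_ndivrMr// ltr_ndivlMr//;
    by move=> /andP[? ?]; apply/andP; split; lra.
rewrite lebesgue_measure_itv/= lte_fin ltr_nM2r ?invr_lt0// ltrD2r cd.
by rewrite -!EFinD -EFinM ltr0_norm//; congr EFin; field.
Qed.

(** For a bijection [T] this says that areas are multiplied by [c]. Preimages make the property
    compose without any injectivity. *)
Definition scales_leb2 (T : R * R -> R * R) (c : R) : Prop :=
  measurable_fun setT T /\
  forall A, measurable A -> (c%:E * leb2 (T @^-1` A) = leb2 A)%E.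

Lemma scales_leb2_comp T1 T2 c1 c2 : scales_leb2 T1 c1 -> scales_leb2 T2 c2 ->
  scales_leb2 (T2 \o T1) (c2 * c1).
Proof.
move=> [m1 e1] [m2 e2]; split; first exact: measurableT_comp.
move=> A mA; rewrite EFinM -muleA comp_preimage e1 ?e2//.
by rewrite -[X in measurable X]setTI; exact: m2.
Qed.

(** The product measure integrates over vertical sections, on each of which the map is affine with
    slope [a]. *)
Lemma scales_leb2_shear (a b c : R) : a != 0 ->
  scales_leb2 (fun z => (z.1, a * z.2 + (b * z.1 + c))) `|a|.
Proof.
move=> a0.
have mT : measurable_fun setT (fun z : R * R => (z.1, a * z.2 + (b * z.1 + c))).
  apply/measurable_fun_pairP; split=> /=; first exact: measurable_fst.
  apply: measurable_funD; first by apply: measurable_funM => //; exact: measurable_snd.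
  by apply: measurable_funD => //; apply: measurable_funM => //; exact: measurable_fst.
split=> // A mA.
have mTA : measurable ((fun z : R * R => (z.1, a * z.2 + (b * z.1 + c))) @^-1` A).
  by rewrite -[X in measurable X]setTI; exact: mT.
rewrite /product_measure1 -ge0_integralZl//; last exact: measurable_fun_xsection.
apply: eq_integral => x _.
rewrite /= -(@lebesgue_measure_affine a (b * x + c) (xsection A x))//; last first.
  exact: measurable_xsection.
Qed.

Lemma scales_leb2_swap : scales_leb2 (fun z => (z.2, z.1)) 1.
Proof.
have mT : measurable_fun setT (fun z : R * R => (z.2, z.1)).
  by apply/measurable_fun_pairP; split=> /=; [exact: measurable_snd|exact: measurable_fst].
split=> // A mA; rewrite mul1e.
have [nu nuE] := @image_density_exists _ _ _ (measurableTypeR R * measurableTypeR R)%type R leb2m setT (cst 1)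
  (fun z => (z.2, z.1)) (fun=> ler01) measurableT (measurable_cst _) mT.
have nuE' B : measurable B -> nu B = leb2 ((fun z => (z.2, z.1)) @^-1` B).
  move=> mB; rewrite nuE// -[RHS]mul1e; apply: image_density_cst.
  by rewrite -[X in measurable X]setTI; exact: mT.
rewrite -nuE'//; apply/esym; apply: product_measure_unique => // B C mB mC.
rewrite nuE'; last exact: measurableX.
have -> : (fun z : R * R => (z.2, z.1)) @^-1` (B `*` C) = C `*` B.
  by apply/seteqP; split => -[x y] /= [].
by rewrite product_measure1E// muleC.
Qed.

Definition affine2 (al be ga de e f : R) (z : R * R) : R * R :=
  (al * z.1 + be * z.2 + e, ga * z.1 + de * z.2 + f).

(** Gaussian elimination: if [al != 0], the map is a shear of the first coordinate, written with two
    swaps, followed by a shear of the second with factor [(al de - be ga) / al]. If [al = 0], then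
    [be != 0] and a swap leads back to the first case. *)
Lemma scales_leb2_affine (al be ga de e f : R) : al * de - be * ga != 0 ->
  scales_leb2 (affine2 al be ga de e f) `|al * de - be * ga|.
Proof.
wlog al0 : al be ga de / al != 0.
  move=> H D0; have [al0|] := eqVneq al 0; last by move/H; exact.
  have be0 : be != 0 by apply: contraNneq D0 => ->; rewrite al0; apply/eqP; ring.
  have D1 : be * ga - al * de != 0 by rewrite -oppr_eq0 opprB.
  have := scales_leb2_comp scales_leb2_swap (H be al de ga be0 D1).
  rewrite mulr1 distrC; congr scales_leb2.
  by apply/funext => z; rewrite /affine2/=; congr pair; ring.
move=> D0.
have Da : (al * de - be * ga) / al != 0 by rewrite mulf_neq0// invr_neq0.
have H1 := scales_leb2_comp scales_leb2_swap
  (scales_leb2_comp (scales_leb2_shear be e al0) scales_leb2_swap).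
have H2 := scales_leb2_comp H1 (scales_leb2_shear (ga / al) (f - ga * e / al) Da).
move: H2; rewrite mul1r mulr1 -normrM divfK//; congr scales_leb2.
by apply/funext => z; rewrite /affine2/=; congr pair; field.
Qed.

Lemma leb2_affine_image (al be ga de e f : R) (A : set (R * R)) :
  al * de - be * ga != 0 -> measurable A ->
  measurable (affine2 al be ga de e f @` A) /\
  leb2 (affine2 al be ga de e f @` A) = (`|al * de - be * ga|%:E * leb2 A)%E.
Proof.
move=> D0 mA; set D := al * de - be * ga in D0 *.
pose T := affine2 (de / D) (- be / D) (- ga / D) (al / D)
  ((be * f - de * e) / D) ((ga * e - al * f) / D).
have DE : de / D * (al / D) - - be / D * (- ga / D) = D^-1.
  by rewrite -[RHS](mulfVK D0) /D; field.
have D'0 : de / D * (al / D) - - be / D * (- ga / D) != 0 by rewrite DE invr_neq0.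
have [mT eT] := scales_leb2_affine ((be * f - de * e) / D) ((ga * e - al * f) / D) D'0.
rewrite -/T in mT eT.
have K1 : cancel (affine2 al be ga de e f) T.
  by move=> [x y]; rewrite /T /affine2/=; congr pair; rewrite /D; field.
have K2 : cancel T (affine2 al be ga de e f).
  by move=> [x y]; rewrite /T /affine2/=; congr pair; rewrite /D; field.
have -> : affine2 al be ga de e f @` A = T @^-1` A.
  apply/seteqP; split => [_ [x Ax <-]|x Ax] /=; first by rewrite K1.
  by exists (T x).
split; first by rewrite -[X in measurable X]setTI; exact: mT.
rewrite -(eT A mA) DE normfV muleA -EFinM mulfV ?mul1e//.
by rewrite normr_eq0.
Qed.

(* Half-open, so that bisection partitions a rectangle. *)
Definition rect (a b p q : R) : set (R * R) :=
  `]a, a + p]%classic `*` `]b, b + q]%classic.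

Lemma rect_measurable a b p q : measurable (rect a b p q).
Proof. by apply: measurableX; exact: measurable_itv. Qed.

Lemma leb2_rect a b p q : 0 <= p -> 0 <= q -> leb2 (rect a b p q) = (p * q)%:E.
Proof.
move=> p0 q0.
have L (c r : R) : 0 <= r -> leb `]c, c + r]%classic = r%:E.
  rewrite le_eqVlt => /predU1P[<-|r0].
    by rewrite addr0 set_itv_ge ?bnd_simp ?ltxx// measure0.
  rewrite lebesgue_measure_itv/= lte_fin ltrDl r0 -EFinB.
  by congr EFin; ring.
transitivity (leb `]a, (a + p)%R]%classic * leb `]b, (b + q)%R]%classic)%E.
  by apply: product_measure1E; exact: measurable_itv.
by rewrite !L.
Qed.

End lebesgue2.

(** * Rectangles: uniqueness of measures and bisection *)

Section rectangles.
Context {R : realType}.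

Definition crect (a b p q : R) : set (R * R) :=
  `[a, a + p]%classic `*` `[b, b + q]%classic.

Lemma rectP (a b p q : R) z :
  rect a b p q z <-> [/\ a < z.1, z.1 <= a + p, b < z.2 & z.2 <= b + q].
Proof.
rewrite /rect /=; rewrite !in_itv/=; split.
  by move=> [/andP[? ?] /andP[? ?]].
by move=> [-> -> -> ->].
Qed.

Lemma crectP (a b p q : R) z :
  crect a b p q z <-> [/\ a <= z.1, z.1 <= a + p, b <= z.2 & z.2 <= b + q].
Proof.
rewrite /crect /=; rewrite !in_itv/=; split.
  by move=> [/andP[? ?] /andP[? ?]].
by move=> [-> -> -> ->].
Qed.

Definition rects : set (set (R * R)) := [set A | exists a b p q, A = rect a b p q].

Lemma rects_setI : setI_closed rects.
Proof.
move=> _ _ [a [b [p [q ->]]]] [a' [b' [p' [q' ->]]]].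
exists (Num.max a a'), (Num.max b b'),
  (Num.min (a + p) (a' + p') - Num.max a a'), (Num.min (b + q) (b' + q') - Num.max b b').
apply/seteqP; split=> z.
  move=> [/rectP[? ? ? ?] /rectP[? ? ? ?]]; apply/rectP.
  by rewrite !subrKC !gt_max !le_min; split; apply/andP.
move=> /rectP; rewrite !subrKC !gt_max !le_min.
by move=> [/andP[? ?] /andP[? ?] /andP[? ?] /andP[? ?]]; split; apply/rectP.
Qed.

Lemma real_bounded_nat (x : R) : exists n : nat, - n%:R < x /\ x <= n%:R.
Proof.
exists (Num.truncn `|x|).+1; have := truncnS_gt `|x|.
by rewrite ltr_norml => /andP[? ?]; split => //; exact: ltW.
Qed.

(** A strip over []c, d]] is a countable union of rectangles of growing length, and the strips
    generate the product sigma-algebra. *)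
Lemma measurable_rects : @measurable _ (R * R)%type = <<s rects >>.
Proof.
apply/seteqP; split; last first.
  apply: smallest_sub; first exact: sigma_algebra_measurable.
  by move=> _ [a [b [p [q ->]]]]; exact: rect_measurable.
have [M0 MC MU] := @smallest_sigma_algebra (R * R)%type setT rects.
have H (f : R * R -> R) : (forall c d, <<s rects >> (f @^-1` `]c, d]%classic)) ->
    forall A, measurable A -> <<s rects >> (f @^-1` A).
  (* The measurable sets of the line are, by conversion, those generated by the intervals []c,
     d]]. *)
  move=> fcd A mA; have : (@ocitv R).-sigma.-measurable A by exact: mA.
  move: A {mA}; apply: smallest_sub; first split.
  - by rewrite preimage_set0.
  - move=> A MA; rewrite setTD (_ : f @^-1` (~` A) = ~` (f @^-1` A))//.
    by rewrite -setTD; exact: MC.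
  - by move=> F MF; rewrite preimage_bigcup; exact: MU.
  by move=> _ [[c d] _ <-]; exact: fcd.
apply: smallest_sub; first exact: smallest_sigma_algebra.
rewrite subUset; split=> _ [A mA <-]; rewrite setTI; apply: H => // c d.
  have -> : fst @^-1` `]c, d]%classic =
      \bigcup_n rect c (- n%:R) (d - c) (n%:R + n%:R).
    apply/seteqP; split=> z /=.
      have [n [? ?]] := real_bounded_nat z.2.
      rewrite in_itv/= => /andP[? ?]; exists n => //; apply/rectP; split; lra.
    by move=> [n _ /rectP[? ? ? ?]]; rewrite in_itv/=; apply/andP; split; lra.
  apply: MU => n; apply: sub_sigma_algebra.
  by exists c, (- n%:R), (d - c), (n%:R + n%:R).
have -> : snd @^-1` `]c, d]%classic =
    \bigcup_n rect (- n%:R) c (n%:R + n%:R) (d - c).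
  apply/seteqP; split=> z /=.
    have [n [? ?]] := real_bounded_nat z.1.
    rewrite in_itv/= => /andP[? ?]; exists n => //; apply/rectP; split; lra.
  by move=> [n _ /rectP[? ? ? ?]]; rewrite in_itv/=; apply/andP; split; lra.
apply: MU => n; apply: sub_sigma_algebra.
by exists (- n%:R), c, (n%:R + n%:R), (d - c).
Qed.

Lemma near_box (c : R * R) (P : R * R -> Prop) : (\forall z \near c, P z) <->
  exists2 d : R, 0 < d & forall z, `|z.1 - c.1| < d -> `|z.2 - c.2| < d -> P z.
Proof.
split.
  move=> /nbhs_ballP[d /= d0 dP]; exists d => // z z1 z2; apply: dP.
  by split; rewrite /ball /= distrC.
move=> [d d0 dP]; apply/nbhs_ballP; exists d => //= z [z1 z2]; apply: dP.
  by rewrite distrC.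
by rewrite distrC.
Qed.

(** Corners and sides are rational, hence countably many rectangles. Their closures are kept inside
    [D] because the limit point of a bisection may lie on the boundary. *)
Lemma open_rect_cover (D : set (R * R)) : open D -> exists Q : nat -> set (R * R),
  (forall n, Q n = set0 \/ exists a b p q : R, [/\ 0 < p, 0 < q, Q n = rect a b p q &
     crect a b p q `<=` D]) /\ D `<=` \bigcup_n Q n.
Proof.
move=> oD.
pose ok (t : rat * rat * (rat * rat)) : Prop :=
  [/\ (0 : R) < ratr t.1.2, (0 : R) < ratr t.2.2 &
    crect (ratr t.1.1) (ratr t.2.1) (ratr t.1.2) (ratr t.2.2) `<=` D].
pose Q (n : nat) : set (R * R) := if unpickle n is Some t then
  if `[< ok t >] then rect (ratr t.1.1 : R) (ratr t.2.1) (ratr t.1.2) (ratr t.2.2)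
  else set0 else set0.
exists Q; split.
  move=> n; rewrite /Q; case: unpickle => [t|]; last by left.
  case: asboolP => [[t1 t2 t3]|_]; last by left.
  by right; exists (ratr t.1.1), (ratr t.2.1), (ratr t.1.2), (ratr t.2.2).
move=> z Dz.
have /near_box[d d0 dD] : \forall z' \near z, D z' by exact: open_nbhs_nbhs.
have rats (x : R) : exists s t : rat, [/\ ratr s < x, x <= ratr s + ratr t, x - d < ratr s,
    0 < (ratr t : R) & ratr s + ratr t < x + d].
  have h1 : x - d < x by lra.
  have h2 : x < x + d by lra.
  have [s] := rat_in_itvoo h1; rewrite in_itv/= => /andP[s1 s2].
  have [t] := rat_in_itvoo h2; rewrite in_itv/= => /andP[t1 t2].
  by exists s, (t - s); rewrite rmorphB/=; split; lra.
have [s1 [t1 [? ? ? ? ?]]] := rats z.1; have [s2 [t2 [? ? ? ? ?]]] := rats z.2.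
exists (pickle (s1, t1, (s2, t2))); first exact: I.
rewrite /Q pickleK.
case: asboolP => [_|[]]; first by apply/rectP; split => /=.
split => //= y /crectP[/= ? ? ? ?]; apply: dD; rewrite ltr_norml; apply/andP; split; lra.
Qed.

(** [D] is cut into countably many disjoint pieces, each inside a rectangle with closure in [D]. On
    such a rectangle the restricted measures agree on all rectangles, a generating family closed
    under intersection. *)
Lemma measure_unique_rects (m1 m2 : {measure set (R * R) -> \bar R}) (D : set (R * R)) :
  open D ->
  (forall a b p q : R, 0 < p -> 0 < q -> crect a b p q `<=` D ->
    m1 (rect a b p q) = m2 (rect a b p q) /\ (m1 (rect a b p q) < +oo)%E) ->
  forall A, measurable A -> A `<=` D -> m1 A = m2 A.
Proof.
move=> oD H.
have rect0 (a b p q : R) : (p <= 0) || (q <= 0) -> rect a b p q = set0.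
  move=> pq; apply/seteqP; split => // z /rectP[? ? ? ?].
  by move: pq => /orP[]; lra.
have H1 (a b p q : R) A : 0 < p -> 0 < q -> crect a b p q `<=` D -> measurable A ->
    m1 (A `&` rect a b p q) = m2 (A `&` rect a b p q).
  move=> p0 q0 cD mA; have mQ := rect_measurable a b p q.
  pose g (n : nat) : set (R * R) := rect (- n%:R) (- n%:R) (n%:R + n%:R) (n%:R + n%:R).
  have gT : \bigcup_k g k = setT.
    apply/seteqP; split => // z _.
    have [n [? ?]] := real_bounded_nat z.1; have [m [? ?]] := real_bounded_nat z.2.
    have nm := leq_maxl n m; have mn := leq_maxr n m.
    rewrite -(ler_nat R) in nm; rewrite -(ler_nat R) in mn.
    by exists (maxn n m) => //; apply/rectP; split; lra.
  apply: (@measure_unique _ _ _ rects g measurable_rects rects_setI _ gT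
    (mrestr m1 mQ) (mrestr m2 mQ)) => //.
  - by move=> i; exists (- i%:R), (- i%:R), (i%:R + i%:R), (i%:R + i%:R).
  - move=> B rB; rewrite /mrestr.
    have rQ : rects (rect a b p q) by exists a, b, p, q.
    have [a' [b' [p' [q' E]]]] := rects_setI rB rQ.
    change (m1 (B `&` rect a b p q) = m2 (B `&` rect a b p q)).
    rewrite E; have [pq|] := boolP ((p' <= 0) || (q' <= 0)).
      by rewrite rect0// !measure0.
    rewrite negb_or -!ltNge => /andP[p'0 q'0].
    apply: (H a' b' p' q' _ _ _).1 => // z /crectP zQ; apply: cD.
    have sub z' : rect a' b' p' q' z' -> rect a b p q z' by rewrite -E => -[].
    have /rectP[? ? ? ?] : rect a b p q (a' + p', b' + q').
      by apply: sub; apply/rectP; split => /=; lra.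
    (* If [a' < a], the abscissa [a' + min p' (a - a')] is reached in the smaller rectangle but does
       not exceed [a], which is excluded in the larger one. So the closed rectangles are nested as
       well. *)
    have ea : a <= a'.
      rewrite leNgt; apply/negP => aa'; have : 0 < Num.min p' (a - a') by rewrite lt_min p'0; lra.
      have mp : Num.min p' (a - a') <= p' by rewrite ge_min lexx.
      have ma : Num.min p' (a - a') <= a - a' by rewrite ge_min lexx orbT.
      move=> m0; have /rectP[/= + _ _ _] : rect a b p q (a' + Num.min p' (a - a'), b' + q').
        by apply: sub; apply/rectP; split => /=; lra.
      lra.
    have eb : b <= b'.
      rewrite leNgt; apply/negP => bb'; have : 0 < Num.min q' (b - b') by rewrite lt_min q'0; lra.
      have mp : Num.min q' (b - b') <= q' by rewrite ge_min lexx.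
      have ma : Num.min q' (b - b') <= b - b' by rewrite ge_min lexx orbT.
      move=> m0; have /rectP[/= _ _ + _] : rect a b p q (a' + p', b' + Num.min q' (b - b')).
        by apply: sub; apply/rectP; split => /=; lra.
      lra.
    case: zQ => ? ? ? ?; apply/crectP; split; simpl in *; lra.
  - move=> k; rewrite /mrestr; apply: le_lt_trans (H a b p q p0 q0 cD).2.
    apply: le_measure; rewrite ?inE//.
    by apply: measurableI => //; exact: rect_measurable.
move=> A mA AD; have [Q [Qr DQ]] := open_rect_cover oD.
have mQ n : measurable (Q n).
  by case: (Qr n) => [->//|[a [b [p [q [_ _ -> _]]]]]]; exact: rect_measurable.
have AE : A = \bigcup_n (A `&` seqDU Q n).
  rewrite -setI_bigcupr -seqDU_bigcup_eq; apply/esym/setIidl.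
  exact: subset_trans AD DQ.
have mS n : measurable (A `&` seqDU Q n).
  by apply: measurableI => //; apply: measurableD => //; exact: bigsetU_measurable.
have tS : trivIset setT (fun n => A `&` seqDU Q n).
  by apply: trivIset_setIl; exact: trivIset_seqDU.
rewrite AE !measure_bigcup//; apply: eq_eseriesr => n _.
have -> : A `&` seqDU Q n = (A `&` seqDU Q n) `&` Q n.
  by apply/esym/setIidl => z [_ []].
case: (Qr n) => [->|[a [b [p [q [p0 q0 -> cD]]]]]]; first by rewrite setI0 !measure0.
exact: H1.
Qed.

Local Lemma half_interval (x0 x l X y : R) : 0 < X -> x0 <= x -> x + (X + X) <= x0 + l ->
  y = x \/ y = x + X -> [/\ x0 <= y, y + X <= x0 + l, x <= y & y + X <= x + (X + X)].
Proof. by move=> ? ? ? [] ->; split; lra. Qed.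

(** Goursat's argument. [G a b r] speaks of the rectangle with corner [(a, b)] and sides [r p],
    [r q]. If it fails for the whole rectangle, it fails for one quarter at every stage; these
    quarters shrink to a point, where the local hypothesis contradicts the failure. *)
Lemma rect_bisection (p q : R) (G : R -> R -> R -> Prop) (a0 b0 : R) :
  0 < p -> 0 < q ->
  (forall a b r, 0 < r -> a0 <= a -> a + r * p <= a0 + p ->
    b0 <= b -> b + r * q <= b0 + q ->
    G a b (r / 2) -> G (a + r / 2 * p) b (r / 2) -> G a (b + r / 2 * q) (r / 2) ->
    G (a + r / 2 * p) (b + r / 2 * q) (r / 2) -> G a b r) ->
  (forall c, crect a0 b0 p q c -> exists2 d, 0 < d & forall a b r, 0 < r -> r < d ->
    a0 <= a -> a + r * p <= a0 + p -> b0 <= b -> b + r * q <= b0 + q ->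
    crect a b (r * p) (r * q) c -> G a b r) ->
  G a0 b0 1.
Proof.
move=> p0 q0 Gadd Gloc; apply: contrapT => bad0.
pose inn (t : R * R * R) := [/\ 0 < t.2, a0 <= t.1.1, t.1.1 + t.2 * p <= a0 + p,
  b0 <= t.1.2 & t.1.2 + t.2 * q <= b0 + q].
pose bad (t : R * R * R) := inn t /\ ~ G t.1.1 t.1.2 t.2.
pose child (t t' : R * R * R) := [/\ t'.2 = t.2 / 2, t.1.1 <= t'.1.1,
  t'.1.1 + t'.2 * p <= t.1.1 + t.2 * p, t.1.2 <= t'.1.2 &
  t'.1.2 + t'.2 * q <= t.1.2 + t.2 * q].
have /choice[g gP] : forall t, exists t', bad t -> bad t' /\ child t t'.
  move=> [[a b] r]; have [|nb] := pselect (bad (a, b, r)); last by exists (a, b, r).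
  move=> [[/= r0 h1 h2 h3 h4]] badt.
  have rp : 0 < r / 2 * p by rewrite mulr_gt0// divr_gt0.
  have rq : 0 < r / 2 * q by rewrite mulr_gt0// divr_gt0.
  have r2 : 0 < r / 2 by rewrite divr_gt0.
  have half_in (a' b' : R) : a' = a \/ a' = a + r / 2 * p -> b' = b \/ b' = b + r / 2 * q ->
      ~ G a' b' (r / 2) -> exists t', bad (a, b, r) -> bad t' /\ child (a, b, r) t'.
    move=> a'E b'E nG; exists (a', b', r / 2) => _; rewrite /bad /inn /child /=.
    have rpE : r * p = r / 2 * p + r / 2 * p by field.
    have rqE : r * q = r / 2 * q + r / 2 * q by field.
    move: (r / 2 * p) (r / 2 * q) (r * p) (r * q) rp rq rpE rqE h1 h2 h3 h4 a'E b'E.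
    move=> P Q P2 Q2 P0 Q0 -> -> h1 h2 h3 h4.
    move=> /(half_interval P0 h1 h2)[? ? ? ?] /(half_interval Q0 h3 h4)[? ? ? ?].
    by split; [split; [split|]|split].
  have [b1|b1] := pselect (G a b (r / 2)); last by apply: half_in b1; auto.
  have [b2|b2] := pselect (G (a + r / 2 * p) b (r / 2)); last by apply: half_in b2; auto.
  have [b3|b3] := pselect (G a (b + r / 2 * q) (r / 2)); last by apply: half_in b3; auto.
  have [b4|b4] := pselect (G (a + r / 2 * p) (b + r / 2 * q) (r / 2)); last first.
    by apply: half_in b4; auto.
  by exfalso; apply: badt; exact: Gadd.
pose f n := iter n g (a0, b0, 1).
have fbad n : bad (f n).
  elim: n => [|n IH]; last by have [] := gP _ IH.
  by split; rewrite /f/= ?mul1r ?expr1n ?mulr1//; split; rewrite /= ?mul1r ?ltr01.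
have fch n : child (f n) (f n.+1) by have [_] := gP _ (fbad n).
have fr n : (f n).2 = 2 ^- n.
  elim: n => [|n IH]; first by rewrite /f/= expr0 invr1.
  by have [-> _ _ _ _] := fch n; rewrite IH exprSr invfM.
(* Lower ends increase and upper ends decrease, so the supremum of the lower ends belongs to every
   interval. *)
have lim (lo hi : R * R * R -> R) : (forall n, lo (f n) <= lo (f n.+1)) ->
    (forall n, hi (f n.+1) <= hi (f n)) -> (forall n, lo (f n) <= hi (f n)) ->
    exists c, forall n, lo (f n) <= c /\ c <= hi (f n).
  move=> hl hh lh.
  have hl' n m : (n <= m)%N -> lo (f n) <= lo (f m).
    move=> /subnK <-; elim: (m - n)%N => [|k IH]; first by rewrite add0n.
    by rewrite addSn; exact: le_trans IH (hl _).
  have hh' n m : (n <= m)%N -> hi (f m) <= hi (f n).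
    move=> /subnK <-; elim: (m - n)%N => [|k IH]; first by rewrite add0n.
    by rewrite addSn; exact: le_trans (hh _) IH.
  have lh' n m : lo (f n) <= hi (f m).
    have [nm|mn] := leqP n m; first exact: le_trans (hl' _ _ nm) (lh m).
    exact: le_trans (lh n) (hh' _ _ (ltnW mn)).
  exists (sup (range (fun n => lo (f n)))) => n; split.
    apply: sup_upper_bound; last by exists n.
    by split; [exists (lo (f 0%N)), 0%N|exists (hi (f 0%N)) => _ [k _ <-]].
  apply: ge_sup; first by exists (lo (f 0%N)), 0%N.
  by move=> _ [k _ <-].
have [c1 c1P] := lim (fun t => t.1.1) (fun t => t.1.1 + t.2 * p)
  (fun n => let: And5 _ h _ _ _ := fch n in h) (fun n => let: And5 _ _ h _ _ := fch n in h)
  (fun n => let: conj (And5 h _ _ _ _) _ := fbad n in ler_wpDr (mulr_ge0 (ltW h) (ltW p0)) (lexx _)).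
have [c2 c2P] := lim (fun t => t.1.2) (fun t => t.1.2 + t.2 * q)
  (fun n => let: And5 _ _ _ h _ := fch n in h) (fun n => let: And5 _ _ _ _ h := fch n in h)
  (fun n => let: conj (And5 h _ _ _ _) _ := fbad n in ler_wpDr (mulr_ge0 (ltW h) (ltW q0)) (lexx _)).
have [d d0 dP] : exists2 d, 0 < d & forall a b r, 0 < r -> r < d ->
    a0 <= a -> a + r * p <= a0 + p -> b0 <= b -> b + r * q <= b0 + q ->
    crect a b (r * p) (r * q) (c1, c2) -> G a b r.
  apply: Gloc; apply/crectP; have := c1P 0%N; have := c2P 0%N; rewrite /f/= !mul1r.
  by move=> [? ?] [? ?].
have [n nd] : exists n : nat, 2 ^- n < d :> R.
  have [n _ nP] := near_infty_natSinv_expn_lt (PosNum d0).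
  by exists n; have := nP n (leqnn n); rewrite /= div1r.
have [[h1 h2 h3 h4 h5]] := fbad n; apply.
apply: dP => //; first by rewrite fr.
by apply/crectP; have [? ?] := c1P n; have [? ?] := c2P n.
Qed.

End rectangles.

(** * The change of variables formula *)

Section change_of_variables.
Context {R : realType}.

Local Notation leb := (@lebesgue_measure R).
Local Notation leb2 := (leb \x leb)%E.
Local Notation leb2m :=
  (leb2 : {measure set (measurableTypeR R * measurableTypeR R) -> \bar R}).

(** Differentiability at [c] with gradient [(a, b)], as an explicit estimate. With the gradient as
    an argument, statements about derivatives become identities between numbers. *)
Definition has_lin (f : R * R -> R) (c : R * R) (a b : R) : Prop :=
  forall eta : R, 0 < eta -> \forall z \near c,
    `|f z - f c - (a * (z.1 - c.1) + b * (z.2 - c.2))|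
      <= eta * (`|z.1 - c.1| + `|z.2 - c.2|).

Lemma integral_bounds d (T : measurableType d) (m : {measure set T -> \bar R})
    (A : set T) (w : T -> R) (c1 c2 : R) :
  measurable A -> measurable_fun A w -> 0 <= c1 ->
  (forall x, A x -> c1 <= w x /\ w x <= c2) ->
  (c1%:E * m A <= \int[m]_(x in A) (w x)%:E)%E /\
  (\int[m]_(x in A) (w x)%:E <= c2%:E * m A)%E.
Proof.
move=> mA mw c10 H.
rewrite -(integral_cst m mA c1%:E) -(integral_cst m mA c2%:E); split.
  apply: ge0_le_integral => //; first by exact/measurable_EFinP.
  by move=> x Ax; rewrite lee_fin; have [] := H _ Ax.
apply: ge0_le_integral => //.
- by move=> x Ax; rewrite lee_fin; have [h _] := H _ Ax; exact: le_trans h.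
- by exact/measurable_EFinP.
- by move=> x Ax; rewrite lee_fin; have [] := H _ Ax.
Qed.

(** Chooses the distortion [s]: with sides stretched by [1 + s] or [1 - s] and a weight off by [s],
    the weighted area stays within [e] of [W Dt]. *)
Local Lemma cov_constant (W Dt e : R) : 0 < W -> 0 < Dt -> 0 < e ->
  exists s : R, [/\ 0 < s, s <= 2^-1, s <= W / 2,
    (W + s) * (Dt * (1 + s) ^+ 2) <= W * Dt + e &
    W * Dt - e <= (W - s) * (Dt * (1 - s) ^+ 2)].
Proof.
move=> W0 D0 e0.
have q0 : 0 < Dt * (4 + 3 * W) by rewrite mulr_gt0//; lra.
(* For [s <= 1/2] both deviations from [W Dt] are at most [s Dt (4 + 3 W)]; [s <= W / 2] keeps the
   lower weight [W - s] positive. *)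
pose s := Num.min 2^-1 (Num.min (W / 2) (e / (Dt * (4 + 3 * W)))).
have s0 : 0 < s by rewrite !lt_min; apply/and3P; split; rewrite ?divr_gt0 ?invr_gt0.
have s1 : s <= 2^-1 by rewrite /s ge_min lexx.
have s2 : s <= W / 2 by rewrite /s !ge_min lexx !orbT.
have s3 : s * (Dt * (4 + 3 * W)) <= e.
  by rewrite -ler_pdivlMr// /s !ge_min lexx !orbT.
exists s; split => //; clearbody s.
  have h1 : (1 + s) ^+ 2 <= 1 + 3 * s by nra.
  have h2 : (W + s) * (1 + s) ^+ 2 <= (W + s) * (1 + 3 * s) by rewrite ler_wpM2l//; lra.
  have h3 : (W + s) * (1 + 3 * s) <= W + s * (4 + 3 * W) by nra.
  have := ler_wpM2l (ltW D0) (le_trans h2 h3).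
  rewrite (_ : Dt * (W + _) = W * Dt + s * (Dt * (4 + 3 * W))); last by ring.
  rewrite (_ : Dt * ((W + s) * _) = (W + s) * (Dt * (1 + s) ^+ 2)); last by ring.
  lra.
have h1 : 1 - 2 * s <= (1 - s) ^+ 2 by nra.
have h2 : (W - s) * (1 - 2 * s) <= (W - s) * (1 - s) ^+ 2 by rewrite ler_wpM2l//; lra.
have h3 : W - s * (4 + 3 * W) <= (W - s) * (1 - 2 * s) by nra.
have := ler_wpM2l (ltW D0) (le_trans h3 h2).
rewrite (_ : Dt * (W - s * _) = W * Dt - s * (Dt * (4 + 3 * W))); last by ring.
rewrite (_ : Dt * ((W - s) * _) = (W - s) * (Dt * (1 - s) ^+ 2)); last by ring.
lra.
Qed.

Lemma lin2_le (u v x y C B : R) : 0 <= B -> `|u| + `|v| <= C -> `|x| <= B -> `|y| <= B ->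
  `|u * x + v * y| <= C * B.
Proof.
move=> B0 uv xB yB; apply: le_trans (ler_normD _ _) _; rewrite !normrM.
apply: (@le_trans _ _ ((`|u| + `|v|) * B)); last by rewrite ler_wpM2r.
by rewrite mulrDl lerD// ler_wpM2l.
Qed.

Lemma rect_dist (a b P Q : R) c z : crect a b P Q c -> rect a b P Q z ->
  `|z.1 - c.1| <= P /\ `|z.2 - c.2| <= Q.
Proof.
move=> /crectP[? ? ? ?] /rectP[? ? ? ?]; rewrite !ler_norml.
by split; apply/andP; split; lra.
Qed.

(** Dilation by the factor [1 + s] about the centre of the rectangle; [s] may be negative. *)
Definition rect_grow (a b P Q s : R) : set (R * R) :=
  rect (a - s * P / 2) (b - s * Q / 2) (P * (1 + s)) (Q * (1 + s)).

Lemma rect_growP (a b P Q s : R) z : rect_grow a b P Q s z <->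
  [/\ a - s * P / 2 < z.1, z.1 <= a + P + s * P / 2,
      b - s * Q / 2 < z.2 & z.2 <= b + Q + s * Q / 2].
Proof.
split=> [/rectP[h1 h2 h3 h4]|[h1 h2 h3 h4]].
  by split => //; lra.
by apply/rectP; split => //; lra.
Qed.

Lemma rect_grow_dist (a b P Q s : R) c z : 0 <= P -> 0 <= Q -> s <= 2^-1 ->
  crect a b P Q c -> rect_grow a b P Q s z ->
  `|z.1 - c.1| <= 2 * P /\ `|z.2 - c.2| <= 2 * Q.
Proof.
move=> P0 Q0 s2 /crectP[? ? ? ?] /rect_growP[? ? ? ?]; rewrite !ler_norml.
have hP : s * P <= P / 2 by nra.
have hQ : s * Q <= Q / 2 by nra.
by split; apply/andP; split; lra.
Qed.

Lemma rect_grow_add (a b P Q s t z1 z2 u1 u2 : R) :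
  rect_grow a b P Q t (z1, z2) ->
  `|u1| < s * P / 2 -> `|u2| < s * Q / 2 -> rect_grow a b P Q (t + s) (z1 + u1, z2 + u2).
Proof.
move=> /rect_growP[/= ? ? ? ?]; rewrite !ltr_norml => /andP[? ?] /andP[? ?].
by apply/rect_growP; split => /=; lra.
Qed.

Lemma rect_grow0 (a b P Q : R) : rect_grow a b P Q 0 = rect a b P Q.
Proof. by rewrite /rect_grow !mul0r !subr0 !addr0 !mulr1. Qed.

Lemma leb2_rect_grow (a b P Q s : R) : 0 <= P -> 0 <= Q -> 0 <= 1 + s ->
  leb2 (rect_grow a b P Q s) = (P * Q * (1 + s) ^+ 2)%:E.
Proof.
by move=> P0 Q0 s1; rewrite leb2_rect ?mulr_ge0//; congr EFin; ring.
Qed.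

(* [phi : D1 -> D2] is a bijection with inverse [psi], both are differentiable with
   mutually inverse derivatives, and [w1 = (w2 o phi) |det D phi|]. *)
Record cov_setup (D1 D2 : set (R * R)) (phi psi : R * R -> R * R) (w1 w2 : R * R -> R)
    : Prop := CovSetup {
  cov_open1 : open D1;
  cov_open2 : open D2;
  cov_psi : forall y, D2 y -> D1 (psi y);
  cov_phi : forall z, D1 z -> D2 (phi z);
  cov_phiK : forall z, D1 z -> psi (phi z) = z;
  cov_psiK : forall y, D2 y -> phi (psi y) = y;
  cov_psi_cont : forall y, D2 y -> {for y, continuous psi};
  cov_w1_cont : forall z, D1 z -> {for z, continuous w1};
  cov_w2_cont : forall y, D2 y -> {for y, continuous w2};
  cov_w1_ge0 : forall z, 0 <= w1 z;
  cov_w2_ge0 : forall z, 0 <= w2 z;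
  cov_w2_gt0 : forall y, D2 y -> 0 < w2 y;
  cov_lin : forall c, D1 c -> exists al be ga de : R,
  [/\ al * de - be * ga != 0,
      has_lin (fst \o phi) c al be /\ has_lin (snd \o phi) c ga de,
      has_lin (fst \o psi) (phi c) (de / (al * de - be * ga)) (- be / (al * de - be * ga)),
      has_lin (snd \o psi) (phi c) (- ga / (al * de - be * ga)) (al / (al * de - be * ga)) &
      w1 c = w2 (phi c) * `|al * de - be * ga|] }.

Definition cov_int1 (D1 : set (R * R)) (w1 : R * R -> R) (A : set (R * R)) : \bar R :=
  (\int[leb2]_(x in D1 `&` A) (w1 x)%:E)%E.
Definition cov_int2 (D2 : set (R * R)) (psi : R * R -> R * R) (w2 : R * R -> R) (A : set (R * R)) : \bar R :=
  (\int[leb2]_(x in D2 `&` psi @^-1` A) (w2 x)%:E)%E.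

(** Let [T] be the affine approximation of [phi] at [c]. For a small rectangle [Q] whose closure
    contains [c], the preimage of [Q] under [psi] lies between the images under [T] of [Q] shrunk by
    [1 - s] and dilated by [1 + s]. The area of these images is known, and [w2] is nearly constant
    there. *)
Local Lemma cov_local (D1 D2 : set (R * R)) (phi psi : R * R -> R * R) (w1 w2 : R * R -> R) (c : R * R) (p q e : R)
    (I1 := cov_int1 D1 w1) (I2 := cov_int2 D2 psi w2) :
  cov_setup D1 D2 phi psi w1 w2 -> D1 c -> 0 < p -> 0 < q -> 0 < e ->
  exists2 d, 0 < d & forall a b r, 0 < r -> r < d -> crect a b (r * p) (r * q) c ->
  [/\ ((w1 c - e) * (r * p * (r * q)))%:E <= I1 (rect a b (r * p) (r * q)),
      I1 (rect a b (r * p) (r * q)) <= ((w1 c + e) * (r * p * (r * q)))%:E,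
      ((w1 c - e) * (r * p * (r * q)))%:E <= I2 (rect a b (r * p) (r * q)) &
      I2 (rect a b (r * p) (r * q)) <= ((w1 c + e) * (r * p * (r * q)))%:E]%E.
Proof.
move=> [oD1 oD2 hpsi hphi K1 K2 cpsi cw1 cw2 w1_ge0 w2_ge0 w2_gt0 lin].
have mpsi : measurable_fun D2 psi by exact: continuous_measurable22.
have mD1 : measurable D1 by exact: open_measurable2.
have mD2 : measurable D2 by exact: open_measurable2.
have mw1 : measurable_fun D1 w1 by exact: continuous_measurable2.
have mw2 : measurable_fun D2 w2 by exact: continuous_measurable2.
move=> D1c p0 q0 e0.
have [al [be [ga [de [D0 [phi1 phi2] psi1 psi2 w1E]]]]] := lin c D1c.
set y0 := phi c in psi1 psi2 w1E; set Dl := al * de - be * ga in D0 psi1 psi2 w1E.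
have Dt0 : 0 < `|Dl| by rewrite normr_gt0.
set W := w2 y0 in w1E; have W0 : 0 < W by apply: w2_gt0; exact: hphi.
have [s [s0 s12 sW su sl]] := cov_constant W0 Dt0 e0.
pose m := Num.min p q; pose M := p + q.
have m0 : 0 < m by rewrite lt_min p0.
have mp : m <= p by rewrite ge_min lexx.
have mq : m <= q by rewrite ge_min lexx orbT.
have M0 : 0 < M by rewrite addr_gt0.
pose C' : R := `|al| + `|be| + `|ga| + `|de|.
have C'0 : 0 <= C' by rewrite !addr_ge0.
have [nal nbe nga nde] := And4 (normr_ge0 al) (normr_ge0 be) (normr_ge0 ga) (normr_ge0 de).
have [C'1 C'2 C'3 C'4] : [/\ `|al| + `|be| <= C', `|ga| + `|de| <= C',
    `|de| + `|be| <= C' & `|ga| + `|al| <= C'].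
  by rewrite /C'; move: nal nbe nga nde; clear; split; lra.
pose C := C' / `|Dl|.
have C0 : 0 <= C by rewrite divr_ge0.
(* The error of [phi] is pulled back by the inverse matrix, of size [C]; the error of [psi] is
   measured at images under [T], of size [C']. At scale [r] either choice bounds the displacement by
   [r s m / 4], less than the margin of the dilated rectangle on its shorter side. *)
pose eta1 := s * m / (4 * (C + 1) * M).
have eta10 : 0 < eta1 by rewrite divr_gt0// ?mulr_gt0//; move: C0; clear; lra.
pose eta2 := s * m / (4 * (C' + 1) * M).
have eta20 : 0 < eta2 by rewrite divr_gt0// ?mulr_gt0//; move: C'0; clear; lra.
have eta1E : C * (eta1 * M) <= s * m / 4.
  have -> : eta1 * M = s * m / 4 / (C + 1).
    by rewrite /eta1; field; rewrite !lt0r_neq0//; move: C0; clear; lra.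
  rewrite mulrA ler_pdivrMr; last by move: C0; clear; lra.
  rewrite mulrC ler_wpM2l ?divr_ge0 ?mulr_ge0 ?(ltW s0) ?(ltW m0)//; clear; lra.
have eta2E : eta2 * (C' * M) <= s * m / 4.
  have -> : eta2 * (C' * M) = C' * (s * m / 4) / (C' + 1).
    by rewrite /eta2; field; rewrite !lt0r_neq0//; move: C'0; clear; lra.
  rewrite ler_pdivrMr; last by move: C'0; clear; lra.
  rewrite mulrC ler_wpM2l ?divr_ge0 ?mulr_ge0 ?(ltW s0) ?(ltW m0)//; clear; lra.
have /near_box[d1 d10 N1] : \forall z \near c, [/\ D1 z,
    `|w1 z - w1 c| <= e,
    `|(phi z).1 - y0.1 - (al * (z.1 - c.1) + be * (z.2 - c.2))|
      <= eta1 * (`|z.1 - c.1| + `|z.2 - c.2|) &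
    `|(phi z).2 - y0.2 - (ga * (z.1 - c.1) + de * (z.2 - c.2))|
      <= eta1 * (`|z.1 - c.1| + `|z.2 - c.2|)].
  near=> z; split.
  - by near: z; exact: open_nbhs_nbhs.
  - near: z; move/cvgrPdist_le: (cw1 c D1c) => /(_ _ e0).
    by apply: filterS => z; rewrite distrC.
  - by near: z; exact: phi1.
  - by near: z; exact: phi2.
have /near_box[d2 d20 N2] : \forall y \near y0, [/\ D2 y,
    `|w2 y - W| <= s,
    `|(psi y).1 - c.1 - (de / Dl * (y.1 - y0.1) + - be / Dl * (y.2 - y0.2))|
      <= eta2 * (`|y.1 - y0.1| + `|y.2 - y0.2|) &
    `|(psi y).2 - c.2 - (- ga / Dl * (y.1 - y0.1) + al / Dl * (y.2 - y0.2))|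
      <= eta2 * (`|y.1 - y0.1| + `|y.2 - y0.2|)].
  near=> y; split.
  - by near: y; apply: open_nbhs_nbhs; split => //; exact: hphi.
  - near: y; move/cvgrPdist_le: (cw2 _ (hphi c D1c)) => /(_ _ s0).
    by apply: filterS => y; rewrite distrC.
  - by near: y; have := psi1 _ eta20; rewrite /= K1.
  - by near: y; have := psi2 _ eta20; rewrite /= K1.
pose C2 := 2 * (C' + 1) * M.
have C20 : 0 < C2 by rewrite !mulr_gt0//; move: C'0; clear; lra.
have d0 : 0 < Num.min (d1 / M) (d2 / C2) by rewrite lt_min !divr_gt0.
exists (Num.min (d1 / M) (d2 / C2)); first exact: d0.
move=> a b r r0; rewrite lt_min => /andP[]; rewrite ltr_pdivlMr//.
rewrite [r < d2 / C2]ltr_pdivlMr// => rd1 rd2.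
pose P := r * p; pose P' := r * q => cQ; rewrite -/P -/P' in cQ *.
have P0 : 0 < P by rewrite mulr_gt0.
have P'0 : 0 < P' by rewrite mulr_gt0.
have rME : r * M = P + P' by rewrite /M mulrDr.
have C'd2 : C' * (2 * (r * M)) < d2.
  apply: le_lt_trans rd2; have -> : r * C2 = C' * (2 * (r * M)) + 2 * (r * M).
    by rewrite /C2; ring.
  by rewrite lerDl !mulr_ge0// ltW.
have eta1M : C * (eta1 * (r * M)) <= r * (s * m) / 4.
  have -> : C * (eta1 * (r * M)) = r * (C * (eta1 * M)) by ring.
  by rewrite -mulrA ler_pM2l.
have eta2M : eta2 * (C' * (r * M)) <= r * (s * m) / 4.
  have -> : eta2 * (C' * (r * M)) = r * (eta2 * (C' * M)) by ring.
  by rewrite -mulrA ler_pM2l.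
have sr0 : 0 < s * r by rewrite mulr_gt0.
have rms_p : r * (s * m) / 4 < s * P / 2.
  have : s * r * m <= s * r * p by rewrite ler_pM2l.
  have : 0 < s * r * p by rewrite mulr_gt0.
  by rewrite /P; clear; lra.
have rms_q : r * (s * m) / 4 < s * P' / 2.
  have : s * r * m <= s * r * q by rewrite ler_pM2l.
  have : 0 < s * r * q by rewrite mulr_gt0.
  by rewrite /P'; clear; lra.
have lQ := leb2_rect a b (ltW P0) (ltW P'0).
pose Q := rect a b P P'; rewrite -/Q in lQ *.
have mQ : measurable Q by exact: rect_measurable.
have Qc z : Q z -> `|z.1 - c.1| <= P /\ `|z.2 - c.2| <= P' by exact: rect_dist.
have QN z : Q z -> `|z.1 - c.1| < d1 /\ `|z.2 - c.2| < d1.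
  by move=> /Qc[]; move: rd1 P0 P'0; rewrite rME; clear; split; lra.
have QD1 : Q `<=` D1 by move=> z /QN[z1 z2]; have [] := N1 z z1 z2.
have DQ : D1 `&` Q = Q by apply/setIidr.
have [I1l I1u] : (((w1 c - e) * (P * P'))%:E <= I1 Q)%E /\
    (I1 Q <= ((w1 c + e) * (P * P'))%:E)%E.
  (* The maximum with 0 makes the lower constant admissible for [integral_bounds], since [w1 c - e]
     may be negative. *)
  have w1Q z : Q z -> Num.max 0 (w1 c - e) <= w1 z /\ w1 z <= w1 c + e.
    move=> /QN[z1 z2]; have [_ + _ _] := N1 z z1 z2.
    by rewrite ge_max w1_ge0/=; clear; rewrite ler_norml => /andP[? ?]; split; lra.
  have mwQ : measurable_fun Q w1 by exact: measurable_funS mw1.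
  have mx0 : 0 <= Num.max 0 (w1 c - e) by rewrite le_max lexx.
  have [lo hi] := integral_bounds leb2m mQ mwQ mx0 w1Q.
  rewrite /I1 /cov_int1 DQ; split; last by rewrite EFinM -lQ.
  apply: le_trans lo; rewrite EFinM -lQ; apply: lee_wpmul2r => //.
  by rewrite lee_fin le_max lexx orbT.
suff [I2l I2u] : (((w1 c - e) * (P * P'))%:E <= I2 Q)%E /\
    (I2 Q <= ((w1 c + e) * (P * P'))%:E)%E by split.
pose T := affine2 al be ga de (y0.1 - al * c.1 - be * c.2) (y0.2 - ga * c.1 - de * c.2).
have TE1 z : (T z).1 - y0.1 = al * (z.1 - c.1) + be * (z.2 - c.2).
  by rewrite /T /affine2/=; ring.
have TE2 z : (T z).2 - y0.2 = ga * (z.1 - c.1) + de * (z.2 - c.2).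
  by rewrite /T /affine2/=; ring.
pose Qp := rect_grow a b P P' s; pose Qm := rect_grow a b P P' (- s).
pose PQ := D2 `&` psi @^-1` Q.
have mP : measurable PQ by exact: mpsi.
have TN z : Qp z -> `|(T z).1 - y0.1| < d2 /\ `|(T z).2 - y0.2| < d2.
  move=> /(rect_grow_dist (ltW P0) (ltW P'0) s12 cQ)[b1 b2].
  have B0 : 0 <= 2 * (r * M) by rewrite !mulr_ge0// ltW.
  have {}b1 : `|z.1 - c.1| <= 2 * (r * M).
    by apply: le_trans b1 _; rewrite ler_pM2l// rME; move: P'0; clear; lra.
  have {}b2 : `|z.2 - c.2| <= 2 * (r * M).
    by apply: le_trans b2 _; rewrite ler_pM2l// rME; move: P0; clear; lra.
  rewrite TE1 TE2; split.
    by apply: le_lt_trans C'd2; apply: lin2_le.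
  by apply: le_lt_trans C'd2; apply: lin2_le.
(* With [z = psi y], the point [y] differs from [T z] by the linearization error [(v1, v2)]. Moving
   [z] by the inverse matrix applied to that error gives the point of [Qp] that [T] sends to [y]. *)
have PsubT : PQ `<=` T @` Qp.
  move=> y [D2y Qy]; have [z1 z2] := QN _ Qy; have [b1 b2] := Qc _ Qy.
  have [_ _] := N1 _ z1 z2; rewrite K2//.
  set z := psi y in Qy z1 z2 b1 b2 *.
  set v1 := (X in `|X| <= _ -> _); set v2 := (X in _ -> `|X| <= _ -> _) => hv1 hv2.
  have b12 : eta1 * (`|z.1 - c.1| + `|z.2 - c.2|) <= eta1 * (r * M).
    by rewrite ler_wpM2l ?(ltW eta10)// rME lerD.
  have {}hv1 := le_trans hv1 b12; have {}hv2 := le_trans hv2 b12.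
  pose u1 := de / Dl * v1 + - be / Dl * v2; pose u2 := - ga / Dl * v1 + al / Dl * v2.
  have e0' : 0 <= eta1 * (r * M) := mulr_ge0 (ltW eta10) (mulr_ge0 (ltW r0) (ltW M0)).
  have ub (x x' : R) : `|x| + `|x'| <= C' -> `|x / Dl * v1 + x' / Dl * v2| <= r * (s * m) / 4.
    move=> xx; apply: le_trans eta1M; apply: lin2_le => //.
    by rewrite !normrM normfV -mulrDl /C ler_wpM2r// invr_ge0.
  have hu1 : `|u1| < s * P / 2.
    by apply: le_lt_trans rms_p; apply: ub; rewrite normrN.
  have hu2 : `|u2| < s * P' / 2.
    by apply: le_lt_trans rms_q; apply: ub; rewrite normrN.
  exists (z.1 + u1, z.2 + u2).
    rewrite /Qp -[s]add0r; apply: rect_grow_add => //.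
    by rewrite rect_grow0 -surjective_pairing.
  rewrite [RHS]surjective_pairing [LHS]surjective_pairing; congr pair.
    apply: (@subIr _ y0.1); rewrite TE1/= /u1 /u2 /v1 /v2 /Dl; move: D0; rewrite /Dl; clear.
    by move=> D0; field.
  apply: (@subIr _ y0.2); rewrite TE2/= /u1 /u2 /v1 /v2 /Dl; move: D0; rewrite /Dl; clear.
  by move=> D0; field.
have TsubP : T @` Qm `<=` PQ.
  move=> _ [z Qz <-].
  have up t : - s <= t -> rect_grow a b P P' t z.
    move=> st; move/rect_growP: Qz => [h1 h2 h3 h4].
    have hP : - s * P <= t * P by rewrite ler_wpM2r// ltW.
    have hP' : - s * P' <= t * P' by rewrite ler_wpM2r// ltW.
    by apply/rect_growP; move: h1 h2 h3 h4 hP hP'; clear; split; lra.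
  have Qpz : Qp z by apply: up; move: s0; clear; lra.
  have QQz : Q z by rewrite /Q -rect_grow0; apply: up; move: s0; clear; lra.
  have [t1 t2] := TN _ Qpz; have [D2T _ e1 e2] := N2 _ t1 t2.
  split => //=; have [b1 b2] := Qc _ QQz.
  have rM0 : 0 <= r * M by rewrite mulr_ge0// ltW.
  have {}b1 : `|z.1 - c.1| <= r * M by apply: le_trans b1 _; rewrite rME; move: P'0; clear; lra.
  have {}b2 : `|z.2 - c.2| <= r * M by apply: le_trans b2 _; rewrite rME; move: P0; clear; lra.
  have nT : eta2 * (`|(T z).1 - y0.1| + `|(T z).2 - y0.2|) <= r * (s * m) / 4.
    apply: le_trans eta2M; rewrite ler_wpM2l ?(ltW eta20)// TE1 TE2.
    have -> : C' * (r * M) = (`|al| + `|be|) * (r * M) + (`|ga| + `|de|) * (r * M).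
      by rewrite /C'; ring.
    by apply: lerD; apply: lin2_le.
  have Te1 : de / Dl * ((T z).1 - y0.1) + - be / Dl * ((T z).2 - y0.2) = z.1 - c.1.
    by rewrite TE1 TE2; move: D0; rewrite /Dl; clear => D0; field.
  have Te2 : - ga / Dl * ((T z).1 - y0.1) + al / Dl * ((T z).2 - y0.2) = z.2 - c.2.
    by rewrite TE1 TE2; move: D0; rewrite /Dl; clear => D0; field.
  rewrite Te1 in e1; rewrite Te2 in e2.
  have hu1 := le_lt_trans (le_trans e1 nT) rms_p.
  have hu2 := le_lt_trans (le_trans e2 nT) rms_q.
  rewrite [z]surjective_pairing in Qz.
  have := rect_grow_add Qz hu1 hu2; rewrite addNr rect_grow0.
  rewrite (_ : z.1 + _ = (psi (T z)).1); last by ring.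
  by rewrite (_ : z.2 + _ = (psi (T z)).2) -?surjective_pairing//; ring.
have lQp : leb2 (T @` Qp) = (`|Dl| * (P * P' * (1 + s) ^+ 2))%:E.
  have [_ ->] := leb2_affine_image (y0.1 - al * c.1 - be * c.2) (y0.2 - ga * c.1 - de * c.2)
    D0 (rect_measurable _ _ _ _ : measurable Qp).
  by rewrite leb2_rect_grow ?(ltW P0) ?(ltW P'0)//; move: s0; clear; lra.
have lQm : leb2 (T @` Qm) = (`|Dl| * (P * P' * (1 - s) ^+ 2))%:E.
  have [_ ->] := leb2_affine_image (y0.1 - al * c.1 - be * c.2) (y0.2 - ga * c.1 - de * c.2)
    D0 (rect_measurable _ _ _ _ : measurable Qm).
  by rewrite leb2_rect_grow ?(ltW P0) ?(ltW P'0)//; move: s12; clear; lra.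
have mTQp : measurable (T @` Qp).
  by have [] := leb2_affine_image (y0.1 - al * c.1 - be * c.2) (y0.2 - ga * c.1 - de * c.2)
    D0 (rect_measurable _ _ _ _ : measurable Qp).
have mTQm : measurable (T @` Qm).
  by have [] := leb2_affine_image (y0.1 - al * c.1 - be * c.2) (y0.2 - ga * c.1 - de * c.2)
    D0 (rect_measurable _ _ _ _ : measurable Qm).
have w2P y : PQ y -> W - s <= w2 y /\ w2 y <= W + s.
  move=> /PsubT[z /TN[t1 t2] <-]; have [_ + _ _] := N2 _ t1 t2.
  by clear; rewrite ler_norml => /andP[? ?]; split; lra.
have mwP : measurable_fun PQ w2 by apply: measurable_funS mw2 => // y [].
have Ws : 0 <= W - s by move: sW W0; clear; lra.
have [lo hi] := integral_bounds leb2m mP mwP Ws w2P.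
have rr0 : 0 <= P * P' by rewrite mulr_ge0// ltW.
split.
  apply: le_trans lo; apply: (@le_trans _ _ ((W - s)%:E * leb2 (T @` Qm))%E).
    rewrite lQm -EFinM lee_fin w1E.
    have := ler_wpM2r rr0 sl; congr (_ <= _); ring.
  by apply: lee_wpmul2l; [rewrite lee_fin|apply: le_measure; rewrite ?inE].
apply: le_trans hi _; apply: (@le_trans _ _ ((W + s)%:E * leb2 (T @` Qp))%E).
  apply: lee_wpmul2l; [rewrite lee_fin|by apply: le_measure; rewrite ?inE].
  by rewrite addr_ge0// ltW.
rewrite lQp -EFinM lee_fin w1E.
have := ler_wpM2r rr0 su; congr (_ <= _); ring.
Unshelve. all: by end_near.
Qed.

Local Lemma rect_split (a b p q : R) : 0 < p -> 0 < q ->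
  rect a b (p + p) (q + q) = \big[setU/set0]_(i < 4)
    nth set0 [:: rect a b p q; rect (a + p) b p q; rect a (b + q) p q;
                 rect (a + p) (b + q) p q] i.
Proof.
move=> p0 q0; rewrite !big_ord_recl big_ord0 /= setU0; apply/seteqP; split => z.
  move=> /rectP[z1 z2 z3 z4].
  have [h|h] := leP z.1 (a + p); have [k|k] := leP z.2 (b + q).
  - by left; apply/rectP; split => //; lra.
  - by right; right; left; apply/rectP; split => //; lra.
  - by right; left; apply/rectP; split => //; lra.
  - by right; right; right; apply/rectP; split => //; lra.
by move=> [|[|[|]]] /rectP[? ? ? ?]; apply/rectP; split; lra.
Qed.

Local Lemma measure_rect_split (m : {measure set (R * R) -> \bar R}) (a b p q : R) :
  0 < p -> 0 < q -> m (rect a b (p + p) (q + q)) =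
  (m (rect a b p q) + m (rect (a + p) b p q) + m (rect a (b + q) p q)
    + m (rect (a + p) (b + q) p q))%E.
Proof.
move=> p0 q0; rewrite rect_split// measure_bigsetU; last 2 first.
- by move=> [|[|[|[|i]]]] /=; rewrite ?nth_nil//; exact: rect_measurable.
- apply/trivIsetP => -[|[|[|[|i]]]] [|[|[|[|j]]]] _ _ //= _; rewrite ?nth_nil ?setI0 ?set0I//;
  by apply/seteqP; split => // z [/rectP[? ? ? ?] /rectP[? ? ? ?]]; lra.
by rewrite !big_ord_recl big_ord0 /= adde0 !addeA.
Qed.

(** Both sides are measures in [A], so rectangles suffice. On rectangles the difference is additive
    under bisection, and by [cov_local] it is at most [e] times the area on small rectangles near
    any point; bisection extends this bound to the whole rectangle. *)
Lemma change_of_variables (D1 D2 : set (R * R)) (phi psi : R * R -> R * R)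
    (w1 w2 : R * R -> R) (A : set (R * R)) :
  cov_setup D1 D2 phi psi w1 w2 -> measurable A -> A `<=` D1 ->
  (\int[leb2]_(x in A) (w1 x)%:E)%E =
  (\int[leb2]_(x in D2 `&` psi @^-1` A) (w2 x)%:E)%E.
Proof.
move=> H mA AD; have [oD1 oD2 _ _ _ _ cpsi cw1 cw2 w1_ge0 w2_ge0 _ _] := H.
have mpsi : measurable_fun D2 psi by exact: continuous_measurable22.
have mD1 : measurable D1 by exact: open_measurable2.
have mD2 : measurable D2 by exact: open_measurable2.
have mw1 : measurable_fun D1 w1 by exact: continuous_measurable2.
have mw2 : measurable_fun D2 w2 by exact: continuous_measurable2.
have mid : measurable_fun D1 (id : R * R -> R * R) by exact: measurable_id.
have [m1 m1E] := @image_density_exists _ _ _ (R * R)%type R leb2m D1 w1 id w1_ge0 mD1 mw1 mid.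
have [m2 m2E] := @image_density_exists _ _ _ (R * R)%type R leb2m D2 w2 psi w2_ge0 mD2 mw2 mpsi.
suff E : m1 A = m2 A.
  by move: E; rewrite m1E// m2E// /image_density preimage_id setIidr.
apply: (measure_unique_rects oD1) mA AD => a b p q p0 q0 cD.
have mr a' b' p' q' := rect_measurable a' b' p' q' : measurable (rect a' b' p' q' : set (R * R)).
(* Finiteness of both measures is carried through the bisection, since neither is known to be finite
   on the rectangle beforehand. *)
pose G (e : R) a' b' r := [/\ (m1 (rect a' b' (r * p) (r * q)) < +oo)%E,
  (m2 (rect a' b' (r * p) (r * q)) < +oo)%E &
  `|fine (m1 (rect a' b' (r * p) (r * q))) - fine (m2 (rect a' b' (r * p) (r * q)))|
    <= e * r ^+ 2].
have Ge e : 0 < e -> G e a b 1.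
  move=> e0; apply: (@rect_bisection _ p q (G e)) => //.
    move=> a' b' r r0 _ _ _ _ [f1 g1 d1] [f2 g2 d2] [f3 g3 d3] [f4 g4 d4].
    have rp0 : 0 < r / 2 * p by rewrite mulr_gt0// divr_gt0.
    have rq0 : 0 < r / 2 * q by rewrite mulr_gt0// divr_gt0.
    have rpE : r * p = r / 2 * p + r / 2 * p by field.
    have rqE : r * q = r / 2 * q + r / 2 * q by field.
    rewrite /G rpE rqE !measure_rect_split//.
    have fn (m : {measure set (R * R) -> \bar R}) B : (m B < +oo)%E -> m B \is a fin_num.
      by move=> mB; rewrite ge0_fin_numE.
    split; [by rewrite !lte_add_pinfty|by rewrite !lte_add_pinfty|].
    rewrite !fineD ?fin_numD ?fn//.
    have -> : e * r ^+ 2 = e * (r / 2) ^+ 2 + e * (r / 2) ^+ 2 + e * (r / 2) ^+ 2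
      + e * (r / 2) ^+ 2 by field.
    set x1 := fine _ in d1 *; set y1 := fine _ in d1 *; set x2 := fine _ in d2 *.
    set y2 := fine _ in d2 *; set x3 := fine _ in d3 *; set y3 := fine _ in d3 *.
    set x4 := fine _ in d4 *; set y4 := fine _ in d4 *.
    have -> : x1 + x2 + x3 + x4 - (y1 + y2 + y3 + y4)
      = x1 - y1 + (x2 - y2) + (x3 - y3) + (x4 - y4) by ring.
    apply: le_trans (ler_normD _ _) _; apply: lerD => //.
    apply: le_trans (ler_normD _ _) _; apply: lerD => //.
    by apply: le_trans (ler_normD _ _) _; apply: lerD.
  move=> c /cD D1c; have pq0 : 0 < p * q by rewrite mulr_gt0.
  have e'0 : 0 < e / 2 / (p * q) by rewrite !divr_gt0.
  have [d d0 dP] := cov_local H D1c p0 q0 e'0.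
  exists d => // a' b' r r0 rd _ _ _ _ cc; have [l1 u1 l2 u2] := dP a' b' r r0 rd cc.
  have E1 : m1 (rect a' b' (r * p) (r * q)) = cov_int1 D1 w1 (rect a' b' (r * p) (r * q)).
    by rewrite m1E.
  have E2 : m2 (rect a' b' (r * p) (r * q)) = cov_int2 D2 psi w2 (rect a' b' (r * p) (r * q)).
    by rewrite m2E.
  rewrite -E1 in l1 u1; rewrite -E2 in l2 u2.
  have f1 := le_lt_trans u1 (ltry _); have f2 := le_lt_trans u2 (ltry _).
  split => //.
  have F1 : m1 (rect a' b' (r * p) (r * q)) \is a fin_num by rewrite ge0_fin_numE.
  have F2 : m2 (rect a' b' (r * p) (r * q)) \is a fin_num by rewrite ge0_fin_numE.
  rewrite -(fineK F1) !lee_fin in l1 u1; rewrite -(fineK F2) !lee_fin in l2 u2.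
  move: (fine _) (fine _) l1 u1 l2 u2 => x y.
  have er : e / 2 / (p * q) * (r * p * (r * q)) = e / 2 * r ^+ 2.
    by field; rewrite !lt0r_neq0.
  rewrite mulrBl mulrDl er; move: (w1 c * _) => K.
  clear; move=> *; rewrite ler_norml; apply/andP; split; lra.
have [fm1 fm2 _] := Ge 1 ltr01; rewrite !mul1r in fm1 fm2.
have F1 : m1 (rect a b p q) \is a fin_num by rewrite ge0_fin_numE.
have F2 : m2 (rect a b p q) \is a fin_num by rewrite ge0_fin_numE.
split => //; rewrite -(fineK F1) -(fineK F2); congr EFin.
apply/eqP; rewrite -subr_eq0 -normr_eq0; apply/negPn/negP => n0.
have h : 0 < `|fine (m1 (rect a b p q)) - fine (m2 (rect a b p q))|.
  by rewrite lt_neqAle eq_sym n0/=.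
(* The tolerance is half of the supposed nonzero difference. *)
have [_ _] := Ge _ (divr_gt0 h (ltr0Sn R 1)).
by rewrite !mul1r expr1n mulr1; move: h; clear; lra.
Qed.

End change_of_variables.

(** * Differential calculus in the plane *)

Section calculus.
Context {R : realType}.
Local Notation D1 := (fun f : R * R -> R => 'D_(1, 0) f).
Local Notation D2 := (fun f : R * R -> R => 'D_(0, 1) f).

Lemma norm2_le (z : R * R) : `|z| <= `|z.1| + `|z.2|.
Proof. by rewrite prod_normE ge_max lerDl lerDr !normr_ge0. Qed.

Lemma norm2_ge (z : R * R) : `|z.1| <= `|z| /\ `|z.2| <= `|z|.
Proof. by rewrite prod_normE !le_max !lexx orbT. Qed.

Lemma near0_sub (V : normedModType R) (P : V -> Prop) : (\forall h \near 0, P h) ->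
  forall c : V, \forall z \near c, P (z - c).
Proof.
move=> hP c; have : (fun z => z - c) @ c --> c - c by apply: cvgB; [exact: cvg_id|exact: cvg_cst].
by rewrite subrr => /(_ _ hP).
Qed.

Lemma differentiable_derive (f : R * R -> R) (c v : R * R) : differentiable f c ->
  'D_v f c = v.1 * D1 f c + v.2 * D2 f c.
Proof.
move=> df; rewrite !deriveE//.
have {1}-> : v = v.1 *: (1, 0) + v.2 *: (0, 1).
  rewrite [LHS]surjective_pairing; congr pair => /=;
  by rewrite /GRing.scale /= ?mulr0 ?mulr1 ?addr0 ?add0r.
by rewrite linearD !linearZ.
Qed.

Lemma differentiable_has_lin (f : R * R -> R) (c : R * R) : differentiable f c ->
  has_lin f c (D1 f c) (D2 f c).
Proof.
move=> df eta eta0; have /diff_locallyxP[_ H] := df.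
have e2 : 0 < eta by [].
have : \forall h \near (0 : R * R), `|f (h + c) - (f c + 'd f c h)| <= eta * `|h|.
  have E : (fun h => f (h + c)) = (fun h => f c + 'd f c h) +o_ (nbhs (0 : R * R)) id.
    exact: eqaddoE (funext H).
  by move/eqaddoP : E => /(_ _ e2).
move/near0_sub => /(_ c); apply: filterS => z; rewrite subrK.
rewrite -deriveE// differentiable_derive//= opprD addrA => hh.
rewrite [_ * (z.1 - c.1)]mulrC [_ * (z.2 - c.2)]mulrC.
by apply: le_trans hh _; rewrite ler_wpM2l ?(ltW eta0)//; exact: norm2_le.
Qed.

Lemma has_linD (f g : R * R -> R) c a b a' b' : has_lin f c a b -> has_lin g c a' b' ->
  has_lin (fun z => f z + g z) c (a + a') (b + b').
Proof.
move=> hf hg eta eta0; have e2 : 0 < eta / 2 by rewrite divr_gt0.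
apply: filterS2 (hf _ e2) (hg _ e2) => z fz gz.
have := le_trans (ler_normD _ _) (lerD fz gz); rewrite -mulrDl -splitr.
by apply: le_trans; rewrite le_eqVlt; apply/orP; left; apply/eqP; congr (`|_|); ring.
Qed.

Lemma has_lin_cvg (f : R * R -> R) c a b : has_lin f c a b -> {for c, continuous f}.
Proof.
move=> hf; apply/cvgrPdist_le => e e0.
pose K := 1 + `|a| + `|b|; have K0 : 0 < K by rewrite /K; have := normr_ge0 a; have := normr_ge0 b; lra.
have := hf 1 ltr01; have eK : 0 < e / K / 2 by rewrite !divr_gt0.
move=> hf1; near=> z.
have h1 : `|f z - f c - (a * (z.1 - c.1) + b * (z.2 - c.2))| <= 1 * (`|z.1 - c.1| + `|z.2 - c.2|).
  by near: z.
have [z1 z2] : `|z.1 - c.1| < e / K / 2 /\ `|z.2 - c.2| < e / K / 2.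
  by near: z; apply/near_box; exists (e / K / 2).
have h2 : `|a * (z.1 - c.1) + b * (z.2 - c.2)| <= (`|a| + `|b|) * (e / K / 2).
  by apply: lin2_le => //; exact: ltW.
rewrite distrC -[f z - f c](subrK (a * (z.1 - c.1) + b * (z.2 - c.2))).
apply: le_trans (ler_normD _ _) _.
have h3 : (`|a| + `|b|) * (e / K / 2) + (e / K / 2 + e / K / 2) <= e.
  have -> : (`|a| + `|b|) * (e / K / 2) + (e / K / 2 + e / K / 2) = e - (`|a| + `|b|) * (e / K / 2).
    by rewrite /K; field; rewrite -/K lt0r_neq0.
  by rewrite gerBl; apply: mulr_ge0; [exact: addr_ge0|exact: ltW].
by move: h1 h2 h3 z1 z2; clear; lra.
Unshelve. all: by end_near. Qed.

Lemma has_lin_unique (f : R * R -> R) c a b a' b' :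
  has_lin f c a b -> has_lin f c a' b' -> a = a' /\ b = b'.
Proof.
move=> hf hg.
have key (v : R * R) : `|v.1| + `|v.2| = 1 -> (a - a') * v.1 + (b - b') * v.2 = 0.
  move=> v1; apply/eqP; rewrite -normr_le0; apply/ler_addgt0Pl => e e0; rewrite addr0.
  have e2 : 0 < e / 2 by rewrite divr_gt0.
  have /near_box[d d0 dP] : \forall z \near c,
      `|f z - f c - (a * (z.1 - c.1) + b * (z.2 - c.2))| <= e / 2 * (`|z.1 - c.1| + `|z.2 - c.2|) /\
      `|f z - f c - (a' * (z.1 - c.1) + b' * (z.2 - c.2))| <= e / 2 * (`|z.1 - c.1| + `|z.2 - c.2|).
    by near=> z; split; near: z; [exact: hf|exact: hg].
  pose t := d / 2; have t0 : 0 < t by rewrite divr_gt0.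
  have [v1l v2l] : `|v.1| <= 1 /\ `|v.2| <= 1.
    by rewrite -v1 lerDl lerDr !normr_ge0.
  have td : t < d by rewrite /t; move: d0; clear; lra.
  clearbody t.
  have hd (x y : R) : `|y| <= 1 -> `|x + t * y - x| < d.
    by move=> y1; rewrite addrAC subrr add0r normrM gtr0_norm//; apply: le_lt_trans td;
      rewrite ger_pMr.
  have /= := dP (c.1 + t * v.1, c.2 + t * v.2) (hd _ _ v1l) (hd _ _ v2l).
  rewrite !(addrAC _ (t * _)) !subrr !add0r !normrM gtr0_norm// -mulrDr v1 mulr1.
  set X := f _ - f c => -[h1 h2]; rewrite -(ler_pM2l t0) -{1}(gtr0_norm t0) -normrM.
  have -> : t * ((a - a') * v.1 + (b - b') * v.2) =
    (X - (a' * (t * v.1) + b' * (t * v.2))) - (X - (a * (t * v.1) + b * (t * v.2))) by ring.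
  by apply: le_trans (ler_normB _ _) _; move: h1 h2; clear; lra.
have := key (1, 0); have := key (0, 1); rewrite /= normr0 normr1 add0r addr0 => /(_ erefl) h1 /(_ erefl) h2.
by split; apply/eqP; rewrite -subr_eq0; apply/eqP; [move: h2|move: h1]; clear; lra.
Unshelve. all: by end_near. Qed.

Lemma near_has_lin (f g : R * R -> R) c a b : (\forall z \near c, f z = g z) ->
  has_lin f c a b -> has_lin g c a b.
Proof.
move=> fg hf eta eta0; have fgc := nbhs_singleton fg.
by apply: filterS2 (hf _ eta0) fg => z + <-; rewrite -fgc.
Qed.

Lemma has_lin_differentiable (f : R * R -> R) (c : R * R) a b : has_lin f c a b ->
  differentiable f c /\ forall v, 'D_v f c = v.1 * a + v.2 * b.
Proof.
move=> hf.
pose L (v : R * R) : R := v.1 * a + v.2 * b.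
have linL : linear L by move=> k u v; rewrite /L /= /GRing.scale /=; ring.
pose LM := GRing.isLinear.Build _ _ _ _ _ linL.
pose Ll : {linear (R * R)%type -> R} := HB.pack L LM.
have cL : continuous Ll.
  move=> z; rewrite /continuous_at /=; apply: cvgD; apply: cvgMl;
  [exact: cvg_fst|exact: cvg_snd].
have E : f \o shift c = cst (f c) + Ll +o_ (nbhs (0 : R * R)) id.
  apply/eqaddoP => eta eta0; have e2 : 0 < eta / 2 by rewrite divr_gt0.
  have /near_box[d d0 dP] := hf _ e2.
  apply/near_box; exists d => //= h; rewrite !subr0 => h1 h2.
  have := dP (h + c); rewrite /= !addrK => /(_ h1 h2).
  rewrite /= !fctE /= /L [h.1 * a]mulrC [h.2 * b]mulrC (opprD (f c)) (addrA (f (h + c))) => H.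
  apply: le_trans H _; have [n1 n2] := norm2_ge h.
  by move: n1 n2 e2; set x := `|h.1|; set y := `|h.2|; set w := `|h|; clear; nra.
have dE := diff_unique cL E.
have df : differentiable f c by apply/diff_locallyP; rewrite dE.
by split => // v; rewrite deriveE// dE.
Qed.

Lemma derive_comp (U V W : normedModType R) (f : U -> V) (g : V -> W) x v :
  differentiable f x -> differentiable g (f x) ->
  'D_v (g \o f) x = 'D_('D_v f x) g (f x).
Proof.
by move=> df dg; rewrite !deriveE//; [rewrite diff_comp|exact: differentiable_comp].
Qed.

Lemma derive_scalar (W : normedModType R) (g : R -> W) (x h : R) :
  differentiable g x -> 'D_h g x = h *: 'D_1 g x.
Proof. by move=> dg; rewrite !deriveE// -{1}[h]mulr1 linearZ. Qed.

Lemma derive_pair (U V W : normedModType R) (f : U -> V) (g : U -> W) x v :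
  differentiable f x -> differentiable g x ->
  'D_v (fun y => (f y, g y)) x = ('D_v f x, 'D_v g x).
Proof.
move=> df dg; rewrite !deriveE//; last exact: differentiable_pair.
by rewrite diff_pair.
Qed.

Lemma is_derive_differentiable (W : normedModType R) (g : R -> W) (x : R) d :
  is_derive x (1 : R) g d -> differentiable g x /\ 'D_1 g x = d.
Proof. by move=> [dg <-]; split => //; exact/derivable1_diffP. Qed.

Lemma differentiable_is_derive (U W : normedModType R) (g : U -> W) x v :
  differentiable g x -> is_derive x v g ('D_v g x).
Proof. by move=> dg; apply: DeriveDef => //; exact: diff_derivable. Qed.

Lemma has_lin_cst (k : R) c : has_lin (fun=> k) c 0 0.
Proof.
move=> eta eta0; near=> z; rewrite !mul0r subrr addr0 subr0 normr0.
by rewrite mulr_ge0 ?(ltW eta0)// addr_ge0.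
Unshelve. all: by end_near. Qed.

Lemma has_linM (f g : R * R -> R) c a b a' b' : has_lin f c a b -> has_lin g c a' b' ->
  has_lin (fun z => f z * g z) c (f c * a' + a * g c) (f c * b' + b * g c).
Proof.
move=> /has_lin_differentiable[df Df] /has_lin_differentiable[dg Dg].
have := differentiable_has_lin (differentiableM df dg).
have d1 v : derivable f c v by exact: diff_derivable.
have d2 v : derivable g c v by exact: diff_derivable.
rewrite !deriveM ?Df ?Dg //= !mul1r !mul0r !addr0 !add0r /GRing.scale/=.
by rewrite ![g c * _]mulrC.
Qed.

Lemma has_lin_comp1 (k : R -> R) (g : R * R -> R) c a b d :
  has_lin g c a b -> is_derive (g c) (1 : R) k d -> has_lin (k \o g) c (d * a) (d * b).
Proof.
move=> /has_lin_differentiable[dg Dg] /is_derive_differentiable[dk Dk].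
have := differentiable_has_lin (differentiable_comp dg dk).
rewrite !(derive_comp _ dg dk) !Dg /= !mul1r !mul0r addr0 add0r.
by rewrite (derive_scalar a dk) (derive_scalar b dk) Dk /GRing.scale /= (mulrC a) (mulrC b).
Qed.

Lemma has_lin_comp2 (f f1 f2 : R * R -> R) c a b a1 b1 a2 b2 :
  has_lin f1 c a1 b1 -> has_lin f2 c a2 b2 -> has_lin f (f1 c, f2 c) a b ->
  has_lin (fun z => f (f1 z, f2 z)) c (a * a1 + b * a2) (a * b1 + b * b2).
Proof.
move=> /has_lin_differentiable[d1 D1'] /has_lin_differentiable[d2 D2'].
move=> /has_lin_differentiable[d D].
have := differentiable_has_lin (differentiable_comp (differentiable_pair d1 d2) d).
rewrite !(derive_comp _ (differentiable_pair d1 d2) d) !derive_pair// !D /= !D1' !D2' /=.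
by rewrite !mul1r !mul0r !addr0 !add0r ![_ * a]mulrC ![_ * b]mulrC.
Qed.

Lemma is_derive_curve (f : R * R -> R) (c1 c2 : R -> R) (s a b d1 d2 : R) :
  is_derive s (1 : R) c1 d1 -> is_derive s (1 : R) c2 d2 ->
  has_lin f (c1 s, c2 s) a b ->
  is_derive s (1 : R) (fun s => f (c1 s, c2 s)) (a * d1 + b * d2).
Proof.
move=> /is_derive_differentiable[dc1 D1'] /is_derive_differentiable[dc2 D2'].
move=> /has_lin_differentiable[d D].
have dd := differentiable_comp (differentiable_pair dc1 dc2) d.
apply: DeriveDef; first exact/derivable1_diffP.
rewrite (derive_comp _ (differentiable_pair dc1 dc2) d) derive_pair// D /= D1' D2'.
by rewrite ![_ * a]mulrC ![_ * b]mulrC.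
Qed.

Lemma is_derive_slice1 (f : R * R -> R) x y a b : has_lin f (x, y) a b ->
  is_derive x (1 : R) (fun s => f (s, y)) a.
Proof.
move=> h; have := is_derive_curve (is_derive_id x 1) (is_derive_cst y x 1) h.
by rewrite mulr1 mulr0 addr0.
Qed.

Lemma is_derive_slice2 (f : R * R -> R) x y a b : has_lin f (x, y) a b ->
  is_derive y (1 : R) (fun s => f (x, s)) b.
Proof.
move=> h; have := is_derive_curve (is_derive_cst x y 1) (is_derive_id y 1) h.
by rewrite mulr1 mulr0 add0r.
Qed.

Lemma mvt_linear (g g' : R -> R) (L eta a b : R) :
  (forall s, Num.min a b <= s -> s <= Num.max a b -> is_derive s (1 : R) g (g' s)) ->
  (forall s, Num.min a b <= s -> s <= Num.max a b -> `|g' s - L| <= eta) ->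
  `|g b - g a - L * (b - a)| <= eta * `|b - a|.
Proof.
wlog ab : a b / a <= b => [H dg bg|dg bg].
  have [/H|/ltW ba] := leP a b; first exact.
  have := H b a ba; rewrite minC maxC => /(_ dg bg).
  rewrite [`|b - a|]distrC.
  by rewrite (_ : g b - g a - L * (b - a) = - (g a - g b - L * (a - b))) ?normrN//; ring.
rewrite min_l// max_r// in dg bg.
have cg : {within `[a, b], continuous g}.
  apply: derivable_within_continuous => s; rewrite in_itv/= => /andP[s1 s2].
  by have [] := dg s s1 s2.
have dg' s : s \in `]a, b[ -> is_derive s (1 : R) g (g' s).
  by rewrite in_itv/= => /andP[s1 s2]; apply: dg; exact: ltW.
have [s + ->] := MVT_segment ab dg' cg; rewrite in_itv/= => /andP[s1 s2].
by rewrite -mulrBl normrM ler_wpM2r// bg.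
Qed.

(** Strict differentiability: both points vary. The increment is split along a path parallel to the
    axes, and the mean value theorem is applied on each segment. This is what yields Lipschitz
    bounds, for functions and for inverses of charts. *)
Lemma strict_lin (f fu fv : R * R -> R) (c : R * R) (eta : R) :
  (\forall z \near c, has_lin f z (fu z) (fv z)) ->
  {for c, continuous fu} -> {for c, continuous fv} -> 0 < eta ->
  exists2 d, 0 < d & forall z z', `|z.1 - c.1| < d -> `|z.2 - c.2| < d ->
    `|z'.1 - c.1| < d -> `|z'.2 - c.2| < d ->
    `|f z - f z' - (fu c * (z.1 - z'.1) + fv c * (z.2 - z'.2))|
      <= eta * (`|z.1 - z'.1| + `|z.2 - z'.2|).
Proof.
move=> fN cu cv eta0.
have /near_box[d d0 dP] : \forall z \near c, [/\ has_lin f z (fu z) (fv z),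
    `|fu z - fu c| <= eta & `|fv z - fv c| <= eta].
  move/cvgrPdist_le : cu => /(_ _ eta0) cu; move/cvgrPdist_le : cv => /(_ _ eta0) cv.
  by apply: filterS3 fN cu cv => z fz cuz cvz; split => //; rewrite distrC.
have btw (x x' y s : R) : `|x - y| < d -> `|x' - y| < d -> Num.min x' x <= s ->
    s <= Num.max x' x -> `|s - y| < d.
  rewrite !ltr_norml => /andP[? ?] /andP[? ?]; rewrite ge_min le_max.
  by move=> /orP[] ? /orP[] ?; apply/andP; split; lra.
exists d => // -[z1 z2] [z1' z2'] /= h1 h2 h1' h2'.
have s1 := @mvt_linear (fun s => f (s, z2)) (fun s => fu (s, z2)) (fu c) eta z1' z1
  (fun s l u => is_derive_slice1 (let: And3 h _ _ := dP (s, z2) (btw _ _ _ _ h1 h1' l u) h2 in h))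
  (fun s l u => let: And3 _ h _ := dP (s, z2) (btw _ _ _ _ h1 h1' l u) h2 in h).
have s2 := @mvt_linear (fun s => f (z1', s)) (fun s => fv (z1', s)) (fv c) eta z2' z2
  (fun s l u => is_derive_slice2 (let: And3 h _ _ := dP (z1', s) h1' (btw _ _ _ _ h2 h2' l u) in h))
  (fun s l u => let: And3 _ _ h := dP (z1', s) h1' (btw _ _ _ _ h2 h2' l u) in h).
have := le_trans (ler_normD _ _) (lerD s1 s2); rewrite -mulrDr.
by congr (`|_| <= _); ring.
Qed.

End calculus.

(** * Functions of class C^1 and C^2 *)

Section C2_functions.
Context {R : realType}.
Local Notation D1 := (fun f : R * R -> R => 'D_(1, 0) f).
Local Notation D2 := (fun f : R * R -> R => 'D_(0, 1) f).
Implicit Types (D : set (R * R)) (f g : R * R -> R).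

Lemma continuous_ext_on (T U : topologicalType) (D : set T) (f g : T -> U) x :
  open D -> D x -> (forall z, D z -> f z = g z) -> {for x, continuous f} ->
  {for x, continuous g}.
Proof.
move=> oD Dx fg cf; have {}cf : f @ x --> g x by rewrite -(fg x Dx).
apply: cvg_trans cf; apply: near_eq_cvg.
by apply: filterS (open_nbhs_nbhs (conj oD Dx)) => z /fg.
Qed.

Definition C1f D f fu fv : Prop :=
  [/\ forall z, D z -> has_lin f z (fu z) (fv z),
      forall z, D z -> {for z, continuous fu} &
      forall z, D z -> {for z, continuous fv}].

Lemma C1f_C1_on D f fu fv : open D -> C1f D f fu fv -> C1_on D f.
Proof.
move=> oD [H cu cv]; split=> [z Dz|v z Dz]; first by have [] := has_lin_differentiable (H z Dz).
apply: (continuous_ext_on (f := fun z => v.1 * fu z + v.2 * fv z) oD Dz).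
  by move=> y Dy; have [_ ->] := has_lin_differentiable (H y Dy).
by apply: cvgD; apply: cvgMr; [exact: cu|exact: cv].
Qed.

Lemma C1_on_C1f D f : C1_on D f -> C1f D f (D1 f) (D2 f).
Proof.
move=> [df cf]; split=> [z Dz|z Dz|z Dz]; [|exact: cf|exact: cf].
exact: differentiable_has_lin (df z Dz).
Qed.

Lemma C1_on_continuous D f z : C1_on D f -> D z -> {for z, continuous f}.
Proof. by move=> [df _] Dz; apply: differentiable_continuous; exact: df. Qed.

Lemma C1_on_ext D f g : open D -> (forall z, D z -> f z = g z) -> C1_on D f -> C1_on D g.
Proof.
move=> oD fg /C1_on_C1f[H cu cv]; apply: (C1f_C1_on oD (fu := D1 f) (fv := D2 f)).
split=> // z Dz; apply: near_has_lin (H z Dz).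
by apply: filterS (open_nbhs_nbhs (conj oD Dz)) => y /fg.
Qed.

Lemma C1_on_sub (V W : normedModType R) (D D' : set V) (f : V -> W) :
  D' `<=` D -> C1_on D f -> C1_on D' f.
Proof. by move=> DD' [h1 h2]; split=> [x /DD'/h1//|v x /DD'/h2]. Qed.

Lemma C2_on_sub (V W : normedModType R) (D D' : set V) (f : V -> W) :
  D' `<=` D -> C2_on D f -> C2_on D' f.
Proof. by move=> DD' [h1 h2]; split=> [|v]; exact: C1_on_sub DD' _. Qed.

Lemma C2_on_local (V W : normedModType R) (D : set V) (f : V -> W) :
  (forall z, D z -> exists2 D', D' z & C2_on D' f) -> C2_on D f.
Proof.
move=> H; split=> [|v]; split=> [x /H[D' D'x [[h1 h2] h3]]|w x /H[D' D'x [[h1 h2] h3]]].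
- exact: h1.
- exact: h2.
- by have [h _] := h3 v; exact: h.
- by have [_ h] := h3 v; exact: h.
Qed.

Lemma C1_on_cst D (k : R) : open D -> C1_on D (fun=> k : R).
Proof.
move=> oD; apply: (C1f_C1_on oD (fu := fun=> 0) (fv := fun=> 0)).
by split=> z _; [exact: has_lin_cst|exact: cvg_cst|exact: cvg_cst].
Qed.

Lemma C1_onD D f g : open D -> C1_on D f -> C1_on D g -> C1_on D (fun z => f z + g z).
Proof.
move=> oD /C1_on_C1f[H cu cv] /C1_on_C1f[H' cu' cv'].
apply: (C1f_C1_on oD (fu := fun z => D1 f z + D1 g z) (fv := fun z => D2 f z + D2 g z)).
split=> z Dz; first by apply: has_linD; [exact: H|exact: H'].
  by apply: cvgD; [exact: cu|exact: cu'].
by apply: cvgD; [exact: cv|exact: cv'].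
Qed.

Lemma C1_onM D f g : open D -> C1_on D f -> C1_on D g -> C1_on D (fun z => f z * g z).
Proof.
move=> oD hf hg; have cf z := @C1_on_continuous D f z hf; have cg z := @C1_on_continuous D g z hg.
have [H cu cv] := C1_on_C1f hf; have [H' cu' cv'] := C1_on_C1f hg.
apply: (C1f_C1_on oD (fu := fun z => f z * D1 g z + D1 f z * g z)
  (fv := fun z => f z * D2 g z + D2 f z * g z)).
split=> z Dz; first by apply: has_linM; [exact: H|exact: H'].
  by apply: cvgD; apply: cvgM; [exact: cf|exact: cu'|exact: cu|exact: cg].
by apply: cvgD; apply: cvgM; [exact: cf|exact: cv'|exact: cv|exact: cg].
Qed.

Lemma C1_on_comp1 D g (k k' : R -> R) : open D -> C1_on D g ->
  (forall z, D z -> is_derive (g z) (1 : R) k (k' (g z))) ->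
  (forall z, D z -> {for g z, continuous k'}) -> C1_on D (k \o g).
Proof.
move=> oD hg dk ck; have cg z := @C1_on_continuous D g z hg.
have [H cu cv] := C1_on_C1f hg.
have ckg z : D z -> {for z, continuous (k' \o g)}.
  by move=> Dz; apply: continuous_comp; [exact: cg|exact: ck].
apply: (C1f_C1_on oD (fu := fun z => k' (g z) * D1 g z) (fv := fun z => k' (g z) * D2 g z)).
split=> z Dz; first by apply: has_lin_comp1; [exact: H|exact: dk].
  by apply: cvgM; [exact: ckg|exact: cu].
by apply: cvgM; [exact: ckg|exact: cv].
Qed.

Lemma C2f_C2_on D f fu fv : open D -> (forall z, D z -> has_lin f z (fu z) (fv z)) ->
  C1_on D fu -> C1_on D fv -> C2_on D f.
Proof.
move=> oD H hu hv; split.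
  apply: (C1f_C1_on oD (fu := fu) (fv := fv)); split => // z; exact: C1_on_continuous.
move=> v; apply: (C1_on_ext (f := fun z => v.1 * fu z + v.2 * fv z) oD).
  by move=> y Dy; have [_ ->] := has_lin_differentiable (H y Dy).
by apply: (C1_onD oD); apply: (C1_onM oD _); first [exact: C1_on_cst|assumption].
Qed.

Lemma C2_on_C2f D f : C2_on D f ->
  [/\ forall z, D z -> has_lin f z (D1 f z) (D2 f z), C1_on D (D1 f) & C1_on D (D2 f)].
Proof. by move=> [/C1_on_C1f[H _ _] h]. Qed.

Lemma C2_on_ext D f g : open D -> (forall z, D z -> f z = g z) -> C2_on D f -> C2_on D g.
Proof.
move=> oD fg /C2_on_C2f[H cu cv]; apply: (C2f_C2_on oD (fu := D1 f) (fv := D2 f)) => //.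
move=> z Dz; apply: near_has_lin (H z Dz).
by apply: filterS (open_nbhs_nbhs (conj oD Dz)) => y /fg.
Qed.

Lemma C2_on_cst D (k : R) : open D -> C2_on D (fun=> k : R).
Proof.
move=> oD; apply: (C2f_C2_on oD (fu := fun=> 0) (fv := fun=> 0)); [|exact: C1_on_cst|exact: C1_on_cst].
by move=> z _; exact: has_lin_cst.
Qed.

Lemma C2_onD D f g : open D -> C2_on D f -> C2_on D g -> C2_on D (fun z => f z + g z).
Proof.
move=> oD /C2_on_C2f[H cu cv] /C2_on_C2f[H' cu' cv'].
apply: (C2f_C2_on oD (fu := fun z => D1 f z + D1 g z) (fv := fun z => D2 f z + D2 g z)).
- by move=> z Dz; apply: has_linD; [exact: H|exact: H'].
- exact (C1_onD oD cu cu').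
- exact (C1_onD oD cv cv').
Qed.

Lemma C2_onM D f g : open D -> C2_on D f -> C2_on D g -> C2_on D (fun z => f z * g z).
Proof.
move=> oD hf hg; have [H cu cv] := C2_on_C2f hf; have [H' cu' cv'] := C2_on_C2f hg.
have [[h1 _] [h2 _]] := (hf, hg).
apply: (C2f_C2_on oD (fu := fun z => f z * D1 g z + D1 f z * g z)
  (fv := fun z => f z * D2 g z + D2 f z * g z)).
- by move=> z Dz; apply: has_linM; [exact: H|exact: H'].
- exact (C1_onD oD (C1_onM oD h1 cu') (C1_onM oD cu h2)).
- exact (C1_onD oD (C1_onM oD h1 cv') (C1_onM oD cv h2)).
Qed.

Lemma C2_on_comp1 D g (k k' k'' : R -> R) : open D -> C2_on D g ->
  (forall z, D z -> is_derive (g z) (1 : R) k (k' (g z))) ->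
  (forall z, D z -> is_derive (g z) (1 : R) k' (k'' (g z))) ->
  (forall z, D z -> {for g z, continuous k''}) -> C2_on D (k \o g).
Proof.
move=> oD hg dk dk' ck; have [H cu cv] := C2_on_C2f hg; have [h1 _] := hg.
have hk : C1_on D (k' \o g) by exact: C1_on_comp1 dk' ck.
apply: (C2f_C2_on oD (fu := fun z => (k' \o g) z * D1 g z) (fv := fun z => (k' \o g) z * D2 g z)).
- by move=> z Dz; apply: has_lin_comp1; [exact: H|exact: dk].
- exact (C1_onM oD hk cu).
- exact (C1_onM oD hk cv).
Qed.

Lemma C1_on_pair (V W1 W2 : normedModType R) (D : set V) (h1 : V -> W1) (h2 : V -> W2) :
  open D -> C1_on D h1 -> C1_on D h2 -> C1_on D (fun x => (h1 x, h2 x)).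
Proof.
move=> oD [d1 c1] [d2 c2]; split=> [x Dx|v x Dx].
  by apply: differentiable_pair; [exact: d1|exact: d2].
apply: (continuous_ext_on (f := fun x => ('D_v h1 x, 'D_v h2 x)) oD Dx).
  by move=> y Dy; rewrite derive_pair//; [exact: d1|exact: d2].
by apply: cvg_pair; [exact: c1|exact: c2].
Qed.

Lemma differentiable_fst (V W1 W2 : normedModType R) (h : V -> W1 * W2) x :
  differentiable h x -> differentiable (fst \o h) x /\ forall v, 'D_v (fst \o h) x = ('D_v h x).1.
Proof.
move=> dh; have cf : continuous (fst : W1 * W2 -> W1) by move=> y; exact: cvg_fst.
have df y : differentiable (fst : W1 * W2 -> W1) y by exact: linear_differentiable.
split=> [|v]; first exact: differentiable_comp.
by rewrite (derive_comp _ dh (df _)) deriveE// diff_lin.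
Qed.

Lemma differentiable_snd (V W1 W2 : normedModType R) (h : V -> W1 * W2) x :
  differentiable h x -> differentiable (snd \o h) x /\ forall v, 'D_v (snd \o h) x = ('D_v h x).2.
Proof.
move=> dh; have cf : continuous (snd : W1 * W2 -> W2) by move=> y; exact: cvg_snd.
have df y : differentiable (snd : W1 * W2 -> W2) y by exact: linear_differentiable.
split=> [|v]; first exact: differentiable_comp.
by rewrite (derive_comp _ dh (df _)) deriveE// diff_lin.
Qed.

Lemma C1_on_fst (V W1 W2 : normedModType R) (D : set V) (h : V -> W1 * W2) :
  open D -> C1_on D h -> C1_on D (fst \o h).
Proof.
move=> oD [d c]; split=> [x Dx|v x Dx]; first by have [] := differentiable_fst (d x Dx).
apply: (continuous_ext_on (f := fun x => ('D_v h x).1) oD Dx).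
  by move=> y Dy; have [_ ->] := differentiable_fst (d y Dy).
by apply: continuous_comp; [exact: c|exact: cvg_fst].
Qed.

Lemma C1_on_snd (V W1 W2 : normedModType R) (D : set V) (h : V -> W1 * W2) :
  open D -> C1_on D h -> C1_on D (snd \o h).
Proof.
move=> oD [d c]; split=> [x Dx|v x Dx]; first by have [] := differentiable_snd (d x Dx).
apply: (continuous_ext_on (f := fun x => ('D_v h x).2) oD Dx).
  by move=> y Dy; have [_ ->] := differentiable_snd (d y Dy).
by apply: continuous_comp; [exact: c|exact: cvg_snd].
Qed.

Lemma C1_on_ext_gen (V W : normedModType R) (D : set V) (f g : V -> W) :
  open D -> (forall z, D z -> f z = g z) -> (forall z, D z -> differentiable g z) ->
  C1_on D f -> C1_on D g.
Proof.
move=> oD fg dg [df cf]; split=> // v x Dx.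
apply: (continuous_ext_on (f := 'D_v f) oD Dx); last exact: cf.
move=> y Dy; apply: near_eq_derive.
by apply: filterS (open_nbhs_nbhs (conj oD Dy)) => u /fg.
Qed.

Lemma near_eq_differentiable (V W : normedModType R) (f g : V -> W) x :
  (\forall y \near x, f y = g y) -> differentiable f x -> differentiable g x.
Proof.
move=> fg df; have /diff_locallyP[cd H] := df.
have E : g \o shift x = cst (g x) + 'd f x +o_ (nbhs (0 : V)) id.
  apply/eqaddoP => e e0; move/eqaddoP : H => /(_ e e0); have := fg.
  have sh : (fun h => h + x) @ (0 : V) --> 0 + x by apply: cvgD; [exact: cvg_id|exact: cvg_cst].
  rewrite add0r in sh; move=> /sh fgn He; near=> h.
  have fgh : f (h + x) = g (h + x) by near: h; exact: fgn.
  have : `|(f \o shift x - (cst (f x) + 'd f x)) h| <= e * `|h| by near: h; exact: He.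
  by rewrite /= !fctE /= -fgh (nbhs_singleton fg).
have dE := diff_unique cd E.
by apply/diff_locallyP; rewrite dE.
Unshelve. all: by end_near. Qed.

Lemma C1_on_eq (V W : normedModType R) (D : set V) (f g : V -> W) :
  open D -> (forall z, D z -> f z = g z) -> C1_on D f -> C1_on D g.
Proof.
move=> oD fg hf; apply: (C1_on_ext_gen oD fg _ hf) => z Dz; have [df _] := hf.
apply: near_eq_differentiable (df z Dz).
by apply: filterS (open_nbhs_nbhs (conj oD Dz)) => u /fg.
Qed.

Lemma C2_on_pair (V W1 W2 : normedModType R) (D : set V) (h1 : V -> W1) (h2 : V -> W2) :
  open D -> C2_on D h1 -> C2_on D h2 -> C2_on D (fun x => (h1 x, h2 x)).
Proof.
move=> oD [c1 d1] [c2 d2]; split=> [|v]; first exact: C1_on_pair.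
apply: (C1_on_eq (f := fun x => ('D_v h1 x, 'D_v h2 x)) oD); last exact: C1_on_pair.
by move=> z Dz; rewrite derive_pair//; [have [h _] := c1|have [h _] := c2]; exact: h.
Qed.

Lemma C2_on_fst (V W1 W2 : normedModType R) (D : set V) (h : V -> W1 * W2) :
  open D -> C2_on D h -> C2_on D (fst \o h).
Proof.
move=> oD [[d c] H]; split=> [|v]; first exact: C1_on_fst.
apply: (C1_on_eq (f := fst \o 'D_v h) oD); last by apply: C1_on_fst.
by move=> z Dz; have [_ ->] := differentiable_fst (d z Dz).
Qed.

Lemma C2_on_snd (V W1 W2 : normedModType R) (D : set V) (h : V -> W1 * W2) :
  open D -> C2_on D h -> C2_on D (snd \o h).
Proof.
move=> oD [[d c] H]; split=> [|v]; first exact: C1_on_snd.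
apply: (C1_on_eq (f := snd \o 'D_v h) oD); last by apply: C1_on_snd.
by move=> z Dz; have [_ ->] := differentiable_snd (d z Dz).
Qed.

(** The mean value theorem in [s] is applied to [g s (y + h) - g s y], whose derivative is itself
    estimated by the mean value theorem in [t]. *)
Lemma mixed_difference (g gs gst : R -> R -> R) (x y h eps L : R) : 0 < h ->
  (forall s t, x <= s <= x + h -> y <= t <= y + h ->
    [/\ is_derive s (1 : R) (g^~ t) (gs s t), is_derive t (1 : R) (gs s) (gst s t) &
        `|gst s t - L| <= eps]) ->
  `|g (x + h) (y + h) - g (x + h) y - g x (y + h) + g x y - L * h * h| <= eps * h * h.
Proof.
move=> h0 H; have [h1 h2] : x <= x + h /\ y <= y + h by move: h0; clear; split; lra.
have tb : y <= y + h <= y + h by rewrite h2 lexx.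
have ta : y <= y <= y + h by rewrite h2 lexx.
have B s : x <= s <= x + h -> `|gs s (y + h) - gs s y - L * h| <= eps * h.
  move=> sb; have := @mvt_linear _ (gs s) (gst s) L eps y (y + h).
  rewrite min_l// max_r// (_ : y + h - y = h); last by ring.
  rewrite (gtr0_norm h0); apply=> t t1 t2; have [] // := H s t sb _; exact/andP.
have := @mvt_linear _ (fun s => g s (y + h) - g s y) (fun s => gs s (y + h) - gs s y)
  (L * h) (eps * h) x (x + h).
rewrite min_l// max_r// (_ : x + h - x = h); last by ring.
rewrite (gtr0_norm h0) => K.
rewrite (_ : _ - _ - _ + _ - _ = g (x + h) (y + h) - g (x + h) y - (g x (y + h) - g x y)
  - L * h * h); last by ring.
apply: K => s s1 s2; last by apply: B; exact/andP.
have sb : x <= s <= x + h by apply/andP.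
have [d1 _ _] := H s _ sb tb; have [d2 _ _] := H s _ sb ta.
exact: is_deriveB.
Qed.

(** The second difference over a square is symmetric in the two variables, so both mixed derivatives
    are close to the same quotient. *)
Lemma schwarz D f z : open D -> C2_on D f -> D z -> D1 (D2 f) z = D2 (D1 f) z.
Proof.
move=> oD /C2_on_C2f[H /C1_on_C1f[Hu cuu cuv] /C1_on_C1f[Hv cvu cvv]] Dz.
apply/eqP; rewrite -subr_eq0 -normr_le0; apply/ler_addgt0Pl => e e0; rewrite addr0.
have e2 : 0 < e / 2 by rewrite divr_gt0.
have /near_box[d d0 dP] : \forall y \near z, [/\ D y, `|D2 (D1 f) y - D2 (D1 f) z| <= e / 2 &
    `|D1 (D2 f) y - D1 (D2 f) z| <= e / 2].
  have /cvgr_distC_le/(_ _ e2) c1 := cuv z Dz; have /cvgr_distC_le/(_ _ e2) c2 := cvu z Dz.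
  by apply: filterS3 (open_nbhs_nbhs (conj oD Dz)) c1 c2 => y Dy h1 h2; exact: (And3 Dy h1 h2).
pose h := d / 2; have h0 : 0 < h by rewrite divr_gt0.
have hd : h < d by rewrite /h; move: d0; clear; lra.
clearbody h.
have bd (x s : R) : x <= s <= x + h -> `|s - x| < d.
  by move: hd h0; clear => ? ? /andP[? ?]; rewrite ltr_norml; apply/andP; split; lra.
have A1 := @mixed_difference (fun s t => f (s, t)) (fun s t => D1 f (s, t))
  (fun s t => D2 (D1 f) (s, t)) z.1 z.2 h (e / 2) (D2 (D1 f) z) h0.
have A2 := @mixed_difference (fun s t => f (t, s)) (fun s t => D2 f (t, s))
  (fun s t => D1 (D2 f) (t, s)) z.2 z.1 h (e / 2) (D1 (D2 f) z) h0.
have {}A1 := A1 (fun s t hs ht => let: And3 Dst h1 h2 := dP (s, t) (bd _ _ hs) (bd _ _ ht) in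
  And3 (is_derive_slice1 (H _ Dst)) (is_derive_slice2 (Hu _ Dst)) h1).
have {}A2 := A2 (fun s t hs ht => let: And3 Dst h1 h2 := dP (t, s) (bd _ _ ht) (bd _ _ hs) in
  And3 (is_derive_slice2 (H _ Dst)) (is_derive_slice1 (Hv _ Dst)) h2).
have hh : 0 < h * h by rewrite mulr_gt0.
rewrite -(ler_pM2r hh) -{1}(gtr0_norm hh) -normrM.
have := le_trans (ler_normB _ _) (lerD A1 A2).
rewrite (_ : e / 2 * h * h + e / 2 * h * h = e * (h * h)); last by field.
move: ('D_(0, 1) ('D_(1, 0) f) z) ('D_(1, 0) ('D_(0, 1) f) z) => u v.
move: (f _) (f _) (f _) (f _) => x1 x2 x3 x4; clear.
by congr (`|_| <= _); ring.
Qed.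

End C2_functions.

(** * Charts and the surface measure *)

Section charts.
Context {R : realType}.
Local Notation pt := (R * R * R)%type.
Implicit Types (S U : set pt) (D : set (R * R)) (th h : R * R -> pt) (g v w : pt).

Definition pu th (z : R * R) : pt := 'D_(1, 0) th z.
Definition pv th (z : R * R) : pt := 'D_(0, 1) th z.

Definition has_lin3 h c (a b : pt) : Prop :=
  [/\ has_lin (fun z => (h z).1.1) c a.1.1 b.1.1,
      has_lin (fun z => (h z).1.2) c a.1.2 b.1.2 &
      has_lin (fun z => (h z).2) c a.2 b.2].

Lemma differentiable_has_lin3 h c : differentiable h c -> has_lin3 h c (pu h c) (pv h c).
Proof.
move=> dh; have [d1 e1] := differentiable_fst dh; have [d2 e2] := differentiable_snd dh.
have [d11 e11] := differentiable_fst d1; have [d12 e12] := differentiable_snd d1.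
rewrite /pu /pv; split.
- by have := differentiable_has_lin d11; rewrite !e11 !e1.
- by have := differentiable_has_lin d12; rewrite !e12 !e1.
- by have := differentiable_has_lin d2; rewrite !e2.
Qed.

Lemma has_lin3_differentiable h c a b : has_lin3 h c a b ->
  differentiable h c /\ forall v : R * R, 'D_v h c = v.1 *: a + v.2 *: b.
Proof.
move=> [/has_lin_differentiable[d1 e1] /has_lin_differentiable[d2 e2]].
move=> /has_lin_differentiable[d3 e3].
have E : h = fun z => ((h z).1.1, (h z).1.2, (h z).2).
  by apply/funext => z; case: (h z) => -[].
rewrite E; have d12 := differentiable_pair d1 d2.
split=> [|v]; first exact (differentiable_pair d12 d3).
by rewrite (derive_pair v d12 d3) (derive_pair v d1 d2) e1 e2 e3.
Qed.

Lemma has_lin3_pu h c a b : has_lin3 h c a b -> pu h c = a /\ pv h c = b.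
Proof.
move=> /has_lin3_differentiable[_ E]; rewrite /pu /pv !E /=.
by rewrite !scale1r !scale0r addr0 add0r.
Qed.

Lemma chart_dir S D th z xi : local_param S D th -> D z ->
  'D_xi th z = xi.1 *: pu th z + xi.2 *: pv th z.
Proof.
move=> [_ [[dth _] _] _ _ _] Dz.
by have [_ ->] := has_lin3_differentiable (differentiable_has_lin3 (dth z Dz)).
Qed.

Lemma chart_lin S D th z : local_param S D th -> D z -> has_lin3 th z (pu th z) (pv th z).
Proof. by move=> [_ [[dth _] _] _ _ _] Dz; exact: differentiable_has_lin3 (dth z Dz). Qed.

Lemma area_elementE0 th z : area_element th z =
  Num.sqrt (inner (th z) (pu th z) (pu th z) * inner (th z) (pv th z) (pv th z)
    - inner (th z) (pu th z) (pv th z) ^+ 2).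
Proof. by []. Qed.

Lemma C2_on_pu D th : C2_on D th -> C1_on D (pu th) /\ C1_on D (pv th).
Proof. by move=> [_ H]; split; [exact (H (1, 0))|exact (H (0, 1))]. Qed.

Lemma chart_C1_pu S D th : local_param S D th -> C1_on D (pu th) /\ C1_on D (pv th).
Proof. by move=> [_ /C2_on_pu H _ _ _]. Qed.

#[global] Opaque pu pv area_element.

(* Components of the cross product of [v] and [w] in the frame X1, X2, T. *)
Definition crossP g v w : R := v.1.2 * Tcoord g w - Tcoord g v * w.1.2.
Definition crossQ g v w : R := Tcoord g v * w.1.1 - v.1.1 * Tcoord g w.
Definition crossO g v w : R := v.1.1 * w.1.2 - v.1.2 * w.1.1.

Definition chartP th z := crossP (th z) (pu th z) (pv th z).
Definition chartQ th z := crossQ (th z) (pu th z) (pv th z).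
Definition chartO th z := crossO (th z) (pu th z) (pv th z).

(** Lagrange's identity in the orthonormal frame: the area element is the length of the cross
    product of the coordinate vectors. *)
Lemma gram_cross g v w : inner g v v * inner g w w - inner g v w ^+ 2 =
  crossP g v w ^+ 2 + crossQ g v w ^+ 2 + crossO g v w ^+ 2.
Proof. by rewrite /inner /crossP /crossQ /crossO; ring. Qed.

Lemma area_elementE th z : area_element th z =
  Num.sqrt (chartP th z ^+ 2 + chartQ th z ^+ 2 + chartO th z ^+ 2).
Proof. by rewrite area_elementE0 gram_cross. Qed.

Lemma area_element_ge0 th z : 0 <= area_element th z.
Proof. by rewrite area_elementE0 sqrtr_ge0. Qed.

(** If some frame component [v_i] is nonzero, the combination [w_i v - v_i w] vanishes, because its
    components are those of the cross product up to sign. If [v = 0], the pair [(1, 0)] works. *)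
Lemma cross0_dep g v w : crossP g v w = 0 -> crossQ g v w = 0 -> crossO g v w = 0 ->
  exists xi : R * R, xi <> 0 /\ xi.1 *: v + xi.2 *: w = 0.
Proof.
rewrite /crossP /crossQ /crossO => P0 Q0 O0.
have comb (xi : R * R) : xi.1 * v.1.1 + xi.2 * w.1.1 = 0 ->
    xi.1 * v.1.2 + xi.2 * w.1.2 = 0 -> xi.1 * Tcoord g v + xi.2 * Tcoord g w = 0 ->
    xi.1 *: v + xi.2 *: w = 0.
  rewrite /Tcoord => h1 h2 h3.
  have h4 : xi.1 * v.2 + xi.2 * w.2 = 0.
    have -> : xi.1 * v.2 + xi.2 * w.2 = xi.1 * (v.2 + (g.1.2 * v.1.1 - g.1.1 * v.1.2) / 2)
      + xi.2 * (w.2 + (g.1.2 * w.1.1 - g.1.1 * w.1.2) / 2)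
      - (g.1.2 * (xi.1 * v.1.1 + xi.2 * w.1.1) - g.1.1 * (xi.1 * v.1.2 + xi.2 * w.1.2)) / 2.
      by field.
    by rewrite h3 h1 h2 !mulr0 !subrr mul0r subr0.
  rewrite [LHS]surjective_pairing [(_ + _).1]surjective_pairing.
  by congr ((_, _), _).
have [v1|v1] := eqVneq v.1.1 0; last first.
  exists (w.1.1, - v.1.1); split.
    by move=> [_ /eqP]; rewrite oppr_eq0; apply/negP.
  apply: comb => /=; [ring|rewrite -[RHS]oppr0 -O0; ring|rewrite -Q0; ring].
have [v2|v2] := eqVneq v.1.2 0; last first.
  exists (w.1.2, - v.1.2); split.
    by move=> [_ /eqP]; rewrite oppr_eq0; apply/negP.
  apply: comb => /=; [rewrite -O0; ring|ring|rewrite -[RHS]oppr0 -P0; ring].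
have [v3|v3] := eqVneq (Tcoord g v) 0; last first.
  exists (Tcoord g w, - Tcoord g v); split.
    by move=> [_ /eqP]; rewrite oppr_eq0; apply/negP.
  apply: comb => /=; [rewrite -[RHS]oppr0 -Q0; ring|rewrite -P0; ring|ring].
exists (1, 0); split; first by move=> [/eqP]; rewrite oner_eq0.
by apply: comb => /=; rewrite mul1r mul0r addr0.
Qed.

Lemma area_element_gt0 S D th z : local_param S D th -> D z -> 0 < area_element th z.
Proof.
move=> H Dz; have [_ _ im _ _] := H.
rewrite lt_neqAle area_element_ge0 andbT eq_sym; apply/negP => /eqP.
rewrite area_elementE => /eqP; rewrite sqrtr_eq0 => le0.
have sq3 (a b c : R) : a ^+ 2 + b ^+ 2 + c ^+ 2 <= 0 -> [/\ a = 0, b = 0 & c = 0].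
  move=> h; have [ha hb hc] := And3 (sqr_ge0 a) (sqr_ge0 b) (sqr_ge0 c).
  by split; apply/eqP; rewrite -sqrf_eq0 eq_le; apply/andP; split => //; move: h ha hb hc;
    clear; lra.
have [P0 Q0 O0] := sq3 _ _ _ le0.
have [xi [xi0 E]] := cross0_dep P0 Q0 O0.
by apply: xi0; apply: (im z Dz); rewrite (chart_dir _ H Dz).
Qed.

(** A linear form with constant coefficients: unlike [inner], it does not involve the base point, so
    it commutes with differentiation along a chart. *)
Definition lf (m w : pt) : R := m.1.1 * w.1.1 + m.1.2 * w.1.2 + m.2 * w.2.

Lemma lfB m v w : lf m (v - w) = lf m v - lf m w.
Proof. by rewrite /lf /=; ring. Qed.

(** The rows of the pseudo-inverse: the Gram matrix of [v] and [w] is inverted, and [cov] turns the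
    inner product with a vector at [g] into a constant form. *)
Lemma left_inverse g v w : inner g v v * inner g w w - inner g v w ^+ 2 != 0 ->
  exists m1 m2, [/\ lf m1 v = 1, lf m1 w = 0, lf m2 v = 0 & lf m2 w = 1].
Proof.
set G := (X in X != 0) => G0.
pose cov (c : pt) : pt := (c.1.1 + Tcoord g c * g.1.2 / 2, c.1.2 - Tcoord g c * g.1.1 / 2, Tcoord g c).
have lfc c x : lf (cov c) x = inner g c x.
  by rewrite /lf /inner /cov /= [Tcoord g x]/Tcoord; field.
have lfl a b m n x : lf (a *: m + b *: n) x = a * lf m x + b * lf n x.
  by rewrite /lf /= /GRing.scale /=; ring.
have sy : inner g w v = inner g v w by rewrite /inner; ring.
exists ((inner g w w / G) *: cov v + (- inner g v w / G) *: cov w).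
exists ((- inner g v w / G) *: cov v + (inner g v v / G) *: cov w).
rewrite !lfl !lfc sy; split.
- by move: G0; rewrite /G => G0; field.
- ring.
- ring.
- by move: G0; rewrite /G => G0; field.
Qed.

Lemma has_lin_lf m h c a b : has_lin3 h c a b -> has_lin (fun z => lf m (h z)) c (lf m a) (lf m b).
Proof.
move=> [h1 h2 h3]; rewrite /lf.
have hc k f p q : has_lin f c p q -> has_lin (fun z => k * f z) c (k * p) (k * q).
  by move=> hf; have := has_linM (has_lin_cst k c) hf; rewrite !mul0r !addr0.
exact (has_linD (has_linD (hc _ _ _ _ h1) (hc _ _ _ _ h2)) (hc _ _ _ _ h3)).
Qed.

Lemma has_lin_lipschitz (f : R * R -> R) c a b : has_lin f c a b -> \forall z \near c,
  `|f z - f c| <= (`|a| + `|b| + 1) * (`|z.1 - c.1| + `|z.2 - c.2|).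
Proof.
move=> hf; apply: filterS (hf 1 ltr01) => z.
move: (f z - f c) (z.1 - c.1) (z.2 - c.2) => d x y h; clear hf.
have n1 : `|a * x + b * y| <= (`|a| + `|b|) * (`|x| + `|y|).
  by apply: lin2_le; rewrite ?addr_ge0 ?lerDl ?lerDr.
rewrite -[d](subrK (a * x + b * y)); apply: le_trans (ler_normD _ _) _.
by rewrite mulrDl [leRHS]addrC lerD.
Qed.

Lemma near_box3 (c : pt) (P : pt -> Prop) : (\forall g \near c, P g) <->
  exists2 d : R, 0 < d & forall g, `|g.1.1 - c.1.1| < d -> `|g.1.2 - c.1.2| < d ->
    `|g.2 - c.2| < d -> P g.
Proof.
split.
  move=> /nbhs_ballP[d /= d0 dP]; exists d => // g g1 g2 g3; apply: dP.
  by split; [split|]; rewrite /ball /= distrC.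
move=> [d d0 dP]; apply/nbhs_ballP; exists d => //= g [[g1 g2] g3]; apply: dP;
  rewrite distrC; [exact: g1|exact: g2|exact: g3].
Qed.

Lemma has_lin3_cvg h c a b : has_lin3 h c a b -> {for c, continuous h}.
Proof. by move=> /has_lin3_differentiable[dh _]; exact: differentiable_continuous. Qed.

Definition chart_inv D th g : R * R := xget (0, 0) [set z | D z /\ th z = g].

Lemma chart_invK S D th z : local_param S D th -> D z -> chart_inv D th (th z) = z.
Proof.
move=> [_ _ _ inj _] Dz; rewrite /chart_inv.
case: xgetP => [y _ [Dy E]|/(_ z)[]//].
by apply: inj => //; rewrite inE.
Qed.

(** Continuity of the inverse of a chart, from the clause of [local_param] that images of open sets
    are relatively open. *)
Lemma chart_inv_near S D th z (A : set (R * R)) : local_param S D th -> D z -> nbhs z A ->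
  exists O, [/\ open O, O (th z) & forall g, S g -> O g ->
    [/\ D (chart_inv D th g), A (chart_inv D th g) & th (chart_inv D th g) = g]].
Proof.
move=> H Dz zA; have [oD _ _ _ hom] := H.
have [B [oB Bz] BA] : exists2 B, open_nbhs z B & B `<=` A `&` D.
  have : nbhs z (A `&` D) by apply: filterI => //; exact: open_nbhs_nbhs.
  by rewrite nbhsE => -[B ? ?]; exists B.
have [Q oQ E] := hom B oB (fun y By => (BA y By).2).
exists Q; split => //.
  by have : (th @` B) (th z) by [exists z]; rewrite E => -[].
move=> g Sg Qg; have [y By <-] : (th @` B) g by rewrite E.
have [Ay Dy] := BA y By.
by rewrite (chart_invK H Dy).
Qed.

(* A left inverse of the differential of [th] gives the derivative of [chart_inv] along
   curves in [S] and along other charts, without the inverse function theorem. *)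
Lemma chart_lift S D th d : local_param S D th -> D d -> exists m1 m2 : pt,
  [/\ lf m1 (pu th d) = 1, lf m1 (pv th d) = 0, lf m2 (pu th d) = 0 & lf m2 (pv th d) = 1] /\
  forall h c a b, h c = th d -> (\forall z \near c, S (h z)) -> has_lin3 h c a b ->
  [/\ \forall z \near c, D (chart_inv D th (h z)) /\ th (chart_inv D th (h z)) = h z,
      has_lin (fun z => (chart_inv D th (h z)).1) c (lf m1 a) (lf m1 b) &
      has_lin (fun z => (chart_inv D th (h z)).2) c (lf m2 a) (lf m2 b)].
Proof.
move=> H Dd; have G0 : inner (th d) (pu th d) (pu th d) * inner (th d) (pv th d) (pv th d)
    - inner (th d) (pu th d) (pv th d) ^+ 2 != 0.
  have := area_element_gt0 H Dd; rewrite area_elementE0 sqrtr_gt0 => h.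
  by rewrite lt0r_neq0.
have [m1 [m2 [m11 m12 m21 m22]]] := left_inverse G0.
exists m1, m2; split => // h c a b hc Sh hl.
have tl := chart_lin H Dd.
pose w z := chart_inv D th (h z).
have wc : w c = d by rewrite /w hc (chart_invK H Dd).
have tr (f : R * R -> R) x p q p' q' : p = p' -> q = q' -> has_lin f x p q -> has_lin f x p' q'.
  by move=> -> ->.
have f1l := tr _ _ _ _ _ _ m11 m12 (has_lin_lf m1 tl).
have f2l := tr _ _ _ _ _ _ m21 m22 (has_lin_lf m2 tl).
have F1l := has_lin_lf m1 hl; have F2l := has_lin_lf m2 hl.
have ch := has_lin3_cvg hl.
have lft eta : 0 < eta -> \forall z \near c, [/\ D (w z), th (w z) = h z,
    `|lf m1 (h z) - lf m1 (h c) - ((w z).1 - d.1)| <= eta * (`|(w z).1 - d.1| + `|(w z).2 - d.2|) &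
    `|lf m2 (h z) - lf m2 (h c) - ((w z).2 - d.2)| <= eta * (`|(w z).1 - d.1| + `|(w z).2 - d.2|)].
  move=> eta0; have nA := @filterI _ (nbhs d) (nbhs_filter d) _ _ (f1l _ eta0) (f2l _ eta0).
  have [Q [oQ Oth OP]] := chart_inv_near H Dd nA.
  have nO : \forall z \near c, Q (h z).
    by apply: ch; rewrite hc; exact: open_nbhs_nbhs.
  apply: filterS2 Sh nO => z Sz Oz; have [Dw [A1 A2] tw] := OP _ Sz Oz.
  split => //; first by move: A1; rewrite tw mul1r mul0r addr0 hc.
  by move: A2; rewrite tw mul1r mul0r add0r hc.
have q0 : 0 < (4^-1 : R) by rewrite invr_gt0.
(* With [eta = 1/4] the two errors add up to half of the displacement [|w z - d|] and are absorbed,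
   so that [w] grows at most linearly; this a priori bound turns [o(|w z - d|)] into [o(|z - c|)]
   below. *)
have [K K0 wl] : exists2 K, 0 <= K & \forall z \near c,
    `|(w z).1 - d.1| + `|(w z).2 - d.2| <= K * (`|z.1 - c.1| + `|z.2 - c.2|).
  pose A1 : R := `|lf m1 a| + `|lf m1 b| + 1; pose A2 : R := `|lf m2 a| + `|lf m2 b| + 1.
  have A10 : 0 <= A1 by rewrite !addr_ge0.
  have A20 : 0 <= A2 by rewrite !addr_ge0.
  exists (2 * (A1 + A2)); first by rewrite mulr_ge0 ?addr_ge0.
  apply: filterS3 (lft _ q0) (has_lin_lipschitz F1l) (has_lin_lipschitz F2l) => z [_ _].
  rewrite -/A1 -/A2; move: (lf m1 (h z) - lf m1 (h c)) (lf m2 (h z) - lf m2 (h c)) => p q.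
  move: ((w z).1 - d.1) ((w z).2 - d.2) (`|z.1 - c.1| + `|z.2 - c.2|) => x y N.
  move: A1 A2 {A10 A20} => A1 A2; clear => h1 h2 h3 h4.
  have t1 : `|x| <= `|p - x| + `|p| by rewrite -{1}(subKr p x) (le_trans (ler_normB _ _)) 1?addrC.
  have t2 : `|y| <= `|q - y| + `|q| by rewrite -{1}(subKr q y) (le_trans (ler_normB _ _)) 1?addrC.
  lra.
have lin_of (m : pt) (pr : R * R -> R) A B :
    has_lin (fun z => lf m (h z)) c A B ->
    (forall eta, 0 < eta -> \forall z \near c, `|lf m (h z) - lf m (h c) - (pr (w z) - pr d)|
      <= eta * (`|(w z).1 - d.1| + `|(w z).2 - d.2|)) ->
    has_lin (fun z => pr (w z)) c A B.
  move=> Fl wm eta eta0.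
  have e2 : 0 < eta / 2 by rewrite divr_gt0.
  have K1 : 0 < K + 1 by rewrite ltr_wpDl.
  have e3 : 0 < eta / 2 / (K + 1) by rewrite divr_gt0.
  apply: filterS3 (Fl _ e2) (wm _ e3) wl => z; rewrite wc.
  move: (lf m (h z) - lf m (h c)) (pr (w z) - pr d) => p x.
  move: (`|(w z).1 - d.1| + `|(w z).2 - d.2|) (A * (z.1 - c.1) + B * (z.2 - c.2)) => W L.
  have := addr_ge0 (normr_ge0 (z.1 - c.1)) (normr_ge0 (z.2 - c.2)).
  move: (`|z.1 - c.1| + `|z.2 - c.2|) => N N0 h1 h2 h3.
  have h4 : eta / 2 / (K + 1) * W <= eta / 2 * N.
    apply: le_trans (ler_wpM2l (ltW e3) h3) _.
    have -> : eta / 2 / (K + 1) * (K * N) = (eta / 2 * N) * (K / (K + 1)) by ring.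
    by rewrite ler_piMr ?(mulr_ge0 (ltW e2) N0)// ler_pdivrMr// mul1r lerDl.
  have -> : x - L = (p - L) - (p - x) by ring.
  apply: le_trans (ler_normB _ _) _.
  by move: h1 h2 h4; clear; lra.
split.
- by apply: filterS (lft _ q0) => z [].
- apply: (lin_of m1 fst) => // eta eta0.
  by apply: filterS (lft _ eta0) => z [].
- apply: (lin_of m2 snd) => // eta eta0.
  by apply: filterS (lft _ eta0) => z [].
Qed.

End charts.

(** * Transition maps between charts *)

Section chart_transitions.
Context {R : realType}.
Local Notation pt := (R * R * R)%type.
Local Notation leb2 := (@lebesgue_measure R \x @lebesgue_measure R)%E.
Implicit Types (S U : set pt) (D : set (R * R)) (th h : R * R -> pt) (g v w : pt).

Lemma chart_continuous S D th z : local_param S D th -> D z -> {for z, continuous th}.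
Proof. by move=> H Dz; exact: has_lin3_cvg (chart_lin H Dz). Qed.

Lemma chart_open S D th : local_param S D th -> open D.
Proof. by case. Qed.

Lemma chart_surf S D th z : local_param S D th -> D z -> S (th z).
Proof.
move=> [oD _ _ _ hom] Dz; have [Q _ E] := hom D oD (@subset_refl _ D).
by have : (th @` D) (th z) by [exists z]; rewrite E => -[].
Qed.

Lemma chart_image S D th : local_param S D th -> exists2 Q, open Q & th @` D = S `&` Q.
Proof. by move=> [oD _ _ _ hom]; exact: (hom D oD (@subset_refl _ D)). Qed.

Lemma chart_preimage_open S D th (Q : set pt) : local_param S D th -> open Q ->
  open (D `&` th @^-1` Q).
Proof.
move=> H oQ; apply: open_preimage_cont => //; first exact: chart_open H.
by move=> z; exact: chart_continuous H.
Qed.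

Lemma chart_sub S D D' th : local_param S D th -> open D' -> D' `<=` D -> local_param S D' th.
Proof.
move=> [oD cth im inj hom] oD' DD; split => //.
- exact: C2_on_sub DD cth.
- by move=> z /DD; exact: im.
- by move=> z z'; rewrite !inE => /DD Dz /DD Dz'; apply: inj; rewrite inE.
- by move=> A oA AD'; exact: hom A oA (subset_trans AD' DD).
Qed.

Lemma chart_restrict S D th (Q : set pt) : local_param S D th -> open Q ->
  local_param (S `&` Q) (D `&` th @^-1` Q) th.
Proof.
move=> H oQ; have oD' := chart_preimage_open H oQ.
have [_ cth im inj hom] := chart_sub H oD' (@subIsetl _ _ _).
split => // A oA AD; have [Q' oQ' E] := hom A oA AD.
exists Q' => //; apply/seteqP; split=> g.
  move=> Ag; have [Sg Qg'] : (S `&` Q') g by rewrite -E.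
  by split => //; split => //; case: Ag => z /AD[_ Qz] <-.
by move=> [[Sg Qg] Qg']; rewrite E.
Qed.

Lemma chart_extend S D th (Q : set pt) : open Q -> local_param (S `&` Q) D th ->
  local_param S D th.
Proof.
move=> oQ [oD cth im inj hom]; split => // A oA AD; have [Q' oQ' E] := hom A oA AD.
by exists (Q `&` Q'); [exact: openI|rewrite E setIA].
Qed.

Lemma C2_surface_open S (Q : set pt) : C2_surface S -> open Q -> C2_surface (S `&` Q).
Proof.
move=> HS oQ g [Sg Qg]; have [D [th [H [z Dz E]]]] := HS g Sg.
exists (D `&` th @^-1` Q), th; split; first exact: chart_restrict.
by exists z => //; split => //; rewrite /preimage/= E.
Qed.

(** [chart_lift] for the second chart, applied to the map [th1], differentiates the transition; the
    last clause is the chain rule for functions on [S]. If the determinant vanished, the chain rule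
    for the three coordinates would make the area element of [th1] vanish. *)
Lemma chart_transition S D1 D2 th1 th2 z1 z2 : local_param S D1 th1 -> local_param S D2 th2 ->
  D1 z1 -> D2 z2 -> th1 z1 = th2 z2 ->
  exists al be ga de : R, [/\ al * de - be * ga != 0,
    has_lin (fun z => (chart_inv D2 th2 (th1 z)).1) z1 al be,
    has_lin (fun z => (chart_inv D2 th2 (th1 z)).2) z1 ga de &
    forall (f : pt -> R) a b, has_lin (f \o th2) z2 a b ->
      has_lin (f \o th1) z1 (al * a + ga * b) (be * a + de * b)].
Proof.
move=> H1 H2 Dz1 Dz2 E.
have [m1 [m2 [_ lift]]] := chart_lift H2 Dz2.
have S1 : \forall z \near z1, S (th1 z).
  have oD1 := chart_open H1.
  by apply: filterS (open_nbhs_nbhs (conj oD1 Dz1)) => z; exact: chart_surf H1.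
have [nD L1 L2] := lift th1 z1 _ _ E S1 (chart_lin H1 Dz1).
have [al [be [ga [de [l1 l2]]]]] : exists al be ga de : R,
    has_lin (fun z => (chart_inv D2 th2 (th1 z)).1) z1 al be /\
    has_lin (fun z => (chart_inv D2 th2 (th1 z)).2) z1 ga de.
  by do 4 eexists; split; [exact L1|exact L2].
clear L1 L2 lift; exists al, be, ga, de.
have fl (f : pt -> R) a b : has_lin (f \o th2) z2 a b ->
    has_lin (f \o th1) z1 (al * a + ga * b) (be * a + de * b).
  move=> fh; have fh' : has_lin (f \o th2) ((chart_inv D2 th2 (th1 z1)).1,
      (chart_inv D2 th2 (th1 z1)).2) a b.
    by rewrite -surjective_pairing E (chart_invK H2 Dz2).
  have tr x y p q p' q' : (\forall z \near z1, x z = y z) -> p = p' -> q = q' ->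
      has_lin x z1 p q -> has_lin (y : R * R -> R) z1 p' q'.
    by move=> xy <- <-; exact: near_has_lin.
  apply: tr (has_lin_comp2 l1 l2 fh'); [|by rewrite mulrC [b * _]mulrC|by rewrite mulrC [b * _]mulrC].
  by apply: filterS nD => z [_ e]; rewrite -surjective_pairing /= e.
split => //.
apply/negP => /eqP D0.
have := chart_lin H2 Dz2; move: (pu th2 z2) (pv th2 z2) => a b [h1 h2 h3].
have k1 := fl (fun g => g.1.1) _ _ h1; have k2 := fl (fun g => g.1.2) _ _ h2.
have k3 := fl (fun g => g.2) _ _ h3.
have pk := has_lin3_pu (And3 k1 k2 k3 : has_lin3 th1 z1
  (al * a.1.1 + ga * b.1.1, al * a.1.2 + ga * b.1.2, al * a.2 + ga * b.2)
  (be * a.1.1 + de * b.1.1, be * a.1.2 + de * b.1.2, be * a.2 + de * b.2)).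
have := area_element_gt0 H1 Dz1; rewrite area_elementE /chartP /chartQ /chartO.
case: pk => -> ->; rewrite (_ : _ + _ = (al * de - be * ga) ^+ 2 *
  (crossP (th1 z1) a b ^+ 2 + crossQ (th1 z1) a b ^+ 2 + crossO (th1 z1) a b ^+ 2)).
  by rewrite D0 expr0n mul0r sqrtr0 ltxx.
by rewrite /crossP /crossQ /crossO /Tcoord /=; field.
Qed.

(* [al be ga de] are the entries of the derivative of the transition map. *)
Definition transition th1 z1 th2 z2 (al be ga de : R) : Prop :=
  al * de - be * ga != 0 /\
  forall (f : pt -> R) a b, has_lin (f \o th2) z2 a b ->
      has_lin (f \o th1) z1 (al * a + ga * b) (be * a + de * b).

Lemma transition_pu S D2 th1 th2 z1 z2 al be ga de : local_param S D2 th2 -> D2 z2 ->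
  transition th1 z1 th2 z2 al be ga de ->
  pu th1 z1 = al *: pu th2 z2 + ga *: pv th2 z2 /\
  pv th1 z1 = be *: pu th2 z2 + de *: pv th2 z2.
Proof.
move=> H2 Dz2 [_ fl]; have := chart_lin H2 Dz2; move: (pu th2 z2) (pv th2 z2) => a b [h1 h2 h3].
have k1 := fl (fun g => g.1.1) _ _ h1; have k2 := fl (fun g => g.1.2) _ _ h2.
have k3 := fl (fun g => g.2) _ _ h3.
exact (has_lin3_pu (And3 k1 k2 k3 : has_lin3 th1 z1 (al *: a + ga *: b) (be *: a + de *: b))).
Qed.

Lemma cross_lin g v w (al be ga de : R) :
  [/\ crossP g (al *: v + ga *: w) (be *: v + de *: w) = crossP g v w * (al * de - be * ga),
      crossQ g (al *: v + ga *: w) (be *: v + de *: w) = crossQ g v w * (al * de - be * ga) &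
      crossO g (al *: v + ga *: w) (be *: v + de *: w) = crossO g v w * (al * de - be * ga)].
Proof.
have cc (x y : R) : [/\ (x *: v + y *: w).1.1 = x * v.1.1 + y * w.1.1,
  (x *: v + y *: w).1.2 = x * v.1.2 + y * w.1.2 & (x *: v + y *: w).2 = x * v.2 + y * w.2] by [].
have [a1 a2 a3] := cc al ga; have [b1 b2 b3] := cc be de.
by rewrite /crossP /crossQ /crossO /Tcoord a1 a2 a3 b1 b2 b3; split; ring.
Qed.

Lemma transition_cross S D2 th1 th2 z1 z2 al be ga de : local_param S D2 th2 -> D2 z2 ->
  th1 z1 = th2 z2 -> transition th1 z1 th2 z2 al be ga de ->
  [/\ chartP th1 z1 = chartP th2 z2 * (al * de - be * ga),
      chartQ th1 z1 = chartQ th2 z2 * (al * de - be * ga) &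
      chartO th1 z1 = chartO th2 z2 * (al * de - be * ga)].
Proof.
move=> H2 Dz2 E T; have [] := transition_pu H2 Dz2 T.
rewrite /chartP /chartQ /chartO E => -> ->; exact: cross_lin.
Qed.

Lemma transition_area S D2 th1 th2 z1 z2 al be ga de : local_param S D2 th2 -> D2 z2 ->
  th1 z1 = th2 z2 -> transition th1 z1 th2 z2 al be ga de ->
  area_element th1 z1 = area_element th2 z2 * `|al * de - be * ga|.
Proof.
move=> H2 Dz2 E T; have [p q o] := transition_cross H2 Dz2 E T.
rewrite !area_elementE p q o !exprMn -!mulrDl.
rewrite sqrtrM ?sqrtr_sqr//.
by rewrite !addr_ge0 ?sqr_ge0.
Qed.

Lemma C1_onB D (f g : R * R -> R) : open D -> C1_on D f -> C1_on D g ->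
  C1_on D (fun z => f z - g z).
Proof.
move=> oD hf hg; apply: (C1_on_ext (f := fun z => f z + (- 1) * g z) oD).
  by move=> z _; rewrite mulN1r.
exact (C1_onD oD hf (C1_onM oD (C1_on_cst (- 1) oD) hg)).
Qed.

Lemma chart_C1 S D th : local_param S D th ->
  [/\ [/\ C2_on D (fun z => (th z).1.1), C2_on D (fun z => (th z).1.2) & C2_on D (fun z => (th z).2)],
      [/\ C1_on D (fun z => (pu th z).1.1), C1_on D (fun z => (pu th z).1.2) &
          C1_on D (fun z => (pu th z).2)] &
      [/\ C1_on D (fun z => (pv th z).1.1), C1_on D (fun z => (pv th z).1.2) &
          C1_on D (fun z => (pv th z).2)]].
Proof.
move=> H; have oD := chart_open H; have [hu hv] := chart_C1_pu H.
have [_ c2 _ _ _] := H.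
by split; split;
  [exact (C2_on_fst oD (C2_on_fst oD c2))|exact (C2_on_snd oD (C2_on_fst oD c2))
  |exact (C2_on_snd oD c2)
  |exact (C1_on_fst oD (C1_on_fst oD hu))|exact (C1_on_snd oD (C1_on_fst oD hu))
  |exact (C1_on_snd oD hu)
  |exact (C1_on_fst oD (C1_on_fst oD hv))|exact (C1_on_snd oD (C1_on_fst oD hv))
  |exact (C1_on_snd oD hv)].
Qed.

Lemma chart_tau_C1 S D th (w : R * R -> pt) : local_param S D th ->
  C1_on D (fun z => (w z).1.1) -> C1_on D (fun z => (w z).1.2) -> C1_on D (fun z => (w z).2) ->
  C1_on D (fun z => Tcoord (th z) (w z)).
Proof.
move=> H w1 w2 w3; have oD := chart_open H; have [[[x _] [y _] [t _]] _ _] := chart_C1 H.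
exact (C1_onD oD w3 (C1_onM oD (C1_onB oD (C1_onM oD y w1) (C1_onM oD x w2)) (C1_on_cst 2^-1 oD))).
Qed.

Lemma chart_cross_C1 S D th : local_param S D th ->
  [/\ C1_on D (chartP th), C1_on D (chartQ th) & C1_on D (chartO th)].
Proof.
move=> H; have oD := chart_open H; have [_ [xu yu tu] [xv yv tv]] := chart_C1 H.
have Tu := chart_tau_C1 H xu yu tu; have Tv := chart_tau_C1 H xv yv tv.
split.
- exact (C1_onB oD (C1_onM oD yu Tv) (C1_onM oD Tu yv)).
- exact (C1_onB oD (C1_onM oD Tu xv) (C1_onM oD xu Tv)).
- exact (C1_onB oD (C1_onM oD xu yv) (C1_onM oD yu xv)).
Qed.

Lemma chart_area_continuous S D th z : local_param S D th -> D z ->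
  {for z, continuous (area_element th)}.
Proof.
move=> H Dz; have [p q o] := chart_cross_C1 H.
have cp := C1_on_continuous p Dz; have cq := C1_on_continuous q Dz.
have co := C1_on_continuous o Dz.
have -> : area_element th = fun z => Num.sqrt (chartP th z ^+ 2 + chartQ th z ^+ 2 + chartO th z ^+ 2).
  by apply/funext => y; exact: area_elementE.
apply: continuous_comp; last exact: sqrt_continuous.
by apply: cvgD; [apply: cvgD|]; apply: cvgM.
Qed.

Lemma chart_cov S D1 D2 th1 th2 Q1 Q2 : local_param S D1 th1 -> local_param S D2 th2 ->
  open Q1 -> open Q2 -> th1 @` D1 = S `&` Q1 -> th2 @` D2 = S `&` Q2 ->
  cov_setup (D1 `&` th1 @^-1` Q2) (D2 `&` th2 @^-1` Q1)
    (chart_inv D2 th2 \o th1) (chart_inv D1 th1 \o th2) (area_element th1) (area_element th2).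
Proof.
move=> H1 H2 oQ1 oQ2 E1 E2.
have lift1 z : D1 z -> Q2 (th1 z) -> exists2 y, D2 y & th2 y = th1 z.
  move=> Dz Qz; have [y Dy e] : (th2 @` D2) (th1 z).
    by rewrite E2; split => //; exact: chart_surf H1 Dz.
  by exists y.
have lift2 y : D2 y -> Q1 (th2 y) -> exists2 z, D1 z & th1 z = th2 y.
  move=> Dy Qy; have [z Dz e] : (th1 @` D1) (th2 y).
    by rewrite E1; split => //; exact: chart_surf H2 Dy.
  by exists z.
have Qth1 z : D1 z -> Q1 (th1 z).
  by move=> Dz; have : (th1 @` D1) (th1 z) by [exists z]; rewrite E1 => -[].
have Qth2 z : D2 z -> Q2 (th2 z).
  by move=> Dz; have : (th2 @` D2) (th2 z) by [exists z]; rewrite E2 => -[].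
split.
- exact: chart_preimage_open H1 oQ2.
- exact: chart_preimage_open H2 oQ1.
- move=> y [Dy Qy]; have [z Dz e] := lift2 y Dy Qy.
  rewrite /= -e (chart_invK H1 Dz); split => //; rewrite /preimage/= e; exact: Qth2.
- move=> z [Dz Qz]; have [y Dy e] := lift1 z Dz Qz.
  rewrite /= -e (chart_invK H2 Dy); split => //; rewrite /preimage/= e; exact: Qth1.
- move=> z [Dz Qz] /=; have [y Dy e] := lift1 z Dz Qz.
  by rewrite -e (chart_invK H2 Dy) e (chart_invK H1 Dz).
- move=> y [Dy Qy] /=; have [z Dz e] := lift2 y Dy Qy.
  by rewrite -e (chart_invK H1 Dz) e (chart_invK H2 Dy).
- move=> y [Dy Qy]; have [z Dz e] := lift2 y Dy Qy.
  have [al [be [ga [de [_ l1 l2 _]]]]] := chart_transition H2 H1 Dy Dz (esym e).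
  rewrite (_ : chart_inv D1 th1 \o th2 = fun y => ((chart_inv D1 th1 (th2 y)).1,
    (chart_inv D1 th1 (th2 y)).2)); last by apply/funext => x; exact: surjective_pairing.
  have [d1 _] := has_lin_differentiable l1; have [d2 _] := has_lin_differentiable l2.
  exact (differentiable_continuous (differentiable_pair d1 d2)).
- by move=> z [Dz _]; exact: chart_area_continuous H1 Dz.
- by move=> z [Dz _]; exact: chart_area_continuous H2 Dz.
- by move=> z; exact: area_element_ge0.
- by move=> z; exact: area_element_ge0.
- by move=> z [Dz _]; exact: area_element_gt0 H2 Dz.
move=> z [Dz Qz]; have [y Dy e] := lift1 z Dz Qz.
have [al [be [ga [de [D0 l1 l2 T12]]]]] := chart_transition H1 H2 Dz Dy (esym e).
have [al' [be' [ga' [de' [D0' l1' l2' T21]]]]] := chart_transition H2 H1 Dy Dz e.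
exists al, be, ga, de; have ye : chart_inv D2 th2 (th1 z) = y by rewrite -e (chart_invK H2 Dy).
have c1 : has_lin (fun w : R * R => w.1) z 1 0.
  move=> eta eta0; near=> w; rewrite mul1r mul0r addr0 subrr normr0.
  by rewrite mulr_ge0 ?(ltW eta0)// addr_ge0.
have c2 : has_lin (fun w : R * R => w.2) z 0 1.
  move=> eta eta0; near=> w; rewrite mul1r mul0r add0r subrr normr0.
  by rewrite mulr_ge0 ?(ltW eta0)// addr_ge0.
have nD : \forall w \near z, chart_inv D1 th1 (th1 w) = w.
  apply: filterS (open_nbhs_nbhs (conj (chart_open H1) Dz)) => w Dw.
  exact: chart_invK H1 Dw.
(* The two transition matrices are inverse to each other: the gradient of [chart_inv D1 th1] is
   transported from the second chart to the first, where this function is the identity. *)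
have i1 := T12 (fst \o chart_inv D1 th1) _ _ l1'.
have i2 := T12 (snd \o chart_inv D1 th1) _ _ l2'.
have [e1 e2] : al * al' + ga * be' = 1 /\ be * al' + de * be' = 0.
  apply: (has_lin_unique i1 _); apply: near_has_lin c1.
  by apply: filterS nD => w /= ->.
have [e3 e4] : al * ga' + ga * de' = 0 /\ be * ga' + de * de' = 1.
  apply: (has_lin_unique i2 _); apply: near_has_lin c2.
  by apply: filterS nD => w /= ->.
set Dl := al * de - be * ga in D0 *.
have s1 : al' = de / Dl.
  apply: (mulIf D0); rewrite divfK// /Dl.
  have -> : al' * (al * de - be * ga) = de * (al * al' + ga * be') - ga * (be * al' + de * be') by ring.
  by rewrite e1 e2 mulr1 mulr0 subr0.
have s2 : be' = - be / Dl.
  apply: (mulIf D0); rewrite divfK// /Dl.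
  have -> : be' * (al * de - be * ga) = al * (be * al' + de * be') - be * (al * al' + ga * be') by ring.
  by rewrite e1 e2 mulr1 mulr0 sub0r.
have s3 : ga' = - ga / Dl.
  apply: (mulIf D0); rewrite divfK// /Dl.
  have -> : ga' * (al * de - be * ga) = de * (al * ga' + ga * de') - ga * (be * ga' + de * de') by ring.
  by rewrite e3 e4 mulr1 mulr0 sub0r.
have s4 : de' = al / Dl.
  apply: (mulIf D0); rewrite divfK// /Dl.
  have -> : de' * (al * de - be * ga) = al * (be * ga' + de * de') - be * (al * ga' + ga * de') by ring.
  by rewrite e3 e4 mulr1 mulr0 subr0.
split => //=; rewrite ?ye; [by rewrite -s1 -s2|by rewrite -s3 -s4|].
exact: (transition_area H2 Dy (esym e) (conj D0 T12)).
Unshelve. all: by end_near. Qed.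

(** The area of a piece of surface does not depend on the chart. This consistency is what makes a
    surface measure possible. *)
Lemma chart_area_transfer S D1 D2 th1 th2 (A : set (R * R)) :
  local_param S D1 th1 -> local_param S D2 th2 -> measurable A -> A `<=` D1 ->
  th1 @` A `<=` th2 @` D2 ->
  (\int[leb2]_(z in A) (area_element th1 z)%:E =
   \int[leb2]_(z in D2 `&` th2 @^-1` (th1 @` A)) (area_element th2 z)%:E)%E.
Proof.
move=> H1 H2 mA AD sub.
have [Q1 oQ1 E1] := chart_image H1; have [Q2 oQ2 E2] := chart_image H2.
rewrite (change_of_variables (chart_cov H1 H2 oQ1 oQ2 E1 E2) mA); last first.
  move=> z Az; split; first exact: AD.
  have : (th2 @` D2) (th1 z) by apply: sub; exists z.
  by rewrite E2 => -[].
congr (integral _ _ _); apply/seteqP; split=> y /=.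
  move=> [[Dy Qy] Ay]; split => //; exists (chart_inv D1 th1 (th2 y)) => //.
  have [z Dz e] : (th1 @` D1) (th2 y) by rewrite E1; split => //; exact: chart_surf H2 Dy.
  by rewrite -e (chart_invK H1 Dz).
move=> [Dy [z Az e]]; split.
  split => //; have : (th1 @` D1) (th1 z) by exists z => //; exact: AD.
  by rewrite E1 e => -[].
by rewrite -e (chart_invK H1 (AD z Az)).
Qed.

End chart_transitions.

(** * Construction of the surface measure *)

Section surface_measure.
Context {R : realType}.
Local Notation pt := (R * R * R)%type.
Local Notation leb2 := (@lebesgue_measure R \x @lebesgue_measure R)%E.
Local Notation leb2m :=
  (leb2 : {measure set (measurableTypeR R * measurableTypeR R) -> \bar R}).
Implicit Types (S U : set pt) (D : set (R * R)) (th h : R * R -> pt) (g v w : pt).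

Lemma open_compact_union (A : set (R * R)) : open A -> exists C : nat -> set (R * R),
  (forall n, compact (C n)) /\ A = \bigcup_n C n.
Proof.
move=> oA.
pose P n := compact (closure (base_R2 n : set (R * R))) /\ closure (base_R2 n) `<=` A.
exists (fun n => if `[<P n>] then closure (base_R2 n) else set0); split.
  by move=> n; case: asboolP => [[]//|_]; exact: compact0.
apply/seteqP; split=> [z Az|z [n _]]; last by case: asboolP => // -[_ sub] /sub.
have [d d0 dA] := (near_box _ _).1 (open_nbhs_nbhs (conj oA Az)).
have d2 : 0 < d / 2 by rewrite divr_gt0.
pose Q : set (R * R) := `[z.1 - d / 2, z.1 + d / 2]%classic `*` `[z.2 - d / 2, z.2 + d / 2]%classic.
have cQ : compact Q by apply: compact_setX; exact: segment_compact.
have hQ : hausdorff_space (R * R)%type by exact: norm_hausdorff.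
have nQ : nbhs z Q.
  apply/near_box; exists (d / 2) => // y; rewrite !ltr_distl => /andP[/ltW a1 /ltW a2] /andP[/ltW a3 /ltW a4].
  by split; rewrite /= in_itv/= ?a1 ?a2 ?a3 ?a4.
have [n [Bz BQ]] := (@base_R2P R).2 z Q nQ.
have clQ : closure (base_R2 n) `<=` Q.
  by rewrite (closure_id Q).1; [exact: closure_subset|exact: compact_closed].
have Pn : P n.
  split; first by apply: subclosed_compact clQ => //; exact: closed_closure.
  move=> y /clQ[]; rewrite /= !in_itv/= -!ler_distl => h1 h2; apply: dA.
  - by rewrite (le_lt_trans h1)// ltr_pdivrMr// ltr_pMr// ltr1n.
  - by rewrite (le_lt_trans h2)// ltr_pdivrMr// ltr_pMr// ltr1n.
by exists n => //; case: asboolP => // _; exact: subset_closure.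
Qed.

(** The image need not be open in space. It is a countable union of images of compact sets, each of
    which is compact, hence closed. *)
Lemma chart_image_open S D th A : local_param S D th -> open A -> A `<=` D -> measurable (th @` A).
Proof.
move=> H oA AD; have [C [cC E]] := open_compact_union oA.
rewrite E image_bigcup; apply: bigcup_measurable => n _.
have h3 : hausdorff_space pt by exact: norm_hausdorff.
have cl : closed (th @` C n).
  apply: compact_closed => //; apply: continuous_compact => //.
  apply: continuous_in_subspaceT => z; rewrite inE => Cz.
  apply: (chart_continuous H); apply: AD; rewrite E; by exists n.
by rewrite -[_ @` _]setCK; apply: measurableC; apply: open_measurable3; exact: closed_openC.
Qed.

Lemma chart_inv_measurable S D th : local_param S D th ->
  measurable_fun (th @` D) (chart_inv D th).
Proof.
move=> H; have oD := chart_open H.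
have m (pr : R * R -> R) : continuous pr -> measurable_fun (th @` D) (pr \o chart_inv D th).
  move=> cpr; apply: (measurability _ (RGenOpens.measurableE R)).
  move=> _ [_ [a [b ->] <-]].
  rewrite (_ : _ `&` _ = th @` (D `&` pr @^-1` `]a, b[%classic)).
    apply: (chart_image_open H); last exact: subIsetl.
    apply: open_preimage_cont; [exact: oD|by move=> z _; exact: cpr|exact: interval_open].
  apply/seteqP; split=> [_ [[z Dz <-]]|_ [z [Dz pz] <-]].
    by rewrite /preimage /= (chart_invK H Dz) => pz; exists z.
  by split; [exists z|rewrite /preimage /= (chart_invK H Dz)].
apply: measurable_fun_pair_on; apply: m => z; [exact (@cvg_fst _ _ _ _ _)|exact (@cvg_snd _ _ _ _ _)].
Qed.

Lemma chart_image_measurable S D th A : local_param S D th -> measurable A -> A `<=` D ->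
  measurable (th @` A).
Proof.
move=> H mA AD; have oD := chart_open H.
rewrite (_ : th @` A = th @` D `&` chart_inv D th @^-1` A).
  by apply: (chart_inv_measurable H) => //; exact: chart_image_open H oD (@subset_refl _ D).
apply/seteqP; split=> [_ [z Az <-]|_ [[z Dz <-]]].
  by split; [exists z => //; exact: AD|rewrite /preimage /= (chart_invK H (AD z Az))].
by rewrite /preimage /= (chart_invK H Dz) => Az; exists z.
Qed.

Lemma chart_measurable S D th : local_param S D th -> measurable_fun D th.
Proof.
move=> H; apply: continuous_measurable23; first exact: chart_open H.
by move=> z; exact: chart_continuous H.
Qed.

Lemma chart_preimage_measurable S D th B : local_param S D th -> measurable B ->
  measurable (D `&` th @^-1` B).
Proof.
move=> H mB; apply: (chart_measurable H) => //; apply: open_measurable2; exact: chart_open H.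
Qed.

Lemma chart_area_measurable S D th : local_param S D th -> measurable_fun D (area_element th).
Proof.
move=> H; apply: continuous_measurable2; first exact: chart_open H.
by move=> z; exact: chart_area_continuous H.
Qed.

Lemma chart_fun_measurable S D th A (f : pt -> R) : local_param S D th -> measurable A -> A `<=` D ->
  measurable_fun A (f \o th) -> measurable_fun (th @` A) f.
Proof.
move=> H mA AD mf; have mtA := chart_image_measurable H mA AD.
apply: (eq_measurable_fun ((f \o th) \o chart_inv D th)).
  by move=> y; rewrite inE => -[z Az <-] /=; rewrite (chart_invK H (AD z Az)).
apply: (@measurable_comp _ _ _ _ _ _ A) => //.
  by move=> _ [_ [z Az <-] <-]; rewrite (chart_invK H (AD z Az)).
apply: measurable_funS (chart_inv_measurable H); last exact: image_subset.
exact: chart_image_open H (chart_open H) (@subset_refl _ D).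
Qed.

Lemma local_param0 S th : local_param S set0 th.
Proof.
split; [exact: open0| |by move=> z []|by move=> z z'; rewrite inE|].
  have e (V W : normedModType R) (f : V -> W) : C1_on set0 f by split=> [x []|v x []].
  by split => [|v]; exact: e.
by move=> A oA A0; exists set0; [exact: open0|rewrite setI0; apply/seteqP; split=> // y [z /A0]].
Qed.

(* [pc_D n] and [pc_th n] are charts and the [pc_A n] disjoint pieces of the surface. *)
Record pieces S := Pieces {
  pc_D : nat -> set (R * R);
  pc_th : nat -> R * R -> pt;
  pc_A : nat -> set (R * R);
  pc_chart : forall n, local_param S (pc_D n) (pc_th n);
  pc_meas : forall n, measurable (pc_A n);
  pc_sub : forall n, pc_A n `<=` pc_D n;
  pc_triv : trivIset setT (fun n => pc_th n @` pc_A n);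
  pc_cover : S = \bigcup_n pc_th n @` pc_A n }.

(** Lindelöf's argument: for each set of a countable base of space a chart is chosen that covers its
    trace on [S], when there is one. These images cover [S] and are then made disjoint. *)
Lemma pieces_exist S : C2_surface S -> inhabited (pieces S).
Proof.
move=> HS.
pose good n (c : set (R * R) * (R * R -> pt)) :=
  local_param S c.1 c.2 /\ S `&` base_R3 n `<=` c.2 @` c.1.
(* The default is the empty chart, for base sets that no single chart covers. *)
pose ch n := xget (set0, fun=> 0) [set c | good n c].
have chP n : local_param S (ch n).1 (ch n).2.
  by rewrite /ch; case: xgetP => [c _ []//|_]; exact: local_param0.
have mim n : measurable ((ch n).2 @` (ch n).1).
  exact: chart_image_open (chP n) (chart_open (chP n)) (@subset_refl _ _).
pose E := seqDU (fun n => (ch n).2 @` (ch n).1).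
have mE n : measurable (E n) by exact: seqDU_measurable.
have EA n : E n = (ch n).2 @` ((ch n).1 `&` (ch n).2 @^-1` E n).
  apply/seteqP; split=> [y Ey|y [z [_ Ez] <-]//].
  have [z Dz zy] : ((ch n).2 @` (ch n).1) y by case: Ey.
  by exists z => //; split => //; rewrite /preimage /= zy.
constructor; apply: (@Pieces S (fun n => (ch n).1) (fun n => (ch n).2)
  (fun n => (ch n).1 `&` (ch n).2 @^-1` E n)) => //.
- by move=> n; exact: chart_preimage_measurable (chP n) (mE n).
- have -> : (fun n => (ch n).2 @` ((ch n).1 `&` (ch n).2 @^-1` E n)) = E.
    by apply/funext => n; rewrite -EA.
  exact: trivIset_seqDU.
transitivity (\bigcup_n E n); last by apply: eq_bigcupr => n _; exact: EA.
rewrite /E -seqDU_bigcup_eq; apply/seteqP; split=> [g Sg|g [n _ [z Dz <-]]]; last first.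
  exact: chart_surf (chP n) Dz.
have [D [th [H Dg]]] := HS g Sg; have [Q oQ EQ] := chart_image H.
have Qg : Q g by move: Dg; rewrite EQ => -[].
have [n [Bg BQ]] := (@base_R3P R).2 g Q (open_nbhs_nbhs (conj oQ Qg)).
have gd : good n (D, th) by split => //= y [Sy By]; rewrite EQ; split => //; exact: BQ.
exists n => //; rewrite /ch; case: xgetP => [c _ [_]|/(_ _ gd)//]; exact.
Qed.

Lemma surface_measurable S : C2_surface S -> measurable S.
Proof.
move=> /pieces_exist[p]; rewrite (pc_cover p); apply: bigcup_measurable => n _.
exact: chart_image_measurable (@pc_chart _ p n) (@pc_meas _ p n) (@pc_sub _ p n).
Qed.

(** The sum of the area measures of the disjoint pieces. For any other chart, its part over each
    piece is transferred to the chart of that piece. *)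
Lemma surface_measure_exists S : C2_surface S -> exists mu, is_surface_measure S mu.
Proof.
move=> /pieces_exist[p].
have ex n : {nu : {measure set pt -> \bar R} | forall B, measurable B ->
    nu B = image_density leb2m (pc_A p n) (area_element (pc_th p n)) (pc_th p n) B}.
  apply: cid; have mA := @pc_meas _ p n; have AD := @pc_sub _ p n.
  apply: (@image_density_exists _ _ _ _ R leb2m) => //.
  - by move=> x; exact: area_element_ge0.
  - apply: measurable_funS (chart_area_measurable (@pc_chart _ p n)) => //.
    by apply: open_measurable2; exact: chart_open (@pc_chart _ p n).
  - apply: measurable_funS (chart_measurable (@pc_chart _ p n)) => //.
    by apply: open_measurable2; exact: chart_open (@pc_chart _ p n).
pose nu n := projT1 (ex n).
exists (mseries nu 0); split.
  rewrite /= /mseries eseries0// => n _ _; rewrite /nu (projT2 (ex n)).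
    rewrite /image_density (_ : _ `&` _ = set0) ?integral_set0//.
    apply/seteqP; split=> // z [Az]; apply => /=.
    by apply: (chart_surf (@pc_chart _ p n)); exact: pc_sub.
  apply: measurableC; rewrite (pc_cover p); apply: bigcup_measurable => n' _.
  exact: chart_image_measurable (@pc_chart _ p n') (@pc_meas _ p n') (@pc_sub _ p n').
move=> D th H A mA AD; rewrite /= /mseries.
have mE n : measurable (pc_th p n @` pc_A p n).
  exact: chart_image_measurable (@pc_chart _ p n) (@pc_meas _ p n) (@pc_sub _ p n).
pose B n := A `&` th @^-1` (pc_th p n @` pc_A p n).
have BE n : B n = A `&` (D `&` th @^-1` (pc_th p n @` pc_A p n)).
  by rewrite setIA; congr (_ `&` _); rewrite (setIidl AD).
have mB n : measurable (B n).
  by rewrite BE; apply: measurableI => //; exact: chart_preimage_measurable H (mE n).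
have AB : A = \bigcup_n B n.
  apply/seteqP; split=> [z Az|z [n _ []//]].
  have : S (th z) by exact: chart_surf H (AD z Az).
  by rewrite {1}(pc_cover p) => -[n _ ?]; exists n.
rewrite {2}AB ge0_integral_bigcup//; last 3 first.
- rewrite -AB; apply/measurable_EFinP; apply: measurable_funS (chart_area_measurable H) => //.
  by apply: open_measurable2; exact: chart_open H.
- by move=> z _; rewrite lee_fin area_element_ge0.
- move=> i j _ _ [z [[_ zi] [_ zj]]]; apply: (@pc_triv _ p i j) => //.
  by exists (th z).
apply: eq_eseriesr => n _.
have BD : B n `<=` D by move=> z [/AD].
rewrite /nu (projT2 (ex n)); last exact: chart_image_measurable H mA AD.
rewrite (chart_area_transfer H (@pc_chart _ p n) (mB n) BD); last first.
  by move=> _ [z [_ [y Ay <-]] <-]; exists y => //; exact: pc_sub.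
rewrite /image_density; congr (integral _ _ _); apply/seteqP; split=> z /=.
  move=> [Az [y Ay yz]]; split; first exact: pc_sub.
  exists y => //; split => //; rewrite /preimage /= yz; by exists z.
move=> [Dz [y [Ay [z' Az' e]] yz]]; split; last by exists y.
have <- // : z' = z.
have [_ _ _ inj _] := @pc_chart _ p n; apply: inj; rewrite ?inE//; last by rewrite e.
exact: pc_sub.
Qed.

Lemma surface_measureP S : C2_surface S -> is_surface_measure S (surface_measure S).
Proof.
move=> HS; rewrite /surface_measure; case: pselect => [e|/(_ (surface_measure_exists HS))//].
exact: (projT2 (cid e)).
Qed.

Lemma integral_chart S D th A (f : pt -> R) : C2_surface S -> local_param S D th ->
  measurable A -> A `<=` D -> measurable_fun A (f \o th) ->
  (\int[surface_measure S]_(y in th @` A) (f y)%:E =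
   \int[leb2]_(z in A) (f (th z) * area_element th z)%:E)%E.
Proof.
move=> HS H mA AD mf; have [_ sm] := surface_measureP HS.
have mD : measurable D by apply: open_measurable2; exact: chart_open H.
apply: (integral_image_density (m := leb2m)).
- by move=> x; exact: area_element_ge0.
- by [].
- by apply: measurable_funS (chart_area_measurable H).
- by apply: measurable_funS (chart_measurable H).
- exact: chart_image_measurable H mA AD.
- by move=> z Az; exists z.
- move=> B mB BA; rewrite [RHS](_ : _ = (\int[leb2]_(z in A `&` th @^-1` B) (area_element th z)%:E)%E)// -(sm D th H (A `&` th @^-1` B)).
  + congr (surface_measure S _); apply/seteqP; split=> [y By|_ [z [_ Bz] <-]//].
    by have [z Az zy] := BA y By; exists z => //; split=> //; rewrite /preimage/= zy.
  + rewrite (_ : _ `&` _ = A `&` (D `&` th @^-1` B)); last by rewrite setIA (setIidl AD).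
    by apply: measurableI => //; exact: chart_preimage_measurable H mB.
  + by move=> z [/AD].
- exact: chart_fun_measurable H mA AD mf.
Qed.

End surface_measure.

(** * Normals and the mean curvature in a chart *)

Section normals.
Context {R : realType}.
Local Notation pt := (R * R * R)%type.
Implicit Types (S U : set pt) (D : set (R * R)) (th : R * R -> pt) (g v w n : pt).

Lemma has_lin_fst (c : R * R) : has_lin (fun z : R * R => z.1) c 1 0.
Proof.
move=> eta eta0; near=> w; rewrite mul1r mul0r addr0 subrr normr0.
by rewrite mulr_ge0 ?(ltW eta0)// addr_ge0.
Unshelve. all: by end_near. Qed.

Lemma is_derive_fst (V1 V2 : normedModType R) (c : R -> V1 * V2) s (v : V1 * V2) :
  is_derive s (1 : R) c v -> is_derive s (1 : R) (fst \o c) v.1.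
Proof.
move=> /is_derive_differentiable[dc E]; have [d e] := differentiable_fst dc.
by have := differentiable_is_derive (1 : R) d; rewrite e E.
Qed.

Lemma is_derive_snd (V1 V2 : normedModType R) (c : R -> V1 * V2) s (v : V1 * V2) :
  is_derive s (1 : R) c v -> is_derive s (1 : R) (snd \o c) v.2.
Proof.
move=> /is_derive_differentiable[dc E]; have [d e] := differentiable_snd dc.
by have := differentiable_is_derive (1 : R) d; rewrite e E.
Qed.

Lemma pt_ext v w : v.1.1 = w.1.1 -> v.1.2 = w.1.2 -> v.2 = w.2 -> v = w.
Proof. by case: v => [[? ?] ?]; case: w => [[? ?] ?] /= -> -> ->. Qed.

Lemma lin_coord (x y : R) v w : [/\ (x *: v + y *: w).1.1 = x * v.1.1 + y * w.1.1,
  (x *: v + y *: w).1.2 = x * v.1.2 + y * w.1.2 & (x *: v + y *: w).2 = x * v.2 + y * w.2].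
Proof. by []. Qed.

Lemma lf_lin m (x y : R) v w : lf m (x *: v + y *: w) = x * lf m v + y * lf m w.
Proof. by rewrite /lf; have [-> -> ->] := lin_coord x y v w; ring. Qed.

Lemma comb_inj m1 m2 v w : lf m1 v = 1 -> lf m1 w = 0 -> lf m2 v = 0 -> lf m2 w = 1 ->
  forall x y a b : R, x *: v + y *: w = a *: v + b *: w -> x = a /\ y = b.
Proof.
move=> m11 m12 m21 m22 x y a b E; have E1 := congr1 (lf m1) E; have E2 := congr1 (lf m2) E.
by move: E1 E2; rewrite !lf_lin m11 m12 m21 m22 !mulr1 !mulr0 !addr0 !add0r.
Qed.

Lemma innerDl g v w n (a b : R) : inner g (a *: v + b *: w) n = a * inner g v n + b * inner g w n.
Proof. by rewrite /inner /Tcoord; have [-> -> ->] := lin_coord a b v w; ring. Qed.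

(** A curve is regarded as a map of the plane that depends on the first variable only, so that
    [chart_lift] lifts it to the chart. *)
Lemma curve_lift S D th d v c : local_param S D th -> D d -> curve_in S (th d) v c ->
  exists a b : R, v = a *: pu th d + b *: pv th d /\
  forall (f : pt -> R) al be, has_lin (f \o th) d al be ->
    is_derive (0 : R) (1 : R) (f \o c) (al * a + be * b).
Proof.
move=> H Dd [Sc c0 dc].
pose h (z : R * R) := c z.1.
have l1 (k : R -> R) x : is_derive (0 : R) (1 : R) k x ->
    has_lin (fun z : R * R => k z.1) (0, 0) x 0.
  move=> dk; have := has_lin_comp1 (has_lin_fst (0, 0)) dk.
  by rewrite mulr1 mulr0.
have hl : has_lin3 h (0, 0) v 0.
  split; [exact (l1 _ _ (is_derive_fst (is_derive_fst dc)))
         |exact (l1 _ _ (is_derive_snd (is_derive_fst dc)))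
         |exact (l1 _ _ (is_derive_snd dc))].
have Sh : \forall z \near ((0, 0) : R * R), S (h z).
  exact: (@cvg_fst _ _ (nbhs (0 : R)) (nbhs (0 : R)) _ _ Sc).
have [m1 [m2 [_ lift]]] := chart_lift H Dd.
have [nD w1 w2] := lift h (0, 0) v 0 c0 Sh hl.
have d1 := is_derive_slice1 w1; have d2 := is_derive_slice1 w2.
have key (f : pt -> R) al be : has_lin (f \o th) d al be ->
    is_derive (0 : R) (1 : R) (f \o c) (al * lf m1 v + be * lf m2 v).
  move=> fl.
  have fl' : has_lin (f \o th) ((chart_inv D th (h (0, 0))).1, (chart_inv D th (h (0, 0))).2) al be.
    by rewrite -surjective_pairing /h /= c0 (chart_invK H Dd).
  apply: near_eq_is_derive (is_derive_curve d1 d2 fl').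
  have n0 : \forall s \near (0 : R), th (chart_inv D th (h (s, 0))) = h (s, 0).
    have [e e0 eP] := (near_box _ _).1 nD.
    apply/nbhs_ballP; exists e => //= s; rewrite /ball /= sub0r normrN => se.
    by apply: (eP (s, 0) _ _).2; rewrite /= subr0 ?normr0.
  by apply: filterS n0 => s /= E; rewrite -surjective_pairing E.
exists (lf m1 v), (lf m2 v); split => //.
have [h1 h2 h3] := chart_lin H Dd.
have u (k : R -> R) x y : is_derive (0 : R) (1 : R) k x -> is_derive (0 : R) (1 : R) k y -> x = y.
  by move=> [_ <-] [_ <-].
have e1 := u _ _ _ (is_derive_fst (is_derive_fst dc)) (key (fun g => g.1.1) _ _ h1).
have e2 := u _ _ _ (is_derive_snd (is_derive_fst dc)) (key (fun g => g.1.2) _ _ h2).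
have e3 := u _ _ _ (is_derive_snd dc) (key (fun g => g.2) _ _ h3).
have [q1 q2 q3] := lin_coord (lf m1 v) (lf m2 v) (pu th d) (pv th d).
apply: pt_ext; [apply: etrans (etrans _ (esym q1))|apply: etrans (etrans _ (esym q2))
  |apply: etrans (etrans _ (esym q3))]; [exact: e1| |exact: e2| |exact: e3|];
  by rewrite [lf m1 v * _]mulrC [lf m2 v * _]mulrC.
Qed.

Lemma curve_exists S D th d (a b : R) : local_param S D th -> D d ->
  exists c, curve_in S (th d) (a *: pu th d + b *: pv th d) c.
Proof.
move=> H Dd; pose p1 (s : R) := d.1 + s * a; pose p2 (s : R) := d.2 + s * b.
have p0 : (p1 0, p2 0) = d by rewrite /p1 /p2 !mul0r !addr0 -surjective_pairing.
have dp (x y : R) : is_derive (0 : R) (1 : R) (fun s => x + s * y) y.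
  have l := has_linD (has_lin_cst x (0, 0)) (has_linM (has_lin_fst (0, 0)) (has_lin_cst y (0, 0))).
  by apply: (is_derive_eq (is_derive_slice1 l)); rewrite /= mul0r !add0r mul1r.
have dl (f : R * R -> R) al be : has_lin f d al be ->
    is_derive (0 : R) (1 : R) (fun s => f (p1 s, p2 s)) (al * a + be * b).
  by move=> fl; apply: is_derive_curve; rewrite ?p0//; exact: dp.
have [h1 h2 h3] := chart_lin H Dd.
have df (f : R -> R) x : is_derive (0 : R) (1 : R) f x -> differentiable f 0 /\ 'D_1 f 0 = x.
  exact: is_derive_differentiable.
have [g1 e1] := df _ _ (dl _ _ _ h1); have [g2 e2] := df _ _ (dl _ _ _ h2).
have [g3 e3] := df _ _ (dl _ _ _ h3).
have dd := differentiable_pair (differentiable_pair g1 g2) g3.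
exists (fun s => ((th (p1 s, p2 s)).1.1, (th (p1 s, p2 s)).1.2, (th (p1 s, p2 s)).2)); split.
- have cp : (p1 s, p2 s) @[s --> (0 : R)] --> (d : R * R).
    have cs (x y : R) : (x + s * y) @[s --> (0 : R)] --> x + 0 * y.
      by apply: cvgD; [exact: cvg_cst|apply: cvgM; [exact: cvg_id|exact: cvg_cst]].
    by rewrite -p0; exact (cvg_pair (cs d.1 a) (cs d.2 b)).
  have nD : \forall s \near (0 : R), D (p1 s, p2 s).
    by apply: cp; apply: open_nbhs_nbhs; split => //; exact: chart_open H.
  apply: filterS nD => s Ds; rewrite -!surjective_pairing; exact: chart_surf H Ds.
- by rewrite -!surjective_pairing p0.
- have D0 := differentiable_is_derive (1 : R) dd; apply: (is_derive_eq D0).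
  rewrite (derive_pair (1 : R) (differentiable_pair g1 g2) g3) (derive_pair (1 : R) g1 g2) e1 e2 e3.
  have [q1 q2 q3] := lin_coord a b (pu th d) (pv th d).
  apply: pt_ext; [apply: etrans (esym q1)|apply: etrans (esym q2)|apply: etrans (esym q3)];
    by rewrite [a * _]mulrC [b * _]mulrC.
Qed.

(** The curve chosen in [derive_along] does not matter: [pu] and [pv] are independent, so every
    curve in [S] with this velocity has the same velocity [(a, b)] in the chart. *)
Lemma derive_along_chart S D th d (a b : R) (f : pt -> R) al be :
  local_param S D th -> D d -> has_lin (f \o th) d al be ->
  derive_along S (th d) (a *: pu th d + b *: pv th d) f = al * a + be * b.
Proof.
move=> H Dd fl; rewrite /derive_along.
have [m1 [m2 [[m11 m12 m21 m22] _]]] := chart_lift H Dd.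
have co := comb_inj m11 m12 m21 m22.
have val c : curve_in S (th d) (a *: pu th d + b *: pv th d) c ->
    is_derive (0 : R) (1 : R) (f \o c) (al * a + be * b).
  move=> /(curve_lift H Dd)[x [y [/esym/co[-> ->] k]]]; exact (k _ _ _ fl).
case: xgetP => [x _ [c /val dc]|].
  by have [_ <-] := dc; move=> [_ <-].
have [c cc] := curve_exists a b H Dd.
by move=> /(_ (al * a + be * b)); case; exists c => //; exact: val.
Qed.

Lemma tangent_chart S D th d v : local_param S D th -> D d ->
  tangent S (th d) v <-> exists a b : R, v = a *: pu th d + b *: pv th d.
Proof.
move=> H Dd; split=> [[c /(curve_lift H Dd)[a [b [-> _]]]]|[a [b ->]]]; first by exists a, b.
exact (curve_exists a b H Dd).
Qed.

(** The vector [p X1 + q X2 + o T] at [g]. *)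
Definition frame_vec g (p q o : R) : pt := (p, q, o - (g.1.2 * p - g.1.1 * q) / 2).

Lemma Tcoord_frame_vec g (p q o : R) : Tcoord g (frame_vec g p q o) = o.
Proof. by rewrite /Tcoord /=; ring. Qed.

Lemma cross_ortho g v w (a b : R) :
  inner g (a *: v + b *: w) (frame_vec g (crossP g v w) (crossQ g v w) (crossO g v w)) = 0.
Proof.
rewrite innerDl /inner Tcoord_frame_vec /frame_vec /= /crossP /crossQ /crossO.
by move: (Tcoord g v) (Tcoord g w) => v3 w3; ring.
Qed.

(* The density of [sigma_H] in the chart [th]. *)
Definition dens th z : R := Num.sqrt (chartP th z ^+ 2 + chartQ th z ^+ 2).

Lemma dens_ge0 th z : 0 <= dens th z.
Proof. exact: sqrtr_ge0. Qed.

Lemma dens_le th z : dens th z <= area_element th z.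
Proof. by rewrite area_elementE ler_wsqrtr// lerDl sqr_ge0. Qed.

Lemma normal_vector_exists S g : C2_surface S -> S g -> exists n, normal_vector S g n.
Proof.
move=> HS Sg; have [D [th [H [d Dd E]]]] := HS g Sg; rewrite -E.
exists (frame_vec (th d) (chartP th d) (chartQ th d) (chartO th d)); split.
  move=> n0; have := area_element_gt0 H Dd.
  have e3 := Tcoord_frame_vec (th d) (chartP th d) (chartQ th d) (chartO th d).
  rewrite n0 /Tcoord /= !mulr0 subrr mul0r addr0 in e3.
  case: n0 => p0 q0 _; rewrite area_elementE p0 q0 -e3 !expr0n /= !addr0 sqrtr0.
  by rewrite ltxx.
move=> v /(tangent_chart _ H Dd)[a [b ->]].
exact (cross_ortho (th d) (pu th d) (pv th d) a b).
Qed.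

Lemma some_normalP S g : C2_surface S -> S g -> normal_vector S g (some_normal S g).
Proof.
move=> HS Sg; have [n hn] := normal_vector_exists HS Sg.
by rewrite /some_normal; case: xgetP => [//|/(_ n)].
Qed.

(** In the frame, with [c] the cross product of [u] and [v], the vector [n |c|^2 - (n . c) c] is a
    combination of [n . u] and [n . v], both zero. The factor is nonzero, for otherwise [n] would
    vanish. *)
Lemma normal_cross S D th d n : local_param S D th -> D d -> normal_vector S (th d) n ->
  exists2 c : R, c != 0 &
    [/\ n.1.1 = c * chartP th d, n.1.2 = c * chartQ th d & Tcoord (th d) n = c * chartO th d].
Proof.
move=> H Dd [n0 tn].
have tu : inner (th d) (pu th d) n = 0.
  apply: tn; apply/(tangent_chart _ H Dd); exists 1, 0.
  by rewrite scale1r scale0r addr0.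
have tv : inner (th d) (pv th d) n = 0.
  apply: tn; apply/(tangent_chart _ H Dd); exists 0, 1.
  by rewrite scale1r scale0r add0r.
have := area_element_gt0 H Dd; rewrite area_elementE sqrtr_gt0.
move: tu tv; rewrite /inner /chartP /chartQ /chartO /crossP /crossQ /crossO.
set g := th d in n0 *; move: (pu th d) (pv th d) => u v.
have nz : ~ (n.1.1 = 0 /\ n.1.2 = 0 /\ Tcoord g n = 0).
  move=> [p0 [q0 r0]]; apply: n0; move: r0; rewrite /Tcoord p0 q0 !mulr0 subrr mul0r addr0.
  by move=> r0; rewrite (surjective_pairing n) (surjective_pairing n.1) p0 q0 r0.
move: nz; move: (n.1.1) (n.1.2) (Tcoord g n) (Tcoord g u) (Tcoord g v) (u.1.1) (u.1.2) (v.1.1) (v.1.2).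
clear => n1 n2 n3 u3 v3 u1 u2 v1 v2 nz tu tv.
set P := u2 * v3 - u3 * v2; set Q := u3 * v1 - u1 * v3; set O' := u1 * v2 - u2 * v1 => A0.
pose A : R := P ^+ 2 + Q ^+ 2 + O' ^+ 2.
pose B : R := n1 * P + n2 * Q + n3 * O'.
have A1 : A != 0 by rewrite lt0r_neq0.
have E1 : n1 * A = B * P.
  apply/eqP; rewrite -subr_eq0; apply/eqP.
  transitivity ((u1 * n1 + u2 * n2 + u3 * n3) * (v2 * O' - v3 * Q)
     + (v1 * n1 + v2 * n2 + v3 * n3) * (u3 * Q - u2 * O')).
    by rewrite /A /B /P /Q /O'; ring.
  by rewrite tu tv !mul0r addr0.
have E2 : n2 * A = B * Q.
  apply/eqP; rewrite -subr_eq0; apply/eqP.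
  transitivity ((u1 * n1 + u2 * n2 + u3 * n3) * (v3 * P - v1 * O')
     + (v1 * n1 + v2 * n2 + v3 * n3) * (u1 * O' - u3 * P)).
    by rewrite /A /B /P /Q /O'; ring.
  by rewrite tu tv !mul0r addr0.
have E3 : n3 * A = B * O'.
  apply/eqP; rewrite -subr_eq0; apply/eqP.
  transitivity ((u1 * n1 + u2 * n2 + u3 * n3) * (v1 * Q - v2 * P)
     + (v1 * n1 + v2 * n2 + v3 * n3) * (u2 * P - u1 * Q)).
    by rewrite /A /B /P /Q /O'; ring.
  by rewrite tu tv !mul0r addr0.
exists (B / A); last first.
  by split; rewrite mulrAC -?E1 -?E2 -?E3 mulfK.
rewrite mulf_neq0 ?invr_eq0//; apply/eqP => B0; apply: nz.
move: E1 E2 E3; rewrite B0 !mul0r => /eqP e1 /eqP e2 /eqP e3.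
by move: e1 e2 e3; rewrite !mulf_eq0 (negbTE A1) !orbF => /eqP -> /eqP -> /eqP ->.
Qed.

Section normal_field.
Variable N : pt -> pt.

Lemma pNE g : pN N g = (N g).1.1.
Proof. by rewrite /pN /inner /Tcoord /=; field. Qed.

Lemma qNE g : qN N g = (N g).1.2.
Proof. by rewrite /qN /inner /Tcoord /=; field. Qed.

Lemma omegaNE g : omegaN N g = Tcoord g (N g).
Proof. by rewrite /omegaN /inner /Tcoord /=; field. Qed.

Lemma sqrtrM_sqr (c x : R) : Num.sqrt (c ^+ 2 * x) = `|c| * Num.sqrt x.
Proof. by rewrite sqrtrM ?sqr_ge0// sqrtr_sqr. Qed.

Lemma WN_chart S D th d : local_param S D th -> D d -> normal_vector S (th d) (N (th d)) ->
  exists2 c : R, c != 0 &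
    [/\ pN N (th d) = c * chartP th d, qN N (th d) = c * chartQ th d,
        omegaN N (th d) = c * chartO th d,
        WN N (th d) = `|c| * dens th d & rnorm (th d) (N (th d)) = `|c| * area_element th d].
Proof.
move=> H Dd nN; have [c c0 [n1 n2 n3]] := normal_cross H Dd nN.
exists c => //; rewrite /WN pNE qNE omegaNE n1 n2 n3; split => //.
  by rewrite !exprMn -mulrDr sqrtrM_sqr.
rewrite area_elementE /rnorm /inner n1 n2 n3 -sqrtrM_sqr; congr Num.sqrt; ring.
Qed.

Lemma WN_rnorm_chart S D th d : local_param S D th -> D d ->
  normal_vector S (th d) (N (th d)) ->
  WN N (th d) / rnorm (th d) (N (th d)) * area_element th d = dens th d.
Proof.
move=> H Dd nN; have [c c0 [_ _ _ -> ->]] := WN_chart H Dd nN.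
have A0 : area_element th d != 0 by rewrite lt0r_neq0// (area_element_gt0 H Dd).
have C0 : `|c| != 0 by rewrite normr_eq0.
by field; rewrite A0 C0.
Qed.

Lemma frame_bracket (i j : 'I_3) g : (i < 2)%N -> (j < 2)%N ->
  (lie_bracket (frame i) (frame j) g).1.1 = 0 :> R /\
  (lie_bracket (frame i) (frame j) g).1.2 = 0 :> R.
Proof.
have dfr (k : 'I_3) : (k < 2)%N -> forall v g : pt, ('D_v (frame k) g).1.1 = 0 :> R /\ ('D_v (frame k) g).1.2 = 0 :> R.
  move=> k2 v h.
  have did : differentiable (@id pt) h by apply: ex_diff.
  have sn1 : differentiable (fun g : pt => g.1.2) h.
    have [d1 _] := differentiable_fst did.
    by have [d2 _] := differentiable_snd d1.
  have sn2 : differentiable (fun g : pt => g.1.1) h.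
    have [d1 _] := differentiable_fst did.
    by have [d2 _] := differentiable_fst d1.
  have dX (f : pt -> R) (x y : R) : differentiable f h ->
      ('D_v (fun g => (x, y, f g)) h).1.1 = 0 /\ ('D_v (fun g => (x, y, f g)) h).1.2 = 0.
    move=> df; have dc (u : R) : differentiable (fun=> u : R) h by exact: differentiable_cst.
    rewrite (derive_pair v (differentiable_pair (dc x) (dc y)) df) (derive_pair v (dc x) (dc y)) /=.
    by rewrite !derive_cst.
  case: k k2 => [[|[|[|k]]]] //= k3 _.
  - apply: (dX (fun g => - g.1.2 / 2)).
    exact: (differentiableM (differentiableN sn1) (differentiable_cst _ _)).
  - apply: (dX (fun g => g.1.1 / 2)).
    exact: (differentiableM sn2 (differentiable_cst _ _)).
have sub0 (v w : pt) : v.1.1 = 0 /\ v.1.2 = 0 -> w.1.1 = 0 /\ w.1.2 = 0 ->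
    (v - w).1.1 = 0 /\ (v - w).1.2 = 0.
  by move=> [v1 v2] [w1 w2]; rewrite /= v1 v2 w1 w2 subrr.
move=> i2 j2; exact (sub0 _ _ (dfr j j2 (frame i g) g) (dfr i i2 (frame j g) g)).
Qed.

(** Brackets of the horizontal frame fields are vertical, hence orthogonal to [X1] and [X2]: every
    term of the Koszul formula vanishes. *)
Lemma christoffel_horizontal (i j k : 'I_3) g : (i < 2)%N -> (j < 2)%N -> (k < 2)%N ->
  christoffel i j k g = 0 :> R.
Proof.
have tz (l : 'I_3) : (l < 2)%N -> Tcoord g (frame l g) = 0.
  by case: l => [[|[|[|l]]]] //= ? _; rewrite /Tcoord /=; field.
have iz (l m n : 'I_3) : (l < 2)%N -> (m < 2)%N -> (n < 2)%N ->
    inner g (lie_bracket (frame l) (frame m) g) (frame n g) = 0 :> R.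
  move=> l2 m2 n2; have [e1 e2] := frame_bracket g l2 m2.
  by rewrite /inner e1 e2 (tz n n2) !mul0r mulr0 !addr0.
have z0 (x y z : R) : x = 0 -> y = 0 -> z = 0 -> (x - y + z) / 2 = 0.
  by move=> -> -> ->; rewrite subrr addr0 mul0r.
by move=> i2 j2 k2; exact (z0 _ _ _ (iz i j k i2 j2 k2) (iz j k i j2 k2 i2) (iz k i j k2 i2 j2)).
Qed.

(** [eH] and [nuH] are horizontal, so the Christoffel symbols that could contribute have three
    horizontal indices, and these are zero. What remains is the derivative of the components
    [(qbar, - pbar)] of [eH]. *)
Lemma Hmean_derive S g : Hmean N S g =
  - (pbar N g * derive_along S g (eH N g) (qbar N)
     + qbar N g * derive_along S g (eH N g) (fun h : pt => - pbar N h)).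
Proof.
rewrite /Hmean; congr (- _).
have nT : Tcoord g (nuH N g) = 0 by rewrite /Tcoord /nuH /= /GRing.scale /=; field.
have eT : Tcoord g (eH N g) = 0 by rewrite /Tcoord /eH /= /GRing.scale /=; field.
have fr2 (V : pt) : Tcoord g V = 0 -> inner g V (frame (lift ord0 (lift ord0 ord0)) g) = 0.
  by move=> V0; rewrite /inner V0 /frame /=; ring.
have fr0 (V h : pt) : inner h V (frame ord0 h) = V.1.1 by rewrite /inner /Tcoord /frame /=; field.
have fr1 (V h : pt) : inner h V (frame (lift ord0 ord0) h) = V.1.2.
  by rewrite /inner /Tcoord /frame /=; field.
pose c (k : 'I_3) : R := derive_along S g (eH N g) (fun h => inner h (eH N h) (frame k h))
     + \sum_(i < 3) \sum_(j < 3)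
         inner g (eH N g) (frame i g) * inner g (eH N g) (frame j g) * christoffel i j k g.
have cE (k : 'I_3) : (k < 2)%N -> c k = derive_along S g (eH N g) (fun h => inner h (eH N h) (frame k h)).
  move=> k2; rewrite /c [X in _ + X]big1 ?addr0// => i _; rewrite big1// => j _.
  have [i2|i2] := ltnP i 2; last first.
    have -> : i = lift ord0 (lift ord0 ord0) :> 'I_3 by apply/val_inj/eqP; rewrite /= eqn_leq i2 -ltnS ltn_ord.
    by rewrite (fr2 _ eT) !mul0r.
  have [j2|j2] := ltnP j 2; last first.
    have -> : j = lift ord0 (lift ord0 ord0) :> 'I_3 by apply/val_inj/eqP; rewrite /= eqn_leq j2 -ltnS ltn_ord.
    by rewrite (fr2 _ eT) mulr0 mul0r.
  by rewrite christoffel_horizontal// mulr0.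
have -> : covariant S g (eH N g) (eH N) = \sum_(k < 3) c k *: frame k g by [].
have key (x y z : R) : inner g (x *: X1 g + (y *: X2 g + z *: T3 g)) (nuH N g) =
    pbar N g * x + qbar N g * y.
  by rewrite /inner nT mulr0 addr0 /nuH /= /GRing.scale /=; ring.
rewrite big_ord_recl big_ord_recl big_ord_recl big_ord0 addr0.
rewrite [LHS]key cE// cE//; congr (_ * _ + _ * _); congr (derive_along _ _ _ _); apply/funext => h.
  by rewrite fr0 /eH /= /GRing.scale /=; ring.
by rewrite fr1 /eH /= /GRing.scale /=; ring.
Qed.

End normal_field.
End normals.

(** * Orientation and the formula for the mean curvature *)

Section mean_curvature.
Context {R : realType}.
Local Notation pt := (R * R * R)%type.
Implicit Types (S U : set pt) (D : set (R * R)) (th : R * R -> pt) (g v w n : pt).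

Lemma chart_within S D th d (f : pt -> pt) : local_param S D th -> D d ->
  {within S, continuous f} -> {for d, continuous (f \o th)}.
Proof.
move=> H Dd cf; have Sd := chart_surf H Dd.
have c1 : th z @[z --> d] --> within S (nbhs (th d)).
  move=> A SA; have n1 : \forall z \near d, S (th z) -> A (th z) by exact (chart_continuous H Dd SA).
  have n2 : \forall z \near d, D z by apply: open_nbhs_nbhs; split => //; exact: chart_open H.
  change (nbhs d (th @^-1` A)); by apply: filterS2 n1 n2 => z /= SzA Dz; exact (SzA (chart_surf H Dz)).
exact: cvg_comp c1 ((subspace_continuousP _ _).1 cf _ Sd).
Qed.

Lemma dens_sqr th z : dens th z ^+ 2 = chartP th z ^+ 2 + chartQ th z ^+ 2.
Proof. by rewrite /dens sqr_sqrtr// addr_ge0 ?sqr_ge0. Qed.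

Lemma WN_dens0 S D th d N : local_param S D th -> D d -> normal_vector S (th d) (N (th d)) ->
  (WN N (th d) == 0) = (dens th d == 0).
Proof.
move=> H Dd nN; have [c c0 [_ _ _ -> _]] := WN_chart H Dd nN.
by rewrite mulf_eq0 normr_eq0 (negbTE c0).
Qed.

Lemma dens_continuous S D th z : local_param S D th -> D z -> {for z, continuous (dens th)}.
Proof.
move=> H Dz; have [p q _] := chart_cross_C1 H.
have cp := C1_on_continuous p Dz; have cq := C1_on_continuous q Dz.
apply: (@continuous_comp _ _ _ (fun z => chartP th z ^+ 2 + chartQ th z ^+ 2) Num.sqrt);
  last exact: sqrt_continuous.
by apply: cvgD; apply: cvgM.
Qed.

(** [N] is only continuous, but after division by [W] its factor relative to the cross product of
    the chart survives only as a sign. That sign is the sign of the continuous function [q0], which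
    does not vanish where [dens] does not; so it is locally constant. *)
Lemma orientation S N D th d : oriented_C2_surface S N -> local_param S D th -> D d ->
  dens th d != 0 -> exists s : R, (s = 1 \/ s = - 1) /\ \forall z \near d,
    [/\ D z, 0 < dens th z, pbar N (th z) = s * (chartP th z / dens th z),
      qbar N (th z) = s * (chartQ th z / dens th z) &
      omegabar N (th z) = s * (chartO th z / dens th z)].
Proof.
move=> [_ cN nN] H Dd d0.
have nD : \forall z \near d, D z by apply: open_nbhs_nbhs; split => //; exact: chart_open H.
have [p q _] := chart_cross_C1 H.
have cp := C1_on_continuous p Dd; have cq := C1_on_continuous q Dd.
have cNt := chart_within H Dd cN.
have cN1 : (N (th z)).1.1 @[z --> d] --> (N (th d)).1.1.
  exact (cvg_comp _ _ (cvg_comp _ _ cNt (@cvg_fst _ _ _ _ _)) (@cvg_fst _ _ _ _ _)).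
have cN2 : (N (th z)).1.2 @[z --> d] --> (N (th d)).1.2.
  exact (cvg_comp _ _ (cvg_comp _ _ cNt (@cvg_fst _ _ _ _ _)) (@cvg_snd _ _ _ _ _)).
pose q0 z : R := (N (th z)).1.1 * chartP th z + (N (th z)).1.2 * chartQ th z.
have cq0 : q0 z @[z --> d] --> q0 d by apply: cvgD; apply: cvgM.
have q0E z : D z -> exists2 c : R, c != 0 & q0 z = c * dens th z ^+ 2 /\
  [/\ pN N (th z) = c * chartP th z, qN N (th z) = c * chartQ th z,
        omegaN N (th z) = c * chartO th z & WN N (th z) = `|c| * dens th z].
  move=> Dz; have [c c0 [e1 e2 e3 e4 _]] := WN_chart H Dz (nN _ (chart_surf H Dz)).
  by exists c => //; split => //; rewrite /q0 -pNE -qNE e1 e2 dens_sqr; ring.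
have dpos : 0 < dens th d by rewrite lt_neqAle eq_sym d0 dens_ge0.
have nd : \forall z \near d, 0 < dens th z.
  exact: (cvgr_gt _ (dens_continuous H Dd) _ dpos).
have fin s z : (s = 1 \/ s = - 1) -> 0 < s * q0 z -> D z -> 0 < dens th z ->
   [/\ D z, 0 < dens th z, pbar N (th z) = s * (chartP th z / dens th z),
      qbar N (th z) = s * (chartQ th z / dens th z) &
      omegabar N (th z) = s * (chartO th z / dens th z)].
  move=> s1 sq Dz dz; have [c c0 [qc [e1 e2 e3 e4]]] := q0E z Dz.
  have ac : `|c| = s * c.
    have sc : 0 < s * c by move: sq; rewrite qc mulrA pmulr_lgt0// exprn_gt0.
    rewrite -(gtr0_norm sc) normrM; case: s1 => ->; rewrite ?normrN normr1 mul1r//.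
  rewrite /pbar /qbar /omegabar e1 e2 e3 e4 ac.
  have D0 : dens th z != 0 by rewrite lt0r_neq0.
  have s0 : s != 0 by case: s1 => ->; rewrite ?oppr_eq0 oner_neq0.
  have ss : s^-1 = s by case: s1 => ->; rewrite ?invrN invr1.
  have cc x : c * x / (s * c * dens th z) = s * (x / dens th z).
    by rewrite -{2}ss; field; rewrite s0 c0 D0.
  by split.
have q1 : q0 d != 0 by have [c c0 [-> _]] := q0E d Dd; rewrite mulf_neq0// expf_neq0.
have [qp|qp] := ltP 0 (q0 d).
  exists 1; split; first by left.
  apply: filterS3 nD nd (cvgr_gt _ cq0 _ qp) => z Dz dz qz.
  by apply: fin => //; [left|rewrite mul1r].
exists (- 1); split; first by right.
have {}qp : q0 d < 0 by rewrite lt_neqAle q1.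
apply: filterS3 nD nd (cvgr_lt _ cq0 _ qp) => z Dz dz qz.
by apply: fin => //; [right|rewrite mulN1r oppr_gt0].
Qed.

Lemma has_lin_inv_sqrt (f : R * R -> R) c a b : has_lin f c a b -> 0 < f c ->
  exists a' b', has_lin (fun z => (Num.sqrt (f z))^-1) c a' b'.
Proof.
move=> fl f0; have ds := is_derive1_sqrt f0.
have s0 : Num.sqrt (f c) != 0 by rewrite sqrtr_eq0 -ltNge.
have dk := @derivableP _ _ _ _ _ _ (derivableV s0 (@ex_derive _ _ _ _ _ _ _ ds)).
by do 2 eexists; exact (has_lin_comp1 fl dk).
Qed.

(** The tangent horizontal direction: the weights are those that cancel the [T] components, and the
    horizontal components are then [crossQ] and [- crossP]. This expresses [eH] in the basis [pu],
    [pv]. *)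
Lemma horizontal_comb g v w (s W : R) :
  (- s * Tcoord g w / W) *: v + (s * Tcoord g v / W) *: w =
  (s * (crossQ g v w / W)) *: X1 g - (s * (crossP g v w / W)) *: X2 g.
Proof.
have [q1 q2 q3] := lin_coord (- s * Tcoord g w / W) (s * Tcoord g v / W) v w.
apply: pt_ext; [apply: etrans q1 _|apply: etrans q2 _|apply: etrans q3 _];
  rewrite /X1 /X2 /= /GRing.scale /= /crossP /crossQ.
- ring.
- ring.
- have ev : v.2 = Tcoord g v - (g.1.2 * v.1.1 - g.1.1 * v.1.2) / 2 by rewrite /Tcoord addrK.
  have ew : w.2 = Tcoord g w - (g.1.2 * w.1.1 - g.1.1 * w.1.2) / 2 by rewrite /Tcoord addrK.
  rewrite ev ew; move: (Tcoord g v) (Tcoord g w) => tu tv; clear; ring.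
Qed.

(** The derivatives [w1], [w2] of [1 / W] cancel, which leaves only the gradients of [P] and [Q]. *)
Lemma curvature_algebra (s p q w tu tv P1 P2 Q1 Q2 w1 w2 : R) : w != 0 -> s * s = 1 ->
  - (s * (p / w) * ((s * (q * w1 + Q1 / w) + 0 * (q / w)) * (- s * tv / w) +
      (s * (q * w2 + Q2 / w) + 0 * (q / w)) * (s * tu / w)) +
     s * (q / w) * ((- s * (p * w1 + P1 / w) + 0 * (p / w)) * (- s * tv / w) +
      (- s * (p * w2 + P2 / w) + 0 * (p / w)) * (s * tu / w))) =
  s / w ^+ 3 * (p * (tv * Q1 - tu * Q2) - q * (tv * P1 - tu * P2)).
Proof.
move=> w0 ss.
transitivity (s * (s * s) / w ^+ 3 * (p * (tv * Q1 - tu * Q2) - q * (tv * P1 - tu * P2))).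
  by field.
by rewrite ss mulr1.
Qed.

Lemma Hmean_chart S N D th d (s P1 P2 Q1 Q2 : R) : local_param S D th ->
  (\forall z \near d, [/\ D z, 0 < dens th z, pbar N (th z) = s * (chartP th z / dens th z),
      qbar N (th z) = s * (chartQ th z / dens th z) &
      omegabar N (th z) = s * (chartO th z / dens th z)]) -> (s = 1 \/ s = - 1) ->
  has_lin (chartP th) d P1 P2 -> has_lin (chartQ th) d Q1 Q2 ->
  Hmean N S (th d) = s / dens th d ^+ 3 *
    (chartP th d * (Tcoord (th d) (pv th d) * Q1 - Tcoord (th d) (pu th d) * Q2)
     - chartQ th d * (Tcoord (th d) (pv th d) * P1 - Tcoord (th d) (pu th d) * P2)).
Proof.
move=> H nd s1 lP lQ; have [Dd d0 pd qd _] := nbhs_singleton nd.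
have [w1 [w2 lw]] : exists w1 w2 : R, has_lin (fun z => (dens th z)^-1) d w1 w2.
  apply: (has_lin_inv_sqrt (has_linD (has_linM lP lP) (has_linM lQ lQ))).
  by rewrite -!expr2 -dens_sqr exprn_gt0.
have l1 := has_linM (has_lin_cst s d) (has_linM lP lw).
have l2 := has_linM (has_lin_cst s d) (has_linM lQ lw).
have lm := has_linM (has_lin_cst (- s) d) (has_linM lP lw).
have np : \forall z \near d, - s * (chartP th z * (dens th z)^-1) = ((fun h : pt => - pbar N h) \o th) z.
  by apply: filterS nd => z [_ _ /= -> _ _]; rewrite mulNr.
have nq : \forall z \near d, s * (chartQ th z * (dens th z)^-1) = (qbar N \o th) z.
  by apply: filterS nd => z [_ _ _ e _]; exact (esym e).
have lp := near_has_lin np lm; have lq := near_has_lin nq l2.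
have eE : eH N (th d) = (- s * Tcoord (th d) (pv th d) / dens th d) *: pu th d
    + (s * Tcoord (th d) (pu th d) / dens th d) *: pv th d.
  by rewrite /eH pd qd; exact (esym (horizontal_comb (th d) (pu th d) (pv th d) s (dens th d))).
rewrite Hmean_derive eE (derive_along_chart _ _ H Dd lp) (derive_along_chart _ _ H Dd lq) pd qd.
have ss : s * s = 1 by case: s1 => ->; rewrite ?mulrNN mulr1.
have D0 : dens th d != 0 by rewrite lt0r_neq0.
exact (curvature_algebra _ _ _ _ _ _ _ _ _ _ D0 ss).
Qed.

End mean_curvature.

(** * Deformed surfaces *)

Section deformation.
Context {R : realType}.
Local Notation pt := (R * R * R)%type.
Implicit Types (S U K : set pt) (D : set (R * R)) (th : R * R -> pt) (g v w n : pt) (X : pt -> pt).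

Lemma surf_near S D th d (P : pt -> Prop) : local_param S D th -> D d ->
  (\forall z \near d, P (th z)) -> \forall g \near th d, S g -> P g.
Proof.
move=> H Dd nP; have [Q [oQ Qd QP]] := chart_inv_near H Dd nP.
apply: filterS (open_nbhs_nbhs (conj oQ Qd)) => g Qg Sg.
by have [_ + e] := QP g Sg Qg; rewrite e.
Qed.

(** A local bound in charts that is monotone in its constant becomes uniform on a compact set:
    compactness in its near-covering form is applied to the filter of large constants. *)
Lemma compact_uniform S K (P : R -> pt -> Prop) : C2_surface S -> compact K -> K `<=` S ->
  (forall C C' g, C <= C' -> P C g -> P C' g) ->
  (forall D th d, local_param S D th -> D d -> K (th d) ->
    exists C, \forall z \near d, P C (th z)) ->
  exists2 C, 0 <= C & forall g, K g -> P C g.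
Proof.
move=> HS /compact_near_coveringP cK KS mono loc.
have : \forall C \near +oo, K `<=` (fun g => S g -> P C g).
  apply: (cK R (+oo)) => x Kx.
  have [D [th [H [d Dd e]]]] := HS x (KS x Kx).
  rewrite -e in Kx *; have [C nC] := loc D th d H Dd Kx.
  exists ([set g | S g -> P C g], [set C' | C <= C']).
    split; first exact: surf_near H Dd nC.
    exact: nbhs_pinfty_ge (num_real C).
  by move=> [g C'] /= [gP CC'] Sg; exact: mono CC' (gP Sg).
move=> nC; have n0 : \forall C \near +oo, (0 : R) <= C by exact: nbhs_pinfty_ge (num_real 0).
have [C [KC C0]] := filter_ex (filterI nC n0).
by exists C => // g Kg; exact: KC g Kg (KS g Kg).
Qed.

Definition lip_field S X (L : R) : Prop :=
  0 <= L /\ forall g g', S g -> S g' -> `|X g - X g'| <= L * `|g - g'|.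

Definition C2_field S X : Prop := forall D th, local_param S D th ->
  [/\ C2_on D (fun z => (X (th z)).1.1), C2_on D (fun z => (X (th z)).1.2) &
      C2_on D (fun z => (X (th z)).2)].

Lemma pt_norm_le g : `|g| <= `|g.1.1| + `|g.1.2| + `|g.2|.
Proof.
have p2 (V W : normedModType R) (x : V * W) : `|x| <= `|x.1| + `|x.2|.
  by rewrite prod_normE/= ge_max lerDl lerDr !normr_ge0.
by apply: le_trans (p2 _ _ g) _; rewrite lerD2r; exact: p2.
Qed.

Lemma pt_norm_ge g : [/\ `|g.1.1| <= `|g|, `|g.1.2| <= `|g| & `|g.2| <= `|g|].
Proof. by rewrite !prod_normE/= !le_max !lexx ?orbT; split. Qed.

Lemma lf_norm_le m w : `|lf m w| <= (`|m.1.1| + `|m.1.2| + `|m.2|) * `|w|.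
Proof.
have [a1 a2 a3] := pt_norm_ge w; rewrite /lf !mulrDl.
apply: le_trans (ler_normD _ _) _; rewrite normrM lerD//; last by rewrite ler_wpM2l.
by apply: le_trans (ler_normD _ _) _; rewrite !normrM lerD// ler_wpM2l.
Qed.

Lemma C1_lipschitz_near D (f : R * R -> R) d : open D -> C1_on D f -> D d ->
  exists C, 0 <= C /\ exists2 e, 0 < e & forall z z', `|z.1 - d.1| < e -> `|z.2 - d.2| < e ->
    `|z'.1 - d.1| < e -> `|z'.2 - d.2| < e ->
    `|f z - f z'| <= C * (`|z.1 - z'.1| + `|z.2 - z'.2|).
Proof.
move=> oD /C1_on_C1f[hf hu hv] Dd.
have nf : \forall z \near d, has_lin f z ('D_(1, 0) f z) ('D_(0, 1) f z).
  by apply: filterS (open_nbhs_nbhs (conj oD Dd)) => z Dz; exact (hf z Dz).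
have [e e0 H] := strict_lin nf (hu d Dd) (hv d Dd) ltr01.
move: ('D_(1, 0) f d) ('D_(0, 1) f d) H => a b H.
exists (`|a| + `|b| + 1); split; first by rewrite !addr_ge0.
exists e => // z z' h1 h2 h3 h4; have := H z z' h1 h2 h3 h4.
move: (f z - f z') (z.1 - z'.1) (z.2 - z'.2) => D' x y; clear => h.
have n1 : `|a * x + b * y| <= (`|a| + `|b|) * (`|x| + `|y|).
  by apply: lin2_le; rewrite ?addr_ge0 ?lerDl ?lerDr.
rewrite -[D'](subrK (a * x + b * y)); apply: le_trans (ler_normD _ _) _.
by rewrite mulrDl [leRHS]addrC lerD.
Qed.

Lemma chart_lf_C1 S D th m : local_param S D th -> C1_on D (fun z => lf m (th z)).
Proof.
move=> H; have oD := chart_open H; have [[[x _] [y _] [t _]] _ _] := chart_C1 H.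
exact (C1_onD oD (C1_onD oD (C1_onM oD (C1_on_cst m.1.1 oD) x) (C1_onM oD (C1_on_cst m.1.2 oD) y))
  (C1_onM oD (C1_on_cst m.2 oD) t)).
Qed.

Lemma chart_lf_strict S D th m d (a b eta : R) : local_param S D th -> D d ->
  lf m (pu th d) = a -> lf m (pv th d) = b -> 0 < eta ->
  exists2 e, 0 < e & forall z z', `|z.1 - d.1| < e -> `|z.2 - d.2| < e ->
    `|z'.1 - d.1| < e -> `|z'.2 - d.2| < e ->
    `|lf m (th z - th z') - (a * (z.1 - z'.1) + b * (z.2 - z'.2))|
      <= eta * (`|z.1 - z'.1| + `|z.2 - z'.2|).
Proof.
move=> H Dd ea eb eta0; have oD := chart_open H.
have [hf hu hv] := C1_on_C1f (chart_lf_C1 m H).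
have nf : \forall z \near d, has_lin (fun z => lf m (th z)) z ('D_(1, 0) (fun z => lf m (th z)) z)
   ('D_(0, 1) (fun z => lf m (th z)) z).
  by apply: filterS (open_nbhs_nbhs (conj oD Dd)) => z Dz; exact (hf z Dz).
have [e e0 P] := strict_lin nf (hu d Dd) (hv d Dd) eta0.
move: P (has_lin_unique (hf d Dd) (has_lin_lf m (chart_lin H Dd))).
move: ('D_(1, 0) (fun z => lf m (th z)) d) ('D_(0, 1) (fun z => lf m (th z)) d) => u v P [eu ev].
have {}eu := etrans eu ea; have {}ev := etrans ev eb; subst u v.
exists e; [exact e0|move=> z z' h1 h2 h3 h4; rewrite lfB; exact (P z z' h1 h2 h3 h4)].
Qed.

(** The forms of [chart_lift] invert the differential at [d]; strict differentiability leaves an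
    error of a quarter for each coordinate, which is absorbed on the left. *)
Lemma chart_lower S D th d : local_param S D th -> D d ->
  exists C, 0 <= C /\ exists2 e, 0 < e & forall z z', `|z.1 - d.1| < e -> `|z.2 - d.2| < e ->
    `|z'.1 - d.1| < e -> `|z'.2 - d.2| < e ->
    `|z.1 - z'.1| + `|z.2 - z'.2| <= C * `|th z - th z'|.
Proof.
move=> H Dd; have [m1 [m2 [[m11 m12 m21 m22] _]]] := chart_lift H Dd.
have q0 : 0 < (4^-1 : R) by rewrite invr_gt0.
have [e1 e10 P1] := chart_lf_strict H Dd m11 m12 q0.
have [e2 e20 P2] := chart_lf_strict H Dd m21 m22 q0.
pose M1 : R := `|m1.1.1| + `|m1.1.2| + `|m1.2|; pose M2 : R := `|m2.1.1| + `|m2.1.2| + `|m2.2|.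
exists (2 * (M1 + M2)); split; first by rewrite mulr_ge0// !addr_ge0.
exists (Num.min e1 e2); first by rewrite lt_min e10.
move=> z z'; rewrite !lt_min => /andP[a1 a2] /andP[b1 b2] /andP[c1 c2] /andP[d1 d2].
have := P1 z z' a1 b1 c1 d1; have := P2 z z' a2 b2 c2 d2.
have := lf_norm_le m1 (th z - th z'); have := lf_norm_le m2 (th z - th z').
rewrite -/M1 -/M2 !mul1r !mul0r addr0 add0r.
move: (lf m1 (th z - th z')) (lf m2 (th z - th z')) `|th z - th z'| => p q T.
move: (z.1 - z'.1) (z.2 - z'.2) M1 M2 => x y M1 M2; clear => h1 h2 h3 h4.
have t1 : `|x| <= `|p - x| + `|p| by rewrite -{1}(subKr p x) (le_trans (ler_normB _ _)) 1?addrC.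
have t2 : `|y| <= `|q - y| + `|q| by rewrite -{1}(subKr q y) (le_trans (ler_normB _ _)) 1?addrC.
by rewrite -mulrA mulrDl; move: h1 h2 h3 h4 t1 t2; clear; lra.
Qed.

Lemma field_lipschitz_near S X D th d : C2_field S X -> local_param S D th -> D d ->
  exists C, 0 <= C /\ exists2 e, 0 < e & forall g g', S g -> S g' ->
    `|g - th d| < e -> `|g' - th d| < e -> `|X g - X g'| <= C * `|g - g'|.
Proof.
move=> cX H Dd; have oD := chart_open H; have [[x1 _] [x2 _] [x3 _]] := cX D th H.
have [C1 [C10 [e1 e10 P1]]] := C1_lipschitz_near oD x1 Dd.
have [C2 [C20 [e2 e20 P2]]] := C1_lipschitz_near oD x2 Dd.
have [C3 [C30 [e3 e30 P3]]] := C1_lipschitz_near oD x3 Dd.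
have [C4 [C40 [e4 e40 P4]]] := chart_lower H Dd.
exists ((C1 + C2 + C3) * C4); split; first by rewrite mulr_ge0 ?addr_ge0.
pose e := Num.min (Num.min e1 e2) (Num.min e3 e4).
have e0 : 0 < e by rewrite !lt_min e10 e20 e30 e40.
have nb : \forall z \near d, `|z.1 - d.1| < e /\ `|z.2 - d.2| < e.
  by apply/near_box; exists e.
have [r r0 rP] : exists2 r, 0 < r & forall g, `|g - th d| < r -> S g ->
    exists2 z, `|z.1 - d.1| < e /\ `|z.2 - d.2| < e & th z = g.
  have [Q [oQ Qd QP]] := chart_inv_near H Dd nb.
  have /nbhs_ballP[r /= r0 rQ] := open_nbhs_nbhs (conj oQ Qd).
  exists r => // g gr Sg; have Qg : Q g.
    by apply: rQ; rewrite -ball_normE /ball_ /= distrC.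
  have [_ ? ?] := QP g Sg Qg; by exists (chart_inv D th g).
exists r => // g g' Sg Sg' gr gr'.
have [z [za zb] <-] := rP g gr Sg; have [z' [za' zb'] <-] := rP g' gr' Sg'.
move: za zb za' zb'; rewrite !lt_min => /andP[/andP[a1 a2] /andP[a3 a4]] /andP[/andP[b1 b2] /andP[b3 b4]].
move=> /andP[/andP[c1 c2] /andP[c3 c4]] /andP[/andP[d1 d2] /andP[d3 d4]].
have h1 := P1 z z' a1 b1 c1 d1; have h2 := P2 z z' a2 b2 c2 d2.
have h3 := P3 z z' a3 b3 c3 d3; have h4 := P4 z z' a4 b4 c4 d4.
apply: le_trans (pt_norm_le _) _.
apply: le_trans (lerD (lerD h1 h2) h3) _.
by rewrite -!mulrDl -mulrA ler_wpM2l// !addr_ge0.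
Qed.

(** Near a point of [K] the bound comes from a chart, through [chart_lower]. Points at distance at
    least [e / 2] are handled by the slope [4 B / e], since values of [X] differ by at most [2 B].
    Off [K] the field is zero. *)
Lemma field_lipschitz S X K : C2_surface S -> C2_field S X -> compact K -> K `<=` S ->
  (forall g, S g -> ~ K g -> X g = 0) -> exists L, lip_field S X L.
Proof.
move=> HS cX cK KS X0.
have [B B0 XB] : exists2 B, 0 <= B & forall g, K g -> `|X g| <= B.
  apply: (compact_uniform HS cK KS) => [C C' g CC' h|D th d H Dd _]; first exact: le_trans CC'.
  have oD := chart_open H; have [[x1 _] [x2 _] [x3 _]] := cX D th H.
  have bn (f : R * R -> R) : C1_on D f -> \forall z \near d, `|f z| <= `|f d| + 1.
    move=> cf; have cfd := cvg_norm (C1_on_continuous cf Dd).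
    have lt1 : `|f d| < `|f d| + 1 by rewrite ltrDl.
    exact: (cvgr_le _ (cfd _) _ lt1).
  eexists; apply: filterS3 (bn _ x1) (bn _ x2) (bn _ x3) => z h1 h2 h3.
  by apply: le_trans (pt_norm_le _) _; apply: lerD (lerD h1 h2) h3.
have XB' g : S g -> `|X g| <= B.
  by move=> Sg; have [/XB//|/(X0 g Sg)->] := pselect (K g); rewrite normr0.
have [L L0 XL] : exists2 L, 0 <= L & forall g, K g ->
    forall g', S g' -> `|X g - X g'| <= L * `|g - g'|.
  apply: (compact_uniform (P := fun L g => forall g', S g' -> `|X g - X g'| <= L * `|g - g'|) HS cK KS).
    by move=> C C' g CC' h g' Sg'; apply: le_trans (h g' Sg') _; rewrite ler_wpM2r.
  move=> D th d H Dd _; have [C [C0 [e e0 CP]]] := field_lipschitz_near cX H Dd.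
  exists (C + 4 * B / e).
  have e2 : 0 < e / 2 by rewrite divr_gt0.
  have n1 : \forall z \near d, `|th z - th d| < e / 2.
    have c := chart_continuous H Dd.
    exact (@cvgr_distC_lt _ _ _ _ _ _ _ c _ e2).
  have n2 : \forall z \near d, D z by apply: open_nbhs_nbhs; split=> //; exact: chart_open H.
  apply: filterS2 n1 n2 => z ze Dz g' Sg'.
  have Sz := chart_surf H Dz.
  have [ge|ge] := ltP `|g' - th d| e.
    apply: le_trans (CP _ _ Sz Sg' _ ge) _.
      by apply: lt_trans ze _; rewrite ltr_pdivrMr// ltr_pMr// ltr1n.
    by rewrite ler_wpM2r// lerDl divr_ge0 ?mulr_ge0// ltW.
  have far : e / 2 <= `|th z - g'|.
    have : `|g' - th d| <= `|th z - th d| + `|th z - g'|.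
      have -> : g' - th d = (th z - th d) - (th z - g') by rewrite opprB [RHS]addrC subrKA.
      exact: ler_normB.
    by move: ge ze; clear; move: `|g' - th d| `|th z - th d| => x y; lra.
  have h : `|X (th z) - X g'| <= 2 * B.
    by apply: le_trans (ler_normB _ _) _; rewrite mulr_natl mulr2n lerD// XB'.
  have q0 : 0 <= 4 * B / e by rewrite divr_ge0 ?mulr_ge0// ltW.
  have h4 : 2 * B <= 4 * B / e * `|th z - g'|.
    rewrite [leLHS](_ : _ = 4 * B / e * (e / 2)); last by field; rewrite lt0r_neq0.
    by rewrite ler_wpM2l.
  by apply: le_trans h (le_trans h4 _); rewrite ler_wpM2r// lerDr.
exists L; split => // g g' Sg Sg'.
have [Kg|Kg] := pselect (K g); first exact: XL.
have [Kg'|Kg'] := pselect (K g'); first by rewrite distrC [`|g - _|]distrC; exact: XL.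
by rewrite (X0 g)// (X0 g')// subrr normr0 mulr_ge0.
Qed.

End deformation.

(** * Charts of the deformed surface *)

Section deformed_charts.
Context {R : realType}.
Local Notation pt := (R * R * R)%type.
Implicit Types (S U K : set pt) (D : set (R * R)) (th : R * R -> pt) (g v w n : pt) (X : pt -> pt).

(** The inequality holds for difference quotients and passes to the limit; a Lipschitz bound on [S]
    thereby bounds the differential of [X \o th] by that of [th]. *)
Lemma derive_norm_le (f g : R * R -> pt) D z xi (L : R) : open D -> D z ->
  differentiable f z -> differentiable g z ->
  (forall z', D z' -> `|g z' - g z| <= L * `|f z' - f z|) ->
  `|'D_xi g z| <= L * `|'D_xi f z|.
Proof.
move=> oD Dz df dg fg.
have cf : h^-1 *: (f (h *: xi + z) - f z) @[h --> (0 : R)^'] --> 'D_xi f z.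
  exact (diff_derivable (v := xi) df).
have cg : h^-1 *: (g (h *: xi + z) - g z) @[h --> (0 : R)^'] --> 'D_xi g z.
  exact (diff_derivable (v := xi) dg).
move: ('D_xi f z) ('D_xi g z) cf cg => p q cf cg.
pose F (h : R) : R := L * `|h^-1 *: (f (h *: xi + z) - f z)|.
pose G (h : R) : R := `|h^-1 *: (g (h *: xi + z) - g z)|.
have cF : F h @[h --> (0 : R)^'] --> L * `|p| by apply: cvgM; [exact: cvg_cst|exact: cvg_norm].
have cG : G h @[h --> (0 : R)^'] --> `|q| by exact: cvg_norm.
refine (ler_cvg_to cG cF _); rewrite /F /G; clear cf cg F G cF cG.
have nD : \forall h \near (0 : R)^', D (h *: xi + z).
  have c0 : h *: xi + z @[h --> (0 : R)] --> 0 *: xi + z.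
    by apply: cvgD; [apply: cvgZr_tmp; exact: cvg_id|exact: cvg_cst].
  rewrite scale0r add0r in c0.
  have : \forall h \near (0 : R), D (h *: xi + z) by apply: c0; exact: open_nbhs_nbhs.
  exact: cvg_within.
apply: filterS nD => h Dh; rewrite !normrZ mulrCA ler_wpM2l//.
exact: fg.
Qed.

Lemma field_lin3 S X D th z : C2_field S X -> local_param S D th -> D z ->
  has_lin3 (X \o th) z (pu (X \o th) z) (pv (X \o th) z).
Proof.
move=> cX H Dz; have [[x1 _] [x2 _] [x3 _]] := cX D th H.
have [h1 _ _] := C1_on_C1f x1; have [h2 _ _] := C1_on_C1f x2; have [h3 _ _] := C1_on_C1f x3.
have h : has_lin3 (X \o th) z (_, _, _) (_, _, _) := And3 (h1 z Dz) (h2 z Dz) (h3 z Dz).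
have [d _] := has_lin3_differentiable h; exact: differentiable_has_lin3 d.
Qed.

Definition deformed X (l : R) th : R * R -> pt := fun z => th z + l *: X (th z).

Lemma deformed_lin3 X l th z v w dv dw : has_lin3 th z v w -> has_lin3 (X \o th) z dv dw ->
  has_lin3 (deformed X l th) z (v + l *: dv) (w + l *: dw).
Proof.
have add (f g : R * R -> R) p q p' q' : has_lin f z p q -> has_lin g z p' q' ->
    has_lin (fun y => f y + l * g y) z (p + l * p') (q + l * q').
  move=> hf hg; have := has_linD hf (has_linM (has_lin_cst l z) hg).
  by rewrite !mul0r !addr0.
move=> [h1 h2 h3] [k1 k2 k3]; split; [exact: add h1 k1|exact: add h2 k2|exact: add h3 k3].
Qed.

Lemma half_perturb (V : normedModType R) (u b : V) :
  `|b| <= 2^-1 * `|u| -> `|u| <= 2 * `|u + b|.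
Proof.
move=> h; have t : `|u| <= `|u + b| + `|b| by rewrite -{1}(addrK b u) ler_normB.
by move: h t; move: `|b| `|u| `|u + b| => x y z; lra.
Qed.

Lemma deform_expand S X L l : lip_field S X L -> `|l| * L <= 2^-1 -> forall g g', S g -> S g' ->
  `|g - g'| <= 2 * `|(g + l *: X g) - (g' + l *: X g')|.
Proof.
move=> [L0 XL] lL g g' Sg Sg'.
have -> : (g + l *: X g) - (g' + l *: X g') = (g - g') + l *: (X g - X g').
  by rewrite scalerBr opprD addrACA.
apply: half_perturb; rewrite normrZ.
apply: le_trans (ler_wpM2l (normr_ge0 l) (XL g g' Sg Sg')) _.
by rewrite mulrA ler_wpM2r.
Qed.

Lemma C2_on_deformed S X l D th : C2_field S X -> local_param S D th -> C2_on D (deformed X l th).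
Proof.
move=> cX H; have oD := chart_open H.
have [[t1 t2 t3] _ _] := chart_C1 H; have [x1 x2 x3] := cX D th H.
have c1 := C2_onD oD t1 (C2_onM oD (C2_on_cst l oD) x1).
have c2 := C2_onD oD t2 (C2_onM oD (C2_on_cst l oD) x2).
have c3 := C2_onD oD t3 (C2_onM oD (C2_on_cst l oD) x3).
have -> : deformed X l th = fun z => ((th z).1.1 + l * (X (th z)).1.1,
    (th z).1.2 + l * (X (th z)).1.2, (th z).2 + l * (X (th z)).2).
  by apply/funext => z; apply: pt_ext.
exact (C2_on_pair oD (C2_on_pair oD c1 c2) c3).
Qed.

Lemma chart_deform S X L l D th : lip_field S X L -> C2_field S X -> `|l| * L <= 2^-1 ->
  local_param S D th -> local_param (deform X l S) D (deformed X l th).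
Proof.
move=> HL cX lL H; have oD := chart_open H.
have expand := deform_expand HL lL; have [L0 XL] := HL.
have [_ [[dth _] _] im inj hom] := H.
split.
- exact oD.
- exact (C2_on_deformed l cX H).
(* The differential of the deformed chart is a perturbation of that of [th] by at most half its size
   in every direction, so its kernel is trivial. *)
- move=> z Dz xi xi0; apply: (im z Dz).
  have hth := chart_lin H Dz; have hX := field_lin3 cX H Dz.
  have [_ e1] := has_lin3_differentiable hth; have [dX e2] := has_lin3_differentiable hX.
  have [_ e3] := has_lin3_differentiable (deformed_lin3 l hth hX).
  have bd : `|'D_xi (X \o th) z| <= L * `|'D_xi th z|.
    have lip z' : D z' -> `|(X \o th) z' - (X \o th) z| <= L * `|th z' - th z|.
      by move=> Dz'; exact: XL (chart_surf H Dz') (chart_surf H Dz).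
    exact (derive_norm_le xi oD Dz (dth z Dz) dX lip).
  have E : 'D_xi th z + l *: 'D_xi (X \o th) z = 0.
    have comb (a b c d : pt) (x y : R) : x *: a + y *: b + l *: (x *: c + y *: d) =
        x *: (a + l *: c) + y *: (b + l *: d).
      by rewrite !scalerDr addrACA !scalerA ![l * _]mulrC.
    by apply: etrans xi0; rewrite e1 e2 e3 comb.
  move: ('D_xi th z) ('D_xi (X \o th) z) bd E => u b bd E.
  have h : `|l *: b| <= 2^-1 * `|u|.
    rewrite normrZ; apply: le_trans (ler_wpM2l (normr_ge0 l) bd) _.
    by rewrite mulrA ler_wpM2r.
  have := half_perturb h; rewrite E normr0 mulr0 normr_le0; exact: eqP.
- move=> z z'; rewrite !inE => Dz Dz' e; apply: inj; rewrite ?inE//.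
  have := expand _ _ (chart_surf H Dz) (chart_surf H Dz').
  move: e; rewrite /deformed => ->; rewrite subrr normr0 mulr0 normr_le0 subr_eq0.
  by move=> /eqP.
move=> A oA AD; have [Q oQ E] := hom A oA AD.
pose f g := g + l *: X g.
(* Balls of radius [r / 2] about [f p], where the ball of radius [r] about [p] lies in [Q]. As [f]
   shrinks distances on [S] by a factor of at most 2, a point [f g] of such a ball has [g] in
   [Q]. *)
pose Q' := \bigcup_(p in [set p : pt * R | [/\ S p.1, 0 < p.2 & forall g, `|g - p.1| < p.2 -> Q g]])
  [set h : pt | `|f p.1 - h| < p.2 / 2].
exists Q'.
  apply: bigcup_open => -[g r] [_ r0 _] /=.
  have -> : [set h : pt | `|f g - h| < r / 2] = ball (f g) (r / 2) by rewrite -ball_normE.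
  by apply: ball_open; rewrite divr_gt0.
apply/seteqP; split.
  move=> _ [z Az <-]; have Sz := chart_surf H (AD z Az).
  have [_ Qz] : (S `&` Q) (th z) by rewrite -E; exists z.
  split; first by exists (th z).
  have /nbhs_ballP[r /= r0 rQ] := open_nbhs_nbhs (conj oQ Qz).
  exists (th z, r); last by rewrite /= /deformed /f subrr normr0 divr_gt0.
  by split => //= g gr; apply: rQ; rewrite -ball_normE /ball_ /= distrC.
move=> _ [[g Sg <-] [[g' r] /= [Sg' r0 rQ] lt]].
have Qg : Q g.
  apply: rQ; rewrite distrC; apply: le_lt_trans (expand _ _ Sg' Sg) _.
  by rewrite mulrC -ltr_pdivlMr.
have [z Az <-] : (th @` A) g by rewrite E.
by exists z.
Qed.

Lemma C2_surface_deform S X L l : C2_surface S -> lip_field S X L -> C2_field S X ->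
  `|l| * L <= 2^-1 -> C2_surface (deform X l S).
Proof.
move=> HS HL cX lL _ [g Sg <-]; have [D [th [H [z Dz e]]]] := HS g Sg.
exists D, (deformed X l th); split; first exact: chart_deform HL cX lL H.
by exists z => //; rewrite /deformed e.
Qed.

End deformed_charts.

(** * The deformed perimeter as an integral over the original surface *)

Section perimeter_formula.
Context {R : realType}.
Local Notation pt := (R * R * R)%type.
Local Notation leb2 := (@lebesgue_measure R \x @lebesgue_measure R)%E.
Implicit Types (S U K : set pt) (D : set (R * R)) (th : R * R -> pt) (g v w : pt) (X : pt -> pt).

Lemma ge0_integral_charts S (D : nat -> set (R * R)) (th : nat -> R * R -> pt)
    (B : nat -> set (R * R)) (f : pt -> R) : C2_surface S ->
  (forall n, local_param S (D n) (th n)) -> (forall n, measurable (B n)) ->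
  (forall n, B n `<=` D n) -> trivIset setT (fun n => th n @` B n) ->
  (forall n, measurable_fun (B n) (f \o th n)) -> (forall g, 0 <= f g) ->
  (\int[surface_measure S]_(g in \bigcup_n th n @` B n) (f g)%:E =
   \sum_(0 <= n <oo) \int[leb2]_(z in B n) (f (th n z) * area_element (th n) z)%:E)%E.
Proof.
move=> HS H mB BD tr mf f0.
have mE n : measurable (th n @` B n) by exact: chart_image_measurable (H n) (mB n) (BD n).
rewrite ge0_integral_bigcup//.
- by apply: eq_eseriesr => n _; exact: integral_chart HS (H n) (mB n) (BD n) (mf n).
- apply/measurable_EFinP/measurable_fun_bigcup => // n.
  exact: chart_fun_measurable (H n) (mB n) (BD n) (mf n).
- by move=> g _; rewrite lee_fin.
Qed.

Lemma surf_fun_measurable S (f : pt -> R) : C2_surface S ->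
  (forall D th, local_param S D th -> measurable_fun D (f \o th)) -> measurable_fun S f.
Proof.
move=> /pieces_exist[p] mf; rewrite (pc_cover p).
have mE n : measurable (pc_th p n @` pc_A p n).
  exact (chart_image_measurable (@pc_chart _ _ p n) (@pc_meas _ _ p n) (@pc_sub _ _ p n)).
apply/measurable_fun_bigcup => // n.
apply: (chart_fun_measurable (@pc_chart _ _ p n) (@pc_meas _ _ p n) (@pc_sub _ _ p n)).
apply: measurable_funS (mf _ _ (@pc_chart _ _ p n)); last exact: pc_sub.
by apply: open_measurable2; exact: chart_open (@pc_chart _ _ p n).
Qed.

(** One matrix transports the derivatives of the charts and of [X], because the components of [X]
    are functions on [S]. *)
Lemma transition_field S X D1 D2 th1 th2 z1 z2 : C2_field S X ->
  local_param S D1 th1 -> local_param S D2 th2 -> D1 z1 -> D2 z2 -> th1 z1 = th2 z2 ->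
  exists al be ga de : R, [/\ al * de - be * ga != 0,
    pu th1 z1 = al *: pu th2 z2 + ga *: pv th2 z2,
    pv th1 z1 = be *: pu th2 z2 + de *: pv th2 z2,
    pu (X \o th1) z1 = al *: pu (X \o th2) z2 + ga *: pv (X \o th2) z2 &
    pv (X \o th1) z1 = be *: pu (X \o th2) z2 + de *: pv (X \o th2) z2].
Proof.
move=> cX H1 H2 Dz1 Dz2 E.
have [al [be [ga [de [D0 _ _ T]]]]] := chart_transition H1 H2 Dz1 Dz2 E.
have [e1 e2] := transition_pu H2 Dz2 (conj D0 T).
exists al, be, ga, de; have := field_lin3 cX H2 Dz2.
move: (pu (X \o th2) z2) (pv (X \o th2) z2) => a b [h1 h2 h3].
have k1 := T (fun g => (X g).1.1) _ _ h1; have k2 := T (fun g => (X g).1.2) _ _ h2.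
have k3 := T (fun g => (X g).2) _ _ h3.
have [f1 f2] := has_lin3_pu (And3 k1 k2 k3 : has_lin3 (X \o th1) z1 (al *: a + ga *: b) (be *: a + de *: b)).
by split.
Qed.

(* Evaluates at [g] a quantity [phi] defined in charts, in some chart around [g]; meaningful
   for [g] in [S] and [phi] independent of the chart. *)
Definition chart_val S (phi : (R * R -> pt) -> R * R -> R) g : R :=
  let c := xget (set0, fun=> 0)
    [set c : set (R * R) * (R * R -> pt) | local_param S c.1 c.2 /\ exists2 z, c.1 z & c.2 z = g] in
  phi c.2 (chart_inv c.1 c.2 g).

Definition chart_invariant S (phi : (R * R -> pt) -> R * R -> R) : Prop :=
  forall D1 th1 z1 D2 th2 z2, local_param S D1 th1 -> local_param S D2 th2 ->
    D1 z1 -> D2 z2 -> th1 z1 = th2 z2 -> phi th1 z1 = phi th2 z2.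

Lemma chart_valE S phi D th z : chart_invariant S phi -> local_param S D th -> D z ->
  chart_val S phi (th z) = phi th z.
Proof.
move=> inv H Dz; rewrite /chart_val; case: xgetP => [[D' th'] _ [/= H' [z' Dz' e]]|].
  by apply: (inv _ _ _ _ _ _ H' H) => //; rewrite -e (chart_invK H' Dz').
by move=> /(_ (D, th)); case; split => //; exists z.
Qed.

(* The density of the perimeter of [deform X l S] with respect to the surface measure of [S]. *)
Definition jac X l th z : R := dens (deformed X l th) z / area_element th z.

Lemma deformed_pu S X l D th z : C2_field S X -> local_param S D th -> D z ->
  pu (deformed X l th) z = pu th z + l *: pu (X \o th) z /\
  pv (deformed X l th) z = pv th z + l *: pv (X \o th) z.
Proof.
move=> cX H Dz.
exact: has_lin3_pu (deformed_lin3 l (chart_lin H Dz) (field_lin3 cX H Dz)).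
Qed.

(** A change of chart multiplies both the numerator and the denominator by the absolute value of the
    same determinant. *)
Lemma jac_invariant S X l : C2_field S X -> chart_invariant S (jac X l).
Proof.
move=> cX D1 th1 z1 D2 th2 z2 H1 H2 Dz1 Dz2 E.
have [al [be [ga [de [D0 e1 e2 e3 e4]]]]] := transition_field cX H1 H2 Dz1 Dz2 E.
rewrite /jac.
have ea : area_element th1 z1 = area_element th2 z2 * `|al * de - be * ga|.
  rewrite !area_elementE /chartP /chartQ /chartO e1 e2 E.
  have [-> -> ->] := cross_lin (th2 z2) (pu th2 z2) (pv th2 z2) al be ga de.
  by rewrite !exprMn -!mulrDl sqrtrM ?sqrtr_sqr// !addr_ge0 ?sqr_ge0.
have ed : dens (deformed X l th1) z1 = dens (deformed X l th2) z2 * `|al * de - be * ga|.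
  have [u1 v1] := deformed_pu l cX H1 Dz1; have [u2 v2] := deformed_pu l cX H2 Dz2.
  have comb (a b c d : pt) (x y : R) : (x *: a + y *: b) + l *: (x *: c + y *: d) =
        x *: (a + l *: c) + y *: (b + l *: d).
    by rewrite !scalerDr addrACA !scalerA ![l * _]mulrC.
  have eg : deformed X l th1 z1 = deformed X l th2 z2 by rewrite /deformed E.
  rewrite /dens /chartP /chartQ eg u1 v1 u2 v2 e1 e2 e3 e4 !comb.
  have [-> -> _] := cross_lin (deformed X l th2 z2) (pu th2 z2 + l *: pu (X \o th2) z2)
    (pv th2 z2 + l *: pv (X \o th2) z2) al be ga de.
  by rewrite !exprMn -!mulrDl sqrtrM ?sqrtr_sqr// !addr_ge0 ?sqr_ge0.
rewrite ea ed; have A0 : area_element th2 z2 != 0 by rewrite lt0r_neq0// (area_element_gt0 H2 Dz2).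
have d0 : `|al * de - be * ga| != 0 by rewrite normr_eq0.
by field; rewrite A0 d0.
Qed.

(** The decomposition of [S] into pieces is deformed along with [S], and both integrals are computed
    piece by piece in the same parameter sets. The open set [Q] serves to treat [S] and its
    relatively compact part together. *)
Lemma perimeter_jac S X L l Q : C2_surface S -> lip_field S X L -> C2_field S X ->
  `|l| * L <= 2^-1 -> open Q ->
  P_H (deform X l (S `&` Q)) =
  (\int[surface_measure S]_(g in S `&` Q) (chart_val S (jac X l) g)%:E)%E.
Proof.
move=> HS HL cX lL oQ.
have HV := C2_surface_open HS oQ.
have HLV : lip_field (S `&` Q) X L.
  by case: HL => L0 XL; split => // g g' [Sg _] [Sg' _]; exact: XL.
have cXV : C2_field (S `&` Q) X by move=> D th /(chart_extend oQ); exact: cX.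
have HV' := C2_surface_deform HV HLV cXV lL.
have [p] := pieces_exist HS.
pose D n := pc_D p n `&` pc_th p n @^-1` Q.
pose B n := pc_A p n `&` pc_th p n @^-1` Q.
pose th' n := deformed X l (pc_th p n).
have H n := @pc_chart _ _ p n.
have BD n : B n `<=` D n by move=> z [Az Qz]; split => //; exact: pc_sub.
have mB n : measurable (B n).
  rewrite (_ : B n = pc_A p n `&` (pc_D p n `&` pc_th p n @^-1` Q)).
    apply: measurableI; first exact: pc_meas.
    by apply: (chart_preimage_measurable (H n)); exact: open_measurable3.
  by rewrite /B setIA (setIidl (@pc_sub _ _ p n)).
have HD n : local_param (S `&` Q) (D n) (pc_th p n) by exact: chart_restrict (H n) oQ.
have H' n : local_param (deform X l (S `&` Q)) (D n) (th' n) by exact: chart_deform HLV cXV lL (HD n).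
have E1 : S `&` Q = \bigcup_n pc_th p n @` B n.
  rewrite {1}(pc_cover p); apply/seteqP; split=> [g [[n _ [z Az <-]] Qz]|g [n _ [z [Az Qz] <-]]].
    by exists n => //; exists z.
  by split => //; exists n => //; exists z.
have E2 : deform X l (S `&` Q) = \bigcup_n th' n @` B n.
  rewrite /deform E1; apply/seteqP; split=> [_ [_ [n _ [z Bz <-]] <-]|_ [n _ [z Bz <-]]].
    by exists n => //; exists z.
  by exists (pc_th p n z) => //; exists n => //; exists z.
have dE n z : D n z -> let N' := some_normal (deform X l (S `&` Q)) in
    WN N' (th' n z) / rnorm (th' n z) (N' (th' n z)) = dens (th' n) z / area_element (th' n) z.
  move=> Dz /=; have A0 : area_element (th' n) z != 0 by rewrite lt0r_neq0// (area_element_gt0 (H' n) Dz).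
  rewrite -(WN_rnorm_chart (H' n) Dz (some_normalP HV' (chart_surf (H' n) Dz))).
  by rewrite mulfK.
rewrite /P_H /integral_sigmaH [X in integral _ X _]E2 (ge0_integral_charts HV' H' mB BD); last 3 first.
(* The deformed pieces are disjoint because the deformation is injective on [S]. *)
- move=> i j _ _ [g [[z [Az Qz] zg] [z' [Az' Qz'] zg']]]; apply: (@pc_triv _ _ p i j) => //.
  exists (pc_th p i z); split; first by exists z.
  exists z' => //; apply/eqP; rewrite eq_sym -subr_eq0 -normr_le0.
  have S1 : S (pc_th p i z) by exact: chart_surf (H i) (pc_sub Az).
  have S2 : S (pc_th p j z') by exact: chart_surf (H j) (pc_sub Az').
  apply: le_trans (deform_expand HL lL S1 S2) _.
  by move: zg zg'; rewrite /th' /deformed => -> ->; rewrite subrr normr0 mulr0.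
- move=> n; have mD : measurable_fun (D n) (fun z => dens (th' n) z / area_element (th' n) z).
    apply: continuous_measurable2; first exact: chart_open (H' n).
    move=> z Dz; apply: cvgM; first exact: dens_continuous (H' n) Dz.
    apply: cvgV; first by rewrite lt0r_neq0// (area_element_gt0 (H' n) Dz).
    exact: chart_area_continuous (H' n) Dz.
  apply: (eq_measurable_fun (fun z => dens (th' n) z / area_element (th' n) z)).
    by move=> z; rewrite inE => Bz /=; rewrite mul1r dE//; exact: BD.
  apply: measurable_funS mD; last exact: BD.
  by apply: open_measurable2; exact: chart_open (H' n).
- by move=> g; rewrite mul1r divr_ge0 ?sqrtr_ge0.
rewrite [X in _ = integral _ X _]E1 (ge0_integral_charts HS H mB); last 4 first.
- by move=> n z [Az _]; exact: pc_sub.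
- move=> i j _ _ [g [[z [Az Qz] zg] [z' [Az' Qz'] zg']]]; apply: (@pc_triv _ _ p i j) => //.
  by exists g; split; [exists z|exists z'].
- move=> n; have mD : measurable_fun (D n) (fun z => dens (th' n) z / area_element (pc_th p n) z).
    apply: continuous_measurable2; first exact: chart_open (H' n).
    move=> z Dz; apply: cvgM; first exact: dens_continuous (H' n) Dz.
    apply: cvgV; first by rewrite lt0r_neq0// (area_element_gt0 (HD n) Dz).
    exact: chart_area_continuous (HD n) Dz.
  apply: (eq_measurable_fun (fun z => dens (th' n) z / area_element (pc_th p n) z)).
    move=> z; rewrite inE => Bz /=; rewrite (chart_valE (jac_invariant l cX) (H n))//.
    by case: Bz => /pc_sub.
  apply: measurable_funS mD; last exact: BD.
  by apply: open_measurable2; exact: chart_open (H' n).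
- move=> g; rewrite /chart_val /jac divr_ge0 ?dens_ge0 ?area_element_ge0//.
have key n z : B n z -> 1 * (WN (some_normal (deform X l (S `&` Q))) (th' n z) /
      rnorm (th' n z) (some_normal (deform X l (S `&` Q)) (th' n z))) * area_element (th' n) z =
    chart_val S (jac X l) (pc_th p n z) * area_element (pc_th p n) z.
  move=> Bz; have Dz := BD n z Bz; have pD : pc_D p n z by case: Dz.
  have A1 : area_element (pc_th p n) z != 0 by rewrite lt0r_neq0// (area_element_gt0 (HD n) Dz).
  have A2 : area_element (th' n) z != 0 by rewrite lt0r_neq0// (area_element_gt0 (H' n) Dz).
  rewrite mul1r (chart_valE (jac_invariant l cX) (H n) pD) /jac -/(th' n) (dE n z Dz).
  exact (etrans (divfK A2 _) (esym (divfK A1 _))).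
apply: eq_eseriesr => n _; apply: eq_integral => z zB.
by apply: congr1; apply: key; move: zB; rewrite inE.
Qed.

End perimeter_formula.

(** * Derivative of the perimeter *)

Section expansion.
Context {R : realType}.
Local Notation pt := (R * R * R)%type.
Implicit Types (S U K : set pt) (D : set (R * R)) (th : R * R -> pt) (g v w xi dv dw : pt) (X : pt -> pt).

(** Multiplication by [s + W] turns [s - W] into a polynomial expression, and [s + W >= W] allows
    division even where [s] vanishes. The bound [|s - W| <= |d1| + |d2|] is obtained in this way and
    then fed into the same computation at second order. *)
Lemma sqrt_taylor (P Q W a b m n M l : R) : 0 < W -> W ^+ 2 = P ^+ 2 + Q ^+ 2 -> `|l| <= 1 ->
  `|a| + `|b| + `|m| + `|n| <= M ->
  `|Num.sqrt ((P + l * a + l ^+ 2 * m) ^+ 2 + (Q + l * b + l ^+ 2 * n) ^+ 2) - W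
    - l * ((P * a + Q * b) / W)| <= (2 * M ^+ 2 / W + M) * l ^+ 2.
Proof.
move=> W0 WE l1 hM.
pose d1 := l * a + l ^+ 2 * m; pose d2 := l * b + l ^+ 2 * n.
set s := Num.sqrt _.
have sE : s ^+ 2 = (P + d1) ^+ 2 + (Q + d2) ^+ 2.
  by rewrite /s sqr_sqrtr ?addr_ge0 ?sqr_ge0// /d1 /d2 !addrA.
have s0 : 0 <= s by exact: sqrtr_ge0.
have le2 (x y z : R) : 0 <= z -> z ^+ 2 = x ^+ 2 + y ^+ 2 -> `|x| <= z.
  by move=> z0 E; rewrite -ler_sqr ?nnegrE// real_normK ?num_real// E lerDl sqr_ge0.
have PW : `|P| <= W by apply: le2 WE; exact: ltW.
have QW : `|Q| <= W by apply: (le2 _ P); rewrite ?ltW// addrC.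
have Ps : `|P + d1| <= s by exact: le2 sE.
have Qs : `|Q + d2| <= s by apply: (le2 _ (P + d1)); rewrite // addrC.
have dot (x y z : R) : `|x| <= z -> `|y| <= z -> `|x * d1 + y * d2| <= z * (`|d1| + `|d2|).
  move=> xz yz; apply: le_trans (ler_normD _ _) _; rewrite !normrM mulrDr.
  by rewrite lerD// ler_wpM2r.
pose dl := `|d1| + `|d2|.
have dl0 : 0 <= dl by rewrite addr_ge0.
have sW : 0 < s + W by rewrite ltr_wpDl.
have D1 : `|s - W| <= dl.
  have E : (s - W) * (s + W) = (P * d1 + Q * d2) + ((P + d1) * d1 + (Q + d2) * d2).
    by rewrite -subr_sqr sE WE; ring.
  rewrite -(ler_pM2r sW) -{1}(gtr0_norm sW) -normrM E.
  apply: le_trans (ler_normD _ _) _.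
  apply: le_trans (lerD (dot _ _ _ PW QW) (dot _ _ _ Ps Qs)) _.
  by rewrite -/dl -mulrDl [W + s]addrC mulrC.
have D2 : `|s - W - (P * d1 + Q * d2) / W| <= 2 * dl ^+ 2 / W.
  have E : (s - W - (P * d1 + Q * d2) / W) * (s + W) =
     (d1 ^+ 2 + d2 ^+ 2) - (s - W) * ((P * d1 + Q * d2) / W).
    have -> : (s - W - (P * d1 + Q * d2) / W) * (s + W) =
       s ^+ 2 - W ^+ 2 - (P * d1 + Q * d2) / W * (s - W) - 2 * (P * d1 + Q * d2).
      by field; rewrite lt0r_neq0.
    by rewrite sE WE; ring.
  have h1 : d1 ^+ 2 + d2 ^+ 2 <= dl ^+ 2.
    rewrite -[d1 ^+ 2]real_normK ?num_real// -[d2 ^+ 2]real_normK ?num_real//.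
    by rewrite /dl sqrrD -addrA [X in _ <= _ + X]addrC addrA lerDl mulrn_wge0// mulr_ge0.
  have h2 : `|(P * d1 + Q * d2) / W| <= dl.
    by rewrite normrM normfV (gtr0_norm W0) ler_pdivrMr// [dl * W]mulrC; exact: dot.
  have h3 : `|s - W - (P * d1 + Q * d2) / W| * (s + W) <= 2 * dl ^+ 2.
    rewrite -{1}(gtr0_norm sW) -normrM E; apply: le_trans (ler_normB _ _) _.
    rewrite ger0_norm ?addr_ge0 ?sqr_ge0// mulr_natl mulr2n lerD// normrM expr2.
    exact: ler_pM.
  rewrite ler_pdivlMr//; apply: le_trans h3.
  by rewrite ler_wpM2l// lerDr.
have M0 : 0 <= M by apply: le_trans hM; rewrite !addr_ge0.
have ll : l ^+ 2 <= `|l| by rewrite -[l ^+ 2]real_normK ?num_real// expr2 ler_piMr.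
have dlM : dl <= `|l| * M.
  have t (x y : R) : `|l * x + l ^+ 2 * y| <= `|l| * (`|x| + `|y|).
    apply: le_trans (ler_normD _ _) _; rewrite (normrM l x) (normrM (l ^+ 2) y) mulrDr lerD2l ler_wpM2r//.
    by rewrite ger0_norm ?sqr_ge0.
  apply: le_trans (lerD (t a m) (t b n)) _; rewrite -mulrDr ler_wpM2l//.
  by rewrite addrACA addrA.
have D3 : dl ^+ 2 <= l ^+ 2 * M ^+ 2.
  by rewrite -[l ^+ 2]real_normK ?num_real// -exprMn ler_sqr ?nnegrE// mulr_ge0.
have D4 : `|(P * m + Q * n) / W| <= M.
  rewrite normrM normfV (gtr0_norm W0) ler_pdivrMr//; apply: le_trans (ler_normD _ _) _.
  rewrite !normrM; apply: (@le_trans _ _ ((`|m| + `|n|) * W)).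
    by rewrite mulrDl lerD// mulrC ler_wpM2l.
  rewrite ler_wpM2r ?(ltW W0)//; apply: le_trans hM.
  by rewrite -addrA lerDr addr_ge0.
have -> : s - W - l * ((P * a + Q * b) / W) = (s - W - (P * d1 + Q * d2) / W)
   + l ^+ 2 * ((P * m + Q * n) / W).
  by rewrite /d1 /d2; field; rewrite lt0r_neq0.
apply: le_trans (ler_normD _ _) _; rewrite [leRHS]mulrDl lerD//.
  apply: le_trans D2 _; rewrite [leRHS]mulrAC ler_wpM2r ?invr_ge0 ?(ltW W0)//.
  by rewrite -mulrA ler_wpM2l// mulrC.
by rewrite (normrM (l ^+ 2)) (ger0_norm (sqr_ge0 l)) mulrC ler_wpM2r ?sqr_ge0.
Qed.

(** [dtau] and [etau] are the coefficients of [l] and [l^2] in [Tcoord (g + l xi) (v + l dv)]; the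
    terms in [xi] appear because the frame moves with the base point. *)
Definition dtau g xi v dv : R := Tcoord g dv + (xi.1.2 * v.1.1 - xi.1.1 * v.1.2) / 2.
Definition etau xi dv : R := (xi.1.2 * dv.1.1 - xi.1.1 * dv.1.2) / 2.

(* [dcrossP] and [ecrossP] are the coefficients of [l] and [l^2] in the expansion of [crossP]
   after the deformation [g + l xi], [v + l dv], [w + l dw]; likewise for [Q]. *)
Definition dcrossP g xi v w dv dw : R :=
  v.1.2 * dtau g xi w dw + dv.1.2 * Tcoord g w - dtau g xi v dv * w.1.2 - Tcoord g v * dw.1.2.
Definition dcrossQ g xi v w dv dw : R :=
  dtau g xi v dv * w.1.1 + Tcoord g v * dw.1.1 - v.1.1 * dtau g xi w dw - dv.1.1 * Tcoord g w.

Definition ecrossP (l : R) g xi v w dv dw : R :=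
  v.1.2 * etau xi dw + dv.1.2 * dtau g xi w dw - dtau g xi v dv * dw.1.2 - etau xi dv * w.1.2
  + l * (dv.1.2 * etau xi dw - etau xi dv * dw.1.2).
Definition ecrossQ (l : R) g xi v w dv dw : R :=
  etau xi dv * w.1.1 + dtau g xi v dv * dw.1.1 - v.1.1 * etau xi dw - dv.1.1 * dtau g xi w dw
  + l * (etau xi dv * dw.1.1 - dv.1.1 * etau xi dw).

Lemma pt_coord (l : R) g xi : [/\ (g + l *: xi).1.1 = g.1.1 + l * xi.1.1,
  (g + l *: xi).1.2 = g.1.2 + l * xi.1.2 & (g + l *: xi).2 = g.2 + l * xi.2].
Proof. by []. Qed.

Lemma Tcoord_expand (l : R) g xi v dv : Tcoord (g + l *: xi) (v + l *: dv) =
  Tcoord g v + l * dtau g xi v dv + l ^+ 2 * etau xi dv.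
Proof.
have [g1 g2 _] := pt_coord l g xi; have [v1 v2 v3] := pt_coord l v dv.
by rewrite /dtau /etau /Tcoord g1 g2 v1 v2 v3; field.
Qed.

Lemma cross_expand (l : R) g xi v w dv dw :
  crossP (g + l *: xi) (v + l *: dv) (w + l *: dw) =
    crossP g v w + l * dcrossP g xi v w dv dw + l ^+ 2 * ecrossP l g xi v w dv dw /\
  crossQ (g + l *: xi) (v + l *: dv) (w + l *: dw) =
    crossQ g v w + l * dcrossQ g xi v w dv dw + l ^+ 2 * ecrossQ l g xi v w dv dw.
Proof.
have [v1 v2 _] := pt_coord l v dv; have [w1 w2 _] := pt_coord l w dw.
rewrite /crossP /crossQ /dcrossP /dcrossQ /ecrossP /ecrossQ !Tcoord_expand v1 v2 w1 w2.
move: (Tcoord g v) (Tcoord g w) (dtau g xi v dv) (dtau g xi w dw) (etau xi dv) (etau xi dw).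
by move=> *; split; ring.
Qed.

Lemma dcross_lin g xi v w dv dw (al be ga de : R) :
  dcrossP g xi (al *: v + ga *: w) (be *: v + de *: w) (al *: dv + ga *: dw) (be *: dv + de *: dw)
    = dcrossP g xi v w dv dw * (al * de - be * ga) /\
  dcrossQ g xi (al *: v + ga *: w) (be *: v + de *: w) (al *: dv + ga *: dw) (be *: dv + de *: dw)
    = dcrossQ g xi v w dv dw * (al * de - be * ga).
Proof.
have Tl (x y : R) (a b : pt) : Tcoord g (x *: a + y *: b) = x * Tcoord g a + y * Tcoord g b.
  by have [a1 a2 a3] := lin_coord x y a b; rewrite /Tcoord a1 a2 a3; ring.
have dl (x y : R) (a b da db : pt) : dtau g xi (x *: a + y *: b) (x *: da + y *: db) =
    x * dtau g xi a da + y * dtau g xi b db.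
  by have [a1 a2 _] := lin_coord x y a b; rewrite /dtau Tl a1 a2; ring.
rewrite /dcrossP /dcrossQ !dl !Tl.
have [a1 a2 _] := lin_coord al ga v w; have [b1 b2 _] := lin_coord be de v w.
have [c1 c2 _] := lin_coord al ga dv dw; have [d1 d2 _] := lin_coord be de dv dw.
rewrite a1 a2 b1 b2 c1 c2 d1 d2.
move: (Tcoord g v) (Tcoord g w) (dtau g xi v dv) (dtau g xi w dw).
by move=> *; split; ring.
Qed.

Definition chartdP X th z : R :=
  dcrossP (th z) (X (th z)) (pu th z) (pv th z) (pu (X \o th) z) (pv (X \o th) z).
Definition chartdQ X th z : R :=
  dcrossQ (th z) (X (th z)) (pu th z) (pv th z) (pu (X \o th) z) (pv (X \o th) z).

(* The derivative of [jac] at [l = 0].  At characteristic points division by zero gives the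
   right value 0, because [X] vanishes around them. *)
Definition djac X th z : R :=
  (chartP th z * chartdP X th z + chartQ th z * chartdQ X th z) / dens th z / area_element th z.

Lemma djac_invariant S X : C2_field S X -> chart_invariant S (djac X).
Proof.
move=> cX D1 th1 z1 D2 th2 z2 H1 H2 Dz1 Dz2 E.
have [al [be [ga [de [D0 e1 e2 e3 e4]]]]] := transition_field cX H1 H2 Dz1 Dz2 E.
have A0 : area_element th2 z2 != 0 by rewrite lt0r_neq0// (area_element_gt0 H2 Dz2).
have ea : area_element th1 z1 = area_element th2 z2 * `|al * de - be * ga|.
  rewrite !area_elementE /chartP /chartQ /chartO e1 e2 E.
  have [-> -> ->] := cross_lin (th2 z2) (pu th2 z2) (pv th2 z2) al be ga de.
  by rewrite !exprMn -!mulrDl sqrtrM ?sqrtr_sqr// !addr_ge0 ?sqr_ge0.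
have ed : dens th1 z1 = dens th2 z2 * `|al * de - be * ga|.
  rewrite /dens /chartP /chartQ e1 e2 E.
  have [-> -> _] := cross_lin (th2 z2) (pu th2 z2) (pv th2 z2) al be ga de.
  by rewrite !exprMn -!mulrDl sqrtrM ?sqrtr_sqr// !addr_ge0 ?sqr_ge0.
have [cp cq] : chartP th1 z1 = chartP th2 z2 * (al * de - be * ga) /\
    chartQ th1 z1 = chartQ th2 z2 * (al * de - be * ga).
  rewrite /chartP /chartQ e1 e2 E.
  by have [-> -> _] := cross_lin (th2 z2) (pu th2 z2) (pv th2 z2) al be ga de.
have [dp dq] : chartdP X th1 z1 = chartdP X th2 z2 * (al * de - be * ga) /\
    chartdQ X th1 z1 = chartdQ X th2 z2 * (al * de - be * ga).
  rewrite /chartdP /chartdQ e1 e2 e3 e4 E; exact: dcross_lin.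
rewrite /djac cp cq dp dq ea ed.
move: (al * de - be * ga) D0 => t t0.
have tt : t * t = `|t| * `|t| by rewrite -!expr2 real_normK ?num_real.
have t1 : `|t| != 0 by rewrite normr_eq0.
(* Where [dens] is zero both sides are zero, by the convention for division by zero. *)
have [->|d0] := eqVneq (dens th2 z2) 0; first by rewrite mul0r !invr0 !mulr0 !mul0r.
move: (chartP th2 z2) (chartQ th2 z2) (chartdP X th2 z2) (chartdQ X th2 z2) d0 A0.
move: (dens th2 z2) (area_element th2 z2) => w A P Q P' Q' w0 A0.
transitivity ((P * P' + Q * Q') * (t * t) / (w * `|t|) / (A * `|t|)); first by congr (_ / _ / _); ring.
by rewrite tt; field; rewrite w0 A0 t1.
Qed.

End expansion.

(** * Uniform second-order expansion of the Jacobian *)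

Section taylor.
Context {R : realType}.
Local Notation pt := (R * R * R)%type.
Implicit Types (S U K : set pt) (D : set (R * R)) (th : R * R -> pt) (g v w xi dv dw : pt) (X : pt -> pt).

Lemma chart_field_C1 S X D th : C2_field S X -> local_param S D th ->
  [/\ C1_on D (fun z => (X (th z)).1.1), C1_on D (fun z => (X (th z)).1.2) &
      C1_on D (fun z => (X (th z)).2)] /\
  [/\ [/\ C1_on D (fun z => (pu (X \o th) z).1.1), C1_on D (fun z => (pu (X \o th) z).1.2) &
      C1_on D (fun z => (pu (X \o th) z).2)] &
     [/\ C1_on D (fun z => (pv (X \o th) z).1.1), C1_on D (fun z => (pv (X \o th) z).1.2) &
      C1_on D (fun z => (pv (X \o th) z).2)]].
Proof.
move=> cX H; have oD := chart_open H; have [x1 x2 x3] := cX D th H.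
split; first by split; [case: x1|case: x2|case: x3].
have c2 : C2_on D (X \o th).
  have -> : X \o th = fun z => ((X (th z)).1.1, (X (th z)).1.2, (X (th z)).2).
    by apply/funext => z; apply: pt_ext.
  exact (C2_on_pair oD (C2_on_pair oD x1 x2) x3).
have [hu hv] := C2_on_pu c2.
by split; split;
  [exact (C1_on_fst oD (C1_on_fst oD hu))|exact (C1_on_snd oD (C1_on_fst oD hu))
  |exact (C1_on_snd oD hu)
  |exact (C1_on_fst oD (C1_on_fst oD hv))|exact (C1_on_snd oD (C1_on_fst oD hv))
  |exact (C1_on_snd oD hv)].
Qed.

(** [ecrossP] is [ecP0 + l ecP1], and likewise for [Q]: the coefficients no longer depend on [l], so
    that local bounds on them are uniform for [|l| <= 1]. *)
Definition ecP0 xi g v w dv dw : R :=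
  v.1.2 * etau xi dw + dv.1.2 * dtau g xi w dw - dtau g xi v dv * dw.1.2 - etau xi dv * w.1.2.
Definition ecP1 xi dv dw : R := dv.1.2 * etau xi dw - etau xi dv * dw.1.2.
Definition ecQ0 xi g v w dv dw : R :=
  etau xi dv * w.1.1 + dtau g xi v dv * dw.1.1 - v.1.1 * etau xi dw - dv.1.1 * dtau g xi w dw.
Definition ecQ1 xi dv dw : R := etau xi dv * dw.1.1 - dv.1.1 * etau xi dw.

Lemma chart_expansion_C1 S X D th : C2_field S X -> local_param S D th ->
  (C1_on D (chartdP X th) /\ C1_on D (chartdQ X th)) /\
  [/\ C1_on D (fun z => ecP0 (X (th z)) (th z) (pu th z) (pv th z) (pu (X \o th) z) (pv (X \o th) z)),
      C1_on D (fun z => ecQ0 (X (th z)) (th z) (pu th z) (pv th z) (pu (X \o th) z) (pv (X \o th) z)),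
      C1_on D (fun z => ecP1 (X (th z)) (pu (X \o th) z) (pv (X \o th) z)) &
      C1_on D (fun z => ecQ1 (X (th z)) (pu (X \o th) z) (pv (X \o th) z))].
Proof.
move=> cX H; have oD := chart_open H.
have [[x1 x2 x3] [[u1 u2 u3] [v1 v2 v3]]] := chart_field_C1 cX H.
have [_ [a1 a2 a3] [b1 b2 b3]] := chart_C1 H.
have Tu := chart_tau_C1 H a1 a2 a3; have Tv := chart_tau_C1 H b1 b2 b3.
have TXu := chart_tau_C1 H u1 u2 u3; have TXv := chart_tau_C1 H v1 v2 v3.
have half := C1_on_cst 2^-1 oD.
have M (f g : R * R -> R) : C1_on D f -> C1_on D g -> C1_on D (fun z => f z * g z : R) by exact: C1_onM oD.
have A (f g : R * R -> R) : C1_on D f -> C1_on D g -> C1_on D (fun z => f z + g z : R) by exact: C1_onD oD.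
have B (f g : R * R -> R) : C1_on D f -> C1_on D g -> C1_on D (fun z => f z - g z : R) by exact: C1_onB oD.
have du := A _ _ TXu (M _ _ (B _ _ (M _ _ x2 a1) (M _ _ x1 a2)) half).
have dv := A _ _ TXv (M _ _ (B _ _ (M _ _ x2 b1) (M _ _ x1 b2)) half).
have eu := M _ _ (B _ _ (M _ _ x2 u1) (M _ _ x1 u2)) half.
have ev := M _ _ (B _ _ (M _ _ x2 v1) (M _ _ x1 v2)) half.
split; split.
- exact (B _ _ (B _ _ (A _ _ (M _ _ a2 dv) (M _ _ u2 Tv)) (M _ _ du b2)) (M _ _ Tu v2)).
- exact (B _ _ (B _ _ (A _ _ (M _ _ du b1) (M _ _ Tu v1)) (M _ _ a1 dv)) (M _ _ u1 Tv)).
- exact (B _ _ (B _ _ (A _ _ (M _ _ a2 ev) (M _ _ u2 dv)) (M _ _ du v2)) (M _ _ eu b2)).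
- exact (B _ _ (B _ _ (A _ _ (M _ _ eu b1) (M _ _ du v1)) (M _ _ a1 ev)) (M _ _ u1 dv)).
- exact (B _ _ (M _ _ u2 ev) (M _ _ eu v2)).
- exact (B _ _ (M _ _ eu v1) (M _ _ u1 ev)).
Qed.

Lemma deformed0 X th : deformed X 0 th = th.
Proof. by apply/funext => z; rewrite /deformed scale0r addr0. Qed.

Lemma continuous_bound_near (f : R * R -> R) d : {for d, continuous f} ->
  \forall z \near d, `|f z| <= `|f d| + 1.
Proof.
move=> cf; have c := cvg_norm cf.
have lt1 : `|f d| < `|f d| + 1 by rewrite ltrDl.
exact: (cvgr_le _ (c _) _ lt1).
Qed.

Lemma chart_deformed_cross S X l D th z : C2_field S X -> local_param S D th -> D z ->
  chartP (deformed X l th) z = chartP th z + l * chartdP X th z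
    + l ^+ 2 * ecrossP l (th z) (X (th z)) (pu th z) (pv th z) (pu (X \o th) z) (pv (X \o th) z) /\
  chartQ (deformed X l th) z = chartQ th z + l * chartdQ X th z
    + l ^+ 2 * ecrossQ l (th z) (X (th z)) (pu th z) (pv th z) (pu (X \o th) z) (pv (X \o th) z).
Proof.
move=> cX H Dz; have [e1 e2] := deformed_pu l cX H Dz.
by rewrite /chartP /chartQ e1 e2; exact (cross_expand l _ _ _ _ _ _).
Qed.

(** [sqrt_taylor] with its constant made uniform near [d]: the expansion coefficients are bounded
    above, and [dens] and [area_element] are bounded below by [w] and [a]. *)
Lemma jac_taylor S X D th d : C2_field S X -> local_param S D th -> D d -> 0 < dens th d ->
  exists C, \forall z \near d, forall l, `|l| <= 1 ->
    `|jac X l th z - jac X 0 th z - l * djac X th z| <= C * l ^+ 2.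
Proof.
move=> cX H Dd W0; have oD := chart_open H.
have [[p q] [p0 q0 p1 q1]] := chart_expansion_C1 cX H.
have bn (f : R * R -> R) : C1_on D f -> exists m, \forall z \near d, `|f z| <= m.
  by move=> cf; exists (`|f d| + 1); apply: continuous_bound_near; exact (C1_on_continuous cf Dd).
have I2 (P Q : R * R -> Prop) : (\forall z \near d, P z) -> (\forall z \near d, Q z) ->
    \forall z \near d, P z /\ Q z by move=> h k; exact: filterI.
have [[m1 k1] [m2 k2]] := (bn _ p, bn _ q); have [[m3 k3] [m4 k4]] := (bn _ p0, bn _ q0).
have [[m5 k5] [m6 k6]] := (bn _ p1, bn _ q1).
have n1 := I2 _ _ k1 k2; have n2 := I2 _ _ k3 k4; have n3 := I2 _ _ k5 k6.
clear k1 k2 k3 k4 k5 k6 bn.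
have n4 : \forall z \near d, D z by exact: open_nbhs_nbhs.
have n5 : \forall z \near d, dens th d / 2 < dens th z.
  by apply: (cvgr_gt _ (dens_continuous H Dd)); rewrite ltr_pdivrMr// ltr_pMr// ltr1n.
have A0 := area_element_gt0 H Dd.
have n6 : \forall z \near d, area_element th d / 2 < area_element th z.
  by apply: (cvgr_gt _ (chart_area_continuous H Dd)); rewrite ltr_pdivrMr// ltr_pMr// ltr1n.
have W2 : 0 < dens th d / 2 by rewrite divr_gt0.
have A2 : 0 < area_element th d / 2 by rewrite divr_gt0.
have [w w0 n5'] : exists2 w, 0 < w & \forall z \near d, w < dens th z.
  by exists (dens th d / 2); [exact W2|exact n5].
have [a a0 n6'] : exists2 a, 0 < a & \forall z \near d, a < area_element th z.
  by exists (area_element th d / 2); [exact A2|exact n6].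
clear n5 n6 W2 A2 A0 W0 p q p0 q0 p1 q1.
pose M : R := m1 + m2 + (m3 + m5) + (m4 + m6).
exists ((2 * M ^+ 2 / w + M) / a).
apply: filterS3 (I2 _ _ n1 n2)
  (I2 _ _ n3 n4) (I2 _ _ n5' n6').
move=> z [[h1 h2] [h3 h4]] [[h5 h6] Dz] [h7 h8] l l1.
have wz : 0 < dens th z by exact: lt_trans h7.
have az : 0 < area_element th z by exact: lt_trans h8.
have [e1 e2] := chart_deformed_cross l cX H Dz.
have tr (x y : R) m m' : `|x| <= m -> `|y| <= m' -> `|x + l * y| <= m + m'.
  move=> xm ym; apply: le_trans (ler_normD _ _) _; rewrite normrM lerD//.
  apply: le_trans ym; exact: ler_piMl.
have t1 := tr _ _ _ _ h3 h5; have t2 := tr _ _ _ _ h4 h6.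
have M0 : 0 <= M.
  by rewrite !addr_ge0//; [exact: le_trans h1|exact: le_trans h2|exact: le_trans h3
    |exact: le_trans h5|exact: le_trans h4|exact: le_trans h6].
have hM : `|chartdP X th z| + `|chartdQ X th z|
   + `|ecrossP l (th z) (X (th z)) (pu th z) (pv th z) (pu (X \o th) z) (pv (X \o th) z)|
   + `|ecrossQ l (th z) (X (th z)) (pu th z) (pv th z) (pu (X \o th) z) (pv (X \o th) z)| <= M.
  exact (lerD (lerD (lerD h1 h2) t1) t2).
have T := sqrt_taylor wz (dens_sqr th z) l1 hM.
have -> : jac X l th z - jac X 0 th z - l * djac X th z =
  (dens (deformed X l th) z - dens th z - l * ((chartP th z * chartdP X th z
    + chartQ th z * chartdQ X th z) / dens th z)) / area_element th z.
  by rewrite /jac deformed0 /djac !mulrBl mulrA.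
have eD : dens (deformed X l th) z = Num.sqrt ((chartP th z + l * chartdP X th z
    + l ^+ 2 * ecrossP l (th z) (X (th z)) (pu th z) (pv th z) (pu (X \o th) z) (pv (X \o th) z)) ^+ 2
   + (chartQ th z + l * chartdQ X th z
    + l ^+ 2 * ecrossQ l (th z) (X (th z)) (pu th z) (pv th z) (pu (X \o th) z) (pv (X \o th) z)) ^+ 2).
  by rewrite /dens e1 e2.
rewrite eD normrM normfV (gtr0_norm az) ler_pdivrMr//; apply: le_trans T _.
have l2 := sqr_ge0 l.
have c1 : 2 * M ^+ 2 / dens th z + M <= 2 * M ^+ 2 / w + M.
  rewrite lerD2r ler_wpM2l ?mulr_ge0 ?sqr_ge0//.
  by rewrite lef_pV2 ?posrE// ltW.
have c2 : 0 <= 2 * M ^+ 2 / w + M by rewrite addr_ge0// divr_ge0 ?(ltW w0)// mulr_ge0 ?sqr_ge0.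
apply: le_trans (ler_wpM2r l2 c1) _.
move: (2 * M ^+ 2 / w + M) c2 => c c2.
have -> : c / a * l ^+ 2 * area_element th z = c * l ^+ 2 * (area_element th z / a) by ring.
apply: ler_peMr; first by rewrite mulr_ge0.
by rewrite ler_pdivlMr// mul1r ltW.
Qed.

Lemma djac_continuous S X D th d : C2_field S X -> local_param S D th -> D d -> 0 < dens th d ->
  {for d, continuous (djac X th)}.
Proof.
move=> cX H Dd W0; have [[p q] _] := chart_expansion_C1 cX H.
have [p' q' _] := chart_cross_C1 H.
have A0 := area_element_gt0 H Dd.
apply: cvgM; last by apply: cvgV; [rewrite lt0r_neq0|exact: chart_area_continuous H Dd].
apply: cvgM; last by apply: cvgV; [rewrite lt0r_neq0|exact: dens_continuous H Dd].
apply: cvgD; apply: cvgM.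
- exact (C1_on_continuous p' Dd).
- exact (C1_on_continuous p Dd).
- exact (C1_on_continuous q' Dd).
- exact (C1_on_continuous q Dd).
Qed.

Lemma field0_pu S X K D th z : C2_field S X -> local_param S D th -> closed K ->
  (forall g, S g -> ~ K g -> X g = 0) -> D z -> ~ K (th z) ->
  [/\ X (th z) = 0, pu (X \o th) z = 0 & pv (X \o th) z = 0].
Proof.
move=> cX H cK X0 Dz Kz.
have oDK := chart_preimage_open H (closed_openC cK).
have nz : \forall y \near z, 0 = X (th y).
  have Dz' : (D `&` th @^-1` (~` K)) z by [].
  apply: filterS (open_nbhs_nbhs (conj oDK Dz')) => y [Dy Ky].
  by rewrite X0//; exact: chart_surf H Dy.
have h : has_lin3 (X \o th) z 0 0.
  by split; (apply: near_has_lin (has_lin_cst 0 z); apply: filterS nz => y /= <-).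
have [e1 e2] := has_lin3_pu h.
by split; [exact: X0 (chart_surf H Dz) Kz|exact e1|exact e2].
Qed.

Lemma jac_off S X K D th z l : C2_field S X -> local_param S D th -> closed K ->
  (forall g, S g -> ~ K g -> X g = 0) -> D z -> ~ K (th z) ->
  jac X l th z = jac X 0 th z /\ djac X th z = 0.
Proof.
move=> cX H cK X0 Dz Kz; have [e1 e2 e3] := field0_pu cX H cK X0 Dz Kz.
have add0 (v w x : pt) : x = v + l *: w -> w = 0 -> x = v by move=> -> ->; rewrite scaler0 addr0.
have [f1 f2] := deformed_pu l cX H Dz.
have g1 := add0 _ _ _ f1 e2; have g2 := add0 _ _ _ f2 e3.
have g3 : deformed X l th z = th z by exact: add0 (erefl _) e1.
split; first by rewrite /jac deformed0 /dens /chartP /chartQ g1 g2 g3.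
have d0 g v w xi dv dw : xi = 0 -> dv = 0 -> dw = 0 ->
    dcrossP g xi v w dv dw = 0 /\ dcrossQ g xi v w dv dw = 0.
  by move=> -> -> ->; rewrite /dcrossP /dcrossQ /dtau /Tcoord /=; split; ring.
have [d1 d2] : chartdP X th z = 0 /\ chartdQ X th z = 0 by exact: d0.
by rewrite /djac d1 d2 !mulr0 addr0 !mul0r.
Qed.

End taylor.

(** * Finite area of compact sets and integrability *)

Section finiteness.
Context {R : realType}.
Local Notation pt := (R * R * R)%type.
Local Notation leb2 := (@lebesgue_measure R \x @lebesgue_measure R)%E.
Implicit Types (S U K Q : set pt) (D : set (R * R)) (th : R * R -> pt) (g : pt) (X : pt -> pt).

(** If [f0] is not integrable, neither is [f0 + e] with [e] integrable, and both sides are [+oo].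
    This covers surfaces of infinite perimeter. *)
Lemma integral_perturbed d (T : measurableType d) (mu : {measure set T -> \bar R})
    (V : set T) (f0 f e : T -> R) : measurable V ->
  measurable_fun V f0 -> measurable_fun V f -> mu.-integrable V (EFin \o e) ->
  (forall x, V x -> 0 <= f0 x) -> (forall x, V x -> 0 <= f x) ->
  (forall x, V x -> f x = f0 x + e x) ->
  (\int[mu]_(x in V) (f x)%:E = \int[mu]_(x in V) (f0 x)%:E + (Rintegral mu V e)%:E)%E.
Proof.
move=> mV m0 mf ie p0 pf E.
have fin (h : T -> R) : measurable_fun V h -> (forall x, V x -> 0 <= h x) ->
    mu.-integrable V (EFin \o h) <-> (\int[mu]_(x in V) (h x)%:E < +oo)%E.
  move=> mh h0; have eqn : (\int[mu]_(x in V) `|(h x)%:E| = \int[mu]_(x in V) (h x)%:E)%E.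
    by apply: eq_integral => x /[!inE] Vx; rewrite gee0_abs// lee_fin h0.
  split=> [/integrableP[_]|fi]; first by rewrite eqn.
  by apply/integrableP; split; [exact/measurable_EFinP|rewrite eqn].
have eR : (\int[mu]_(x in V) (e x)%:E)%E = (Rintegral mu V e)%:E.
  by rewrite /Rintegral fineK//; exact: integrable_fin_num.
have [i0|ni0] := pselect (mu.-integrable V (EFin \o f0)).
  rewrite -eR -integralD//; apply: eq_integral => x /[!inE] Vx.
  by rewrite (E x Vx).
have nif : ~ mu.-integrable V (EFin \o f).
  move=> fi; apply: ni0; apply: (@eq_integrable _ _ _ _ _ mV ((EFin \o f) \- (EFin \o e))%E).
    by move=> x /[!inE] Vx /=; rewrite (E x Vx) -EFinB addrK.
  exact: integrableB.
have inf (h : T -> R) : measurable_fun V h -> (forall x, V x -> 0 <= h x) ->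
    ~ mu.-integrable V (EFin \o h) -> (\int[mu]_(x in V) (h x)%:E = +oo)%E.
  move=> mh h0 /(fin h mh h0)/negP; rewrite -leNgt leye_eq => /eqP; exact.
by rewrite (inf f)// (inf f0)// addye.
Qed.

Lemma surface_locally_finite S g : C2_surface S -> S g -> exists Q : set pt,
  [/\ open Q, Q g & (surface_measure S (S `&` Q) < +oo)%E].
Proof.
move=> HS Sg; have [D [th [H [d Dd <-]]]] := HS g Sg.
have oD := chart_open H; have [_ sm] := surface_measureP HS.
have nb : \forall z \near d, D z /\ area_element th z <= area_element th d + 1.
  have n1 : \forall z \near d, D z by exact: open_nbhs_nbhs.
  have n2 : \forall z \near d, area_element th z <= area_element th d + 1.
    by apply: (cvgr_le _ (chart_area_continuous H Dd)); rewrite ltrDl.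
  exact: filterI n1 n2.
have [e e0 eP] := (near_box _ _).1 nb.
pose B : set (R * R) := ball (d : R * R) e.
have BE z : B z -> `|z.1 - d.1| < e /\ `|z.2 - d.2| < e.
  by move=> [h1 h2]; split; rewrite distrC; [exact: h1|exact: h2].
have oB : open B by exact: ball_open.
have BD : B `<=` D by move=> z /BE[h1 h2]; have [] := eP z h1 h2.
have [_ _ _ _ hom] := H; have [Q oQ EQ] := hom B oB BD.
have Bd : B d by exact: ballxx.
exists Q; split => //.
  by have : (th @` B) (th d) by [exists d]; rewrite EQ => -[].
have mB : measurable B by exact: open_measurable2.
rewrite -EQ (sm D th H B mB BD).
have mw : measurable_fun B (area_element th).
  apply: measurable_funS (chart_area_measurable H) => //; exact: open_measurable2.
have [_ ub] := @integral_bounds R _ _ (leb2 : {measure set (measurableTypeR R * measurableTypeR R) -> \bar R})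
  B (area_element th) 0 (area_element th d + 1) mB mw (lexx 0)
  (fun z Bz => conj (area_element_ge0 th z) (eP z (BE z Bz).1 (BE z Bz).2).2).
apply: le_lt_trans ub _.
have sub : B `<=` rect (d.1 - e) (d.2 - e) (2 * e) (2 * e).
  move=> z /BE[]; rewrite !ltr_distl => /andP[h1 h2] /andP[h3 h4].
  by apply/rectP; split; move: h1 h2 h3 h4; clear; lra.
have mR : measurable (rect (d.1 - e) (d.2 - e) (2 * e) (2 * e)) by exact: rect_measurable.
have e2 : 0 <= 2 * e by rewrite mulr_ge0// ltW.
have fB : (leb2 B <= (2 * e * (2 * e))%:E)%E.
  rewrite -(leb2_rect (d.1 - e) (d.2 - e) e2 e2).
  by apply: (le_measure (leb2 : {measure set (measurableTypeR R * measurableTypeR R) -> \bar R}));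
    rewrite ?inE.
apply: (@le_lt_trans _ _ ((area_element th d + 1)%:E * (2 * e * (2 * e))%:E)%E).
  by apply: lee_wpmul2l => //; rewrite lee_fin addr_ge0// area_element_ge0.
by rewrite -EFinM ltry.
Qed.

(** The constant that [compact_uniform] makes uniform is the index of a base set of finite area
    around the point; finitely many such sets then cover [K]. *)
Lemma surface_compact_finite S K : C2_surface S -> compact K -> K `<=` S ->
  (surface_measure S K < +oo)%E.
Proof.
move=> HS cK KS; have mS := surface_measurable HS.
pose O n : set pt := if `[<(surface_measure S (S `&` base_R3 n) < +oo)%E>] then base_R3 n else set0.
have oO n : open (O n).
  by rewrite /O; case: asboolP => _; [exact: (@base_R3P R).1|exact: open0].
have fO n : (surface_measure S (S `&` O n) < +oo)%E.
  by rewrite /O; case: asboolP => // _; rewrite setI0 measure0.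
have [C C0 CP] : exists2 C : R, 0 <= C & forall g, K g -> exists2 n : nat, n%:R <= C & O n g.
  apply: (compact_uniform (P := fun (C : R) (g : pt) => exists2 n : nat, n%:R <= C & O n g) HS cK KS).
    by move=> C C' g CC' [n nC ng]; exists n => //; exact: le_trans CC'.
  move=> D th d H Dd _; have Sd := chart_surf H Dd.
  have [Q [oQ Qd Qf]] := surface_locally_finite HS Sd.
  have [n [Bn BQ]] := (@base_R3P R).2 _ _ (open_nbhs_nbhs (conj oQ Qd)).
  have fn : (surface_measure S (S `&` base_R3 n) < +oo)%E.
    apply: le_lt_trans Qf; apply: le_measure; rewrite ?inE.
    - by apply: measurableI => //; apply: open_measurable3; exact: (@base_R3P R).1.
    - by apply: measurableI => //; exact: open_measurable3.
    - by move=> g [Sg Bg]; split => //; exact: BQ.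
  have On : O n (th d) by rewrite /O; case: asboolP.
  exists n%:R; have ct := chart_continuous H Dd.
  have : \forall z \near d, O n (th z) by apply: ct; exact: open_nbhs_nbhs.
  by apply: filterS => z Oz; exists n.
have [N CN] : exists N : nat, C < N%:R.
  by exists (Num.bound C); apply: archi_boundP.
have KN : K `<=` \big[setU/set0]_(i < N) (S `&` O i).
  move=> g Kg; have [n nC ng] := CP g Kg.
  have nN : (n < N)%N by rewrite -(ltr_nat R); exact: le_lt_trans CN.
  by rewrite -(bigcup_mkord N (fun i => S `&` O i)); exists n => //; split => //; exact: KS.
have mO n : measurable (S `&` O n) by apply: measurableI => //; exact: open_measurable3.
have mK : measurable K.
  have h3 : hausdorff_space pt by exact: norm_hausdorff.
  have cl : closed K by exact: compact_closed.
  by rewrite -[K]setCK; apply: measurableC; apply: open_measurable3; exact: closed_openC.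
apply: (@le_lt_trans _ _ (surface_measure S (\big[setU/set0]_(i < N) (S `&` O i)))).
  by apply: le_measure; rewrite ?inE//; exact: bigsetU_measurable.
elim: N {CN KN} => [|N IH]; first by rewrite big_ord0 measure0.
rewrite big_ord_recr /=; apply: le_lt_trans (measureU2 _ _ _) _ => //.
  exact: bigsetU_measurable.
by apply: lte_add_pinfty; [exact: IH|exact: fO].
Qed.

Lemma surface_integrable S K (f : pt -> R) (M : R) : C2_surface S -> compact K -> K `<=` S ->
  measurable_fun S f -> (forall g, K g -> `|f g| <= M) -> (forall g, S g -> ~ K g -> f g = 0) ->
  (surface_measure S).-integrable S (EFin \o f) /\
  `|Rintegral (surface_measure S) S f| <= M * fine (surface_measure S K).
Proof.
move=> HS cK KS mf fM f0; have mS := surface_measurable HS.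
have h3 : hausdorff_space pt by exact: norm_hausdorff.
have mK : measurable K.
  have cl : closed K by exact: compact_closed.
  by rewrite -[K]setCK; apply: measurableC; apply: open_measurable3; exact: closed_openC.
have fK := surface_compact_finite HS cK KS.
have M0 g : K g -> 0 <= M by move=> /fM; exact: le_trans.
have E : (\int[surface_measure S]_(g in S) `|(f g)%:E| =
    \int[surface_measure S]_(g in K) `|(f g)%:E|)%E.
  rewrite -{1}(setIidr KS) integral_mkcondr; apply: eq_integral => g /[!inE] Sg.
  by rewrite patchE; case: ifPn => //; rewrite notin_setE => Kg; rewrite f0// abse0.
have ub : (\int[surface_measure S]_(g in S) `|(f g)%:E| <= (M * fine (surface_measure S K))%:E)%E.
  rewrite E EFinM fineK ?ge0_fin_numE// -integral_cst//.
  apply: ge0_le_integral => //.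
  by apply/measurableT_comp => //; apply/measurable_EFinP; exact: measurable_funS mf.
have fi : (surface_measure S).-integrable S (EFin \o f).
  apply/integrableP; split; first exact/measurable_EFinP.
  by apply: le_lt_trans ub _; rewrite ltry.
split => //; apply: le_trans (le_normr_Rintegral mS fi) _.
rewrite -lee_fin; apply: le_trans ub; rewrite /Rintegral fineK//.
apply: (@integrable_fin_num _ _ _ _ _ mS); exact: (integrable_abse fi).
Qed.

End finiteness.

(** * Differentiability of the perimeter *)

Section variation.
Context {R : realType}.
Local Notation pt := (R * R * R)%type.
Implicit Types (S U K Q : set pt) (D : set (R * R)) (th : R * R -> pt) (g : pt) (X : pt -> pt).

Lemma quadratic_is_derive (f : R -> R) (I C e : R) : 0 < e ->
  (forall l, `|l| <= e -> `|f l - f 0 - l * I| <= C * l ^+ 2) -> is_derive (0 : R) (1 : R) f I.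
Proof.
move=> e0 H.
have C0 : 0 <= C.
  have := H e; rewrite ger0_norm ?lexx ?(ltW e0)// => /(_ isT)/(le_trans (normr_ge0 _)).
  by rewrite pmulr_lge0// exprn_gt0.
have c : h^-1 *: ((f \o shift 0) (h *: (1 : R)) - f 0) @[h --> (0 : R)^'] --> I.
  apply/cvgrPdist_le => eps eps0.
  have d0 : 0 < Num.min e (eps / (C + 1)) by rewrite lt_min e0 divr_gt0// ltr_wpDl.
  apply/nbhs_ballP; exists (Num.min e (eps / (C + 1))) => //= h.
  rewrite /ball /= sub0r normrN lt_min => /andP[he heps] h0.
  have -> : h *: (1 : R) + 0 = h by rewrite addr0 -[h *: _]/(h * 1) mulr1.
  rewrite distrC -[_ *: _]/(h^-1 * (f h - f 0)).
  have -> : h^-1 * (f h - f 0) - I = h^-1 * (f h - f 0 - h * I) by field.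
  have k := H h (ltW he); rewrite normrM normfV ler_pdivrMl ?normr_gt0//.
  apply: le_trans k _; rewrite -[h ^+ 2]real_normK ?num_real// expr2 mulrCA ler_wpM2l//.
  have C1 : 0 < C + 1 by rewrite ltr_wpDl.
  apply: (@le_trans _ _ ((C + 1) * `|h|)); first by rewrite ler_wpM2r// lerDl.
  by rewrite mulrC -ler_pdivlMr// ltW.
apply: DeriveDef; first by apply/cvg_ex; exists I.
exact: (cvg_lim _ c).
Qed.

(** The Jacobian changes only on [K], so the increment of the perimeter is the integral [r l] of a
    bounded function supported in [K], for [S] and for [U] alike. The expansion on [K] gives [r l]
    up to a constant times [l^2]. *)
Lemma perimeter_variation S X K U L : C2_surface S -> lip_field S X L -> C2_field S X ->
  compact K -> K `<=` S -> (forall g, S g -> ~ K g -> X g = 0) ->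
  (forall D th d, local_param S D th -> D d -> K (th d) -> 0 < dens th d) ->
  (exists2 Q : set pt, open Q & U = S `&` Q) -> compact (closure U) -> closure U `<=` S -> K `<=` U ->
  is_derive (0 : R) (1 : R) (perimeter S X U)
    (Rintegral (surface_measure S) S (chart_val S (djac X))).
Proof.
move=> HS HL cX cK KS X0 dK [Q oQ UE] cU clU KU; have mS := surface_measurable HS.
pose mu := surface_measure S; pose J l := chart_val S (jac X l); pose dJ := chart_val S (djac X).
have [L0 _] := HL.
have clK : closed K by apply: compact_closed => //; exact: norm_hausdorff.
have JE l D th z : local_param S D th -> D z -> J l (th z) = jac X l th z.
  exact: chart_valE (jac_invariant l cX).
have dJE D th z : local_param S D th -> D z -> dJ (th z) = djac X th z.
  exact: chart_valE (djac_invariant cX).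
have [C C0 CP] : exists2 C : R, 0 <= C & forall g, K g -> forall l, `|l| <= 1 ->
    `|J l g - J 0 g - l * dJ g| <= C * l ^+ 2.
  apply: (compact_uniform (P := fun (C : R) (g : pt) => forall l, `|l| <= 1 ->
    `|J l g - J 0 g - l * dJ g| <= C * l ^+ 2) HS cK KS).
    by move=> C C' g CC' h l l1; apply: le_trans (h l l1) _; rewrite ler_wpM2r ?sqr_ge0.
  move=> D th d H Dd Kd; have [C nC] := jac_taylor cX H Dd (dK D th d H Dd Kd).
  have nD : \forall z \near d, D z by apply: open_nbhs_nbhs; split=> //; exact: chart_open H.
  exists C; apply: filterS2 nC nD => z h Dz l l1.
  by rewrite (JE l D th z H Dz) (JE 0 D th z H Dz) (dJE D th z H Dz); exact: h.
have off g : S g -> ~ K g -> dJ g = 0 /\ forall l, J l g = J 0 g.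
  move=> Sg; have [D [th [H [z Dz <-]]]] := HS g Sg => Kz; split.
    by rewrite (dJE D th z H Dz); have [] := jac_off 0 cX H clK X0 Dz Kz.
  move=> l; rewrite (JE l D th z H Dz) (JE 0 D th z H Dz).
  by have [] := jac_off l cX H clK X0 Dz Kz.
have dcont D th z : local_param S D th -> D z -> {for z, continuous (djac X th)}.
  move=> H Dz; have [Kz|Kz] := pselect (K (th z)); first exact: djac_continuous cX H Dz (dK D th z H Dz Kz).
  have oDK := chart_preimage_open H (closed_openC clK).
  apply: (@continuous_ext_on _ _ (D `&` th @^-1` (~` K)) (fun=> 0)) => //.
    by move=> y [Dy Ky]; have [_ ->] := jac_off 0 cX H clK X0 Dy Ky.
  exact: cst_continuous.
have mdJ : measurable_fun S dJ.
  apply: surf_fun_measurable => // D th H; have oD := chart_open H.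
  apply: (eq_measurable_fun (djac X th)).
    by move=> z; rewrite inE => Dz; rewrite /= (dJE D th z H Dz).
  by apply: continuous_measurable2 => // z; exact: dcont H.
have [M M0 MP] : exists2 M : R, 0 <= M & forall g, K g -> `|dJ g| <= M.
  apply: (compact_uniform (P := fun (M : R) (g : pt) => `|dJ g| <= M) HS cK KS).
    by move=> M M' g MM' h; exact: le_trans MM'.
  move=> D th d H Dd _; exists (`|djac X th d| + 1).
  have nD : \forall z \near d, D z by apply: open_nbhs_nbhs; split=> //; exact: chart_open H.
  apply: filterS2 (continuous_bound_near (dcont D th d H Dd)) nD => z h Dz.
  by rewrite (dJE D th z H Dz).
have [idJ _] := surface_integrable HS cK KS mdJ MP (fun g Sg Kg => (off g Sg Kg).1).
(* [|l| <= 1] is for the expansion, [|l| L <= 1/2] for the deformed charts. *)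
have [e [e0 e1 eL]] : exists e : R, [/\ 0 < e, e <= 1 & forall l : R, `|l| <= e -> `|l| * L <= 2^-1].
  exists (Num.min 1 (2 * (L + 1))^-1); have L1 : 0 < L + 1 by rewrite ltr_wpDl.
  split; [by rewrite lt_min ltr01 invr_gt0 mulr_gt0|by rewrite ge_min lexx|].
  move=> l; rewrite le_min => /andP[_ h].
  apply: (@le_trans _ _ ((2 * (L + 1))^-1 * (L + 1))).
    by apply: ler_pM => //; rewrite lerDl.
  by rewrite invfM mulfVK// lt0r_neq0.
have mJ l : `|l| <= e -> measurable_fun S (J l).
  move=> le; apply: (@surf_fun_measurable R S (J l) HS) => D th H; have oD := chart_open H.
  have H' := chart_deform HL cX (eL l le) H.
  apply: (eq_measurable_fun (jac X l th)).
    by move=> z; rewrite inE => Dz; rewrite /= (JE l D th z H Dz).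
  apply: continuous_measurable2 => // z Dz; apply: cvgM; first exact: dens_continuous H' Dz.
  apply: cvgV; first by rewrite lt0r_neq0// (area_element_gt0 H Dz).
  exact: chart_area_continuous H Dz.
have l0e : `|0 : R| <= e by rewrite normr0 ltW.
have J0 l g : 0 <= J l g.
  by rewrite /J /chart_val /jac divr_ge0 ?dens_ge0 ?area_element_ge0.
pose E l g := J l g - J 0 g; pose r l := Rintegral mu S (E l).
have iE l : `|l| <= e -> mu.-integrable S (EFin \o E l).
  move=> le; have l1 : `|l| <= 1 by exact: le_trans e1.
  have [] // := @surface_integrable R S K (E l) (C * l ^+ 2 + `|l| * M) HS cK KS.
  - by apply: measurable_funB; apply: mJ.
  - move=> g Kg; rewrite -[E l g](subrK (l * dJ g)); apply: le_trans (ler_normD _ _) _.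
    by rewrite lerD ?CP// normrM ler_wpM2l// MP.
  - by move=> g Sg Kg; rewrite /E (off g Sg Kg).2 subrr.
have rE l : `|l| <= e -> `|r l - l * Rintegral mu S dJ| <= C * fine (mu K) * l ^+ 2.
  move=> le; have l1 : `|l| <= 1 by exact: le_trans e1.
  have il : mu.-integrable S (EFin \o (fun g => l * dJ g)).
    apply: (@eq_integrable _ _ _ _ _ mS (fun g => l%:E * (dJ g)%:E)%E) => //.
    exact: integrableZl.
  rewrite -(RintegralZl l mS idJ) -(RintegralB mS (iE l le) il) mulrAC.
  apply: (surface_integrable HS cK KS _ _ _).2.
  - apply: measurable_funB; last exact: measurable_funM.
    by apply: measurable_funB; apply: mJ.
  - by move=> g Kg; exact: CP.
  - by move=> g Sg Kg; rewrite /E (off g Sg Kg).2 (off g Sg Kg).1 mulr0 !subrr.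
have PV Q' l : open Q' -> K `<=` Q' -> `|l| <= e ->
    P_H (deform X l (S `&` Q')) = (P_H (deform X 0 (S `&` Q')) + (r l)%:E)%E.
  move=> oQ' KQ' le; have mV : measurable (S `&` Q') by apply: measurableI => //; exact: open_measurable3.
  rewrite (perimeter_jac HS HL cX (eL l le) oQ') (perimeter_jac HS HL cX (eL 0 l0e) oQ').
  have sub : S `&` Q' `<=` S by move=> g [].
  have m0 : measurable_fun (S `&` Q') (J 0) by exact: measurable_funS (mJ 0 l0e).
  have ml : measurable_fun (S `&` Q') (J l) by exact: measurable_funS (mJ l le).
  have ie : mu.-integrable (S `&` Q') (EFin \o E l) by exact: integrableS (iE l le).
  have JlE g : J l g = J 0 g + E l g by rewrite /E addrC subrK.
  have := integral_perturbed mV m0 ml ie (fun g _ => J0 0 g) (fun g _ => J0 l g) (fun g _ => JlE g).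
  move=> h; apply: (etrans h); congr (_ + _%:E)%E.
  rewrite /r Rintegral_mkcondr; apply: eq_Rintegral => g /[!inE] Sg.
  rewrite patchE; case: ifPn => //; rewrite notin_setE => Qg.
  by rewrite /E (off g Sg _).2 ?subrr// => /KQ'.
have r0 : r 0 = 0.
  by rewrite /r (@eq_Rintegral _ _ _ _ _ (fun=> 0)) ?Rintegral_cst ?mul0r// => g _; rewrite /E subrr.
have ge0P V l : (0 <= P_H (deform X l V))%E.
  by apply: integral_ge0 => g _; rewrite lee_fin mul1r divr_ge0 ?sqrtr_ge0.
have fin0 (p : \bar R) (x : R) : (p < +oo)%E -> (0 <= p)%E -> fine (p + x%:E)%E = fine p + x.
  by move=> p1 p0; rewrite fineD// ge0_fin_numE.
have SE l : deform X l S = deform X l (S `&` setT) by rewrite setIT.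
have PS l : `|l| <= e -> P_H (deform X l S) = (P_H (deform X 0 S) + (r l)%:E)%E.
  by move=> le; rewrite !SE; apply: PV => //; exact: openT.
have KQ : K `<=` Q by move=> g /KU; rewrite UE => -[].
(* The density of the perimeter is at most that of the area, and [U] lies in its closure, a compact
   part of [S]. *)
have UF : (P_H (deform X 0 U) < +oo)%E.
  rewrite UE (perimeter_jac HS HL cX (eL 0 l0e) oQ).
  have mV : measurable (S `&` Q) by apply: measurableI => //; exact: open_measurable3.
  apply: (@le_lt_trans _ _ (\int[mu]_(g in S `&` Q) (cst 1%:E g))%E).
    apply: ge0_le_integral => //.
    - by move=> g _; rewrite lee_fin; exact: J0.
    - apply/measurable_EFinP; apply: measurable_funS (mJ 0 l0e) => //.
    - move=> g [Sg _]; rewrite lee_fin; have [D [th [H [z Dz <-]]]] := HS g Sg.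
      change (is_true (J 0 (th z) <= 1)); rewrite (JE 0 D th z H Dz) /jac deformed0 ler_pdivrMr ?(area_element_gt0 H Dz)// mul1r.
      exact: dens_le.
  rewrite integral_cst// mul1e.
  apply: le_lt_trans (surface_compact_finite HS cU clU).
  apply: le_measure; rewrite ?inE//; last by rewrite UE; exact: subset_closure.
  rewrite -[closure U]setCK; apply: measurableC; apply: open_measurable3.
  by apply: closed_openC; exact: closed_closure.
(* A finite increment cannot change whether [P_H (S^l)] is finite, so all small [l] fall into the
   same branch of [perimeter]. *)
have pE l : `|l| <= e -> perimeter S X U l = perimeter S X U 0 + r l.
  move=> le; rewrite /perimeter (PS l le).
  have [fS|iS] := ltP (P_H (deform X 0 S)) +oo%E.
    by rewrite lte_add_pinfty ?ltry// fin0.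
  have -> : P_H (deform X 0 S) = +oo%E by apply/eqP; rewrite -leye_eq.
  rewrite addye// ltxx; have -> : P_H (deform X l U) = (P_H (deform X 0 U) + (r l)%:E)%E.
    by rewrite UE; exact: PV.
  by rewrite fin0.
apply: (quadratic_is_derive e0) => l le.
by rewrite (pE l le) [perimeter S X U 0 + r l]addrC addrK; exact: rE.
Qed.

End variation.

(** * The divergence theorem on the surface *)

Section plane.
Context {R : realType}.
Local Notation leb := (@lebesgue_measure R).
Local Notation leb2 := (leb \x leb)%E.
Local Notation leb2m :=
  (leb2 : {measure set (measurableTypeR R * measurableTypeR R) -> \bar R}).

Lemma integral_derive0 (g g' : R -> R) (B : R) : 0 < B ->
  (forall x, is_derive x (1 : R) g (g' x)) -> continuous g' ->
  (forall x, B <= `|x| -> g x = 0 /\ g' x = 0) ->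
  (\int[leb]_x (g' x)%:E = 0)%E.
Proof.
move=> B0 dg cg' off.
have BB : - B < B by rewrite gtrN.
have cg : continuous g.
  by move=> x; have [d _] := is_derive_differentiable (dg x); exact: differentiable_continuous.
transitivity (\int[leb]_(x in `[(- B)%R, B]) (g' x)%:E)%E.
  rewrite [RHS]integral_mkcond; apply: eq_integral => x _.
  rewrite patchE; case: ifPn => // ; rewrite notin_setE /= in_itv/= -ler_norml => /negP.
  by rewrite -ltNge => /ltW/off[_ ->].
have oo : derivable_oo_LRcontinuous (g : R -> R^o) (- B) B.
  split.
  - by move=> x _; have [] := dg x.
  - by apply: cvg_at_right_filter; exact: cg.
  - by apply: cvg_at_left_filter; exact: cg.
rewrite (@continuous_FTC2 R g' (g : R -> R^o) (- B) B BB _ oo); last 2 first.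
- by apply: continuous_subspaceT => x; exact: cg'.
- by move=> x _; rewrite derive1E; have [] := dg x.
have [gB _] : g B = 0 /\ g' B = 0 by apply: off; rewrite ger0_norm// ltW.
have [gNB _] : g (- B) = 0 /\ g' (- B) = 0 by apply: off; rewrite normrN ger0_norm// ltW.
by rewrite gB gNB sube0.
Qed.

Lemma compact_box (L : set (R * R)) : compact L -> exists2 B : R, 0 < B &
  forall z, B <= `|z.1| \/ B <= `|z.2| -> ~ L z.
Proof.
move=> /compact_bounded [M [_ bM]].
have M1 : M < `|M| + 1 by rewrite (le_lt_trans (ler_norm M))// ltrDl.
have bL := bM _ M1.
exists (`|M| + 2); first by rewrite ltr_wpDl.
move=> z h Lz; have := bL z Lz; have [n1 n2] := norm2_ge z.
have lt2 : `|M| + 1 < `|M| + 2 by rewrite ltrD2l ltr1n.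
case: h => h k.
- by have := le_lt_trans (le_trans h (le_trans n1 k)) lt2; rewrite ltxx.
- by have := le_lt_trans (le_trans h (le_trans n2 k)) lt2; rewrite ltxx.
Qed.

Lemma plane_integrable (f : R * R -> R) (L : set (R * R)) : compact L ->
  continuous f -> (forall z, ~ L z -> f z = 0) -> leb2m.-integrable setT (EFin \o f).
Proof.
move=> cL cf f0; have [B B0 BL] := compact_box cL.
have [M fM] : exists M : R, forall z, `|f z| <= M.
  have cfL : compact (f @` L) by apply: continuous_compact => //; exact: continuous_subspaceT.
  have [M [_ bM]] := compact_bounded cfL.
  have M1 : M < `|M| + 1 by rewrite (le_lt_trans (ler_norm M))// ltrDl.
  exists (`|M| + 1) => z; have [Lz|Lz] := pselect (L z); first by apply: (bM _ M1); exists z.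
  by rewrite f0// normr0 addr_ge0.
have mf : measurable_fun setT f.
  by apply: continuous_measurable2; [exact: openT|move=> z _; exact: cf].
have mQ : measurable (rect (- B) (- B) (2 * B) (2 * B)) by exact: rect_measurable.
have B2 : 0 <= 2 * B by rewrite mulr_ge0// ltW.
apply/integrableP; split; first exact/measurable_EFinP.
have -> : (\int[leb2m]_z `|(EFin \o f) z| =
    \int[leb2m]_(z in rect (- B) (- B) (2 * B) (2 * B)) (`|f z|)%:E)%E.
  rewrite [RHS]integral_mkcond; apply: eq_integral => z _; rewrite patchE.
  case: ifPn => //; rewrite notin_setE => nz; rewrite /= f0 ?normr0//.
  apply: BL; have [h1|h1] := leP B `|z.1|; first by left.
  have [h2|h2] := leP B `|z.2|; first by right.
  exfalso; apply: nz; move: h1 h2; rewrite !ltr_norml => /andP[a1 a2] /andP[a3 a4].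
  by apply/rectP; split; move: a1 a2 a3 a4; clear; lra.
have [_ ub] := @integral_bounds R _ _ leb2m _ (fun z => `|f z|) 0 M mQ
  (measurableT_comp (@normr_measurable R setT) (measurable_funTS mf)) (lexx 0)
  (fun z _ => conj (normr_ge0 (f z)) (fM z)).
apply: le_lt_trans ub _.
have -> : leb2m (rect (- B) (- B) (2 * B) (2 * B)) = (2 * B * (2 * B))%:E by exact: leb2_rect.
by rewrite -EFinM ltry.
Qed.

(** Each partial derivative is integrated first in its own variable, in which it is the derivative
    of a function that vanishes at both ends of a large interval. *)
Lemma plane_stokes (g gu gv : R * R -> R) (L : set (R * R)) : compact L -> C1f setT g gu gv ->
  (forall z, ~ L z -> g z = 0) ->
  [/\ leb2m.-integrable setT (EFin \o gu), leb2m.-integrable setT (EFin \o gv),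
      (\int[leb2]_z (gu z)%:E = 0)%E & (\int[leb2]_z (gv z)%:E = 0)%E].
Proof.
move=> cL [hg hu hv] g0.
have clL : closed L by apply: compact_closed => //; exact: norm_hausdorff.
have off z : ~ L z -> gu z = 0 /\ gv z = 0.
  move=> Lz; have n0 : \forall y \near z, 0 = g y.
    have oL : open (~` L) by exact: closed_openC.
    by apply: filterS (open_nbhs_nbhs (conj oL Lz)) => y /g0 ->.
  exact: has_lin_unique (hg z I) (near_has_lin n0 (has_lin_cst 0 z)).
have cu : continuous gu by move=> z; exact: hu.
have cv : continuous gv by move=> z; exact: hv.
have iu := plane_integrable cL cu (fun z Lz => (off z Lz).1).
have iv := plane_integrable cL cv (fun z Lz => (off z Lz).2).
have [B B0 BL] := compact_box cL.
split => //.
- rewrite -(integral21_prod_meas1 iu) /fubini_G; apply: integral0_eq => y _.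
  apply: (@integral_derive0 (fun x => g (x, y)) (fun x => gu (x, y)) B B0).
  + by move=> x; exact: is_derive_slice1 (hg (x, y) I).
  + move=> x; apply: (@continuous_comp _ _ _ (fun x => (x, y)) gu); last exact: cu.
    exact: (cvg_pair cvg_id (cvg_cst _)).
  + move=> x Bx; have Lz : ~ L (x, y) by apply: BL; left.
    by rewrite g0// (off _ Lz).1.
- rewrite -(integral12_prod_meas1 iv) /fubini_F; apply: integral0_eq => x _.
  apply: (@integral_derive0 (fun y => g (x, y)) (fun y => gv (x, y)) B B0).
  + by move=> y; exact: is_derive_slice2 (hg (x, y) I).
  + move=> y; apply: (@continuous_comp _ _ _ (fun y => (x, y)) gv); last exact: cv.
    exact: (cvg_pair (cvg_cst _) cvg_id).
  + move=> y By; have Lz : ~ L (x, y) by apply: BL; right.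
    by rewrite g0// (off _ Lz).2.
Qed.

Lemma C1_on_extend0 (D L : set (R * R)) (f : R * R -> R) : open D -> closed L -> L `<=` D ->
  C1_on D f -> (forall z, D z -> ~ L z -> f z = 0) ->
  C1_on setT (fun z => if `[<D z>] then f z else 0).
Proof.
move=> oD clL LD cf f0; set g := fun z => _.
have oL : open (~` L) by exact: closed_openC.
have c1 : C1_on D g.
  apply: C1_on_ext cf => // z Dz; rewrite /g; case: asboolP => //.
have c2 : C1_on (~` L) g.
  apply: (C1_on_ext oL _ (C1_on_cst 0 oL)) => z Lz; rewrite /g; case: asboolP => // Dz.
  by rewrite f0.
have cov z : D z \/ (~` L) z by have [/LD|] := pselect (L z); [left|right].
case: c1 => d1 e1; case: c2 => d2 e2.
split=> [z _|v z _]; first by case: (cov z) => [/d1|/d2].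
by case: (cov z) => [/(e1 v)|/(e2 v)].
Qed.

Definition pos (x : R) : R := Num.max x 0.

Lemma pos_is_derive n (x : R) :
  is_derive x (1 : R) (fun s => pos s ^+ n.+2) (n.+2%:R * pos x ^+ n.+1).
Proof.
have [x0|x0|x0] := ltgtP x 0.
- have -> : n.+2%:R * pos x ^+ n.+1 = 0 :> R.
    by rewrite /pos max_r ?(ltW x0)// expr0n mulr0.
  have ne : \forall y \near x, (0 : R) = pos y ^+ n.+2.
    by apply: filterS (lt_nbhsl x0) => y y0; rewrite /pos max_r ?(ltW y0)// expr0n.
  exact: near_eq_is_derive ne (is_derive_cst (0 : R) x (1 : R)).
- have -> : n.+2%:R * pos x ^+ n.+1 = n.+2%:R * x ^+ n.+1 :> R by rewrite /pos max_l// ltW.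
  have ne : \forall y \near x, y ^+ n.+2 = pos y ^+ n.+2.
    by apply: filterS (lt_nbhsr x0) => y y0; rewrite /pos max_l// ltW.
  apply: near_eq_is_derive ne _.
  apply: DeriveDef; first exact: exprn_derivable.
  by rewrite exp_derive /GRing.scale /= mulr1.
(* At the origin an exponent of at least 2 gives the bound [l^2], hence derivative 0. *)
- rewrite x0 /pos maxxx expr0n mulr0; apply: (@quadratic_is_derive R _ 0 1 1 ltr01) => l l1.
  rewrite maxxx expr0n /= subr0 mulr0 subr0 mul1r normrX.
  have h : `|Num.max l 0| <= `|l|.
    by rewrite ger0_norm ?le_max ?lexx ?orbT// ge_max ler_norm normr_ge0.
  apply: (@le_trans _ _ (`|l| ^+ n.+2)); first by rewrite lerXn2r ?nnegrE.
  rewrite -[l ^+ 2]real_normK ?num_real// -addn2 exprD ler_piMl ?exprn_ge0//.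
  exact: exprn_ile1.
Qed.

Lemma pos_continuous n : continuous (fun s => pos s ^+ n.+1).
Proof.
move=> x; apply: (@continuous_comp _ _ _ pos (fun y => y ^+ n.+1)); last exact: exprn_continuous.
by apply: continuous_max; [exact: cvg_id|exact: cvg_cst].
Qed.

(** The cube is what makes the positive part twice continuously differentiable; the cut-off
    functions are built from it. *)
Lemma C2_on_pos3 (D : set (R * R)) (f : R * R -> R) : open D -> C2_on D f ->
  C2_on D (fun z => pos (f z) ^+ 3).
Proof.
move=> oD cf.
apply: (C2_on_comp1 (k := fun s => pos s ^+ 3) (k' := fun s => 3 * pos s ^+ 2)
  (k'' := fun s => 3 * (2 * pos s ^+ 1)) oD cf).
- by move=> z _; exact: pos_is_derive 1 (f z).
- move=> z _; have d2 := pos_is_derive 0 (f z).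
  exact (@is_deriveZ R R R _ 3 _ _ _ d2).
- move=> z _; apply: (@continuousM _ _ (cst 3)); first exact: cvg_cst.
  apply: (@continuousM _ _ (cst 2)); first exact: cvg_cst.
  exact: pos_continuous.
Qed.

End plane.

(** * The curvature integrand and the algebra of the divergence *)

Section local_stokes.
Context {R : realType}.
Local Notation pt := (R * R * R)%type.
Implicit Types (S U K Q : set pt) (D : set (R * R)) (th : R * R -> pt) (g : pt) (X N : pt -> pt).

(** The function [F] for an arbitrary field: for [vfield a b k], the quantities in it are [a], [b]
    and [k]. *)
Definition normal_speed N X g : R :=
  pbar N g * (X g).1.1 + qbar N g * (X g).1.2 + omegabar N g * Tcoord g (X g).

(** The density of [H F d sigma_H] with respect to the surface measure. *)
Definition mean_flux N S X g : R :=
  Hmean N S g * normal_speed N X g * (WN N g / rnorm g (N g)).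

(** The orientation sign [s] enters once through [H] and once through [F], and its square is 1. *)
Lemma flux_algebra (s P Q O W w tu tv P1 P2 Q1 Q2 a b k : R) : W != 0 -> s * s = 1 -> w = W ->
  s / W ^+ 3 * (P * (tv * Q1 - tu * Q2) - Q * (tv * P1 - tu * P2)) *
    (s * (P / W) * a + s * (Q / W) * b + s * (O / W) * k) * w =
  - ((Q * (tv * P1 - tu * P2) - P * (tv * Q1 - tu * Q2)) * (P * a + Q * b + O * k) / W ^+ 3).
Proof.
move=> W0 ss ->; transitivity ((s * s) * - ((Q * (tv * P1 - tu * P2) - P * (tv * Q1 - tu * Q2)) *
  (P * a + Q * b + O * k) / W ^+ 3)); first by field.
by rewrite ss mul1r.
Qed.

Lemma mean_flux_chart S N X D th d (P1 P2 Q1 Q2 : R) : oriented_C2_surface S N ->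
  local_param S D th -> D d -> 0 < dens th d ->
  has_lin (chartP th) d P1 P2 -> has_lin (chartQ th) d Q1 Q2 ->
  mean_flux N S X (th d) * area_element th d =
  - ((chartQ th d * (Tcoord (th d) (pv th d) * P1 - Tcoord (th d) (pu th d) * P2)
      - chartP th d * (Tcoord (th d) (pv th d) * Q1 - Tcoord (th d) (pu th d) * Q2)) *
     (chartP th d * (X (th d)).1.1 + chartQ th d * (X (th d)).1.2
      + chartO th d * Tcoord (th d) (X (th d))) / dens th d ^+ 3).
Proof.
move=> hS H Dd W0 lP lQ; have W1 : dens th d != 0 by rewrite lt0r_neq0.
have [s [s1 ns]] := orientation hS H Dd W1.
have [_ _ pE qE oE] := nbhs_singleton ns.
have HE := Hmean_chart H ns s1 lP lQ.
have [_ _ nN] := hS.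
have wE := WN_rnorm_chart H Dd (nN _ (chart_surf H Dd)).
have ss : s * s = 1 by case: s1 => ->; rewrite ?mulrNN mulr1.
rewrite /mean_flux /normal_speed HE pE qE oE -[LHS]mulrA.
exact (flux_algebra _ _ _ _ _ _ _ _ _ _ _ _ W1 ss wE).
Qed.

(** Once [1 / W] is known to be differentiable, differentiating the identity [W^-2 (P^2 + Q^2) = 1]
    determines its gradient. *)
Lemma inv_dens_has_lin th z (P1 P2 Q1 Q2 : R) : has_lin (chartP th) z P1 P2 ->
  has_lin (chartQ th) z Q1 Q2 -> 0 < dens th z ->
  has_lin (fun y => (dens th y)^-1) z
    (- (chartP th z * P1 + chartQ th z * Q1) / dens th z ^+ 3)
    (- (chartP th z * P2 + chartQ th z * Q2) / dens th z ^+ 3).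
Proof.
move=> lP lQ W0; have W1 : dens th z != 0 by rewrite lt0r_neq0.
have lPQ := has_linD (has_linM lP lP) (has_linM lQ lQ).
have E0 y : chartP th y * chartP th y + chartQ th y * chartQ th y = dens th y ^+ 2.
  by rewrite dens_sqr !expr2.
have [w1 [w2 lw]] : exists w1 w2 : R, has_lin (fun y => (dens th y)^-1) z w1 w2.
  by apply: (has_lin_inv_sqrt lPQ); rewrite E0 exprn_gt0.
have cW := has_lin_cvg lw.
have n0 : \forall y \near z, 0 < (dens th y)^-1 by apply: (cvgr_gt _ cW); rewrite invr_gt0.
have l1 := has_linM (has_linM lw lw) lPQ.
have n1 : \forall y \near z, (dens th y)^-1 * (dens th y)^-1 *
    (chartP th y * chartP th y + chartQ th y * chartQ th y) = 1.
  apply: filterS n0 => y; rewrite invr_gt0 => y0; rewrite E0.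
  by field; rewrite lt0r_neq0.
have [e1 e2] := has_lin_unique (near_has_lin n1 l1) (has_lin_cst 1 z).
have solve (P Q W P1' Q1' w : R) : W != 0 -> P * P + Q * Q = W ^+ 2 ->
   W^-1 * W^-1 * (P * P1' + P1' * P + (Q * Q1' + Q1' * Q)) + (W^-1 * w + w * W^-1) * (P * P + Q * Q) = 0 ->
   w = - (P * P1' + Q * Q1') / W ^+ 3.
  move=> V0 -> e; have {}e : (P * P1' + Q * Q1') * 2 / W ^+ 2 + 2 * w * W = 0.
    by rewrite -[RHS]e; field.
  have -> : w = ((P * P1' + Q * Q1') * 2 / W ^+ 2 + 2 * w * W) / (2 * W)
     - (P * P1' + Q * Q1') / W ^+ 3 by field.
  by rewrite e mul0r sub0r mulNr.
have tr (p q p' q' : R) (f : R * R -> R) : p = p' -> q = q' -> has_lin f z p q -> has_lin f z p' q'.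
  by move=> -> ->.
apply: tr lw; [exact: solve W1 (E0 z) e1|exact: solve W1 (E0 z) e2].
Qed.

(** The letters [x], [y], [t] stand for frame components of the coordinate vectors, [a], [b], [k]
    for those of the field, and [p1], [p2], [q1], [q2] for the derivatives of [P / W] and [Q / W].
    The hypothesis [tvu = tuv - O] is the non-closedness of the contact form,
    [d tau = - dx wedge dy]. The two sides then differ by multiples of [N0] and [N1], the
    orthogonality of the cross product to the coordinate vectors. *)
Lemma divergence_algebra (P Q O W P1 P2 Q1 Q2 xu xv yu yv tu tv a b k a1 a2 b1 b2 k1 k2
    p1 p2 q1 q2 xuv yuv tuv tvu : R) : W != 0 ->
  P = yu * tv - tu * yv -> Q = tu * xv - xu * tv -> O = xu * yv - yu * xv ->
  p1 = Q * (Q * P1 - P * Q1) / W ^+ 3 -> p2 = Q * (Q * P2 - P * Q2) / W ^+ 3 ->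
  q1 = - P * (Q * P1 - P * Q1) / W ^+ 3 -> q2 = - P * (Q * P2 - P * Q2) / W ^+ 3 ->
  tvu = tuv - O ->
  (P * (yu * (k2 + b * xv - a * yv) + b1 * tv - (k1 + b * xu - a * yu) * yv - tu * b2)
   + Q * ((k1 + b * xu - a * yu) * xv + tu * a2 - xu * (k2 + b * xv - a * yv) - a1 * tv)) / W
  + (Q * (tv * P1 - tu * P2) - P * (tv * Q1 - tu * Q2)) * (P * a + Q * b + O * k) / W ^+ 3 =
  (tvu * (P / W * b - Q / W * a) + tv * (p1 * b + P / W * b1 - (q1 * a + Q / W * a1))
   - (k1 * (P / W * yv - Q / W * xv) + k * (p1 * yv + P / W * yuv - (q1 * xv + Q / W * xuv))))
  + (k2 * (P / W * yu - Q / W * xu) + k * (p2 * yu + P / W * yuv - (q2 * xu + Q / W * xuv))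
   - (tuv * (P / W * b - Q / W * a) + tu * (p2 * b + P / W * b2 - (q2 * a + Q / W * a2)))).
Proof.
move=> W0 EP EQ EO -> -> -> -> ->.
have N0 : P * xu + Q * yu + O * tu = 0 by rewrite EP EQ EO; ring.
have N1 : P * xv + Q * yv + O * tv = 0 by rewrite EP EQ EO; ring.
apply/eqP; rewrite -subr_eq0; apply/eqP.
transitivity (k / W ^+ 3 * ((Q * P1 - P * Q1) * (P * xv + Q * yv + O * tv)
   - (Q * P2 - P * Q2) * (P * xu + Q * yu + O * tu))); last by rewrite N0 N1; ring.
rewrite EO; field => //.
Qed.

End local_stokes.

(** * The divergence identity in a chart *)

Section chart_divergence.
Context {R : realType}.
Local Notation pt := (R * R * R)%type.
Implicit Types (S U K Q : set pt) (D : set (R * R)) (th : R * R -> pt) (g : pt) (X N : pt -> pt).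

Lemma has_lin_tr (f : R * R -> R) z p q p' q' : p = p' -> q = q' -> has_lin f z p q -> has_lin f z p' q'.
Proof. by move=> -> ->. Qed.

Lemma has_linB (f g : R * R -> R) c a b a' b' : has_lin f c a b -> has_lin g c a' b' ->
  has_lin (fun z => f z - g z) c (a - a') (b - b').
Proof.
move=> hf hg; have h := has_linD hf (has_linM (has_lin_cst (- 1) c) hg).
have n0 : \forall z \near c, f z + - 1 * g z = f z - g z by near=> z; rewrite mulN1r.
by apply: has_lin_tr (near_has_lin n0 h); rewrite mul0r addr0 mulN1r.
Unshelve. all: by end_near. Qed.

(** By Schwarz's theorem the two gradients share the entry [b]. *)
Lemma second_derivatives D (f fu fv : R * R -> R) z : open D -> C2_on D f ->
  (forall y, D y -> has_lin f y (fu y) (fv y)) -> D z ->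
  exists a b c, has_lin fu z a b /\ has_lin fv z b c.
Proof.
move=> oD cf hf Dz; have [h cu cv] := C2_on_C2f cf.
have [hu _ _] := C1_on_C1f cu; have [hv _ _] := C1_on_C1f cv.
have lu := hu z Dz; have lv := hv z Dz.
have nD : \forall y \near z, D y by exact: open_nbhs_nbhs.
have nu : \forall y \near z, 'D_(1, 0) f y = fu y.
  by apply: filterS nD => y Dy; have [e _] := has_lin_unique (h y Dy) (hf y Dy); exact e.
have nv : \forall y \near z, 'D_(0, 1) f y = fv y.
  by apply: filterS nD => y Dy; have [_ e] := has_lin_unique (h y Dy) (hf y Dy); exact e.
do 3 eexists; split; first exact (near_has_lin nu lu).
exact (has_lin_tr (schwarz oD cf Dz) (erefl _) (near_has_lin nv lv)).
Qed.

Lemma Tcoord_has_lin (th w : R * R -> pt) z (x1 x2 y1 y2 a1 a2 b1 b2 c1 c2 : R) :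
  has_lin (fun y => (th y).1.1) z x1 x2 -> has_lin (fun y => (th y).1.2) z y1 y2 ->
  has_lin (fun y => (w y).1.1) z a1 a2 -> has_lin (fun y => (w y).1.2) z b1 b2 ->
  has_lin (fun y => (w y).2) z c1 c2 ->
  has_lin (fun y => Tcoord (th y) (w y)) z
    (c1 + (y1 * (w z).1.1 + (th z).1.2 * a1 - (x1 * (w z).1.2 + (th z).1.1 * b1)) / 2)
    (c2 + (y2 * (w z).1.1 + (th z).1.2 * a2 - (x2 * (w z).1.2 + (th z).1.1 * b2)) / 2).
Proof.
move=> lx ly la lb lc.
have h := has_linD lc (has_linM (has_linB (has_linM ly la) (has_linM lx lb)) (has_lin_cst 2^-1 z)).
by apply: has_lin_tr h; rewrite mulr0 add0r; congr (_ + _ / 2); congr (_ - _); exact: addrC.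
Qed.

(** The one-form obtained by contracting [(p dy - q dx) wedge tau] with the field of frame
    components [a], [b], [k], evaluated on the vector of frame components [x], [y], [t]. With
    [p = P / W] and [q = Q / W], the two-form takes the value [W] on the pair of coordinate
    vectors. *)
Definition flux (t p q x y a b k : R * R -> R) (w : R * R) : R :=
  t w * (p w * b w - q w * a w) - k w * (p w * y w - q w * x w).

Lemma flux_has_lin (t p q x y a b k : R * R -> R) z
    (t1 t2 p1 p2 q1 q2 x1 x2 y1 y2 a1 a2 b1 b2 k1 k2 : R) :
  has_lin t z t1 t2 -> has_lin p z p1 p2 -> has_lin q z q1 q2 -> has_lin x z x1 x2 ->
  has_lin y z y1 y2 -> has_lin a z a1 a2 -> has_lin b z b1 b2 -> has_lin k z k1 k2 ->
  has_lin (flux t p q x y a b k) z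
    (t1 * (p z * b z - q z * a z) + t z * (p1 * b z + p z * b1 - (q1 * a z + q z * a1))
     - (k1 * (p z * y z - q z * x z) + k z * (p1 * y z + p z * y1 - (q1 * x z + q z * x1))))
    (t2 * (p z * b z - q z * a z) + t z * (p2 * b z + p z * b2 - (q2 * a z + q z * a2))
     - (k2 * (p z * y z - q z * x z) + k z * (p2 * y z + p z * y2 - (q2 * x z + q z * x2)))).
Proof.
move=> lt lp lq lx ly la lb lk.
have h := has_linB (has_linM lt (has_linB (has_linM lp lb) (has_linM lq la)))
  (has_linM lk (has_linB (has_linM lp ly) (has_linM lq lx))).
by apply: has_lin_tr h; ring.
Qed.

Lemma flux_C1 D (t p q x y a b k : R * R -> R) : open D ->
  C1_on D t -> C1_on D p -> C1_on D q -> C1_on D x -> C1_on D y ->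
  C1_on D a -> C1_on D b -> C1_on D k -> C1_on D (flux t p q x y a b k).
Proof.
move=> oD ct cp cq cx cy ca cb ck.
exact (C1_onB oD (C1_onM oD ct (C1_onB oD (C1_onM oD cp cb) (C1_onM oD cq ca)))
  (C1_onM oD ck (C1_onB oD (C1_onM oD cp cy) (C1_onM oD cq cx)))).
Qed.

(* [djac X - mean_flux N S X], times the area element, is the divergence
   [d_u flux_u - d_v flux_v]. *)
Definition flux_u X th : R * R -> R :=
  flux (fun y => Tcoord (th y) (pv th y)) (fun y => chartP th y * (dens th y)^-1)
    (fun y => chartQ th y * (dens th y)^-1) (fun y => (pv th y).1.1) (fun y => (pv th y).1.2)
    (fun y => (X (th y)).1.1) (fun y => (X (th y)).1.2) (fun y => Tcoord (th y) (X (th y))).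

Definition flux_v X th : R * R -> R :=
  flux (fun y => Tcoord (th y) (pu th y)) (fun y => chartP th y * (dens th y)^-1)
    (fun y => chartQ th y * (dens th y)^-1) (fun y => (pu th y).1.1) (fun y => (pu th y).1.2)
    (fun y => (X (th y)).1.1) (fun y => (X (th y)).1.2) (fun y => Tcoord (th y) (X (th y))).

Lemma flux_C1_on S X D D' th : C2_field S X -> local_param S D th -> open D' -> D' `<=` D ->
  (forall z, D' z -> 0 < dens th z) -> C1_on D' (flux_u X th) /\ C1_on D' (flux_v X th).
Proof.
move=> cX H oD' DD W0; have oD := chart_open H.
have [[x1 x2 x3] _] := chart_field_C1 cX H.
have [_ [a1 a2 a3] [b1 b2 b3]] := chart_C1 H.
have Tu := chart_tau_C1 H a1 a2 a3; have Tv := chart_tau_C1 H b1 b2 b3.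
have TX := chart_tau_C1 (w := fun z => X (th z)) H x1 x2 x3.
have [cP cQ _] := chart_cross_C1 H.
have s (f : R * R -> R) : C1_on D f -> C1_on D' f by exact: C1_on_sub.
have cI : C1_on D' (fun y => (dens th y)^-1).
  have [hP hPu hPv] := C1_on_C1f (s _ cP); have [hQ hQu hQv] := C1_on_C1f (s _ cQ).
  have dc z : D' z -> {for z, continuous (fun y => (dens th y)^-1 ^+ 3)}.
    move=> Dz; have W1 : dens th z != 0 by rewrite lt0r_neq0// W0.
    have ci : {for z, continuous (fun y => (dens th y)^-1)}.
      by apply: cvgV => //; exact: dens_continuous H (DD z Dz).
    apply: (@continuous_comp _ _ _ (fun y => (dens th y)^-1) (fun x => x ^+ 3)); first exact ci.
    exact: exprn_continuous.
  have e3 y : (dens th y ^+ 3)^-1 = (dens th y)^-1 ^+ 3 by rewrite exprVn.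
  have cp z : D' z -> {for z, continuous (chartP th)} by move=> Dz; exact (C1_on_continuous (s _ cP) Dz).
  have cq z : D' z -> {for z, continuous (chartQ th)} by move=> Dz; exact (C1_on_continuous (s _ cQ) Dz).
  have key (u v : R * R -> R) z : D' z -> {for z, continuous u} -> {for z, continuous v} ->
     {for z, continuous (fun y => - (chartP th y * u y + chartQ th y * v y) * (dens th y)^-1 ^+ 3)}.
    move=> Dz cu cv; apply: cvgM; last exact: dc.
    by apply: cvgN; apply: cvgD; apply: cvgM => //; [exact: cp|exact: cq].
  have key' (u v : R * R -> R) z : D' z -> {for z, continuous u} -> {for z, continuous v} ->
     {for z, continuous (fun y => - (chartP th y * u y + chartQ th y * v y) / dens th y ^+ 3)}.
    move=> Dz cu cv; have := key u v z Dz cu cv.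
    have -> // : (fun y => - (chartP th y * u y + chartQ th y * v y) * (dens th y)^-1 ^+ 3) =
      (fun y => - (chartP th y * u y + chartQ th y * v y) / dens th y ^+ 3).
    by apply/funext => y; rewrite e3.
  exact (C1f_C1_on oD' (And3 (fun z Dz => inv_dens_has_lin (hP z Dz) (hQ z Dz) (W0 z Dz))
    (fun z Dz => key' _ _ z Dz (hPu z Dz) (hQu z Dz)) (fun z Dz => key' _ _ z Dz (hPv z Dz) (hQv z Dz)))).
have cp := C1_onM oD' (s _ cP) cI; have cq := C1_onM oD' (s _ cQ) cI.
split.
- exact (flux_C1 oD' (s _ Tv) cp cq (s _ b1) (s _ b2) (s _ x1) (s _ x2) (s _ TX)).
- exact (flux_C1 oD' (s _ Tu) cp cq (s _ a1) (s _ a2) (s _ x1) (s _ x2) (s _ TX)).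
Qed.

(** [divergence_algebra] for actual vectors: [p_der] and [q_der] simplify the quotient rule for
    [P / W] and [Q / W] by means of [W^2 = P^2 + Q^2], and [ET] is the asymmetry of the mixed [T]
    components. *)
Lemma divergence_points g (v w xi dv dw : pt) (W P1 P2 Q1 Q2 xuv yuv tuv : R)
   (P := crossP g v w) (Q := crossQ g v w) :
  W != 0 -> W ^+ 2 = P ^+ 2 + Q ^+ 2 ->
  (P * dcrossP g xi v w dv dw + Q * dcrossQ g xi v w dv dw) / W +
  (Q * (Tcoord g w * P1 - Tcoord g v * P2) - P * (Tcoord g w * Q1 - Tcoord g v * Q2)) *
    (P * xi.1.1 + Q * xi.1.2 + crossO g v w * Tcoord g xi) / W ^+ 3 =
  (tuv + (v.1.2 * w.1.1 + g.1.2 * xuv - (v.1.1 * w.1.2 + g.1.1 * yuv)) / 2) *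
    (P / W * xi.1.2 - Q / W * xi.1.1) +
  Tcoord g w * ((P * (- (P * P1 + Q * Q1) / W ^+ 3) + P1 / W) * xi.1.2 + P / W * dv.1.2 -
    ((Q * (- (P * P1 + Q * Q1) / W ^+ 3) + Q1 / W) * xi.1.1 + Q / W * dv.1.1)) -
  ((dv.2 + (v.1.2 * xi.1.1 + g.1.2 * dv.1.1 - (v.1.1 * xi.1.2 + g.1.1 * dv.1.2)) / 2) *
     (P / W * w.1.2 - Q / W * w.1.1) +
   Tcoord g xi * ((P * (- (P * P1 + Q * Q1) / W ^+ 3) + P1 / W) * w.1.2 + P / W * yuv -
     ((Q * (- (P * P1 + Q * Q1) / W ^+ 3) + Q1 / W) * w.1.1 + Q / W * xuv))) -
  ((tuv + (w.1.2 * v.1.1 + g.1.2 * xuv - (w.1.1 * v.1.2 + g.1.1 * yuv)) / 2) *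
    (P / W * xi.1.2 - Q / W * xi.1.1) +
   Tcoord g v * ((P * (- (P * P2 + Q * Q2) / W ^+ 3) + P2 / W) * xi.1.2 + P / W * dw.1.2 -
    ((Q * (- (P * P2 + Q * Q2) / W ^+ 3) + Q2 / W) * xi.1.1 + Q / W * dw.1.1)) -
   ((dw.2 + (w.1.2 * xi.1.1 + g.1.2 * dw.1.1 - (w.1.1 * xi.1.2 + g.1.1 * dw.1.2)) / 2) *
     (P / W * v.1.2 - Q / W * v.1.1) +
    Tcoord g xi * ((P * (- (P * P2 + Q * Q2) / W ^+ 3) + P2 / W) * v.1.2 + P / W * yuv -
     ((Q * (- (P * P2 + Q * Q2) / W ^+ 3) + Q2 / W) * v.1.1 + Q / W * xuv)))).
Proof.
move=> W0 WE.
have EP : P = v.1.2 * Tcoord g w - Tcoord g v * w.1.2 by [].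
have EQ : Q = Tcoord g v * w.1.1 - v.1.1 * Tcoord g w by [].
have EO : crossO g v w = v.1.1 * w.1.2 - v.1.2 * w.1.1 by [].
have p_der (x y : R) : P * (- (P * x + Q * y) / W ^+ 3) + x / W = Q * (Q * x - P * y) / W ^+ 3.
  have -> : x / W = x * W ^+ 2 / W ^+ 3 by field.
  by rewrite WE; ring.
have q_der (x y : R) : Q * (- (P * x + Q * y) / W ^+ 3) + y / W = - P * (Q * x - P * y) / W ^+ 3.
  have -> : y / W = y * W ^+ 2 / W ^+ 3 by field.
  by rewrite WE; ring.
have ET : tuv + (v.1.2 * w.1.1 + g.1.2 * xuv - (v.1.1 * w.1.2 + g.1.1 * yuv)) / 2 =
    tuv + (w.1.2 * v.1.1 + g.1.2 * xuv - (w.1.1 * v.1.2 + g.1.1 * yuv)) / 2 - crossO g v w.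
  by rewrite EO; field.
have key := divergence_algebra xi.1.1 xi.1.2 (Tcoord g xi) dv.1.1 dw.1.1 dv.1.2 dw.1.2
  (dv.2 + (v.1.2 * xi.1.1 + g.1.2 * dv.1.1 - (v.1.1 * xi.1.2 + g.1.1 * dv.1.2)) / 2)
  (dw.2 + (w.1.2 * xi.1.1 + g.1.2 * dw.1.1 - (w.1.1 * xi.1.2 + g.1.1 * dw.1.2)) / 2)
  xuv yuv W0 EP EQ EO (p_der P1 Q1) (p_der P2 Q2) (q_der P1 Q1) (q_der P2 Q2) ET.
have dP : dcrossP g xi v w dv dw = v.1.2 *
   (dw.2 + (w.1.2 * xi.1.1 + g.1.2 * dw.1.1 - (w.1.1 * xi.1.2 + g.1.1 * dw.1.2)) / 2
     + xi.1.2 * w.1.1 - xi.1.1 * w.1.2) + dv.1.2 * Tcoord g w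
   - (dv.2 + (v.1.2 * xi.1.1 + g.1.2 * dv.1.1 - (v.1.1 * xi.1.2 + g.1.1 * dv.1.2)) / 2
     + xi.1.2 * v.1.1 - xi.1.1 * v.1.2) * w.1.2 - Tcoord g v * dw.1.2.
  rewrite /dcrossP /dtau [Tcoord g dv]/Tcoord [Tcoord g dw]/Tcoord.
  by move: (Tcoord g v) (Tcoord g w) => *; field.
have dQ : dcrossQ g xi v w dv dw =
   (dv.2 + (v.1.2 * xi.1.1 + g.1.2 * dv.1.1 - (v.1.1 * xi.1.2 + g.1.1 * dv.1.2)) / 2
     + xi.1.2 * v.1.1 - xi.1.1 * v.1.2) * w.1.1 + Tcoord g v * dw.1.1
   - v.1.1 * (dw.2 + (w.1.2 * xi.1.1 + g.1.2 * dw.1.1 - (w.1.1 * xi.1.2 + g.1.1 * dw.1.2)) / 2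
     + xi.1.2 * w.1.1 - xi.1.1 * w.1.2) - dv.1.1 * Tcoord g w.
  rewrite /dcrossQ /dtau [Tcoord g dv]/Tcoord [Tcoord g dw]/Tcoord.
  by move: (Tcoord g v) (Tcoord g w) => *; field.
rewrite dP dQ; apply: (etrans key); by rewrite opprB.
Qed.

Lemma flux_divergence S X D th z (e1 e2 f1 f2 P1 P2 Q1 Q2 : R) : C2_field S X -> local_param S D th ->
  D z -> 0 < dens th z -> has_lin (chartP th) z P1 P2 -> has_lin (chartQ th) z Q1 Q2 ->
  has_lin (flux_u X th) z e1 e2 -> has_lin (flux_v X th) z f1 f2 ->
  djac X th z * area_element th z +
  (chartQ th z * (Tcoord (th z) (pv th z) * P1 - Tcoord (th z) (pu th z) * P2)
      - chartP th z * (Tcoord (th z) (pv th z) * Q1 - Tcoord (th z) (pu th z) * Q2)) *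
     (chartP th z * (X (th z)).1.1 + chartQ th z * (X (th z)).1.2
      + chartO th z * Tcoord (th z) (X (th z))) / dens th z ^+ 3 = e1 - f2.
Proof.
move=> cX H Dz W0 lP lQ lu lv; have oD := chart_open H.
have W1 : dens th z != 0 by rewrite lt0r_neq0.
have [[cx cy ct] _ _] := chart_C1 H.
have hth y : D y -> has_lin3 th y (pu th y) (pv th y) by exact (chart_lin H).
have hx0 y : D y -> has_lin (fun z => (th z).1.1) y (pu th y).1.1 (pv th y).1.1 by case/hth.
have hy0 y : D y -> has_lin (fun z => (th z).1.2) y (pu th y).1.2 (pv th y).1.2 by case/hth.
have ht0 y : D y -> has_lin (fun z => (th z).2) y (pu th y).2 (pv th y).2 by case/hth.
have [xuu [xuv [xvv [hxu hxv]]]] :=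
  second_derivatives (fu := fun z => (pu th z).1.1) (fv := fun z => (pv th z).1.1) oD cx hx0 Dz.
have [yuu [yuv [yvv [hyu hyv]]]] :=
  second_derivatives (fu := fun z => (pu th z).1.2) (fv := fun z => (pv th z).1.2) oD cy hy0 Dz.
have [tuu [tuv [tvv [htu htv]]]] :=
  second_derivatives (fu := fun z => (pu th z).2) (fv := fun z => (pv th z).2) oD ct ht0 Dz.
clear hx0 hy0 ht0.
have [hx hy _] := hth z Dz.
have Tu := Tcoord_has_lin hx hy hxu hyu htu.
have Tv := Tcoord_has_lin hx hy hxv hyv htv.
have [ha hb hc] := field_lin3 cX H Dz.
have Tk := Tcoord_has_lin (w := fun y => X (th y)) hx hy ha hb hc.
have lw := inv_dens_has_lin lP lQ W0.
have lp := has_linM lP lw; have lq := has_linM lQ lw.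
have U := flux_has_lin Tv lp lq hxv hyv ha hb Tk.
have V := flux_has_lin Tu lp lq hxu hyu ha hb Tk.
have [-> _] := has_lin_unique lu U; have [_ ->] := has_lin_unique lv V.
clear U V lu lv lp lq lw Tk Tu Tv hx hy hxu hyu htu hxv hyv htv ha hb hc lP lQ hth cx cy ct.
have A0 : area_element th z != 0 by rewrite lt0r_neq0// (area_element_gt0 H Dz).
rewrite /djac (divfK A0).
exact (@divergence_points (th z) (pu th z) (pv th z) (X (th z)) (pu (X \o th) z) (pv (X \o th) z)
  (dens th z) P1 P2 Q1 Q2 xuv yuv tuv W1 (dens_sqr th z)).
Qed.

End chart_divergence.

(** * The integral identity for fields supported in one chart *)

Section stokes.
Context {R : realType}.
Local Notation pt := (R * R * R)%type.
Local Notation leb2 := (@lebesgue_measure R \x @lebesgue_measure R)%E.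
Local Notation leb2m :=
  (leb2 : {measure set (measurableTypeR R * measurableTypeR R) -> \bar R}).
Implicit Types (S U K Q : set pt) (D : set (R * R)) (th : R * R -> pt) (g : pt) (X Y N : pt -> pt).

Lemma surface_cont_integrable S K (f : pt -> R) : C2_surface S -> compact K -> K `<=` S ->
  (forall D th z, local_param S D th -> D z -> {for z, continuous (f \o th)}) ->
  (forall g, S g -> ~ K g -> f g = 0) ->
  (surface_measure S).-integrable S (EFin \o f).
Proof.
move=> HS cK KS cf f0.
have mf : measurable_fun S f.
  apply: (@surf_fun_measurable R S f HS) => D th H.
  by apply: continuous_measurable2; [exact: chart_open H|move=> z; exact: cf].
have [M M0 MP] : exists2 M : R, 0 <= M & forall g, K g -> `|f g| <= M.
  apply: (compact_uniform (P := fun (M : R) (g : pt) => `|f g| <= M) HS cK KS).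
    by move=> M M' g MM' h; exact: le_trans MM'.
  move=> D th d H Dd _; exists (`|(f \o th) d| + 1).
  exact: continuous_bound_near (cf D th d H Dd).
by have [] := surface_integrable HS cK KS mf MP f0.
Qed.

(** The density of the difference between the first variation and the curvature integral; its
    integral is to be shown to vanish. *)
Definition stokes_defect N S X g : R := chart_val S (djac X) g - mean_flux N S X g.

(* [K] plays the role of the support of [X]. *)
Record supported S X K : Prop := Supported {
  spt_surface : C2_surface S;
  spt_field : C2_field S X;
  spt_compact : compact K;
  spt_sub : K `<=` S;
  spt_off : forall g, ~ K g -> X g = 0;
  spt_dens : forall D th d, local_param S D th -> D d -> K (th d) -> 0 < dens th d }.

Lemma spt_closed S X K : supported S X K -> closed K.
Proof. by move=> h; apply: compact_closed (spt_compact h); exact: norm_hausdorff. Qed.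

Lemma dens_pos_open S D th : local_param S D th -> open (D `&` [set y | 0 < dens th y]).
Proof.
move=> H; have -> : [set y | 0 < dens th y] = dens th @^-1` [set x : R | 0 < x] by [].
apply: open_preimage_cont; first exact: chart_open H.
  by move=> y; exact: dens_continuous H.
exact: open_gt.
Qed.

Lemma Tcoord0 g : Tcoord g 0 = 0.
Proof.
change ((0 : R) + (g.1.2 * (0 : R) - g.1.1 * (0 : R)) / 2 = 0).
by rewrite !mulr0 subrr mul0r addr0.
Qed.

Lemma mean_flux_off N S X g : X g = 0 -> mean_flux N S X g = 0.
Proof.
move=> X0; rewrite /mean_flux; have -> : normal_speed N X g = 0.
  rewrite /normal_speed X0 Tcoord0.
  change (pbar N g * (0 : R) + qbar N g * (0 : R) + omegabar N g * (0 : R) = 0).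
  by rewrite !mulr0 !addr0.
by rewrite mulr0 mul0r.
Qed.

Lemma defect_off N S X K g : supported S X K -> S g -> ~ K g -> stokes_defect N S X g = 0.
Proof.
move=> h Sg Kg; rewrite /stokes_defect mean_flux_off ?subr0; last exact: (spt_off h).
have [D [th [H [z Dz e]]]] := spt_surface h Sg; rewrite -e in Kg *.
rewrite (chart_valE (djac_invariant (spt_field h)) H Dz).
have X0 g' : S g' -> ~ K g' -> X g' = 0 by move=> _; exact: spt_off h g'.
by have [_ ->] := jac_off 0 (spt_field h) H (spt_closed h) X0 Dz Kg.
Qed.

Lemma defect_chart N S X D th z (e1 e2 f1 f2 : R) : oriented_C2_surface S N -> C2_field S X ->
  local_param S D th -> D z -> 0 < dens th z ->
  has_lin (flux_u X th) z e1 e2 -> has_lin (flux_v X th) z f1 f2 ->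
  stokes_defect N S X (th z) * area_element th z = e1 - f2.
Proof.
move=> hS cX H Dz W0 lu lv; have [cP cQ _] := chart_cross_C1 H.
have [P1 [P2 lP]] : exists P1 P2 : R, has_lin (chartP th) z P1 P2.
  by have [hP _ _] := C1_on_C1f cP; do 2 eexists; exact (hP z Dz).
have [Q1 [Q2 lQ]] : exists Q1 Q2 : R, has_lin (chartQ th) z Q1 Q2.
  by have [hQ _ _] := C1_on_C1f cQ; do 2 eexists; exact (hQ z Dz).
have e := flux_divergence cX H Dz W0 lP lQ lu lv.
have m := mean_flux_chart X hS H Dz W0 lP lQ.
rewrite /stokes_defect mulrBl (chart_valE (djac_invariant cX) H Dz).
by apply: etrans e; rewrite m opprK.
Qed.

(** In the chart the defect is a divergence over the area element, and the fluxes are of class C^1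
    where [dens > 0]. *)
Lemma defect_continuous_dens N S X D th z : oriented_C2_surface S N -> C2_field S X ->
  local_param S D th -> D z -> 0 < dens th z -> {for z, continuous (stokes_defect N S X \o th)}.
Proof.
move=> hS cX H Dz W0; have oD := chart_open H.
pose D' := D `&` [set y | 0 < dens th y].
have oD' : open D' by exact: dens_pos_open H.
have DD : D' `<=` D by move=> y [].
have Dz' : D' z by [].
have [cu cv] := flux_C1_on cX H oD' DD (fun y Dy => Dy.2).
have [hu hu1 hu2] := C1_on_C1f cu; have [hv hv1 hv2] := C1_on_C1f cv.
have c1 := hu1 z Dz'; have c2 := hv2 z Dz'.
have ca : {for z, continuous (fun y => (area_element th y)^-1)}.
  by apply: cvgV; [rewrite lt0r_neq0// (area_element_gt0 H Dz)|exact: chart_area_continuous H Dz].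
apply: (@continuous_ext_on _ _ D' _ _ z oD' Dz' _ (cvgM (cvgB c1 c2) ca)) => y Dy.
have A0 : area_element th y != 0 by rewrite lt0r_neq0// (area_element_gt0 H Dy.1).
have E := defect_chart hS cX H Dy.1 Dy.2 (hu y Dy) (hv y Dy).
exact (etrans (congr1 (fun x => x / area_element th y) (esym E)) (mulfK A0 _)).
Qed.

Lemma defect_continuous N S X K D th z : oriented_C2_surface S N -> supported S X K ->
  local_param S D th -> D z -> {for z, continuous (stokes_defect N S X \o th)}.
Proof.
move=> hS h H Dz; have oD := chart_open H.
have [Kz|Kz] := pselect (K (th z)).
  exact: defect_continuous_dens hS (spt_field h) H Dz (spt_dens h H Dz Kz).
have oDK := chart_preimage_open H (closed_openC (spt_closed h)).
apply: (@continuous_ext_on _ _ (D `&` th @^-1` (~` K)) (fun=> 0 : R)) => //.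
  by move=> y [Dy Ky]; rewrite /= (defect_off N h)//; exact: chart_surf H Dy.
exact: cst_continuous.
Qed.

Lemma defect_integrable N S X K : oriented_C2_surface S N -> supported S X K ->
  (surface_measure S).-integrable S (EFin \o stokes_defect N S X).
Proof.
move=> hS h; apply: (surface_cont_integrable (spt_surface h) (spt_compact h) (spt_sub h)).
  by move=> D th z H Dz; exact: defect_continuous hS h H Dz.
by move=> g; exact: defect_off.
Qed.

(** The defect vanishes off [K], so its integral can be computed in the one chart, where it becomes
    the integral over the plane of a divergence with compact support. *)
Lemma local_stokes N S X K D th : oriented_C2_surface S N -> supported S X K ->
  local_param S D th -> K `<=` th @` D ->
  (\int[surface_measure S]_(g in S) (stokes_defect N S X g)%:E = 0)%E.
Proof.
move=> hS h H KD; have oD := chart_open H; have HS := spt_surface h.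
have mD : measurable D by exact: open_measurable2.
have DS : th @` D `<=` S by move=> _ [z Dz <-]; exact: chart_surf H Dz.
have cZ z : D z -> {for z, continuous (stokes_defect N S X \o th)} by exact: (defect_continuous hS h H).
have -> : (\int[surface_measure S]_(g in S) (stokes_defect N S X g)%:E =
    \int[surface_measure S]_(g in th @` D) (stokes_defect N S X g)%:E)%E.
  rewrite -[in RHS](setIidr DS) integral_mkcondr; apply: eq_integral => g /[!inE] Sg.
  rewrite patchE; case: ifPn => //; rewrite notin_setE => Kg.
  by rewrite (defect_off N h Sg)// => /KD.
rewrite (integral_chart HS H mD (@subset_refl _ D)); last exact: continuous_measurable2.
pose L := D `&` th @^-1` K.
have cL : compact L.
  have -> : L = chart_inv D th @` K.
    apply/seteqP; split=> [z [Dz Kz]|_ [g Kg <-]].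
      by exists (th z) => //; exact: chart_invK H Dz.
    by have [z Dz e] := KD g Kg; rewrite -e (chart_invK H Dz); split => //; rewrite /preimage /= e.
  apply: continuous_compact; last exact: spt_compact h.
  apply/subspace_continuousP => g Kg; have [z Dz e] := KD g Kg.
  subst g; move=> A zA.
  have {}zA : nbhs (chart_inv D th (th z)) A by exact zA.
  rewrite (chart_invK H Dz) in zA.
  have [Q [oQ Qz QP]] := chart_inv_near H Dz zA.
  change (nbhs (th z) (fun y => K y -> A (chart_inv D th y))).
  apply: filterS (open_nbhs_nbhs (conj oQ Qz)) => y Qy Ky.
  by have [_ ? _] := QP y (spt_sub h Ky) Qy.
have clL : closed L by apply: compact_closed => //; exact: norm_hausdorff.
(* The fluxes contain [1 / dens] and are of class C^1 only on [D']. The support [L] lies in [D'], so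
   their extensions by zero from [D'] are of class C^1 on the whole plane. *)
pose D' := D `&` [set y | 0 < dens th y].
have oD' : open D' by exact: dens_pos_open H.
have LD : L `<=` D' by move=> z [Dz Kz]; split => //; exact: spt_dens h _ _ _ H Dz Kz.
have DD : D' `<=` D by move=> y [].
have [cu cv] := flux_C1_on (spt_field h) H oD' DD (fun y Dy => Dy.2).
have off z : D' z -> ~ L z -> X (th z) = 0.
  by move=> [Dz _] Lz; apply: (spt_off h) => Kz; apply: Lz.
have f0 t p q x y k z : (forall w, X (th w) = 0 -> k w = 0) -> X (th z) = 0 ->
    flux t p q x y (fun y => (X (th y)).1.1) (fun y => (X (th y)).1.2) k z = 0.
  move=> k0 X0; rewrite /flux k0// X0.
  change (t z * (p z * (0 : R) - q z * (0 : R)) - 0 * (p z * y z - q z * x z) = 0).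
  by rewrite !mulr0 subrr mulr0 mul0r subrr.
have k0 w : X (th w) = 0 -> Tcoord (th w) (X (th w)) = 0.
  by move=> ->; exact: Tcoord0.
have ceu := C1_on_extend0 oD' clL LD cu (fun z Dz Lz => f0 _ _ _ _ _ _ z k0 (off z Dz Lz)).
have cev := C1_on_extend0 oD' clL LD cv (fun z Dz Lz => f0 _ _ _ _ _ _ z k0 (off z Dz Lz)).
pose eu z : R := if `[<D' z>] then flux_u X th z else 0.
pose ev z : R := if `[<D' z>] then flux_v X th z else 0.
have eu0 z : ~ L z -> eu z = 0.
  by move=> Lz; rewrite /eu; case: asboolP => // Dz; exact: f0 k0 (off z Dz Lz).
have ev0 z : ~ L z -> ev z = 0.
  by move=> Lz; rewrite /ev; case: asboolP => // Dz; exact: f0 k0 (off z Dz Lz).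
have [eu1 [eu2 Cu]] : exists eu1 eu2, C1f setT eu eu1 eu2 by do 2 eexists; exact (C1_on_C1f ceu).
have [ev1 [ev2 Cv]] : exists ev1 ev2, C1f setT ev ev1 ev2 by do 2 eexists; exact (C1_on_C1f cev).
have [iu _ Iu _] := plane_stokes cL Cu eu0; have [_ iv _ Iv] := plane_stokes cL Cv ev0.
have nD z : D' z -> \forall y \near z, D' y by move=> Dz; exact: open_nbhs_nbhs.
have [hu _ _] := Cu; have [hv _ _] := Cv.
have id z : D' z -> stokes_defect N S X (th z) * area_element th z = eu1 z - ev2 z.
  move=> Dz; apply: (defect_chart hS (spt_field h) H Dz.1 Dz.2 (e2 := eu2 z) (f1 := ev1 z)).
    by apply: near_has_lin (hu z I); apply: filterS (nD z Dz) => y Dy; rewrite /eu; case: asboolP.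
  by apply: near_has_lin (hv z I); apply: filterS (nD z Dz) => y Dy; rewrite /ev; case: asboolP.
have zero (e e1 e2 : R * R -> R) z : (forall z, ~ L z -> e z = 0) ->
    (forall z, setT z -> has_lin e z (e1 z) (e2 z)) -> ~ L z -> e1 z = 0 /\ e2 z = 0.
  move=> e0 he Lz; have oL : open (~` L) by exact: closed_openC.
  have n0 : \forall y \near z, 0 = e y.
    by apply: filterS (open_nbhs_nbhs (conj oL Lz)) => y /e0 ->.
  exact: has_lin_unique (he z I) (near_has_lin n0 (has_lin_cst 0 z)).
transitivity (\int[leb2m]_z ((eu1 z)%:E - (ev2 z)%:E))%E; last first.
  by rewrite (integralB_EFin measurableT iu iv) Iu Iv sube0.
rewrite integral_mkcond; apply: eq_integral => z _; rewrite patchE -EFinB.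
have [Lz|Lz] := pselect (L z).
  rewrite (id z (LD z Lz)); case: ifPn => //; rewrite notin_setE => Dz.
  by case: Dz; exact: Lz.1.
have [-> _] := zero _ _ _ z eu0 hu Lz; have [_ ->] := zero _ _ _ z ev0 hv Lz.
rewrite subrr; case: ifPn => //; rewrite inE => Dz.
have Kz : ~ K (th z) by move=> Kz; apply: Lz.
by rewrite (defect_off N h (chart_surf H Dz) Kz) mul0r.
Qed.

End stokes.

(** * Additivity in the field and the partition of unity *)

Section partition.
Context {R : realType}.
Local Notation pt := (R * R * R)%type.
Implicit Types (S U K Q : set pt) (D : set (R * R)) (th : R * R -> pt) (g : pt) (X Y N : pt -> pt).

Lemma C2_fieldD S X Y : C2_field S X -> C2_field S Y -> C2_field S (fun g => X g + Y g).
Proof.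
move=> cX cY D th H; have oD := chart_open H.
have [x1 x2 x3] := cX D th H; have [y1 y2 y3] := cY D th H.
by split; [exact (C2_onD oD x1 y1)|exact (C2_onD oD x2 y2)|exact (C2_onD oD x3 y3)].
Qed.

Lemma dcrossD g (v w xi xi' dv dv' dw dw' : pt) :
  dcrossP g (xi + xi') v w (dv + dv') (dw + dw') =
    dcrossP g xi v w dv dw + dcrossP g xi' v w dv' dw' /\
  dcrossQ g (xi + xi') v w (dv + dv') (dw + dw') =
    dcrossQ g xi v w dv dw + dcrossQ g xi' v w dv' dw'.
Proof.
have add (a b : pt) : [/\ (a + b).1.1 = a.1.1 + b.1.1, (a + b).1.2 = a.1.2 + b.1.2 &
  (a + b).2 = a.2 + b.2] by [].
have TD (a b : pt) : Tcoord g (a + b) = Tcoord g a + Tcoord g b.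
  by have [e1 e2 e3] := add a b; rewrite /Tcoord e1 e2 e3; field.
have dD (u a b : pt) : dtau g (xi + xi') u (a + b) = dtau g xi u a + dtau g xi' u b.
  by have [e1 e2 _] := add xi xi'; rewrite /dtau TD e1 e2; field.
have [a1 a2 _] := add dv dv'; have [b1 b2 _] := add dw dw'.
rewrite /dcrossP /dcrossQ !dD a1 a2 b1 b2.
move: (Tcoord g v) (Tcoord g w) (dtau g xi v dv) (dtau g xi' v dv') (dtau g xi w dw) (dtau g xi' w dw').
by move=> *; split; ring.
Qed.

Lemma djacD S X Y D th z : C2_field S X -> C2_field S Y -> local_param S D th -> D z ->
  djac (fun g => X g + Y g) th z = djac X th z + djac Y th z.
Proof.
move=> cX cY H Dz.
have [h1 h2 h3] := field_lin3 cX H Dz; have [k1 k2 k3] := field_lin3 cY H Dz.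
have [e1 e2] := has_lin3_pu (And3 (has_linD h1 k1) (has_linD h2 k2) (has_linD h3 k3) :
  has_lin3 ((fun g => X g + Y g) \o th) z (pu (X \o th) z + pu (Y \o th) z)
    (pv (X \o th) z + pv (Y \o th) z)).
have [d1 d2] := dcrossD (th z) (pu th z) (pv th z) (X (th z)) (Y (th z)) (pu (X \o th) z)
  (pu (Y \o th) z) (pv (X \o th) z) (pv (Y \o th) z).
have f1 : chartdP (fun g => X g + Y g) th z = chartdP X th z + chartdP Y th z.
  by rewrite {1}/chartdP e1 e2; exact d1.
have f2 : chartdQ (fun g => X g + Y g) th z = chartdQ X th z + chartdQ Y th z.
  by rewrite {1}/chartdQ e1 e2; exact d2.
have alg (P Q p q p' q' W A : R) : (P * (p + p') + Q * (q + q')) / W / A =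
  (P * p + Q * q) / W / A + (P * p' + Q * q') / W / A by ring.
by rewrite /djac f1 f2; exact (alg _ _ _ _ _ _ _ _).
Qed.

Lemma normal_speedD N X Y g : normal_speed N (fun g => X g + Y g) g =
  normal_speed N X g + normal_speed N Y g.
Proof.
rewrite /normal_speed; move: (X g) (Y g) => a b.
have TD : Tcoord g (a + b) = Tcoord g a + Tcoord g b.
  change (a.2 + b.2 + (g.1.2 * (a.1.1 + b.1.1) - g.1.1 * (a.1.2 + b.1.2)) / 2 =
     Tcoord g a + Tcoord g b); by rewrite /Tcoord; field.
rewrite TD; change (pbar N g * (a.1.1 + b.1.1) + qbar N g * (a.1.2 + b.1.2) +
  omegabar N g * (Tcoord g a + Tcoord g b) = pbar N g * a.1.1 + qbar N g * a.1.2 +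
  omegabar N g * Tcoord g a + (pbar N g * b.1.1 + qbar N g * b.1.2 + omegabar N g * Tcoord g b)).
by move: (pbar N g) (qbar N g) (omegabar N g) (Tcoord g a) (Tcoord g b) => *; ring.
Qed.

Lemma defectD N S X Y g : C2_surface S -> C2_field S X -> C2_field S Y -> S g ->
  stokes_defect N S (fun g => X g + Y g) g = stokes_defect N S X g + stokes_defect N S Y g.
Proof.
move=> HS cX cY Sg; have [D [th [H [z Dz <-]]]] := HS g Sg.
have e0 := chart_valE (djac_invariant (C2_fieldD cX cY)) H Dz.
have e1 := chart_valE (djac_invariant cX) H Dz; have e2 := chart_valE (djac_invariant cY) H Dz.
have alg (c a b ns n1 n2 k w : R) : c = a + b -> ns = n1 + n2 ->
  c - k * ns * w = (a - k * n1 * w) + (b - k * n2 * w) by move=> -> ->; ring.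
rewrite /stokes_defect /mean_flux; apply: alg (normal_speedD N X Y (th z)).
exact (etrans e0 (etrans (djacD cX cY H Dz) (esym (congr2 +%R e1 e2)))).
Qed.

(** The vanishing of the integral is bundled with what makes it stable under sums: regularity, by
    which the defect is additive, and integrability, by which the integrals add. *)
Definition stokes_holds N S X : Prop :=
  [/\ C2_field S X, (surface_measure S).-integrable S (EFin \o stokes_defect N S X) &
      (\int[surface_measure S]_(g in S) (stokes_defect N S X g)%:E = 0)%E].

Lemma stokes_holdsD N S X Y : C2_surface S -> stokes_holds N S X -> stokes_holds N S Y ->
  stokes_holds N S (fun g => X g + Y g).
Proof.
move=> HS [cX iX IX] [cY iY IY]; have mS := surface_measurable HS.
split; first exact: C2_fieldD.
  apply: (@eq_integrable _ _ _ _ _ mS ((EFin \o stokes_defect N S X) \+ (EFin \o stokes_defect N S Y))%E).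
    by move=> g /[!inE] Sg; rewrite /= (defectD N HS cX cY Sg).
  exact: integrableD.
transitivity (\int[surface_measure S]_(g in S) ((stokes_defect N S X g)%:E + (stokes_defect N S Y g)%:E))%E.
  by apply: eq_integral => g /[!inE] Sg; rewrite (defectD N HS cX cY Sg).
by rewrite (integralD mS iX iY) IX IY adde0.
Qed.

Definition obox (i : pt * R) : set pt := [set g | [/\ `|g.1.1 - i.1.1.1| < i.2,
  `|g.1.2 - i.1.1.2| < i.2 & `|g.2 - i.1.2| < i.2]].

(** For [i.2 > 0], positive on the open box with centre [i.1] and half side [i.2], and zero
    elsewhere. The cubes give class C^2. *)
Definition bump (i : pt * R) g : R :=
  pos (i.2 ^+ 2 - (g.1.1 - i.1.1.1) ^+ 2) ^+ 3 * pos (i.2 ^+ 2 - (g.1.2 - i.1.1.2) ^+ 2) ^+ 3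
  * pos (i.2 ^+ 2 - (g.2 - i.1.2) ^+ 2) ^+ 3.

Lemma pos_ge0 (x : R) : 0 <= pos x.
Proof. by rewrite /pos le_max lexx orbT. Qed.

Lemma bump_ge0 i g : 0 <= bump i g.
Proof.
have p (x : R) : 0 <= pos x ^+ 3 by rewrite exprn_ge0// pos_ge0.
exact: mulr_ge0 (mulr_ge0 (p _) (p _)) (p _).
Qed.

Lemma pos_sqr_gt0 (r x : R) : 0 < r -> (0 < pos (r ^+ 2 - x ^+ 2)) = (`|x| < r).
Proof.
move=> r0; rewrite /pos lt_max ltxx orbF subr_gt0 -[x ^+ 2]real_normK ?num_real//.
by rewrite ltr_sqr ?nnegrE// ltW.
Qed.

Lemma bump_gt0 i g : 0 < i.2 -> obox i g -> 0 < bump i g.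
Proof.
move=> r0 [h1 h2 h3].
have p (x : R) : `|x| < i.2 -> 0 < pos (i.2 ^+ 2 - x ^+ 2) ^+ 3.
  by move=> xi; rewrite exprn_gt0// pos_sqr_gt0.
exact: mulr_gt0 (mulr_gt0 (p _ h1) (p _ h2)) (p _ h3).
Qed.

Lemma bump_off i g : 0 < i.2 -> ~ obox i g -> bump i g = 0.
Proof.
move=> r0 nb; apply/eqP; apply/negPn/negP => b0; apply: nb.
have np (x : R) : pos (i.2 ^+ 2 - x ^+ 2) ^+ 3 != 0 -> `|x| < i.2.
  by rewrite expf_eq0 /= => p0; rewrite -pos_sqr_gt0// lt0r p0 pos_ge0.
move: b0; rewrite /bump mulf_eq0 negb_or => /andP[+ /np h3].
by rewrite mulf_eq0 negb_or => /andP[/np h1 /np h2]; split.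
Qed.

Lemma bump_C2 S D th i : local_param S D th -> C2_on D (bump i \o th).
Proof.
move=> H; have oD := chart_open H; have [[cx cy ct] _ _] := chart_C1 H.
have one (f : R * R -> R) (c : R) : C2_on D f -> C2_on D (fun z => pos (i.2 ^+ 2 - (f z - c) ^+ 2) ^+ 3).
  move=> cf; apply: (C2_on_pos3 oD).
  have cfc := C2_onD oD cf (C2_on_cst (- c) oD).
  have h := C2_onD oD (C2_on_cst (i.2 ^+ 2) oD) (C2_onM oD (C2_on_cst (- 1) oD) (C2_onM oD cfc cfc)).
  by apply: (C2_on_ext oD _ h) => z _; rewrite mulN1r.
exact (C2_onM oD (C2_onM oD (one _ i.1.1.1 cx) (one _ i.1.1.2 cy)) (one _ i.1.2 ct)).
Qed.

Definition bump_sum (s : seq (pt * R)) g : R := \sum_(i <- s) bump i g.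

Lemma bump_sum_C2 S D th s : local_param S D th -> C2_on D (bump_sum s \o th).
Proof.
move=> H; have oD := chart_open H; elim: s => [|i s IH].
  by apply: (C2_on_ext oD _ (C2_on_cst 0 oD)) => z _; rewrite /= /bump_sum big_nil.
by apply: (C2_on_ext oD _ (C2_onD oD (bump_C2 i H) IH)) => z _; rewrite /= /bump_sum big_cons.
Qed.

Lemma C2_on_inv (D : set (R * R)) (f : R * R -> R) : open D -> C2_on D f -> (forall z, D z -> 0 < f z) ->
  C2_on D (fun z => (f z)^-1).
Proof.
move=> oD cf f0.
have dI (x : R) : x != 0 -> is_derive x (1 : R) (fun y : R => y^-1) (- (x^-1 * x^-1)).
  move=> x0; apply: DeriveDef; first exact: (derivableV (f := id)).
  rewrite (deriveV (f := id))// derive_id -[_ *: _]/(_ * _) mulr1.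
  by rewrite -exprVn expr2.
have cI (x : R) : x != 0 -> {for x, continuous (fun y : R => y^-1)}.
  by move=> x0; apply: cvgV => //; exact: cvg_id.
have n0 z : D z -> f z != 0 by move=> Dz; rewrite lt0r_neq0// f0.
apply: (C2_on_comp1 (k := fun y => y^-1) (k' := fun y => - (y^-1 * y^-1))
  (k'' := fun y => 2 * (y^-1 * y^-1 * y^-1)) oD cf).
- by move=> z Dz; exact: dI (n0 z Dz).
- move=> z Dz; have d := dI _ (n0 z Dz).
  have D0 := @is_deriveN R R R _ _ _ _ (@is_deriveM R R _ _ _ _ _ _ d d).
  by apply: (is_derive_eq D0); rewrite -![_ *: _]/(_ * _); ring.
- move=> z Dz; have c := cI _ (n0 z Dz).
  by apply: cvgM; [exact: cvg_cst|apply: cvgM => //; apply: cvgM].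
Qed.

Definition cbox (i : pt * R) : set pt := [set g | [/\ `|g.1.1 - i.1.1.1| <= i.2,
  `|g.1.2 - i.1.1.2| <= i.2 & `|g.2 - i.1.2| <= i.2]].

Lemma cbox_closed i : closed (cbox i).
Proof.
have cl (pr : pt -> R) (c : R) : continuous pr -> closed [set g | `|pr g - c| <= i.2].
  move=> cpr; have -> : [set g | `|pr g - c| <= i.2] = (fun g => `|pr g - c|) @^-1` [set x | x <= i.2] by [].
  apply: closed_comp; last exact: closed_le.
  by move=> g _; apply: cvg_norm; apply: cvgB; [exact: cpr|exact: cvg_cst].
have -> : cbox i = [set g | `|g.1.1 - i.1.1.1| <= i.2] `&` [set g | `|g.1.2 - i.1.1.2| <= i.2]
    `&` [set g | `|g.2 - i.1.2| <= i.2].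
  by apply/seteqP; split=> g /=; [move=> [? ? ?]|move=> [[? ?] ?]].
apply: closedI; first apply: closedI.
- apply: (cl (fun g => g.1.1)) => g; apply: (@continuous_comp _ _ _ fst fst); exact: cvg_fst.
- apply: (cl (fun g => g.1.2)) => g; apply: (@continuous_comp _ _ _ fst snd); [exact: cvg_fst|exact: cvg_snd].
- apply: (cl snd) => g; exact: cvg_snd.
Qed.

(** One term of [X] in the partition of unity. Where the sum of the bumps vanishes the quotient is
    0, which is harmless: the sum is positive wherever [X] is not zero. *)
Definition bump_field (s : seq (pt * R)) X i g : pt := (bump i g / bump_sum s g) *: X g.

(** The quotient is of class C^2 on the open set where the sum is positive, which contains [K], and
    the field is zero off [K]; the two open sets cover the chart. *)
Lemma bump_field_supported S X K s i : supported S X K -> 0 < i.2 ->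
  (forall g, K g -> 0 < bump_sum s g) -> supported S (bump_field s X i) (K `&` cbox i).
Proof.
move=> h r0 s0; split; first exact: spt_surface h.
- move=> D th H; have oD := chart_open H; have [x1 x2 x3] := spt_field h H.
  have cs := bump_sum_C2 s H; have cb := bump_C2 i H.
  pose D1 := D `&` [set z | 0 < bump_sum s (th z)]; pose D2 := D `&` th @^-1` (~` K).
  have oD1 : open D1.
    rewrite /D1; have -> : [set z | 0 < bump_sum s (th z)] = (bump_sum s \o th) @^-1` [set x : R | 0 < x] by [].
    apply: open_preimage_cont; [exact: oD| |exact: open_gt].
    by move=> z Dz; case: cs => cs _; exact (C1_on_continuous cs Dz).
  have oD2 : open D2 by apply: chart_preimage_open H _; exact: closed_openC (spt_closed h).
  have key (pr : pt -> R) : C2_on D (fun z => pr (X (th z))) -> (forall c g, pr (c *: g) = c * pr g) ->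
      C2_on D (fun z => pr (bump_field s X i (th z))).
    move=> cx prl; apply: C2_on_local => z Dz.
    have [Kz|Kz] := pselect (K (th z)).
      exists D1; first by split => //; exact: s0.
      have D1D : D1 `<=` D by move=> y [].
      have q := C2_on_inv oD1 (C2_on_sub D1D cs) (fun y Dy => Dy.2).
      have m := C2_onM oD1 (C2_onM oD1 (C2_on_sub D1D cb) q) (C2_on_sub D1D cx).
      by apply: (C2_on_ext oD1 _ m) => y _; rewrite /bump_field prl.
    exists D2; first by split.
    apply: (C2_on_ext oD2 _ (C2_on_cst 0 oD2)) => y [_ Ky].
    by rewrite /bump_field prl (spt_off h Ky) -[X in pr X](scale0r (0 : pt)) prl mul0r mulr0.
  by split; [exact (key (fun p => p.1.1) x1 (fun _ _ => erefl))
    |exact (key (fun p => p.1.2) x2 (fun _ _ => erefl))|exact (key (fun p => p.2) x3 (fun _ _ => erefl))].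
- apply: (@subclosed_compact _ _ K) => //; [|exact: spt_compact h].
  apply: closedI; first exact: spt_closed h.
  exact: cbox_closed.
- by move=> g [Kg _]; exact: spt_sub h g Kg.
- move=> g nKB; rewrite /bump_field; have [Kg|Kg] := pselect (K g); last by rewrite (spt_off h Kg) scaler0.
  rewrite bump_off ?mul0r ?scale0r// => -[h1 h2 h3]; apply: nKB; split => //.
  by split; exact: ltW.
- by move=> D th d H Dd [Kd _]; exact: spt_dens h _ _ _ H Dd Kd.
Qed.

End partition.

(** * The integral identity on the whole surface *)

Section global_stokes.
Context {R : realType}.
Local Notation pt := (R * R * R)%type.
Implicit Types (S U K Q : set pt) (D : set (R * R)) (th : R * R -> pt) (g : pt) (X Y N : pt -> pt).

Lemma obox_open (i : pt * R) : open (obox i).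
Proof.
rewrite openE => g [h1 h2 h3]; apply/near_box3.
exists (Num.min (i.2 - `|g.1.1 - i.1.1.1|) (Num.min (i.2 - `|g.1.2 - i.1.1.2|) (i.2 - `|g.2 - i.1.2|))).
  by rewrite !lt_min !subr_gt0 h1 h2 h3.
have tri (x y c d : R) : `|y - x| < d - `|x - c| -> `|y - c| < d.
  rewrite ltrBrDr; apply: le_lt_trans; rewrite -(subrKA x y (- c)).
  exact: ler_normD.
move=> y; rewrite !lt_min => /andP[a1 /andP[_ _]] /andP[_ /andP[a2 _]] /andP[_ /andP[_ a3]].
by split; [exact: tri a1|exact: tri a2|exact: tri a3].
Qed.

(** A finite subcover by open boxes. The closed boxes, which contain the supports of the bumps, must
    still meet [S] inside a single chart; the half side [d / 2] leaves room for this. *)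
Lemma chart_boxes S K : C2_surface S -> compact K -> K `<=` S -> exists s : seq (pt * R),
  (forall i, i \in s -> 0 < i.2 /\ exists D th, local_param S D th /\
    forall g, S g -> `|g.1.1 - i.1.1.1| <= i.2 -> `|g.1.2 - i.1.1.2| <= i.2 ->
      `|g.2 - i.1.2| <= i.2 -> (th @` D) g) /\
  forall g, K g -> exists2 i, i \in s & obox i g.
Proof.
move=> HS cK KS.
pose good : set (pt * R) := [set i | 0 < i.2 /\ exists D th, local_param S D th /\
    forall g, S g -> `|g.1.1 - i.1.1.1| <= i.2 -> `|g.1.2 - i.1.1.2| <= i.2 ->
      `|g.2 - i.1.2| <= i.2 -> (th @` D) g].
have cov g : K g -> exists2 i, good i & obox i g.
  move=> Kg; have [D [th [H [z Dz e]]]] := HS g (KS g Kg).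
  have [Q oQ EQ] := chart_image H.
  have Qg : Q g by have : (th @` D) g by [exists z]; rewrite EQ => -[].
  have [d d0 dP] := (near_box3 _ _).1 (open_nbhs_nbhs (conj oQ Qg)).
  have d2 : 0 < d / 2 by rewrite divr_gt0.
  have dd : d / 2 < d by rewrite ltr_pdivrMr// ltr_pMr// ltr1n.
  exists (g, d / 2) => /=; last by split; rewrite /= subrr normr0.
  split => //; exists D, th; split => // g' Sg' h1 h2 h3; rewrite EQ; split => //.
  by apply: dP; [exact: le_lt_trans h1 dd|exact: le_lt_trans h2 dd|exact: le_lt_trans h3 dd].
pose goods (s : seq (pt * R)) := forall i, i \in s -> good i.
(* the finite families of boxes, directed by inclusion *)
pose F : set_system (seq (pt * R)) := [set A | exists2 s0, goods s0 &
  forall s, goods s -> {subset s0 <= s} -> A s].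
have FF : Filter F.
  split.
  - by exists [::].
  - move=> A1 A2 [s1 g1 h1] [s2 g2 h2]; exists (s1 ++ s2).
      by move=> i; rewrite mem_cat => /orP[/g1|/g2].
    move=> s gs sub; split; [apply: h1 => // i is1|apply: h2 => // i is2];
      apply: sub; rewrite mem_cat ?is1 ?is2 ?orbT//.
  - by move=> A1 A2 sub [s0 g0 h0]; exists s0 => // s gs /(h0 s gs); exact: sub.
have [s0 gs0 h0] : F [set s : seq (pt * R) | K `<=` [set g | exists2 i, i \in s & obox i g]].
  apply: ((compact_near_coveringP K).1 cK _ F (fun (s : seq (pt * R)) g => exists2 i, i \in s & obox i g) FF) => g Kg.
  have [i gi ig] := cov g Kg.
  exists (obox i, [set s : seq (pt * R) | i \in s]) => /=.
    split; first by apply: open_nbhs_nbhs; split => //; exact: obox_open.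
    exists [:: i]; first by move=> j; rewrite inE => /eqP ->.
    by move=> s gs sub /=; apply: sub; rewrite inE.
  by move=> [g' s] /= [g'i si]; exists i.
exists s0; split; first exact: gs0.
exact: h0 gs0 (fun _ h => h).
Qed.

Lemma stokes N S X K : oriented_C2_surface S N -> supported S X K -> stokes_holds N S X.
Proof.
move=> hS h; have HS := spt_surface h.
have [s [sg sK]] := chart_boxes HS (spt_compact h) (spt_sub h).
have s0 g : K g -> 0 < bump_sum s g.
  move=> /sK[i si gi]; rewrite /bump_sum (big_rem i)//=.
  apply: ltr_wpDr; last by apply: bump_gt0 => //; case: (sg i si).
  by apply: sumr_ge0 => j _; exact: bump_ge0.
have zero : stokes_holds N S (fun=> 0).
  have h0 : supported S (fun=> 0) set0.
    split => //; [|exact: compact0].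
    move=> D th H; have oD := chart_open H.
    by split; exact (C2_on_cst 0 oD).
  split; [exact: spt_field h0|exact: defect_integrable hS h0|].
  exact: local_stokes hS h0 (local_param0 S (fun=> 0)) (@sub0set _ _).
(* The induction runs over parts [t] of the family, while the denominator of [bump_field] keeps the
   sum over the whole of [s]. *)
have part t : {subset t <= s} -> stokes_holds N S (fun g => \sum_(i <- t) bump_field s X i g).
  elim: t => [|i t IH] ts.
    by have -> : (fun g => \sum_(i <- [::]) bump_field s X i g) = (fun=> 0) by
      apply/funext => g; rewrite big_nil.
  have -> : (fun g => \sum_(j <- i :: t) bump_field s X j g) =
     (fun g => bump_field s X i g + \sum_(j <- t) bump_field s X j g).
    by apply/funext => g; rewrite big_cons.
  have {}IH := IH (fun j jt => ts j (mem_behead (s := i :: t) jt)).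
  apply: (stokes_holdsD HS _ IH).
  have si : i \in s by apply: ts; rewrite mem_head.
  have [i0 [D [th [H cH]]]] := sg i si.
  have hi := bump_field_supported h i0 s0.
  split; [exact: spt_field hi|exact: defect_integrable hS hi|].
  apply: (local_stokes hS hi H) => g [Kg [h1 h2 h3]].
  by apply: cH => //; exact: spt_sub h g Kg.
(* On [K] the quotients add up to 1; off [K] both sides are zero. *)
have -> : X = fun g => \sum_(i <- s) bump_field s X i g.
  apply/funext => g; have [Kg|Kg] := pselect (K g).
    rewrite /bump_field -scaler_suml -mulr_suml -/(bump_sum s g) divff ?scale1r//.
    by rewrite lt0r_neq0// s0.
  by rewrite (spt_off h Kg) big1// => i _; rewrite /bump_field (spt_off h Kg) scaler0.
exact: part.
Qed.

Lemma djac_chart_integrable S X K : supported S X K ->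
  (surface_measure S).-integrable S (EFin \o chart_val S (djac X)).
Proof.
move=> h; have HS := spt_surface h; have cX := spt_field h; have clK := spt_closed h.
have X0 g : S g -> ~ K g -> X g = 0 by move=> _; exact: spt_off h g.
apply: (surface_cont_integrable HS (spt_compact h) (spt_sub h)) => [D th z H Dz|g Sg].
  have oD := chart_open H.
  refine (continuous_ext_on oD Dz (fun y Dy => esym (chart_valE (djac_invariant cX) H Dy)) _).
  have [Kz|Kz] := pselect (K (th z)).
    exact: djac_continuous cX H Dz (spt_dens h H Dz Kz).
  have oDK := chart_preimage_open H (closed_openC clK).
  have z0 y : (D `&` th @^-1` (~` K)) y -> (0 : R) = djac X th y.
    by move=> [Dy Ky]; have [_ e] := jac_off 0 cX H clK X0 Dy Ky; exact (esym e).
  have c0 : {for z, continuous (fun=> 0 : R)} by exact: cst_continuous.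
  exact (continuous_ext_on oDK (conj Dz Kz) z0 c0).
have [D [th [H [z Dz <-]]]] := HS g Sg => Kz.
have [_ e] := jac_off 0 cX H clK X0 Dz Kz.
exact (etrans (chart_valE (djac_invariant cX) H Dz) e).
Qed.

Lemma integral_mean_flux N S X K : oriented_C2_surface S N -> supported S X K ->
  (\int[surface_measure S]_(g in S) (mean_flux N S X g)%:E =
   (Rintegral (surface_measure S) S (chart_val S (djac X)))%:E)%E.
Proof.
move=> hS h; have mS := surface_measurable (spt_surface h).
have [_ iZ IZ] := stokes hS h; have iJ := djac_chart_integrable h.
transitivity (\int[surface_measure S]_(g in S)
   ((chart_val S (djac X) g)%:E - (stokes_defect N S X g)%:E))%E.
  apply: eq_integral => g _; rewrite -EFinB; congr EFin.
  by rewrite /stokes_defect opprB addrC subrK.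
rewrite (integralB_EFin mS iJ iZ) IZ sube0 /Rintegral fineK//.
exact: integrable_fin_num iJ.
Qed.

End global_stokes.

(** * First variation and stationary surfaces *)

Section variation_of_perimeter.
Context {R : realType}.
Local Notation pt := (R * R * R)%type.
Implicit Types (S U K Q M : set pt) (D : set (R * R)) (th : R * R -> pt) (g : pt) (X Y N : pt -> pt).

Lemma local_param_into S M D th : local_param S D th -> M `<=` S -> (forall z, D z -> M (th z)) ->
  local_param M D th.
Proof.
move=> [oD c2 im inj hom] MS DM; split => // A oA AD; have [Q oQ E] := hom A oA AD.
exists Q => //; apply/seteqP; split=> [_ [z Az <-]|g [Mg Qg]].
  split; first exact: DM (AD z Az).
  by have : (th @` A) (th z) by [exists z]; rewrite E => -[].
by rewrite E; split => //; exact: MS.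
Qed.

Lemma charset_dens S N D th z : oriented_C2_surface S N -> local_param S D th -> D z ->
  charset N S (th z) <-> dens th z = 0.
Proof.
move=> [_ _ nN] H Dz; have Sz := chart_surf H Dz; have e := WN_dens0 H Dz (nN _ Sz).
by split=> [[_ /eqP]|d0]; [rewrite e => /eqP|split => //; apply/eqP; rewrite e d0].
Qed.

(** [a] is regular in charts of the non-characteristic part. Its support is closed and avoids the
    characteristic set, so every other point has a neighbourhood where [a] is zero, and regularity
    extends to all charts of [S]. *)
Lemma C2_0_chart S N a D th : oriented_C2_surface S N -> C2_0 (S `\` charset N S) a ->
  local_param S D th -> C2_on D (a \o th).
Proof.
move=> hS [cf cK KM] H; have oD := chart_open H; apply: C2_on_local => z Dz.
have [Kz|Kz] := pselect (closure [set g | a g != 0] (th z)).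
  exists (D `&` [set y | 0 < dens th y]).
    split => //=; rewrite lt0r dens_ge0 andbT; apply/eqP => d0.
    by case: (KM _ Kz) => _; apply; apply/(charset_dens hS H Dz).
  apply: cf; have oD' := dens_pos_open H.
  apply: (local_param_into (chart_sub H oD' (@subIsetl _ _ _))); first by move=> g [].
  move=> y [Dy /= dy]; split; first exact: chart_surf H Dy.
  by move=> /(charset_dens hS H Dy) d0; rewrite d0 ltxx in dy.
have oK : open (~` closure [set g | a g != 0]) by apply: closed_openC; exact: closed_closure.
have oD2 := chart_preimage_open H oK.
exists (D `&` th @^-1` (~` closure [set g | a g != 0])) => //.
apply: (C2_on_ext oD2 _ (C2_on_cst 0 oD2)) => y [_ Ky] /=.
apply/esym/eqP/negPn/negP => ay; apply: Ky; exact: subset_closure.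
Qed.

Lemma vfield_coord (a b k : pt -> R) g :
  [/\ (vfield a b k g).1.1 = a g, (vfield a b k g).1.2 = b g,
      (vfield a b k g).2 = k g + (b g * g.1.1 - a g * g.1.2) / 2 & Tcoord g (vfield a b k g) = k g].
Proof.
have e1 : (vfield a b k g).1.1 = a g.
  by change (a g * 1 + b g * 0 + k g * 0 = a g); rewrite mulr1 !mulr0 !addr0.
have e2 : (vfield a b k g).1.2 = b g.
  by change (a g * 0 + b g * 1 + k g * 0 = b g); rewrite mulr1 !mulr0 addr0 add0r.
have e3 : (vfield a b k g).2 = k g + (b g * g.1.1 - a g * g.1.2) / 2.
  change (a g * (- g.1.2 / 2) + b g * (g.1.1 / 2) + k g * 1 =
    k g + (b g * g.1.1 - a g * g.1.2) / 2); by field.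
by split => //; rewrite /Tcoord e1 e2 e3; field.
Qed.

Lemma vfield_C2 S (a b k : pt -> R) : (forall D th, local_param S D th -> C2_on D (a \o th)) ->
  (forall D th, local_param S D th -> C2_on D (b \o th)) ->
  (forall D th, local_param S D th -> C2_on D (k \o th)) -> C2_field S (vfield a b k).
Proof.
move=> ca cb ck D th H; have oD := chart_open H; have [[cx cy _] _ _] := chart_C1 H.
have a' := ca D th H; have b' := cb D th H; have k' := ck D th H.
have xB (f h : R * R -> R) : C2_on D f -> C2_on D h -> C2_on D (fun z => f z - h z).
  move=> cf ch; have q := C2_onD oD cf (C2_onM oD (C2_on_cst (- 1) oD) ch).
  by apply: (C2_on_ext oD _ q) => z _; rewrite mulN1r.
split.
- by apply: (C2_on_ext oD _ a') => z _; have [-> _ _ _] := vfield_coord a b k (th z).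
- by apply: (C2_on_ext oD _ b') => z _; have [_ -> _ _] := vfield_coord a b k (th z).
- have q := C2_onD oD k' (C2_onM oD (xB _ _ (C2_onM oD b' cx) (C2_onM oD a' cy)) (C2_on_cst 2^-1 oD)).
  by apply: (C2_on_ext oD _ q) => z _; have [_ _ -> _] := vfield_coord a b k (th z).
Qed.

(** The support lies in the union of those of [a], [b] and [k], a compact set without characteristic
    points; hence [dens > 0] on it. *)
Lemma vfield_supported S N (a b k : pt -> R) : oriented_C2_surface S N ->
  C2_0 (S `\` charset N S) a -> C2_0 (S `\` charset N S) b -> C2_0 (S `\` charset N S) k ->
  supported S (vfield a b k) (support (vfield a b k)).
Proof.
move=> hS ha hb hk; have [HS _ _] := hS.
pose Ka := closure [set g | a g != 0]; pose Kb := closure [set g | b g != 0].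
pose Kk := closure [set g | k g != 0].
have [_ cKa Sa] := ha; have [_ cKb Sb] := hb; have [_ cKk Sk] := hk.
have KU : support (vfield a b k) `<=` Ka `|` Kb `|` Kk.
  have cl : closed (Ka `|` Kb `|` Kk) by apply: closedU; [apply: closedU|]; exact: closed_closure.
  rewrite [X in _ `<=` X](closure_id _).1//; apply: closure_subset => g /= X0.
  apply: contrapT => /not_orP[/not_orP[na nb] nk].
  have z (f : pt -> R) : ~ closure [set g | f g != 0] g -> f g = 0.
    by move=> nf; apply/eqP/negPn/negP => fg; apply: nf; exact: subset_closure.
  move/eqP: X0; apply; rewrite /vfield (z a na) (z b nb) (z k nk) !scale0r !addr0//.
have KM g : support (vfield a b k) g -> (S `\` charset N S) g.
  by move=> /KU[[/Sa|/Sb]|/Sk].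
split.
- exact: HS.
- apply: vfield_C2 => D th H; exact: C2_0_chart hS _ H.
- apply: subclosed_compact KU; first exact: closed_closure.
  by apply: compactU; [apply: compactU|].
- by move=> g /KM[].
- by move=> g nK; apply/eqP/negPn/negP => Xg; apply: nK; exact: subset_closure.
- move=> D th d H Dd /KM[_ nc]; rewrite lt0r dens_ge0 andbT; apply/eqP => d0.
  by apply: nc; apply/(charset_dens hS H Dd).
Qed.

(** The denominator equals [WN N g], since [nuH] is the normalized horizontal part of [N]. *)
Lemma normal_speed_inner N S (X : pt -> pt) g : (S `\` charset N S) g ->
  normal_speed N X g = inner g (X g) (N g) / inner g (nuH N g) (N g).
Proof.
move=> [Sg nc]; have W0 : WN N g != 0 by apply/eqP => W0; apply: nc.
have WE : WN N g ^+ 2 = pN N g ^+ 2 + qN N g ^+ 2 by rewrite /WN sqr_sqrtr ?addr_ge0 ?sqr_ge0.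
have e1 : inner g (nuH N g) (N g) = WN N g.
  have iC v w : inner g v w = inner g w v.
    by rewrite /inner (mulrC v.1.1) (mulrC v.1.2) (mulrC (Tcoord g v)).
  rewrite /nuH innerDl (iC (X1 g)) (iC (X2 g)) -/(pN N g) -/(qN N g) /pbar /qbar.
  by rewrite mulrAC (mulrAC (qN N g)) -mulrDl -!expr2 -WE expr2 mulfK.
have -> : inner g (X g) (N g) =
    (X g).1.1 * pN N g + (X g).1.2 * qN N g + Tcoord g (X g) * omegaN N g.
  by rewrite pNE qNE omegaNE.
by rewrite e1 /normal_speed /pbar /qbar /omegabar; field.
Qed.

Lemma variation_formula S N (a b k : pt -> R) U : oriented_C2_surface S N ->
  C2_0 (S `\` charset N S) a -> C2_0 (S `\` charset N S) b -> C2_0 (S `\` charset N S) k ->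
  rel_compact_nbhd S (vfield a b k) U ->
  derivable (perimeter S (vfield a b k) U) (0 : R) 1 /\
  (first_variation S (vfield a b k) U)%:E =
    (\int[surface_measure S]_(g in S) (mean_flux N S (vfield a b k) g)%:E)%E.
Proof.
move=> hS ha hb hk [oU cU clU KU]; have h := vfield_supported hS ha hb hk.
have X0 g : S g -> ~ support (vfield a b k) g -> vfield a b k g = 0 by move=> _; exact: spt_off h g.
have [L HL] := field_lipschitz (spt_surface h) (spt_field h) (spt_compact h) (spt_sub h) X0.
have dP := perimeter_variation (spt_surface h) HL (spt_field h) (spt_compact h) (spt_sub h) X0
  (@spt_dens _ _ _ _ h) oU cU clU KU.
split; first exact: ex_derive.
rewrite (integral_mean_flux hS h) /first_variation; congr EFin.
by have [_ ->] := dP.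
Qed.

End variation_of_perimeter.

(** * Stationary surfaces and H-minimal surfaces *)

Section stationary_surfaces.
Context {R : realType}.
Local Notation pt := (R * R * R)%type.
Local Notation leb2 := (@lebesgue_measure R \x @lebesgue_measure R)%E.
Local Notation leb2m :=
  (leb2 : {measure set (measurableTypeR R * measurableTypeR R) -> \bar R}).
Implicit Types (S U K Q M : set pt) (D : set (R * R)) (th : R * R -> pt) (g : pt) (X Y N : pt -> pt).

Lemma surface_compact_nbhd S g0 : C2_surface S -> S g0 -> exists C Q,
  [/\ compact C, C `<=` S, open Q, Q g0 & forall g, S g -> Q g -> C g].
Proof.
move=> HS Sg0; have [D [th [H [d Dd e]]]] := HS g0 Sg0; have oD := chart_open H.
have [del d0 dP] := (near_box _ _).1 (open_nbhs_nbhs (conj oD Dd)).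
have d2 : 0 < del / 2 by rewrite divr_gt0.
have dd : del / 2 < del by rewrite ltr_pdivrMr// ltr_pMr// ltr1n.
pose A := `[d.1 - del / 2, d.1 + del / 2]%classic `*` `[d.2 - del / 2, d.2 + del / 2]%classic.
have AP z : A z <-> `|z.1 - d.1| <= del / 2 /\ `|z.2 - d.2| <= del / 2.
  by rewrite /A /= !in_itv/= !ler_distl.
have AD : A `<=` D by move=> z /AP[h1 h2]; apply: dP; exact: le_lt_trans dd.
have nA : nbhs d A.
  by apply/near_box; exists (del / 2) => // z h1 h2; apply/AP; split; exact: ltW.
have [Q [oQ Qd QP]] := chart_inv_near H Dd nA.
exists (th @` A), Q; split => //.
- apply: continuous_compact; last by apply: compact_setX; exact: segment_compact.
  apply: continuous_in_subspaceT => z /[!inE] /AD Dz; exact: chart_continuous H Dz.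
- by move=> _ [z /AD Dz <-]; exact: chart_surf H Dz.
- by rewrite -e.
- by move=> g Sg Qg; have [_ Ag eg] := QP g Sg Qg; exists (chart_inv D th g).
Qed.

Lemma integral_surface_gt0 S (f : pt -> R) g0 : C2_surface S -> S g0 ->
  (forall D th z, local_param S D th -> D z -> {for z, continuous (f \o th)}) ->
  (forall g, S g -> 0 <= f g) -> 0 < f g0 ->
  (0 < \int[surface_measure S]_(g in S) (f g)%:E)%E.
Proof.
move=> HS Sg0 cf f0 fg0; have [D [th [H [d Dd e]]]] := HS g0 Sg0; have oD := chart_open H.
have cw z : D z -> {for z, continuous (fun z => f (th z) * area_element th z)}.
  by move=> Dz; apply: cvgM; [exact: cf D th z H Dz|exact: chart_area_continuous H Dz].
have w0 : 0 < f (th d) * area_element th d.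
  by rewrite e mulr_gt0// (area_element_gt0 H Dd).
move: (cw d Dd) w0; set w := fun z => f (th z) * area_element th z => cwd w0.
have {}w0 : 0 < w d by exact w0.
have nw : \forall z \near d, D z /\ w d / 2 <= w z /\ w z <= w d * 2.
  apply: filterI; first exact: open_nbhs_nbhs.
  by apply: filterI; [apply: (cvgr_ge _ cwd)|apply: (cvgr_le _ cwd)];
    rewrite ?ltr_pMr ?ltr_pdivrMr ?ltr1n// ltr_pMr// ltr1n.
have [del d0 dP] := (near_box _ _).1 nw.
have d2 : 0 < del / 2 by rewrite divr_gt0.
have dd : del / 2 < del by rewrite ltr_pdivrMr// ltr_pMr// ltr1n.
pose A := rect d.1 d.2 (del / 2) (del / 2).
have AP z : A z -> D z /\ w d / 2 <= w z /\ w z <= w d * 2.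
  move=> /rectP[h1 h2 h3 h4].
  by apply: dP; rewrite ltr_norml; apply/andP; split; move: h1 h2 h3 h4 d0; clear; lra.
have AD : A `<=` D by move=> z /AP[].
have mA : measurable A by exact: rect_measurable.
have mf : measurable_fun S f.
  apply: (@surf_fun_measurable R S f HS) => D' th' H'.
  by apply: continuous_measurable2; [exact: chart_open H'|move=> z; exact: cf].
have mD : measurable D by exact: open_measurable2.
apply: (@lt_le_trans _ _ (\int[surface_measure S]_(g in th @` A) (f g)%:E)%E); last first.
  apply: ge0_subset_integral.
  - exact: chart_image_measurable H mA AD.
  - exact: surface_measurable.
  - exact/measurable_EFinP.
  - by move=> g Sg; rewrite lee_fin f0.
  - by move=> _ [z /AD Dz <-]; exact: chart_surf H Dz.
rewrite (integral_chart HS H mA AD); last first.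
  apply: (measurable_funS mD AD); apply: continuous_measurable2 => // z; exact: cf.
have mw : measurable_fun A w.
  by apply: (measurable_funS mD AD); apply: continuous_measurable2.
have w2 : 0 <= w d / 2 by rewrite divr_ge0// ltW.
have [lo _] := integral_bounds leb2m mA mw w2 (fun z Az => (AP z Az).2).
have lA : leb2m A = (del / 2 * (del / 2))%:E by apply: leb2_rect; exact: ltW.
by apply: lt_le_trans lo; rewrite lA -EFinM lte_fin; exact: mulr_gt0 (divr_gt0 w0 (ltr0n _ 2)) (mulr_gt0 d2 d2).
Qed.

(** The curvature integrand is [djac] minus the defect, and both are continuous in charts; no
    separate study of [Hmean] is involved. *)
Lemma mean_flux_continuous N S X D th z : oriented_C2_surface S N -> C2_field S X ->
  local_param S D th -> D z -> 0 < dens th z -> {for z, continuous (mean_flux N S X \o th)}.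
Proof.
move=> hS cX H Dz W0; have oD := chart_open H.
have c1 := djac_continuous cX H Dz W0.
have c2 := defect_continuous_dens hS cX H Dz W0.
refine (continuous_ext_on oD Dz _ (cvgB c1 c2)) => y Dy.
have E := chart_valE (djac_invariant cX) H Dy.
rewrite /= /stokes_defect; apply: etrans (congr1 (fun x => x - _) (esym E)) _.
by rewrite opprB addrC subrK.
Qed.

(** For the test field the integrand is the bump times a continuous function, the flux [c] of the
    field with constant frame components [al] and [be]. At [g0] its value is [|H| W / |N|], which is
    positive, and the bump is supported where [c] remains so. *)
Lemma stationary_minimal N S : oriented_C2_surface S N -> charset N S = set0 ->
  stationary S -> H_minimal N S.
Proof.
move=> hS c0 st g0 [Sg0 _]; apply: contrapT => /eqP H0; have [HS _ nN] := hS.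
have dpos D th z : local_param S D th -> D z -> 0 < dens th z.
  move=> H Dz; rewrite lt0r dens_ge0 andbT; apply/eqP => d0.
  by have : charset N S (th z) by [apply/(charset_dens hS H Dz)]; rewrite c0.
have W0 g : S g -> WN N g != 0.
  by move=> Sg; apply/eqP => W0; have : charset N S g by []; rewrite c0.
have r0 g : S g -> 0 < WN N g / rnorm g (N g).
  move=> Sg; have [D [th [H [d Dd e]]]] := HS g Sg; rewrite -e in Sg *.
  by rewrite -(pmulr_lgt0 _ (area_element_gt0 H Dd)) (WN_rnorm_chart H Dd (nN _ Sg)) (dpos _ _ _ H Dd).
pose s := Num.sg (Hmean N S g0); pose al := s * pbar N g0; pose be := s * qbar N g0.
have flux a b g : mean_flux N S (vfield a b (fun=> 0)) g =
    Hmean N S g * (pbar N g * a g + qbar N g * b g) * (WN N g / rnorm g (N g)).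
  have [e1 e2 _ e4] := vfield_coord a b (fun=> 0) g.
  by rewrite /mean_flux /normal_speed e1 e2 e4 mulr0 addr0.
(* [mean_flux] at a point depends only on the value of the field there, so the bump factors out and
   positivity can be studied for constant components. *)
pose c := mean_flux N S (vfield (fun=> al) (fun=> be) (fun=> 0)).
have cc D th z : local_param S D th -> D z -> {for z, continuous (c \o th)}.
  move=> H Dz; apply: (mean_flux_continuous hS _ H Dz (dpos _ _ _ H Dz)).
  by apply: vfield_C2 => D' th' H'; apply: C2_on_cst; exact: chart_open H'.
have cg0 : 0 < c g0.
  rewrite /c flux mulr_gt0 ?r0//.
  have -> : pbar N g0 * al + qbar N g0 * be = s.
    have WE : WN N g0 ^+ 2 = pN N g0 ^+ 2 + qN N g0 ^+ 2.
      by rewrite /WN sqr_sqrtr ?addr_ge0 ?sqr_ge0.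
    rewrite /al /be /pbar /qbar; transitivity (s * ((pN N g0 ^+ 2 + qN N g0 ^+ 2) / WN N g0 ^+ 2)).
      by have := W0 _ Sg0; move=> W1; field.
    by rewrite -WE divff ?mulr1// sqrf_eq0 W0.
  by rewrite mulrC -normrEsg normr_gt0.
have [C [Q [cC CS oQ Qg0 QC]]] := surface_compact_nbhd HS Sg0.
have nP : \forall g \near g0, Q g /\ (S g -> 0 < c g).
  apply: filterI; first exact: open_nbhs_nbhs.
  have [D [th [H [d Dd e]]]] := HS g0 Sg0; rewrite -e; apply: (surf_near H Dd).
  by apply: (cvgr_gt _ (cc D th d H Dd)); rewrite /= e.
have [del d0 dP] := (near_box3 _ _).1 nP.
pose r := del / 2; have r00 : 0 < r by rewrite divr_gt0.
have rd : r < del by rewrite ltr_pdivrMr// ltr_pMr// ltr1n.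
pose cb := cbox (g0, r).
have cbP g : cb g -> Q g /\ (S g -> 0 < c g).
  by move=> [h1 h2 h3]; apply: dP; exact: le_lt_trans rd.
have clcb : closed (C `&` cb).
  by apply: closedI; [exact: compact_closed (@norm_hausdorff _ _) cC|exact: cbox_closed].
pose et g := bump (g0, r) g.
(* The bump lives on a box of space, whereas elements of [C2_0 S] have their support inside [S];
   hence the extension by zero off [S]. *)
pose a (t : R) g := if `[<S g>] then t * et g else 0.
have aE t g : S g -> a t g = t * et g by rewrite /a; case: asboolP.
have a0 t g : a t g != 0 -> (C `&` cb) g.
  rewrite /a; case: asboolP => [Sg|_]; last by rewrite eqxx.
  move=> h; have cg : cb g.
    have [[h1 h2 h3]|nb] := pselect (obox (g0, r) g); first by split; exact: ltW.
    by move: h; rewrite /et bump_off// mulr0 eqxx.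
  by split => //; apply: QC => //; case: (cbP g cg).
have aC2 t D th : local_param S D th -> C2_on D (a t \o th).
  move=> H; have oD := chart_open H.
  apply: (C2_on_ext oD _ (C2_onM oD (C2_on_cst t oD) (bump_C2 (g0, r) H))) => z Dz.
  by rewrite /= aE//; exact: chart_surf H Dz.
have SS : S `\` charset N S = S by rewrite c0 setD0.
have aC0 t : C2_0 S (a t).
  have sub : closure [set g | a t g != 0] `<=` C `&` cb.
    rewrite [X in _ `<=` X](closure_id _).1//; apply: closure_subset => g; exact: a0.
  split.
  - by move=> D th; exact: aC2.
  - apply: subclosed_compact (cC) _; first exact: closed_closure.
    by move=> g /sub[].
  - by move=> g /sub[/CS].
have k0 : C2_0 S (fun=> 0 : R).
  have e0 : closure [set g : pt | (0 : R) != 0] = set0.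
    by rewrite -closure0; congr closure; apply/seteqP; split => // g /=; rewrite eqxx.
  split; [|rewrite e0; exact: compact0|by rewrite e0].
  by move=> D th H; apply: C2_on_cst; exact: chart_open H.
have X0 g : vfield (a al) (a be) (fun=> 0) g != 0 -> (C `&` cb) g.
  rewrite /vfield; have [->|] := eqVneq (a al g) 0; last by move=> /a0.
  have [->|] := eqVneq (a be g) 0; last by move=> /a0.
  by rewrite !scale0r !addr0 eqxx.
have nb : rel_compact_nbhd S (vfield (a al) (a be) (fun=> 0)) (S `&` Q).
  have clC : closed C by apply: compact_closed => //; exact: norm_hausdorff.
  have sub : closure (S `&` Q) `<=` C.
    rewrite [X in _ `<=` X](closure_id _).1//; apply: closure_subset => g [Sg Qg]; exact: QC.
  split; first by exists Q.
  - by apply: subclosed_compact sub => //; exact: closed_closure.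
  - exact: subset_trans sub CS.
  - apply: (@subset_trans _ (C `&` cb)); last by move=> g [/CS Sg /cbP[]].
    by rewrite [X in _ `<=` X](closure_id _).1//; apply: closure_subset => g; exact: X0.
have [_ v0] := st _ _ _ (aC0 al) (aC0 be) k0 _ nb.
have [_] : derivable (perimeter S (vfield (a al) (a be) (fun=> 0)) (S `&` Q)) (0 : R) 1 /\
  (first_variation S (vfield (a al) (a be) (fun=> 0)) (S `&` Q))%:E =
    (\int[surface_measure S]_(g in S) (mean_flux N S (vfield (a al) (a be) (fun=> 0)) g)%:E)%E.
  by apply: variation_formula hS _ _ _ nb; rewrite SS.
have fE g : S g -> mean_flux N S (vfield (a al) (a be) (fun=> 0)) g = et g * c g.
  by move=> Sg; rewrite /c !flux !aE//; ring.
rewrite v0 => I0.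
suff : (0 < \int[surface_measure S]_(g in S)
    (mean_flux N S (vfield (a al) (a be) (fun=> 0)) g)%:E)%E by rewrite -I0 ltxx.
apply: (integral_surface_gt0 HS Sg0).
- move=> D th z H Dz; apply: (mean_flux_continuous hS _ H Dz (dpos _ _ _ H Dz)).
  by apply: vfield_C2 => D' th' H'; [exact: aC2|exact: aC2|apply: C2_on_cst; exact: chart_open H'].
- move=> g Sg; rewrite fE//; have [bg|bg] := pselect (obox (g0, r) g); last first.
    by rewrite /et bump_off// mul0r.
  rewrite mulr_ge0 ?bump_ge0// ltW//.
  have [h1 h2 h3] := bg; have cg : cb g by split; exact: ltW.
  by case: (cbP g cg) => _; apply.
- rewrite fE// mulr_gt0//; apply: bump_gt0 => //.
  by split; rewrite /= subrr normr0.
Qed.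

Lemma minimal_stationary N S : oriented_C2_surface S N -> charset N S = set0 ->
  H_minimal N S -> stationary S.
Proof.
move=> hS c0 Hm a b k ha hb hk U hU.
have SS : S `\` charset N S = S by rewrite c0 setD0.
have [dP e] : derivable (perimeter S (vfield a b k) U) (0 : R) 1 /\
  (first_variation S (vfield a b k) U)%:E =
    (\int[surface_measure S]_(g in S) (mean_flux N S (vfield a b k) g)%:E)%E.
  by apply: variation_formula hS _ _ _ hU; rewrite SS.
split => //; apply: EFin_inj; rewrite e; apply: integral0_eq => g Sg.
by rewrite /mean_flux Hm ?mul0r// SS.
Qed.

End stationary_surfaces.

Theorem theorem14p3 (R : realType) (S : set (R * R * R))
    (N : R * R * R -> R * R * R) (hS : oriented_C2_surface S N) :
  (forall a b k : R * R * R -> R,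
     C2_0 (S `\` charset N S) a ->
     C2_0 (S `\` charset N S) b ->
     C2_0 (S `\` charset N S) k ->
     let X := vfield a b k in
     let F := fun g => pbar N g * a g + qbar N g * b g + omegabar N g * k g in
     (forall g, (S `\` charset N S) g ->
        F g = inner g (X g) (N g) / inner g (nuH N g) (N g)) /\
     (forall U, rel_compact_nbhd S X U ->
        derivable (perimeter S X U) (0 : R) 1 /\
        (first_variation S X U)%:E =
          integral_sigmaH N S (fun g => Hmean N S g * F g)))
  /\
  (charset N S = set0 -> (stationary S <-> H_minimal N S)).
Proof.
split=> [a b k ha hb hk X F|c0]; last first.
  by split; [exact: stationary_minimal|exact: minimal_stationary].
have FE g : F g = normal_speed N X g.
  by rewrite /F /normal_speed; have [-> -> _ ->] := vfield_coord a b k g.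
split=> [g Mg|U hU]; first by rewrite FE; exact: normal_speed_inner Mg.
have [dP ->] := variation_formula hS ha hb hk hU.
split => //; apply: eq_integral => g _.
by rewrite FE.
Qed.
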